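(* Let $H$ be a planar graph that has a planar embedding in which all vertices of $H$ of degree at least $4$ lie on a single face. Then there exists a constant $k$ such that every graph $G$ that does not contain $H$ as a topological minor is nonrepetitively $k$-colourable.
   Context: All graphs are finite and simple. $G$ contains $H$ as a topological minor if some subgraph of $G$ is isomorphic to a subdivision of $H$. A $k$-colouring of $G$ assigns one of $k$ colours to each vertex. A path $(v_1,\dots,v_{2s})$ of even order is repetitively coloured by $\psi$ if $\psi(v_i)=\psi(v_{s+i})$ for all $i\in\{1,\dots,s\}$; a colouring is nonrepetitive if no path of even order is repetitively coloured. *)

(* Defs.v *)
From mathcomp Require Import all_boot all_order all_algebra.
From mathcomp Require Import all_classical all_reals all_analysis.

Set Implicit Arguments.
Unset Strict Implicit.
Unset Printing Implicit Defensive.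

Import Order.TTheory GRing.Theory Num.Theory.
Import numFieldNormedType.Exports.

Local Open Scope classical_set_scope.

Record sgraph := SGraph {
  vertex :> finType;
  adj : rel vertex;
  adj_sym : symmetric adj;
  adj_irrefl : irreflexive adj }.

Definition edges (G : sgraph) : {set {set G}} :=
  [set [set p.1; p.2] | p : G * G & adj p.1 p.2]%SET.

Definition degree (G : sgraph) (v : G) : nat := #|[set w | adj v w]%SET|.

Definition isomorphic (G H : sgraph) : Prop :=
  exists2 f : G -> H, bijective f & forall x y, adj (f x) (f y) = adj x y.

Record subgraph (G : sgraph) := Subgraph {
  sub_vertices : {set G};
  sub_edges : {set {set G}};
  sub_edges_edges : (sub_edges \subset edges G)%SET;
  sub_edges_ends : forall e, (e \in sub_edges)%SET -> (e \subset sub_vertices)%SET }.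

Section SubgraphGraph.
Variables (G : sgraph) (S : subgraph G).

Definition subgraph_adj (x y : {x : G | x \in sub_vertices S}) : bool :=
  [set val x; val y]%SET \in sub_edges S.

Lemma subgraph_adj_sym : symmetric subgraph_adj.
Proof. by move=> x y; rewrite /subgraph_adj finset.setUC. Qed.

Lemma subgraph_adj_irrefl : irreflexive subgraph_adj.
Proof.
move=> x; apply/negP => /(fintype.subsetP (sub_edges_edges S)) /imsetP[[u w]].
rewrite inE /= finset.setUid => uw E.
have: u \in [set val x]%SET by rewrite E !inE eqxx.
have: w \in [set val x]%SET by rewrite E !inE eqxx orbT.
by rewrite !inE => /eqP wx /eqP ux; move: uw; rewrite wx ux adj_irrefl.
Qed.

Definition subgraph_graph : sgraph :=
  SGraph subgraph_adj_sym subgraph_adj_irrefl.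
End SubgraphGraph.

Section SubdivideEdge.
Variables (G : sgraph) (x y : G).

(* [None] is the subdivision vertex: the edge [x y] is deleted and [None] is
   joined to [x] and [y].  Only meaningful when [adj x y]. *)
Definition subdivide_adj (u v : option G) : bool :=
  match u, v with
  | Some a, Some b => adj a b && ([set a; b] != [set x; y])%SET
  | Some a, None | None, Some a => a \in [set x; y]%SET
  | None, None => false
  end.

Lemma subdivide_adj_sym : symmetric subdivide_adj.
Proof. by move=> [a|] [b|] //=; rewrite adj_sym finset.setUC. Qed.

Lemma subdivide_adj_irrefl : irreflexive subdivide_adj.
Proof. by move=> [a|] //=; rewrite adj_irrefl. Qed.

Definition subdivide_edge : sgraph :=
  SGraph subdivide_adj_sym subdivide_adj_irrefl.
End SubdivideEdge.

Inductive subdivision (H : sgraph) : sgraph -> Prop :=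
| subdivision_refl : subdivision H H
| subdivision_step (K : sgraph) (x y : K) :
    subdivision H K -> adj x y -> subdivision H (subdivide_edge x y).

Definition topological_minor (H G : sgraph) : Prop :=
  exists (S : subgraph G) (K : sgraph),
    subdivision H K /\ isomorphic (subgraph_graph S) K.

Definition is_path (G : sgraph) (p : seq G) : bool :=
  [&& 0 < size p, sorted (@adj G) p & uniq p].

Definition repetitively_coloured (G : sgraph) (k : nat) (psi : G -> 'I_k)
    (p : seq G) : Prop :=
  exists s : nat, size p = (2 * s)%N /\
    take s (map psi p) = drop s (map psi p).

Definition nonrepetitive (G : sgraph) (k : nat) (psi : G -> 'I_k) : Prop :=
  forall p : seq G, is_path p -> ~ repetitively_coloured psi p.

Definition nonrepetitively_colourable (G : sgraph) (k : nat) : Prop :=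
  exists psi : G -> 'I_k, nonrepetitive psi.

Section Plane.
Variable R : realType.

Definition is_arc (A : set (R * R)) (a b : R * R) : Prop :=
  exists g : R -> R * R,
    [/\ {within `[0%R, 1%R], continuous g}, set_inj `[0%R, 1%R] g,
        g 0%R = a, g 1%R = b & g @` `[0%R, 1%R] = A].

(* Arcs are attached to unordered edges; [edge_arc e] is irrelevant when [e] is
   not an edge. *)
Record planar_embedding (H : sgraph) := PlanarEmbedding {
  point : H -> R * R;
  edge_arc : {set H} -> set (R * R);
  point_inj : injective point;
  edge_arcP : forall x y : H, adj x y ->
    is_arc (edge_arc [set x; y]%SET) (point x) (point y);
  edge_arc_vertex : forall (e : {set H}) (z : H), e \in edges H ->
    edge_arc e (point z) -> z \in e;
  edge_arc_disjoint : forall e f : {set H},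
    e \in edges H -> f \in edges H -> e != f ->
    edge_arc e `&` edge_arc f `<=` range point }.

Definition drawing (H : sgraph) (D : planar_embedding H) : set (R * R) :=
  range (point D) `|` \bigcup_(e in [set` edges H]) edge_arc D e.

Definition face (H : sgraph) (D : planar_embedding H) (F : set (R * R)) : Prop :=
  exists2 z : R * R, (~` drawing D) z &
    F = connected_component (~` drawing D) z.

(* Faces are disjoint from the drawing, so a vertex lies on a face when it
   belongs to the boundary of the face, i.e. to its closure. *)
Definition lies_on (H : sgraph) (D : planar_embedding H) (v : H)
    (F : set (R * R)) : Prop :=
  closure F (point D v).
End Plane.

(* Main.v *)
(* Thickening a drawing of H on a fine grid, with an apex vertex put in
   the special face and sent to infinity by an inversion, and deleting the apex,
   one finds H in a "fan grid": a grid plus one extra vertex for every vertex v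
   with deg v >= 4, the extra vertices being joined to consecutive blocks of the
   first row.  In this model the vertices of degree >= 4 are single vertices, so
   any graph with a large enough fan grid as a minor, in which the extra vertices
   are single vertices, has H as a topological minor; branch sets of vertices of
   degree <= 3 cause no problem.

   A large well-linked set W yields a grid.  If there are in addition
   many vertices that no small separator cuts off from W, these can be linked by
   many paths each to the grid, and rerouting makes a fan grid out of them.
   Hence, when H is not a topological minor, only boundedly many vertices fail to
   be separated from W, and the usual recursive construction of tree
   decompositions produces bags of which all but boundedly many vertices have
   bounded degree in the torso.

   In a bag, the vertices of large degree get private colours and the
   others are coloured by Rosenfeld's counting argument.  A graph glued from bags
   along cliques with at most k + 1 vertices is cut into layers, each glued along
   cliques with at most k vertices.  Colour a vertex by its layer modulo 3, by the
   letter its layer has in a square-free word, and by the inductive colour inside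
   its layer: a repetition then stays at corresponding levels in both halves,
   and contracting it onto its lowest layer gives a repetition there. *)

From mathcomp Require Import all_boot.
From mathcomp Require Import boolp.
From mathcomp Require Import zify.

Set Implicit Arguments.
Unset Strict Implicit.
Unset Printing Implicit Defensive.

(** The obstacle is that vertices of degree at least 4 must be single vertices, while a minor only
    provides branch sets. So the candidates for these vertices are deleted before the grid is built,
    and tied to it afterwards by many disjoint paths from clones of each of them. These paths may
    run through the grid; choosing them with a minimal set of non-grid edges confines such edges to
    the small side of one tight separation, and some band of rows is then entered along grid edges
    only.

    Models always represent the graph with every edge subdivided once ([smodel]): edges are
    connected sets like vertices, all sets are disjoint, and a vertex of degree at most 3 shrinks to
    a tripod at the very end.

    The grid comes from many disjoint connected pieces, each highly linked to [W]: either they can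
    be joined pairwise, which gives a clique model, or one linkage is crossed too often, which gives
    a ladder. In both cases the grid stays on the side of [W], which is what the paths from the
    deleted vertices need. *)

Lemma choose_fun (X Y : Type) (P : X -> Y -> Prop) :
  (forall x, exists y, P x y) -> exists f, forall x, P x (f x).
Proof. by move=> /choice[f fP]; exists f. Qed.

(** * Menger's theorem *)

Section Walks.
Variable V : finType.
Implicit Types (e : rel V) (A B S X Y : {set V}) (s t : seq V).

Definition starts A s := if s is x :: _ then x \in A else false.
Definition ends B s := if s is x :: t then last x t \in B else false.

Lemma starts_cat A s1 z s2 : starts A (s1 ++ z :: s2) = starts A (rcons s1 z).
Proof. by case: s1. Qed.

Lemma ends_cat B s1 z s2 : ends B (s1 ++ z :: s2) = ends B (z :: s2).
Proof. by case: s1 => //= x s1; rewrite last_cat. Qed.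

Lemma ends_rcons B s z : ends B (rcons s z) = (z \in B).
Proof. by case: s => //= x s; rewrite last_rcons. Qed.

Lemma sorted_split e s1 z s2 :
  sorted e (s1 ++ z :: s2) = sorted e (rcons s1 z) && path e z s2.
Proof. by case: s1 => //= x s1; rewrite cat_path rcons_path /= andbA. Qed.

Lemma sorted_cat e s1 s2 : sorted e (s1 ++ s2) -> sorted e s1 /\ sorted e s2.
Proof.
case: s2 => [|z s2]; first by rewrite cats0.
rewrite sorted_split => /andP[h hp]; split => //.
by case: s1 h => //= x s1; rewrite rcons_path => /andP[].
Qed.

Lemma sorted_rev_sym e s : symmetric e -> sorted e (rev s) = sorted e s.
Proof.
by move=> es; rewrite rev_sorted; apply: eq_sorted => x y; rewrite es.
Qed.

Lemma mem_split z s : z \in s -> exists s1 s2, s = s1 ++ z :: s2.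
Proof. by case/splitPr => s1 s2; exists s1, s2. Qed.

Lemma first_hit (P : pred V) s : has P s ->
  exists s1 z s2, [/\ s = s1 ++ z :: s2, P z & ~~ has P s1].
Proof.
elim: s => // x s IH; case Px: (P x); first by exists [::], x, s.
rewrite /= Px => /IH[s1 [z [s2 [-> Pz h]]]].
by exists (x :: s1), z, s2; split => //=; rewrite Px.
Qed.

Lemma last_hit (P : pred V) s : has P s ->
  exists s1 z s2, [/\ s = s1 ++ z :: s2, P z & ~~ has P s2].
Proof.
rewrite -has_rev => /first_hit[s1 [z [s2 [E Pz h]]]].
exists (rev s2), z, (rev s1); split; rewrite ?has_rev //.
by rewrite -(revK s) E rev_cat rev_cons cat_rcons.
Qed.

Definition separates e A B S :=
  forall s, sorted e s -> starts A s -> ends B s -> has (mem S) s.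

(** Inner vertices may lie in [A] or [B] again; [trim] shortens such a path where this matters. *)
Definition abpath e A B s := [&& sorted e s, uniq s, starts A s & ends B s].

Definition linkage e A B k (p : 'I_k -> seq V) :=
  (forall i, abpath e A B (p i)) /\
  (forall i j z, z \in p i -> z \in p j -> i = j).

Lemma abpath_last e A B s x : abpath e A B s -> last x s \in s /\ last x s \in B.
Proof.
case: s => [|y s] /and4P[] //= _ _ _ h; split => //; exact: mem_last.
Qed.

Lemma abpath_head e A B s x : abpath e A B s -> head x s \in s /\ head x s \in A.
Proof. by case: s => [|y s] /and4P[] //= _ _ h _; rewrite inE eqxx. Qed.

Lemma card_inj k S : k <= #|S| ->
  exists2 f : 'I_k -> V, injective f & forall i, f i \in S.
Proof.
move=> h; exists (fun i => enum_val (widen_ord h i)) => [i j /enum_val_inj|i].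
  by move/(congr1 val) => /= E; apply: val_inj.
exact: enum_valP.
Qed.

Lemma inj_surj_card k (f : 'I_k -> V) S : injective f ->
  (forall i, f i \in S) -> #|S| <= k -> forall z, z \in S -> exists i, f i = z.
Proof.
move=> fi fS cS z zS.
have E : [set f i | i : 'I_k] = S.
  apply/eqP; rewrite eqEcard card_imset // card_ord cS andbT.
  by apply/subsetP => _ /imsetP[i _ ->].
by move: zS; rewrite -E => /imsetP[i _ ->]; exists i.
Qed.

End Walks.

(* Goring's proof: delete an edge [x y]; if this creates a separator [S] with
   fewer than [k] vertices, then [x |: S] and [y |: S] are reached from both
   sides, and the two linkages only meet in [S]. *)
Lemma menger (V : finType) (e : rel V) (A B : {set V}) k :
  (forall S, separates e A B S -> k <= #|S|) ->
  exists p : 'I_k -> seq V, linkage e A B p.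
Proof.
have [n] := ubnP #|[set p : V * V | e p.1 p.2]|; elim: n e A B => // n IH e A B.
rewrite ltnS => le_n hS.
case: (pickP (fun p : V * V => e p.1 p.2)) => [[x y] /= exy|e0]; last first.
  have: k <= #|A :&: B|.
    apply: hS => -[|u [|v s]] //=; first by rewrite orbF inE => _ -> ->.
    by rewrite (e0 (u, v)).
  case/card_inj => f fi fS; exists (fun i => [:: f i]); split.
    by move=> i; have:= fS i; rewrite inE /abpath /= => /andP[-> ->].
  by move=> i j z; rewrite !inE => /eqP-> /eqP/fi.
(* Only the ordered pair is deleted: [e] is not assumed symmetric, so the theorem covers directed
   graphs. *)
pose e' := [rel u v | e u v && ((u, v) != (x, y))].
have e'e : subrel e' e by move=> u v /andP[].
have lt_n : #|[set p : V * V | e' p.1 p.2]| < n.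
  apply: leq_trans le_n; apply: proper_card; apply/properP; split.
    by apply/subsetP => p; rewrite !inE => /andP[].
  by exists (x, y); rewrite !inE //= eqxx andbF.
case: (pselect (forall S, separates e' A B S -> k <= #|S|)) => [h|].
  have [p [p1 p2]] := IH _ _ _ lt_n h; exists p; split => // i.
  by have /and4P[h1 h2 h3 h4] := p1 i; rewrite /abpath h2 h3 h4 (sub_sorted e'e).
move=> /existsNP[S /not_implyP[sepS /negP]]; rewrite -ltnNge => ltS.
have avoid z s : z \in [:: x; y] -> z \notin s -> sorted e s -> sorted e' s.
  move=> zxy; elim: s => // a [|b s] //= IHs; rewrite !inE !negb_or.
  case/and3P => za zb zs /andP[eab ps]; rewrite IHs ?inE ?negb_or ?zb //= andbT.
  rewrite eab /=; apply/eqP => -[Ea Eb].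
  by move: zxy za zb; rewrite !inE Ea Eb => /orP[] /eqP->; rewrite eqxx.
have sepz z : z \in [:: x; y] -> separates e A B (z |: S).
  move=> zxy s es sA sB; case zs: (z \in s).
    by apply/hasP; exists z => //; rewrite !inE eqxx.
  have /hasP[w ws wS] := sepS s (avoid z s zxy (negbT zs) es) sA sB.
  by apply/hasP; exists w => //; rewrite !inE (wS : w \in S) orbT.
have cardz z : z \in [:: x; y] -> z \notin S /\ #|z |: S| = k.
  move=> zxy; have := hS _ (sepz z zxy); rewrite cardsU1.
  by case: (z \in S) => /= h; lia.
have [x2 y2] : x \in [:: x; y] /\ y \in [:: x; y] by rewrite !inE !eqxx orbT.
have [xS cx] := cardz x x2; have [yS cy] := cardz y y2.
(* Up to its first vertex in [x |: S] a walk cannot use the deleted edge, so a set [T] that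
   separates here in [e'] also separates [A] from [B] in [e]. *)
have /(IH _ _ _ lt_n) [p [p1 p2]] : forall T, separates e' A (x |: S) T -> k <= #|T|.
  move=> T sT; apply: hS => s es sA sB.
  have /first_hit[s1 [z [s2 [E zS hs1]]]] := sepz x x2 s es sA sB.
  move: es sA sB; rewrite E sorted_split starts_cat => /andP[es1 _] sA _.
  suff: has (mem T) (rcons s1 z) by rewrite -cat_rcons has_cat => ->.
  apply: sT; rewrite ?ends_rcons //.
  move: es1; have xs1 : x \notin s1.
    apply: contra hs1 => xs1; apply/hasP; exists x => //; exact: setU11.
  have := avoid x s1 x2 xs1.
  case: (s1) xs1 => // a s1' xs1 h /=; rewrite !rcons_path => /andP[h1 h2].
  have h3 := h h1; rewrite /= in h3; rewrite h3 /= h2 /=.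
  apply: contra xs1 => /eqP[<- _]; exact: mem_last.
have /(IH _ _ _ lt_n) [q [q1 q2]] : forall T, separates e' (y |: S) B T -> k <= #|T|.
  move=> T sT; apply: hS => s es sA sB.
  have /last_hit[s1 [z [s2 [E zS hs1]]]] := sepz y y2 s es sA sB.
  move: es sA sB; rewrite E sorted_split ends_cat => /andP[_ es1] _ sB.
  suff: has (mem T) (z :: s2) by rewrite has_cat => ->; rewrite orbT.
  apply: sT => //; move: es1 => /=; have ys1 : y \notin s2.
    apply: contra hs1 => ys1; apply/hasP; exists y => //; exact: setU11.
  have := avoid y s2 y2 ys1.
  case: (s2) ys1 => // a s1' ys1 h /= /andP[h2 h1].
  have h3 := h h1; rewrite /= in h3; rewrite h3 h2 andbT /=.
  by apply: contra ys1 => /eqP[_ <-]; rewrite mem_head.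
pose en i := last x (p i); pose st j := head x (q j).
have enP i : en i \in p i /\ en i \in x |: S by exact: abpath_last (p1 i).
have stP j : st j \in q j /\ st j \in y |: S by exact: abpath_head (q1 j).
have en_inj : injective en.
  by move=> i j E; apply: (p2 i j (en i)); rewrite ?(proj1 (enP _)) // E (proj1 (enP j)).
have st_inj : injective st.
  by move=> i j E; apply: (q2 i j (st i)); rewrite ?(proj1 (stP _)) // E (proj1 (stP j)).
have en_surj := inj_surj_card en_inj (fun i => proj2 (enP i)) (eq_leq cx).
have st_surj := inj_surj_card st_inj (fun i => proj2 (stP i)) (eq_leq cy).
have enU i z : z \in p i -> z \in x |: S -> z = en i.
  by move=> zp /en_surj[j E]; rewrite -E; congr (en _); apply: (p2 _ _ z) => //; rewrite -E (proj1 (enP j)).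
have stU j z : z \in q j -> z \in y |: S -> z = st j.
  by move=> zq /st_surj[i E]; rewrite -E; congr (st _); apply: (q2 _ _ z) => //; rewrite -E (proj1 (stP i)).
(* If [p i] and [q j] met outside [S], changing from one to the other there would give a walk in
   [e'] from [A] to [B] that avoids [S]. *)
have cross i j z : z \in p i -> z \in q j -> [/\ z \in S, z = en i & z = st j].
  move=> zp zq; suff zS : z \in S.
    by split => //; [apply: enU|apply: stU]; rewrite // !inE zS orbT.
  have /and4P[ep up pA _] := p1 i; have /and4P[eq uq _ qB] := q1 j.
  have [s1 [s2 Ep]] := mem_split zp; have [t1 [t2 Eq]] := mem_split zq.
  have /hasP[w ws wS] : has (mem S) (s1 ++ z :: t2).
    apply: sepS.
    - move: ep eq; rewrite Ep Eq !sorted_split => /andP[-> _] /andP[_ ->] //.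
    - by move: pA; rewrite Ep !starts_cat.
    - by move: qB; rewrite Eq !ends_cat.
  have wxS : w \in x |: S by rewrite !inE (wS : w \in S) orbT.
  have wyS : w \in y |: S by rewrite !inE (wS : w \in S) orbT.
  move: ws; rewrite mem_cat inE => /or3P[ws|/eqP<-//|wt].
    have wp : w \in p i by rewrite Ep mem_cat ws.
    have Ew := enU i w wp wxS; move: up; rewrite Ep cat_uniq => /and3P[_ /hasP[]].
    exists w => //; rewrite Ew /en Ep last_cat /=; exact: mem_last.
  have wq : w \in q j by rewrite Eq mem_cat inE wt !orbT.
  have := stU j w wq wyS; rewrite /st Eq => Ew.
  move: uq; rewrite Eq -cat_rcons cat_uniq => /and3P[_ /hasP[]]; exists w => //.
  by rewrite Ew; case: (t1) => [|a t1'] /=; rewrite mem_head.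
(* Paths are glued at common vertices of [S], except that the one ending in [x] continues along the
   deleted edge to the one starting in [y]. *)
pose f z := if z == x then y else z.
have [tau tauP] : exists tau, forall i, st (tau i) = f (en i).
  apply: (@fin_all_exists _ (fun=> _) (fun i j => st j = f (en i))) => i.
  apply: st_surj; have := proj2 (enP i); rewrite /f !inE.
  by case: ifP => [_|] /=; rewrite ?eqxx // => _ ->; rewrite orbT.
have tau_inj : injective tau.
  move=> i j E; apply: en_inj; have h : f (en j) = f (en i) by rewrite -!tauP E.
  move: h (proj2 (enP i)) (proj2 (enP j)); rewrite /f !inE.
  case: (en j =P x) => [->|_]; case: (en i =P x) => [->|_] //=.
  - by move=> <-; rewrite (negbTE yS).
  - by move=> -> _; rewrite (negbTE yS).
pose r i := p i ++ (if en i == x then q (tau i) else behead (q (tau i))).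
have memr i z : z \in r i -> z \in p i \/ z \in q (tau i) /\ z \notin p i.
  rewrite mem_cat; case zp: (z \in p i); [by left|move=> h; right; split => //].
  by move: h; case: ifP => _ //= /mem_behead.
exists r; split=> [i|i j z /memr[zi|[zi zi']] /memr[zj|[zj zj']]]; first last.
- by apply: tau_inj; apply: q2 zi zj.
- have [zS E1 E2] := cross _ _ _ zj zi; move: E2; rewrite tauP /f.
  by case: ifP => _ E2; [move: yS; rewrite -E2 zS | apply: en_inj; rewrite -E1 -E2].
- have [zS E1 E2] := cross _ _ _ zi zj; move: E2; rewrite tauP /f.
  by case: ifP => _ E2; [move: yS; rewrite -E2 zS | apply: en_inj; rewrite -E1 -E2].
- exact: p2 zi zj.
have /and4P[ep up pA pB] := p1 i; have /and4P[eq uq qA qB] := q1 (tau i).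
have := tauP i; rewrite /r /st.
have [enp enx] := enP i.
move: (cross i (tau i)) eq uq qA qB; case: (q (tau i)) => [_ _ _ []|b t crossi eq uq qA qB] //=.
move: enp enx up ep pA pB crossi; rewrite /en /f.
case/lastP: (p i) => // s a; rewrite last_rcons => _ aS up ep pA pB crossi.
rewrite -cats1 -catA /=; case: eqP => [Ea|_] Eb; apply/and4P; split.
- by rewrite sorted_split (sub_sorted e'e ep) /= Ea Eb exy; move: (sub_path e'e eq); rewrite Eb.
- rewrite -cat_rcons cat_uniq up uq andbT andTb; apply/hasPn => z zb.
  apply: contraTN xS => zs; have [zS E1 _] := crossi z zs zb.
  by rewrite -Ea negbK -E1.
- by move: pA; rewrite starts_cat.
- by rewrite -cat_rcons ends_cat.
- by rewrite sorted_split (sub_sorted e'e ep) /= -Eb (sub_path e'e eq).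
- move: (uq) => /= /andP[_ ut]; rewrite -cat_rcons cat_uniq up ut andbT andTb; apply/hasPn => z zb.
  apply/negP => zs; have [|_ E _] := crossi z zs; first by rewrite inE zb orbT.
  by move: uq; rewrite /= Eb -E zb.
- by move: pA; rewrite starts_cat.
- by move: qB; rewrite /= -Eb ends_cat.
Qed.

(** * Well-linked sets *)

Lemma connect_ind (T : finType) (r : rel T) (Q : T -> Prop) x y :
  connect r x y -> Q x -> (forall u v, r u v -> Q u -> Q v) -> Q y.
Proof.
move=> /connectP[p + ->] + h; elim: p x => //= u p IH x /andP[xu pu] Qx.
exact: IH (h _ _ xu Qx).
Qed.

Section Connectivity.
Variable V : finType.
Implicit Types (e : rel V) (X Y S W : {set V}).

Definition restr e X : rel V := [rel x y | [&& e x y, x \in X & y \in X]].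
Definition conn e X := forall x y, x \in X -> y \in X -> connect (restr e X) x y.
End Connectivity.

Section ConnectivityTheory.
Variable V : finType.
Implicit Types (e : rel V) (X Y S W : {set V}).

Definition adjS e X Y := exists x y, [/\ x \in X, y \in Y & e x y].
Definition touch e X Y := exists x y, [/\ x \in X, y \in Y & (x == y) || e x y].
(** Since [connect] is reflexive, this is [[set x]] when [x] lies outside [X]. *)
Definition comp e X x := [set y | connect (restr e X) x y].

Lemma adjS_sym e X Y : symmetric e -> adjS e X Y -> adjS e Y X.
Proof. by move=> es [x [y [h1 h2 h3]]]; exists y, x; rewrite es. Qed.

Lemma adjS_touch e X Y : adjS e X Y -> touch e X Y.
Proof. by move=> [x [y [h1 h2 h3]]]; exists x, y; rewrite h3 orbT. Qed.

Lemma touch_sym e X Y : symmetric e -> touch e X Y -> touch e Y X.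
Proof. by move=> es [x [y [h1 h2 h3]]]; exists y, x; rewrite es eq_sym. Qed.

Lemma adjS_mono e e' X X' Y Y' : subrel e e' -> X \subset X' -> Y \subset Y' ->
  adjS e X Y -> adjS e' X' Y'.
Proof.
move=> ee /subsetP h1 /subsetP h2 [x [y [xX yY exy]]]; exists x, y.
by split; [exact: h1|exact: h2|exact: ee].
Qed.

Lemma restr_sym e X : symmetric e -> symmetric (restr e X).
Proof. by move=> es x y; rewrite /restr /= es [(x \in X) && _]andbC. Qed.

Lemma connect_restr_sym e X : symmetric e -> connect_sym (restr e X).
Proof. by move=> es; exact: sym_connect_sym (restr_sym X es). Qed.

Lemma connect_restr_mono e e' X X' x y : subrel e e' -> X \subset X' ->
  connect (restr e X) x y -> connect (restr e' X') x y.
Proof.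
move=> ee /subsetP h; apply: connect_sub => u v /and3P[h1 h2 h3].
by apply: connect1; apply/and3P; split; [exact: ee|exact: h|exact: h].
Qed.

Lemma connect_restr_in e X x y : connect (restr e X) x y -> x \in X -> y \in X.
Proof. by move=> c xX; apply: (@connect_ind _ _ (fun z => z \in X) _ _ c) => // u v /and3P[]. Qed.

Lemma connect_restr1 e X x y : e x y -> x \in X -> y \in X ->
  connect (restr e X) x y.
Proof. by move=> *; apply: connect1; apply/and3P. Qed.

Lemma conn_mono e e' X : subrel e e' -> conn e X -> conn e' X.
Proof. by move=> ee h x y xX yX; apply: connect_restr_mono (h x y xX yX). Qed.

Lemma conn_sub e X Y x y : conn e X -> X \subset Y -> x \in X -> y \in X ->
  connect (restr e Y) x y.
Proof. by move=> h s xX yX; apply: connect_restr_mono (h x y xX yX). Qed.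

Lemma conn1 e x : conn e [set x].
Proof. by move=> u v /set1P-> /set1P->. Qed.

Lemma conn_bigcup e (I : finType) (L : rel I) (P : {set I}) (F : I -> {set V}) :
  conn L P -> (forall i, i \in P -> conn e (F i)) ->
  (forall i j, L i j -> i \in P -> j \in P -> touch e (F i) (F j)) ->
  conn e (\bigcup_(i in P) F i).
Proof.
move=> cP cF tF x y /bigcupP[i iP xi] /bigcupP[j jP yj].
have sub k : k \in P -> F k \subset \bigcup_(i in P) F i.
  by move=> kP; apply: bigcup_sup.
move: y yj; apply: (@connect_ind _ _ (fun k => forall y, y \in F k -> connect (restr e (\bigcup_(i in P) F i)) x y) _ _ (cP i j iP jP)) => [y yi|k l /and3P[Lkl kP lP] IH y yl].
  exact: conn_sub (cF i iP) (sub i iP) xi yi.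
have [u [v [uk vl uv]]] := tF k l Lkl kP lP.
apply: connect_trans (IH u uk) _; apply: connect_trans (conn_sub (cF l lP) (sub l lP) vl yl).
case/orP: uv => [/eqP->|uv]; first exact: connect0.
by apply: connect_restr1 => //; [exact: subsetP (sub k kP) _ uk|exact: subsetP (sub l lP) _ vl].
Qed.

Lemma connU e X Y : symmetric e -> conn e X -> conn e Y -> touch e X Y ->
  conn e (X :|: Y).
Proof.
move=> es cX cY tXY.
have := @conn_bigcup e bool [rel x y | true] [set: bool] (fun b => if b then X else Y).
have -> : \bigcup_(i in [set: bool]) (if i then X else Y) = X :|: Y.
  apply/setP => z; rewrite inE; apply/bigcupP/orP => [[[] _ h]|[h|h]]; [by left|by right|by exists true|by exists false].
apply => [x y _ _|[]//|[] [] _ _ _]; first by apply: connect1; rewrite /restr /= !inE.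
all: try exact: tXY; try exact: touch_sym.
  by have [x [_ [xX _ _]]] := tXY; exists x, x; rewrite eqxx.
by have [_ [x [_ xX _]]] := tXY; exists x, x; rewrite eqxx.
Qed.

Lemma comp_sub e X x : x \in X -> comp e X x \subset X.
Proof. by move=> xX; apply/subsetP => y; rewrite inE => /connect_restr_in; exact. Qed.

Lemma comp_conn e X x : symmetric e -> conn e (comp e X x).
Proof.
move=> es; suff h y : y \in comp e X x -> connect (restr e (comp e X x)) x y.
  by move=> y z /h hy /h; apply: connect_trans; rewrite (connect_restr_sym _ es).
rewrite inE => cy; have : connect (restr e X) x y /\ connect (restr e (comp e X x)) x y; last by case.
apply: (@connect_ind _ _ (fun z => connect (restr e X) x z /\ connect (restr e (comp e X x)) x z) _ _ cy); first by split; exact: connect0.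
move=> u v uv [c1 c2]; have c3 := connect_trans c1 (connect1 uv); split => //.
by apply: connect_trans c2 (connect_restr1 _ _ _); rewrite ?inE //; case/and3P: uv.
Qed.

Lemma comp_closed e X x y z : y \in comp e X x -> y \in X -> z \in X -> e y z ->
  z \in comp e X x.
Proof.
rewrite !inE => c yX zX eyz; apply: connect_trans c (connect_restr1 _ _ _) => //.
Qed.

Lemma walk_conn e s : symmetric e -> sorted e s -> conn e [set z in s].
Proof.
move=> es; elim: s => [|x [|y s] IH] /=; first by move=> _ u v; rewrite inE.
  by move=> _ u v; rewrite !inE => /eqP-> /eqP->.
case/andP => exy ps.
have -> : [set z in x :: y :: s] = [set x] :|: [set z in y :: s].
  by apply/setP => z; rewrite !inE.
apply: connU => //; [exact: conn1|exact: IH|].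
by exists x, y; rewrite !inE !eqxx exy orbT.
Qed.

Lemma connect_walk e X x y : connect (restr e X) x y -> x \in X ->
  exists s, [/\ path e x s, uniq (x :: s), last x s = y & {subset x :: s <= X}].
Proof.
move=> /connectP[p pp ->] xX; case/shortenP: pp => s ps us _.
exists s; split => //; first by apply: sub_path ps => u v /and3P[].
move=> z; rewrite inE => /orP[/eqP->//|zs].
elim: s x xX ps {us} zs => //= u s IH x xX /andP[/and3P[_ _ uX] pu].
by rewrite inE => /orP[/eqP->//|zs]; exact: IH uX pu zs.
Qed.

Lemma walk_connect e X s x : symmetric e -> path e x s -> {subset x :: s <= X} ->
  connect (restr e X) x (last x s).
Proof.
move=> es ps sub; apply: (@conn_sub e [set z in x :: s]).
- exact: walk_conn.
- by apply/subsetP => z; rewrite inE; exact: sub.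
- by rewrite inE mem_head.
- by rewrite inE mem_last.
Qed.

(** Existence of a non-cut vertex: a maximal proper connected subset becomes the whole set as soon
    as one neighbour is added. *)
Lemma conn_remove e X : symmetric e -> conn e X -> 1 < #|X| ->
  exists Y y, [/\ conn e Y, Y != set0, y \notin Y & X = y |: Y].
Proof.
move=> es cX X2; have [x0 x0X] : exists x, x \in X by apply/set0Pn; rewrite -card_gt0; lia.
pose P Y := `[< conn e Y >] && (Y != set0) && (Y \proper X).
have [|Y /maxsetP[/andP[/andP[/asboolP cY Y0] /properP[YX [z zX zY]]] maxY] _] :=
  @maxset_exists _ P [set x0].
  rewrite /P -card_gt0 cards1 properEcard sub1set x0X cards1 X2 !andbT.
  apply/asboolP; exact: conn1.
have /set0Pn[y0 y0Y] := Y0.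
have [y [yX yY /adjS_touch tY]] : exists y, [/\ y \in X, y \notin Y & adjS e Y [set y]].
  apply: contrapT => h; move: zY; apply/negP; rewrite negbK.
  apply: (@connect_ind _ _ (fun z => z \in Y) _ _ (cX y0 z (subsetP YX _ y0Y) zX) y0Y) => u v /and3P[euv uX vX] uY.
  apply/negPn/negP => vY; apply: h; exists v; split => //.
  by exists u, v; rewrite !inE.
exists Y, y; split => //; have cU := connU es cY (conn1 e (x := y)) tY.
apply/eqP; rewrite eqEsubset subUset sub1set yX YX andbT; apply/negPn/negP => h.
have /maxY E : P (Y :|: [set y]).
  rewrite /P (asboolT cU) /= setU_eq0 negb_and Y0 /= properE subUset sub1set YX yX /=.
  by move: h; rewrite andbT setUC.
by move: yY; rewrite -E ?subsetUl // !inE eqxx orbT.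
Qed.

(** Well-linkedness with defect [c]: a small separator cannot leave large parts of [W] on both
    sides. The defect pays for deleting vertices, see [wl_del]. *)
Definition wl e W c := forall S W1 W2,
  W1 \subset W :\: S -> W2 \subset W :\: S ->
  (forall x y, x \in W1 -> y \in W2 -> ~~ connect (restr e (~: S)) x y) ->
  minn #|W1| #|W2| <= #|S| + c.

(** The dual form of [j] disjoint paths from [X] to [W]; [linked_menger] converts it. *)
Definition linked e W X j := forall S, #|S| < j ->
  exists x w, [/\ x \in X :\: S, w \in W :\: S & connect (restr e (~: S)) x w].

Definition cut_off e W X S := forall x w, x \in X :\: S -> w \in W :\: S ->
  ~~ connect (restr e (~: S)) x w.

(** Otherwise a maximal union of components with at most [#|S| + c] vertices of [W] could be
    enlarged by one small component. The enlarged union and the rest would then both hold more of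
    [W] than [wl] permits. *)
Lemma big_component e W c S j : symmetric e -> wl e W c ->
  3 * (#|S| + c) + #|S| + j < #|W| ->
  exists2 x, x \notin S & j <= #|W :&: comp e (~: S) x|.
Proof.
move=> es wW hW; apply: contrapT => small.
have {}small x : x \notin S -> #|W :&: comp e (~: S) x| < j.
  by move=> xS; rewrite ltnNge; apply/negP => h; apply: small; exists x.
pose closed X := [forall x in X, forall y, restr e (~: S) x y ==> (y \in X)].
have closedP X x y : closed X -> x \in X -> connect (restr e (~: S)) x y -> y \in X.
  move=> /forall_inP h xX c'; apply: (@connect_ind _ _ (fun z => z \in X) _ _ c' xX) => u v uv uX.
  by have /forallP/(_ v)/implyP := h u uX; exact.
have indep X : closed X -> minn #|(W :&: X) :\: S| #|W :\: S :\: X| <= #|S| + c.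
  move=> cX; apply: wW; rewrite ?setSD ?subsetIl ?subsetDl //.
  move=> x y; rewrite !inE => /and3P[_ _ xX] /and3P[yX _ _].
  by apply: contra yX; exact: closedP.
pose P (X : {set V}) := closed X && (#|(W :&: X) :\: S| <= #|S| + c).
have P0 : P set0.
  rewrite /P setI0 set0D cards0 andbT; apply/forall_inP => x; rewrite inE.
  by [].
have [X /maxsetP[/andP[cX sX] maxX] _] := maxset_exists P0.
have cWS : #|W| <= #|W :\: S| + #|S|.
  by rewrite -(cardsID S W) addnC leq_add2l subset_leq_card ?subsetIr.
have cWSX : #|W :\: S| <= #|W :\: S :\: X| + #|(W :&: X) :\: S|.
  rewrite -(cardsID X (W :\: S)) addnC leq_add2l subset_leq_card //.
  by apply/subsetP => z; rewrite !inE; case: (z \in S); rewrite ?andbT.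
have /set0Pn[w] : W :\: S :\: X != set0 by rewrite -card_gt0; lia.
rewrite !inE => /and3P[wX wS wW'].
have cY : closed (X :|: comp e (~: S) w).
  apply/forall_inP => u; rewrite !inE => /orP[uX|uw]; apply/forallP => v; apply/implyP => uv.
    by rewrite !inE (closedP X u) // connect1.
  by rewrite !inE (connect_trans uw (connect1 uv)) orbT.
have split : #|(W :&: (X :|: comp e (~: S) w)) :\: S| <= #|(W :&: X) :\: S| + #|W :&: comp e (~: S) w|.
  rewrite -cardsUI -[X in X <= _]addn0 leq_add // subset_leq_card //.
  by apply/subsetP => z; rewrite !inE => /and3P[-> -> /orP[->|->]]; rewrite ?orbT.
have sw := small w wS.
have rest : #|W :\: S| <= #|W :\: S :\: (X :|: comp e (~: S) w)| + #|(W :&: (X :|: comp e (~: S) w)) :\: S|.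
  rewrite -(cardsID (X :|: comp e (~: S) w) (W :\: S)) addnC leq_add2l subset_leq_card //.
  by apply/subsetP => z; rewrite !inE; case: (z \in S); rewrite ?andbT.
have := indep _ cY; rewrite geq_min => /orP[h|]; last by lia.
have E := maxX (X :|: comp e (~: S) w); rewrite /P cY h in E.
by move: wX; rewrite -E ?subsetUl // !inE connect0 orbT.
Qed.

Lemma linked_sub e W X Y j : X \subset Y -> linked e W X j -> linked e W Y j.
Proof.
move=> /subsetP XY h S /h[x [w [xX wW c]]]; exists x, w; split => //.
by move: xX; rewrite !inE => /andP[-> /XY].
Qed.

(** Take [Q] minimal. Without a non-cut vertex [y] it is no longer linked, so fewer than [j]
    vertices cut [Q] minus [y] from [W], and adding [y] to them cuts off all of [Q]. *)
Lemma min_piece e W X j : symmetric e -> conn e X -> linked e W X j -> 0 < j ->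
  exists Q S : {set V}, [/\ Q \subset X, conn e Q, linked e W Q j, #|S| <= j & cut_off e W Q S].
Proof.
move=> es cX lX j0; pose P Y := `[< conn e Y /\ linked e W Y j >].
have PX : P X by apply/asboolP.
have [Q /minsetP[/asboolP[cQ lQ] minQ] QX] := minset_exists PX.
case: (leqP #|Q| 1) => [Q1|Q2].
  exists Q, Q; split => //; first exact: leq_trans Q1 j0.
  by move=> x w; rewrite setDv inE.
have [Y [y [cY Y0 yY E]]] := conn_remove es cQ Q2.
have YQ : Y \subset Q by rewrite E subsetUr.
have : ~ linked e W Y j.
  move=> lY; have := minQ Y (asboolT (conj cY lY)) YQ => E'.
  by move: yY; rewrite E' E !inE eqxx.
move=> /existsNP[S /not_implyP[Sj hS]]; exists Q, (y |: S); split => //.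
  by rewrite cardsU1; lia.
move=> x w; rewrite !inE !negb_or E !inE => /andP[/andP[xy xS]].
rewrite (negbTE xy) /= => xY /andP[/andP[wy wS] wW].
apply/negP => c; apply: hS; exists x, w; rewrite !inE xS wS; split => //.
by apply: connect_restr_mono c => //; rewrite setCS subsetUr.
Qed.

(** Greedy: [min_piece] cuts each piece found so far from [W] at a cost of at most [j] vertices. The
    next piece is taken in a component of the rest with at least [j] vertices of [W], so it cannot
    meet the earlier ones. *)
Lemma pieces e W c q j : symmetric e -> wl e W c -> 0 < j ->
  3 * (q * j + c) + q * j + j < #|W| ->
  exists Q : nat -> {set V}, (forall i, i < q -> conn e (Q i) /\ linked e W (Q i) j) /\
    (forall i i' z, i < q -> i' < q -> z \in Q i -> z \in Q i' -> i = i').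
Proof.
move=> es wW j0 hW.
have [Q [S [h1 h2 _ _]]] : exists (Q : nat -> {set V}) S, [/\
   forall i, i < q -> conn e (Q i) /\ linked e W (Q i) j,
   forall i i' z, i < q -> i' < q -> z \in Q i -> z \in Q i' -> i = i',
   #|S| <= q * j & forall i, i < q -> cut_off e W (Q i) S]; last by exists Q.
move: hW; elim: q => [|q IH] hW; first by exists (fun=> set0), set0; rewrite cards0.
have [|Q [S [h1 h2 h3 h4]]] := IH; first by lia.
have [|x xS xW] := @big_component e W c S j es wW; first by lia.
have cD := @comp_conn e (~: S) x es; set D := comp _ _ _ in xW cD.
have lD : linked e W D j.
  move=> T Tj; have /set0Pn[w] : (W :&: D) :\: T != set0.
    rewrite -card_gt0; have := cardsID T (W :&: D).
    have : #|W :&: D :&: T| <= #|T| by rewrite subset_leq_card ?subsetIr.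
    by lia.
  by rewrite !inE => /and3P[wT wW' wD]; exists w, w; rewrite !inE wT wW' wD.
have [Q' [S' [QD cQ lQ S'j coQ]]] := min_piece es cD lD j0.
have DS z : z \in D -> z \notin S.
  by move/(subsetP (comp_sub _ (_ : x \in ~: S))); rewrite !inE xS; exact.
have /set0Pn[w] : W :&: D != set0 by rewrite -card_gt0; lia.
rewrite inE => /andP[wW' wD].
have disj i z : i < q -> z \in Q i -> z \in Q' -> False.
  move=> iq zi /(subsetP QD) zD.
  have := h4 i iq z w; rewrite !inE zi DS // DS // wW' => /(_ isT isT) /negP[].
  by apply: (conn_sub cD) => //; apply/subsetP => u /DS; rewrite inE.
exists (fun i => if i == q then Q' else Q i), (S :|: S'); split.
- by move=> i; case: eqP => [//|iq] lt; apply: h1; lia.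
- move=> i i' z; case: eqP => [->|iq]; case: eqP => [->|iq'] // lt lt' z1 z2.
  + by case: (@disj i' z) => //; lia.
  + by case: (@disj i z) => //; lia.
  + by apply: (h2 i i' z) => //; lia.
- by have := cardsUI S S'; lia.
- have mono X (T : {set V}) : T \subset S :|: S' -> cut_off e W X T -> cut_off e W X (S :|: S').
    move=> sT h u v; rewrite !inE => /andP[uS uX] /andP[vS vW].
    have nT z : ~~ ((z \in S) || (z \in S')) -> z \notin T.
      by apply: contra => /(subsetP sT); rewrite inE.
    have := h u v; rewrite !inE !nT // uX vW => /(_ isT isT); apply: contra.
    by apply: connect_restr_mono; rewrite ?setCS.
  move=> i; case: eqP => [_ _|iq lt]; first exact: mono (subsetUr _ _) coQ.
  by apply: mono (subsetUl _ _) (h4 i _); lia.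
Qed.

Lemma linked_menger e X Y k : symmetric e -> linked e Y X k ->
  exists p : 'I_k -> seq V, linkage e X Y p.
Proof.
move=> es h; apply: menger => S sS; rewrite leqNgt; apply/negP => /h[x [w [xX wW c]]].
move: xX wW; rewrite !inE => /andP[xS xX] /andP[wS wW].
have [|s [ps us ls sub]] := connect_walk c; first by rewrite inE.
have /hasP[z zs zS] : has (mem S) (x :: s) by apply: sS => //=; rewrite ls.
by have := sub z zs; rewrite inE (zS : z \in S).
Qed.

Definition anchored e W Y := exists p : V -> seq V,
  (forall y, y \in Y -> abpath e [set y] W (p y)) /\
  (forall y y' z, y \in Y -> y' \in Y -> z \in p y -> z \in p y' -> y = y').

Lemma anchored_sub e W Y Y' : Y' \subset Y -> anchored e W Y -> anchored e W Y'.
Proof.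
move=> /subsetP s [p [h1 h2]]; exists p; split => [y /s/h1//|y y' z /s y1 /s y2].
exact: h2.
Qed.

Lemma linked_anchored e W X j : symmetric e -> linked e W X j ->
  exists Y, [/\ Y \subset X, #|Y| = j & anchored e W Y].
Proof.
move=> es /(linked_menger es)[p [p1 p2]].
case: j p p1 p2 => [|j] p p1 p2.
  exists set0; rewrite sub0set cards0; split => //; exists (fun=> [::]).
  by split => y; rewrite ?inE // => y' z; rewrite inE.
have hp i : exists y, p i = y :: behead (p i).
  by have := p1 i; case: (p i) => [|y s] // _; exists y.
have [x0 _] := hp ord0.
pose h i := head x0 (p i).
have hP i : h i \in p i /\ h i \in X by exact: abpath_head (p1 i).
have h_inj : injective h.
  by move=> i i' E; apply: (p2 i i' (h i)); rewrite ?(proj1 (hP _)) // E (proj1 (hP i')).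
exists [set h i | i : 'I_j.+1]; split.
- by apply/subsetP => _ /imsetP[i _ ->]; exact: (proj2 (hP i)).
- by rewrite card_imset // card_ord.
pose g y := if [pick i | h i == y] is Some i then p i else [::].
have gE i : g (h i) = p i.
  rewrite /g; case: pickP => [i' /eqP/h_inj->//|/(_ i)]; by rewrite eqxx.
exists g; split => [_ /imsetP[i _ ->]|_ _ z /imsetP[i _ ->] /imsetP[i' _ ->]].
  rewrite gE; have := p1 i; rewrite /h; have [y ->] := hp i.
  by move=> /and4P[h1 h2 _ h3]; apply/and4P; split => //=; rewrite inE.
by rewrite !gE => z1 z2; congr h; exact: p2 z1 z2.
Qed.

(** Each vertex of [S] destroys at most one of the disjoint paths; [W1] collects the ends of the
    surviving ones. *)
Lemma anchored_ends e W Y S : symmetric e -> anchored e W Y ->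
  exists W1, [/\ W1 \subset W :\: S, #|Y| <= #|W1| + #|S| &
   forall w, w \in W1 -> exists2 y, y \in Y :\: S & connect (restr e (~: S)) y w].
Proof.
move=> es [p [p1 p2]]; pose f y := last y (p y).
have fP y : y \in Y -> f y \in p y /\ f y \in W by move=> /p1; exact: abpath_last.
pose Y1 := [set y in Y | ~~ has (mem S) (p y)].
have f_inj : {in Y &, injective f}.
  move=> y y' yY yY' E; apply: (p2 y y' (f y)) => //; first by case: (fP y yY).
  by rewrite E; case: (fP y' yY').
have Y1Y : Y1 \subset Y by apply/subsetP => y; rewrite inE => /andP[].
have nS y : y \in Y1 -> forall z, z \in p y -> z \notin S.
  by rewrite inE => /andP[_ /hasPn].
have hd y : y \in Y -> p y = y :: behead (p y).
  by move=> /p1; case: (p y) => [|u s] /and4P[] //= _ _ /set1P->.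
exists (f @: Y1); split.
- apply/subsetP => _ /imsetP[y yY1 ->]; have [h1 h2] := fP y (subsetP Y1Y _ yY1).
  by rewrite inE h2 (nS _ yY1 _ h1).
- rewrite card_in_imset; last by move=> y y' /(subsetP Y1Y) h /(subsetP Y1Y) h'; exact: f_inj.
  rewrite -(cardsID Y1 Y); apply: leq_add; first by rewrite subset_leq_card ?subsetIr.
  have pS y : y \in Y :\: Y1 -> exists z, z \in S /\ z \in p y.
    by rewrite !inE => /andP[h yY]; move: h; rewrite yY /= negbK => /hasP[z]; exists z.
  have [g gP] : exists g : V -> V, forall y, y \in Y :\: Y1 -> g y \in S /\ g y \in p y.
    apply: (@fin_all_exists _ (fun=> V) (fun y u => y \in Y :\: Y1 -> u \in S /\ u \in p y)) => y.
    case h : (y \in Y :\: Y1); last by exists y.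
    by have [z zP] := pS y h; exists z.
  rewrite -(@card_in_imset _ _ g); first by apply: subset_leq_card; apply/subsetP => _ /imsetP[y /gP[h _] ->].
  move=> y y' h h' E; have [_ g1] := gP y h; have [_ g2] := gP y' h'.
  move: h h'; rewrite !in_setD => /andP[_ h] /andP[_ h'].
  by apply: (p2 y y' (g y)) => //; rewrite E.
move=> _ /imsetP[y yY1 ->]; have yY := subsetP Y1Y _ yY1; exists y.
  by rewrite inE yY (nS _ yY1) // hd // mem_head.
have := p1 y yY; rewrite /f hd // => /and4P[/= ps _ _ _].
apply: walk_connect => // z zp; rewrite inE; apply: nS yY1 _ _; by rewrite hd.
Qed.

(** After the deletion of fewer than [k] vertices, more than [k + c] paths of either family still
    reach [W], too many for [wl] to allow a separation. *)
Lemma anchored_link e W c Y Y' k : symmetric e -> wl e W c ->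
  anchored e W Y -> anchored e W Y' -> 2 * k + c <= #|Y| -> 2 * k + c <= #|Y'| ->
  exists p : 'I_k -> seq V, linkage e Y Y' p.
Proof.
move=> es wW aY aY' cY cY'; apply: linked_menger => // S Sk.
have [W1 [s1 c1 h1]] := anchored_ends S es aY.
have [W2 [s2 c2 h2]] := anchored_ends S es aY'.
apply: contrapT => no; have := wW S W1 W2 s1 s2.
have E : minn #|W1| #|W2| <= #|S| + c = false by lia.
rewrite E => h; suff: false by []; apply: h => w w' wW1 wW2; apply/negP => cw.
have [y yY cy] := h1 w wW1; have [y' yY' cy'] := h2 w' wW2.
apply: no; exists y, y'; split => //.
apply: connect_trans cy (connect_trans cw _); by rewrite (connect_restr_sym _ es).
Qed.

End ConnectivityTheory.

(** * Ladders and grids *)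

Section Ladder.
Variable V : finType.
Implicit Types (e : rel V) (A B S X Y W : {set V}).

(** The intermediate object between a linkage and a grid. The common order in which the paths meet
    the sets [R s] allows every path to be cut into one segment per set. *)
Definition ladder e A n M (p : 'I_n -> seq V) (R : nat -> {set V}) :=
  [/\ forall j, [&& sorted e (p j), uniq (p j) & starts A (p j)],
      forall i j z, z \in p i -> z \in p j -> i = j,
      forall s, s < M -> conn e (R s),
      forall s s' z, s < M -> s' < M -> z \in R s -> z \in R s' -> s = s' &
      (forall s j, s < M -> exists2 x, x \in R s & x \in p j) /\
      (forall s s' j x y, s < s' -> s' < M -> x \in R s -> x \in p j ->
         y \in R s' -> y \in p j -> index x (p j) < index y (p j))].

Lemma ladder_mono e e' A n M (p : 'I_n -> seq V) R :
  subrel e e' -> ladder e A M p R -> ladder e' A M p R.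
Proof.
move=> ee [h1 h2 h3 h4 h5]; split => //.
  by move=> j; have /and3P[h -> ->] := h1 j; rewrite (sub_sorted ee h).
by move=> s /h3; exact: conn_mono.
Qed.

Definition consec (s : seq V) x y := exists a b, s = a ++ x :: y :: b.

Lemma consec_mem (s : seq V) x y : consec s x y -> x \in s /\ y \in s.
Proof. by move=> [a [b ->]]; rewrite !mem_cat !inE !eqxx !orbT. Qed.

Lemma consec_infix (a s b : seq V) x y : consec s x y -> consec (a ++ s ++ b) x y.
Proof. by move=> [c [d ->]]; exists (a ++ c), (d ++ b); rewrite -!catA. Qed.

Lemma sorted_consec (r : rel V) s :
  sorted r s <-> (forall x y, consec s x y -> r x y).
Proof.
split=> [rs x y [a [b E]]|].
  by move: rs; rewrite E sorted_split /= => /and3P[].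
elim: s => // x [|y s] IH h //=; apply/andP; split; first by apply: h; exists [::], s.
by apply: IH => u v [a [b E]]; apply: h; exists (x :: a), b; rewrite E.
Qed.

(** * Ordering the sets that cross a minimal linkage *)

Section Cut.
Variables (e : rel V) (A B : {set V}) (k q : nat) (p : 'I_k -> seq V).
Variable R : 'I_q -> {set V}.
Hypothesis es : symmetric e.
Hypothesis Rc : forall i, conn e (R i).
Hypothesis Rd : forall i j z, z \in R i -> z \in R j -> i = j.

Definition sameR x y := [exists i, (x \in R i) && (y \in R i)].
(** The edges of the paths that run outside all [R i], as pairs in both orders. In a linkage with
    the fewest such edges each of them is critical. *)
Definition offs (p : 'I_k -> seq V) : {set V * V} :=
  [set u | `[< exists i, consec (p i) u.1 u.2 \/ consec (p i) u.2 u.1 >] &&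
           ~~ sameR u.1 u.2].

Lemma sameR_sym x y : sameR x y = sameR y x.
Proof. by apply: eq_existsb => i; rewrite andbC. Qed.

Lemma offs_sym p' x y : ((x, y) \in offs p') = ((y, x) \in offs p').
Proof.
rewrite !inE /= sameR_sym; congr (_ && _); apply/asboolP/asboolP => -[i h];
by exists i; case: h; [right|left].
Qed.

Hypothesis link : linkage e A B p.
Hypothesis minp : forall p', linkage e A B p' -> #|offs p| <= #|offs p'|.

Definition prec i i' := forall j x y, x \in R i -> x \in p j ->
  y \in R i' -> y \in p j -> index x (p j) < index y (p j).

(* Minimality of the linkage makes the edge [x0 y0] critical: without it a
   separator with one vertex on each of the other [k - 1] lines appears, and an
   [R i] missing it lies on one side of it. *)
Lemma cut_edge j1 s1 x0 y0 s2 : p j1 = s1 ++ x0 :: y0 :: s2 -> ~~ sameR x0 y0 ->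
  exists2 S : {set V}, #|S| < k & forall i i', [disjoint R i & S] -> [disjoint R i' & S] ->
    has (mem (R i)) (rcons s1 x0) -> has (mem (R i')) (y0 :: s2) -> prec i i'.
Proof.
move=> Ej1 nsame; have [lp ld] := link.
(* All edges inside the sets [R i] and all edges of the linkage, without [x0 y0]. A linkage in [e1]
   would have fewer edges outside the [R i], against [minp]. *)
pose e1 := [rel u v | [&& e u v, (u, v) != (x0, y0), (u, v) != (y0, x0) &
                          sameR u v || ((u, v) \in offs p)]].
have e1s : symmetric e1.
  move=> u v; rewrite /= es sameR_sym offs_sym; congr (_ && _).
  by rewrite andbCA; congr [&& _, _ & _]; congr (~~ _);
    apply/eqP/eqP => -[-> ->].
have e1e : subrel e1 e by move=> u v /and4P[].
have [S sS Sk] : exists2 S : {set V}, separates e1 A B S & #|S| < k.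
  apply: contrapT => no.
  have /menger[p' lp'] : forall S, separates e1 A B S -> k <= #|S|.
    by move=> S sS; rewrite leqNgt; apply/negP => h; apply: no; exists S.
  have /minp : linkage e A B p'.
    case: lp' => h1 h2; split=> // i.
    by have /and4P[h ? ? ?] := h1 i; apply/and4P; split; rewrite ?(sub_sorted e1e h).
  rewrite leqNgt => /negP[]; apply: proper_card; apply/properP; split.
    apply/subsetP => -[u v]; rewrite inE /= => /andP[/asboolP[i ci] ns].
    have e1uv : e1 u v.
      have /and4P[/sorted_consec h _ _ _] := lp'.1 i.
      by case: ci => /h //; rewrite e1s.
    by case/and4P: e1uv => _ _ _; rewrite (negbTE ns).
  exists (x0, y0); first by rewrite inE /= nsame andbT; apply/asboolP; exists j1; left; exists s1, s2.
  rewrite inE /= nsame andbT; apply/asboolP => -[i ci].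
  have /and4P[/sorted_consec h _ _ _] := lp'.1 i.
  by case: ci => /h; rewrite /= eqxx ?andbF.
have sub_walk j a t b : p j = a ++ t ++ b -> x0 \notin t \/ y0 \notin t -> sorted e1 t.
  move=> E no; apply/sorted_consec => u v cuv.
  have [ut vt] := consec_mem cuv.
  have cj : consec (p j) u v by rewrite E; exact: consec_infix.
  apply/and4P; split.
  - by have /and4P[/sorted_consec h _ _ _] := lp j; exact: h.
  - by apply/eqP => -[E1 E2]; case: no; rewrite -?E1 -?E2 ?ut ?vt.
  - by apply/eqP => -[E1 E2]; case: no; rewrite -?E1 -?E2 ?ut ?vt.
  - by case ns: (sameR u v) => //=; rewrite inE /= ns andbT; apply/asboolP; exists j; left.
have un j : uniq (p j) by have /and4P[] := lp j.
have nj j z : j != j1 -> z \in p j1 -> z \notin p j.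
  by move=> jj zj1; apply: contra jj => zj; rewrite (ld _ _ _ zj zj1).
have x0p : x0 \in p j1 by rewrite Ej1 mem_cat !inE eqxx orbT.
have y0p : y0 \in p j1 by rewrite Ej1 mem_cat !inE eqxx !orbT.
have [h hP] : exists h, forall j, j != j1 -> h j \in S /\ h j \in p j.
  apply: (@choose_fun _ _ (fun j z => j != j1 -> z \in S /\ z \in p j)) => j; case: (eqVneq j j1) => [_|jj]; first by exists x0.
  have /and4P[_ _ sA sB] := lp j.
  have /hasP[z zp zS] : has (mem S) (p j).
    apply: sS => //; apply: (sub_walk j [::] (p j) [::]); first by rewrite cats0.
    by left; exact: nj.
  by exists z.
(* Each of the other [k - 1] paths survives in [e1] and needs a vertex of [S] of its own, so none is
   left for [p j1]. *)
have hS : h @: [set~ j1] = S.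
  apply/eqP; rewrite eqEcard; apply/andP; split.
    by apply/subsetP => _ /imsetP[j jj ->]; move: jj; rewrite !inE => /hP[].
  rewrite card_in_imset; first by rewrite cardsC1 card_ord; lia.
  move=> i j; rewrite !inE => /hP[_ hi] /hP[_ hj] E; apply: (ld i j (h i)) => //.
  by rewrite E.
have Suniq j z : z \in S -> z \in p j -> j != j1 /\ z = h j.
  rewrite -hS => /imsetP[i]; rewrite !inE => ij1 -> hj.
  by have E := ld _ _ _ (hP i ij1).2 hj; rewrite -E.
pose areach u := exists a, [/\ a \in A, a \notin S & connect (restr e1 (~: S)) a u].
pose breach u := exists b, [/\ b \in B, b \notin S & connect (restr e1 (~: S)) u b].
have contra_ab u v : areach u -> breach v -> connect (restr e1 (~: S)) u v -> False.
  move=> [a [aA aS ca]] [b [bB bS cb]] cuv.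
  have [|s [ps _ ls sub]] := connect_walk (connect_trans ca (connect_trans cuv cb)); first by rewrite inE.
  have /hasP[z zs zS] : has (mem S) (a :: s) by apply: sS => //=; rewrite ls.
  by have := sub z zs; rewrite inE (zS : z \in S).
have in_walk t : sorted e1 t -> (forall z, z \in t -> z \notin S) ->
    forall u v, u \in t -> v \in t -> connect (restr e1 (~: S)) u v.
  move=> wt nS u v ut vt; apply: (@conn_sub _ e1 [set z in t]); rewrite ?inE //.
    exact: walk_conn.
  by apply/subsetP => z; rewrite !inE; exact: nS.
have areach_walk j t b : p j = t ++ b -> sorted e1 t -> (forall z, z \in t -> z \notin S) ->
    forall u, u \in t -> areach u.
  move=> E wt nS u ut; case: t E wt nS ut => // a t E wt nS ut.
  exists a; split; first by have /and4P[_ _ + _] := lp j; rewrite E.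
    by apply: nS; rewrite mem_head.
  by apply: (in_walk (a :: t)) => //; rewrite mem_head.
have breach_walk j t b : p j = b ++ t -> sorted e1 t -> (forall z, z \in t -> z \notin S) ->
    forall u, u \in t -> breach u.
  move=> E wt nS u ut; case: t E wt nS ut => // a t E wt nS ut.
  exists (last a t); split; first by have /and4P[_ _ _] := lp j; rewrite E ends_cat.
    by apply: nS; rewrite mem_last.
  by apply: (in_walk (a :: t)) => //; rewrite mem_last.
have nSj1 z : z \in p j1 -> z \notin S.
  by move=> zp; apply/negP => /Suniq/(_ zp)[]; rewrite eqxx.
have := un j1; rewrite Ej1 -cat_rcons cat_uniq => /and3P[u1 /hasPn u2 u3].
have pre u : u \in rcons s1 x0 -> areach u.
  apply: (areach_walk j1 _ (y0 :: s2)); first by rewrite cat_rcons.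
    apply: (sub_walk j1 [::] _ (y0 :: s2)); first by rewrite cat_rcons.
    by right; apply: u2; rewrite mem_head.
  by move=> z zr; apply: nSj1; rewrite Ej1 -cat_rcons mem_cat zr.
have suf u : u \in y0 :: s2 -> breach u.
  apply: (breach_walk j1 _ (rcons s1 x0)); first by rewrite cat_rcons.
    apply: (sub_walk j1 (rcons s1 x0) _ [::]); first by rewrite cats0 cat_rcons.
    by left; apply/negP => /u2; rewrite mem_rcons mem_head.
  by move=> z zr; apply: nSj1; rewrite Ej1 -cat_rcons mem_cat zr orbT.
have Rconn i u v : [disjoint R i & S] -> u \in R i -> v \in R i ->
    connect (restr e1 (~: S)) u v.
  move=> dS ui vi; have := Rc ui vi; apply: connect_sub => a b /and3P[eab ai bi].
  have ns z : z \in R i -> z \in ~: S by move=> zi; rewrite inE (disjointFr dS zi).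
  have sab : sameR a b by apply/existsP; exists i; rewrite ai bi.
  apply: connect_restr1; rewrite ?ns //; apply/and4P; split; rewrite ?sab //.
    by apply: contra nsame => /eqP[<- <-].
  by apply: contra nsame => /eqP[<- <-]; rewrite sameR_sym.
exists S => // i i' di di' /hasP[u up ui] /hasP[v vs vi'] j x y xi xp yi yp.
(* An [R i] that avoids [S] and meets the first part of [p j1] hangs together with [A], so it cannot
   reach [B]; on any other path it therefore lies before the vertex [h j] of [S]. For [R i'] the
   roles of [A] and [B] are exchanged. *)
have nbx : ~ breach x.
  by move=> bx; apply: (contra_ab u x) => //; [exact: pre|exact: Rconn di ui xi].
have nay : ~ areach y.
  by move=> ay; apply: (contra_ab y v) => //; [exact: suf|exact: Rconn di' yi vi'].
case: (eqVneq j j1) => [Ejj|jj].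
  move: xp yp; rewrite Ejj Ej1 -cat_rcons !mem_cat !index_cat.
  case: ifP => [xr _|_ /= /suf/nbx[]]; case: ifP => [/pre/nay[]|_ /= _].
  by rewrite (leq_trans _ (leq_addr _ _)) // index_mem.
have [hjS hjp] := hP j jj; have [t1 [t2 Et]] := mem_split hjp.
have := un j; rewrite Et -cat_rcons cat_uniq => /and3P[w1 /hasPn w2 w3].
have x0t : x0 \notin p j by exact: nj.
have onlyh z : z \in p j -> z \in S -> z = h j by move=> zp zS; have [] := Suniq j z zS zp.
have tt1 z : z \in t1 -> areach z.
  apply: (areach_walk j _ (h j :: t2)) => //.
    apply: (sub_walk j [::] _ (h j :: t2)) => //; left.
    by apply: contra x0t => h'; rewrite Et mem_cat h'.
  move=> w wt; apply/negP => /onlyh Ew; move: w1; rewrite rcons_uniq => /andP[/negP[]].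
  by rewrite -Ew // Et mem_cat wt.
have tt2 z : z \in t2 -> breach z.
  apply: (breach_walk j _ (rcons t1 (h j))); first by rewrite cat_rcons.
    apply: (sub_walk j (rcons t1 (h j)) _ [::]); first by rewrite cats0 cat_rcons.
    by left; apply: contra x0t => h'; rewrite Et mem_cat inE h' !orbT.
  move=> w wt; apply/negP => /onlyh Ew; have /negP[] := w2 w wt.
  by rewrite Ew ?mem_rcons ?mem_head // Et mem_cat inE wt !orbT.
have neh z i0 : [disjoint R i0 & S] -> z \in R i0 -> z != h j.
  by move=> d zi; apply/eqP => E; have := disjointFr d zi; rewrite E hjS.
move: xp yp; rewrite Et !mem_cat !inE (negbTE (neh _ _ di xi)) (negbTE (neh _ _ di' yi)) /=.
move=> /orP xt /orP yt.
have xr : x \in rcons t1 (h j).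
  by rewrite mem_rcons inE; case: xt => [->|/tt2/nbx[]]; rewrite orbT.
have yr : y \notin rcons t1 (h j).
  by rewrite mem_rcons inE negb_or (neh _ _ di' yi); apply/negP => /tt1/nay.
by rewrite !index_cat xr (negbTE yr) (leq_trans _ (leq_addr _ _)) // index_mem.
Qed.

Lemma hit_card S : #|[set i | ~~ [disjoint R i & S]]| <= #|S|.
Proof.
set T := [set i | _].
have [g gP] : exists g : 'I_q -> option V, forall i, i \in T ->
    exists z, [/\ g i = Some z, z \in R i & z \in S].
  apply: (@choose_fun _ _ (fun i o => i \in T -> exists z, [/\ o = Some z, z \in R i & z \in S])) => i; case iT: (i \in T); last by exists None.
  move: iT; rewrite inE => /pred0Pn[z /andP[zi zS]].
  by exists (Some z) => _; exists z.
rewrite -(@card_in_imset _ _ g).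
  have Si : injective (@Some V) by move=> ? ? [].
  rewrite -(card_imset _ Si); apply: subset_leq_card.
  by apply/subsetP => _ /imsetP[i /gP[z [-> _ zS]] ->]; apply: imset_f.
move=> i j /gP[z [-> zi _]] /gP[z' [-> zj _]] [E]; apply: (Rd zi).
by rewrite E.
Qed.

(** Sort the sets by their first vertex on [p j1] and cut this path in front of every [2 * k]-th of
    them. The two separators around a block have fewer than [2 * k] vertices together, so some set
    of the block avoids both. The cut between two blocks then orders their chosen sets on all
    paths. *)
Lemma star_order M j1 (I : {set 'I_q}) : 
  (forall i, i \in I -> has (mem (R i)) (p j1)) ->
  2 * k * M.+1 < #|I| ->
  exists r : nat -> 'I_q, (forall s, s < M -> r s \in I) /\
    (forall s, s.+1 < M -> prec (r s) (r s.+1)).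
Proof.
move=> hit cI; have k0 : 0 < k by exact: leq_ltn_trans (ltn_ord j1).
have [i0 _] : exists i, i \in I by apply/set0Pn; rewrite -card_gt0; lia.
pose f i := find (mem (R i)) (p j1).
have x0 : V by have := hit i0; case: (p j1) (link.1 j1) => [/and4P[]//|x].
pose L := sort (relpre f leq) (enum I).
have Lsz : size L = #|I| by rewrite size_sort -cardE.
have LI a : a < #|I| -> nth i0 L a \in I.
  by move=> h; rewrite -mem_enum -(mem_sort (relpre f leq)) mem_nth ?Lsz.
have Luniq : uniq L by rewrite sort_uniq enum_uniq.
have fP i : i \in I -> nth x0 (p j1) (f i) \in R i by move=> /hit; exact: nth_find.
have f_inj i i' : i \in I -> i' \in I -> f i = f i' -> i = i'.
  by move=> iI i'I E; apply: (Rd (fP i iI)); rewrite E; exact: fP.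
have Lle a b : a <= b -> b < #|I| -> f (nth i0 L a) <= f (nth i0 L b).
  move=> ab bI; apply: (@sorted_leq_nth _ (relpre f leq)) => //; rewrite ?inE ?Lsz //.
  - by move=> x y z /=; exact: leq_trans.
  - by move=> x /=.
  - by apply: sort_sorted => x y /=; exact: leq_total.
  - exact: leq_ltn_trans ab bI.
have Llt a b : a < b -> b < #|I| -> f (nth i0 L a) < f (nth i0 L b).
  move=> ab bI; rewrite ltn_neqAle Lle ?(ltnW ab) // andbT; apply/eqP => E.
  have aI : a < #|I| by exact: ltn_trans ab bI.
  have /eqP := f_inj _ _ (LI a aI) (LI b bI) E.
  by rewrite nth_uniq ?Lsz // => /eqP; lia.
have cut c : exists S : {set V}, 0 < c < #|I| -> #|S| < k /\ forall a b, a < c -> c <= b -> b < #|I| ->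
    [disjoint R (nth i0 L a) & S] -> [disjoint R (nth i0 L b) & S] ->
    prec (nth i0 L a) (nth i0 L b).
  case h: (0 < c < #|I|); last by exists set0.
  case/andP: h => c0 cc.
  have fc0 : 0 < f (nth i0 L c) by apply: leq_ltn_trans (Llt 0 c c0 cc).
  have [t1 [y0 [s2 [E y0R nh]]]] := first_hit (hit _ (LI c cc)).
  have Ef : f (nth i0 L c) = size t1.
    by rewrite /f E find_cat (negbTE nh) /= (y0R : y0 \in _) addn0.
  case/lastP: t1 E nh Ef => [|s1 x0'] E nh Ef; first by move: fc0; rewrite Ef.
  move: (E); rewrite cat_rcons => E'.
  have ns : ~~ sameR x0' y0.
    apply/negP => /existsP[i /andP[xi yi]]; case/negP: nh; apply/hasP; exists x0'.
      by rewrite mem_rcons mem_head.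
    by rewrite /= (Rd y0R yi).
  have [S Sk hS] := cut_edge E' ns; exists S => _; split => // a b ac cb bI da db.
  have aI : a < #|I| by apply: leq_trans cc; exact: ltnW.
  apply: hS => //; apply/hasP.
    exists (nth x0 (p j1) (f (nth i0 L a))); last exact: fP (LI a aI).
    have lt := Llt a c ac cc; rewrite E nth_cat -Ef lt mem_nth // -Ef //.
  exists (nth x0 (p j1) (f (nth i0 L b))); last exact: fP (LI b bI).
  have le := Lle c b cb bI; have := hit _ (LI b bI); rewrite has_find -/(f _) {1}E size_cat.
  rewrite Ef in le => lt; rewrite E nth_cat ltnNge le /=; apply: mem_nth => /=.
  by move: lt le; rewrite /=; lia.
have [Sc ScP] := choose_fun cut.
(* The successor keeps [c 0] positive: a cut needs a vertex of the path in front of it. *)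
pose c s := (2 * k * s).+1.
have cM s : s <= M -> 0 < c s < #|I|.
  move=> sM; rewrite /c /=; apply: leq_trans cI; rewrite ltnS mulnS.
  by have := leq_mul (leqnn (2 * k)) sM; lia.
have blk s : exists a, s < M -> [/\ c s <= a, a < c s.+1,
    [disjoint R (nth i0 L a) & Sc (c s)] & [disjoint R (nth i0 L a) & Sc (c s.+1)]].
  case sM: (s < M); last by exists 0.
  have /andP[_ h2] := cM s.+1 sM.
  pose g (a : 'I_(2 * k)) := nth i0 L (c s + a).
  have lt a : a < 2 * k -> c s + a < #|I| by rewrite /c in h2 *; lia.
  have g_inj : injective g.
    move=> a b /eqP; rewrite nth_uniq ?Lsz ?lt // => /eqP E; apply: val_inj => /=; lia.
  have cg : #|g @: setT| = 2 * k by rewrite card_imset // cardsT card_ord.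
  have [S1 _] := ScP (c s) (cM s (ltnW sM)); have [S2 _] := ScP (c s.+1) (cM s.+1 sM).
  pose T c' : {set 'I_q} := [set i | ~~ [disjoint R i & Sc c']].
  have H1 : #|T (c s)| <= #|Sc (c s)| := hit_card _.
  have H2 : #|T (c s.+1)| <= #|Sc (c s.+1)| := hit_card _.
  have : ~~ (g @: setT \subset T (c s) :|: T (c s.+1)).
    by apply/negP => /subset_leq_card; rewrite cg cardsU; lia.
  case/subsetPn => _ /imsetP[a _ ->]; rewrite !inE negb_or !negbK => /andP[d1 d2].
  by exists (c s + a) => _; split => //; rewrite /c; have := ltn_ord a; lia.
have [a aP] := choose_fun blk.
exists (fun s => nth i0 L (a s)); split=> [s sM|s sM].
  by have [h1 h2 _ _] := aP s sM; have /andP[_ h3] := cM s.+1 sM; apply: LI; lia.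
have [h1 h2 h3 h4] := aP s (ltnW sM); have [h1' h2' h3' h4'] := aP s.+1 sM.
have [_] := ScP (c s.+1) (cM s.+1 (ltnW sM)); apply => //.
by have /andP[_ h5] := cM s.+2 sM; lia.
Qed.

End Cut.

Lemma min_linkage e A B k q (R : 'I_q -> {set V}) :
  (exists p : 'I_k -> seq V, linkage e A B p) ->
  exists2 p : 'I_k -> seq V, linkage e A B p &
    forall p' : 'I_k -> seq V, linkage e A B p' -> #|offs R p| <= #|offs R p'|.
Proof.
move=> [p lp]; pose P n := `[< exists2 p : 'I_k -> seq V, linkage e A B p & #|offs R p| = n >].
have exP : exists n, P n by exists #|offs R p|; apply/asboolP; exists p.
case: (ex_minnP exP) => m /asboolP[p0 lp0 <-] hm; exists p0 => // p' lp'.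
by apply: hm; apply/asboolP; exists p'.
Qed.

(** [star_order] compares neighbouring sets only. Transitivity passes through the sets in between,
    which meet every path of [J]; a set chosen twice would precede itself. *)
Lemma star e A B k q (p : 'I_k -> seq V) (R : 'I_q -> {set V}) n M
    (J : {set 'I_k}) (I : {set 'I_q}) :
  symmetric e -> (forall i, conn e (R i)) ->
  (forall i j z, z \in R i -> z \in R j -> i = j) ->
  linkage e A B p ->
  (forall p' : 'I_k -> seq V, linkage e A B p' -> #|offs R p| <= #|offs R p'|) ->
  0 < n -> n <= #|J| -> 2 * k * M.+1 < #|I| ->
  (forall i j, i \in I -> j \in J -> has (mem (R i)) (p j)) ->
  exists (p' : 'I_n -> seq V) R', ladder e A M p' R'.
Proof.
move=> es Rc Rd lp mp n0 nJ cI hit.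
have [f f_inj fJ] := card_inj nJ.
have [|r [rI rlt]] := @star_order e A B k q p R es Rc Rd lp mp M (f (Ordinal n0)) I _ cI.
  by move=> i iI; exact: hit.
pose prec' i i' := forall j x y, j \in J -> x \in R i -> x \in p j ->
  y \in R i' -> y \in p j -> index x (p j) < index y (p j).
have ord s d : s + d.+1 < M -> prec' (r s) (r (s + d.+1)).
  elim: d => [|d IH] h j x y jJ xi xp yi yp.
    by rewrite addn1 in h yi; exact: (rlt s h j x y).
  have h' : s + d.+1 < M by lia.
  have /hasP[z zp zi] := hit _ j (rI _ h') jJ.
  apply: ltn_trans (IH h' j x z jJ xi xp zi zp) _.
  by rewrite addnS in h yi; exact: (rlt _ h j z y).
have ord' s s' : s < s' -> s' < M -> prec' (r s) (r s').
  by move=> lt; have -> : s' = s + (s' - s.+1).+1 by [lia]; exact: ord.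
exists (p \o f), (R \o r); split=> [j|i j z|s sM|s s' z sM sM'|].
- by have /and4P[h1 h2 h3 _] := lp.1 (f j); rewrite /= h1 h2 h3.
- by move=> zi zj; apply: f_inj; exact: lp.2 zi zj.
- exact: Rc.
- move=> /= zs zs'; have E := Rd _ _ _ zs zs'; apply: contrapT => /eqP ne.
  have loop t t' : t < t' -> t' < M -> r t = r t' -> False.
    move=> lt lt' Ett; have /hasP[w wp wr] := hit _ _ (rI t' lt') (fJ (Ordinal n0)).
    have := ord' t t' lt lt' _ w w (fJ (Ordinal n0)); rewrite Ett => /(_ wr wp wr wp).
    by rewrite ltnn.
  by case: (ltngtP s s') ne => // lt _; [apply: (loop s s')|apply: (loop s' s)].
- split=> [s j sM|s s' j x y lt sM] /=.
    by have /hasP[w wp wr] := hit _ _ (rI s sM) (fJ j); exists w.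
  exact: ord'.
Qed.

End Ladder.

(** If all degrees are below [g], a ball of radius [g] has at most [g ^ g] vertices, so some vertex
    lies outside it and every simple path to that vertex is long enough. *)
Lemma path_or_star (T : finType) (L : rel T) g :
  (forall x y, connect L x y) -> irreflexive L -> g ^ g < #|T| ->
  (exists c : nat -> T, (forall i j, i < g -> j < g -> c i = c j -> i = j) /\
     (forall i, i.+1 < g -> L (c i) (c i.+1))) \/
  (exists c0 (c : nat -> T), (forall i j, i < g -> j < g -> c i = c j -> i = j) /\
     (forall i, i < g -> L c0 (c i))).
Proof.
move=> cL iL cT.
case: (pselect (exists c0, g <= #|[set y | L c0 y]|)) => [[c0 /card_inj[f fi fL]]|no].
  right; case: g f fi fL {cT} => [|g] f fi fL; first by exists c0, (fun=> c0).
  exists c0, (fun i => f (inord i)); split => [i j ig jg /fi|i ig].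
    by move/(congr1 val); rewrite /= !inordK.
  by have := fL (inord i); rewrite inE.
left; have [x _] : exists x : T, x \in T by apply/card_gt0P; exact: leq_ltn_trans (leq0n _) cT.
pose ball n := iter n (fun X : {set T} => \bigcup_(x in X) (x |: [set y | L x y])) [set x].
have ballS n y z : y \in ball n -> L y z -> z \in ball n.+1.
  by move=> yb Lyz; apply/bigcupP; exists y; rewrite // !inE Lyz orbT.
have ball_mono n m : n <= m -> ball n \subset ball m.
  move=> /subnKC <-; elim: (m - n) => [|d IH]; first by rewrite addn0.
  rewrite addnS; apply: subset_trans IH _; apply/subsetP => y yb.
  by apply/bigcupP; exists y; rewrite // !inE eqxx.
have card_ball n : #|ball n| <= g ^ n.
  elim: n => [|n IH]; first by rewrite /= cards1.
  rewrite expnSr; apply: leq_trans (leq_mul IH (leqnn g)); rewrite -sum_nat_const.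
  apply: leq_trans (_ : _ <= \sum_(y in ball n) #|y |: [set z | L y z]|) _.
    rewrite /ball /= -/(ball n); elim/big_ind2: _ => [|A a B b hA hB|//]; first by rewrite cards0.
    by rewrite cardsU; lia.
  apply: leq_sum => y _; rewrite cardsU1 inE iL /= add1n ltnNge; apply/negP => h.
  by apply: no; exists y.
have /subsetPn[y _ yb] : ~~ ([set: T] \subset ball g).
  apply/negP => /subset_leq_card; rewrite cardsT; have := card_ball g; lia.
have /connectP[p pp ly] := cL x y.
case/shortenP: pp ly => p' pp' up' _ ly.
have inb i : i < size (x :: p') -> nth x (x :: p') i \in ball i.
  elim: i => [_|i IH lt]; first by rewrite /= inE.
  by apply: ballS (IH (ltnW lt)) _; exact: (pathP x pp').
have big : g <= size p'.
  rewrite leqNgt; apply/negP => lt; case/negP: yb.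
  apply: (subsetP (ball_mono (size p') g (ltnW lt))).
  by rewrite ly -[last x p']/(last x (x :: p')) -nth_last; exact: (inb (size p')).
exists (nth x (x :: p')); split => [i j ig jg|i ig].
  have h k : k < g -> k < size (x :: p').
    by move=> kg; rewrite /= ltnS; exact: leq_trans (ltnW kg) big.
  by move/eqP; rewrite nth_uniq ?h // => /eqP.
by apply: (pathP x pp'); exact: leq_trans (ltnW ig) big.
Qed.

Lemma pigeonhole (T : finType) (F : finType) (f : T -> F) m :
  #|F| * m < #|T| -> exists y, m < #|[set x | f x == y]|.
Proof.
move=> h; apply: contrapT => no; move: h; rewrite ltnNge => /negP[].
rewrite -cardsT (card_partition (preim_partitionP f [set: T])).
have sub : preim_partition f [set: T] \subset [set [set x | f x == y] | y : F].
  apply/subsetP => X /imsetP[x _ ->]; apply/imsetP; exists (f x) => //.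
  by apply/setP => z; rewrite !inE eq_sym.
apply: leq_trans (_ : \sum_(X in preim_partition f [set: T]) m <= _).
  apply: leq_sum => X /(subsetP sub)/imsetP[y _ ->]; rewrite leqNgt; apply/negP => h.
  by apply: no; exists y.
rewrite sum_nat_const leq_mul2r; apply/orP; right.
by apply: leq_trans (subset_leq_card sub) _; exact: leq_imset_card.
Qed.

(** * From a ladder to a grid *)

Section Grid.
Variable V : finType.
Implicit Types (e : rel V) (A B S X Y W : {set V}).

(** The first index numbers columns and the second rows. Extra adjacencies are allowed: this is a
    grid minor, not an induced one. *)
Definition gridm e g M (B : nat -> nat -> {set V}) :=
  [/\ forall i r, i < g -> r < M -> conn e (B i r) /\ B i r != set0,
      forall i r i' r' z, i < g -> r < M -> i' < g -> r' < M ->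
        z \in B i r -> z \in B i' r' -> i = i' /\ r = r',
      forall i r, i.+1 < g -> r < M -> adjS e (B i r) (B i.+1 r) &
      forall i r, i < g -> r.+1 < M -> adjS e (B i r) (B i r.+1)].

Lemma gridm_mono e e' g M (B : nat -> nat -> {set V}) : subrel e e' -> gridm e g M B -> gridm e' g M B.
Proof.
move=> ee [h1 h2 h3 h4]; split => //.
- by move=> i r ig rM; have [c n] := h1 i r ig rM; split => //; exact: conn_mono c.
- by move=> i r ig rM; apply: adjS_mono (h3 i r ig rM).
- by move=> i r ig rM; apply: adjS_mono (h4 i r ig rM).
Qed.

Definition sub (s : seq V) a b := [set z in s | a <= index z s < b].

Lemma sub_walk e s a b : symmetric e -> sorted e s -> uniq s -> conn e (sub s a b).
Proof.
move=> es ss us; have -> : sub s a b = [set z in take (b - a) (drop a s)].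
  apply/setP => z; rewrite !inE; apply/andP/idP => [[zs /andP[h1 h2]]|zt].
    rewrite -(nth_index z zs) -[index z s](subnKC h1) -nth_drop.
    have lt : index z s - a < size (take (b - a) (drop a s)).
      have lt0 : index z s < size s by rewrite index_mem.
      by rewrite size_take_min size_drop; lia.
    by rewrite -(nth_take z (n0 := b - a)) ?mem_nth //; lia.
  have /(nthP z)[i] := zt; rewrite size_take_min size_drop => lt.
  move: lt; rewrite leq_min ltn_subRL => /andP[lt1 lt2].
  rewrite nth_take; last by lia.
  rewrite nth_drop => <-; rewrite mem_nth; last by lia.
  by rewrite index_uniq //; lia.
apply: walk_conn => //.
have h1 : sorted e (drop a s) by have := @sorted_cat _ e (take a s) (drop a s); rewrite cat_take_drop => /(_ ss)[].
by have := @sorted_cat _ e (take (b - a) (drop a s)) (drop (b - a) (drop a s)); rewrite cat_take_drop => /(_ h1)[].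
Qed.

Lemma sub_mono s a b a' b' : a' <= a -> b <= b' -> sub s a b \subset sub s a' b'.
Proof.
by move=> h1 h2; apply/subsetP => z; rewrite !inE => /and3P[-> h3 h4]; lia.
Qed.

Lemma sub_disj s a b a' b' z : z \in sub s a b -> z \in sub s a' b' ->
  b <= a' -> False.
Proof. by rewrite !inE => /and3P[_ h1 h2] /and3P[_ h3 h4]; lia. Qed.

Lemma sub_n0 s a b : uniq s -> a < b -> b <= size s -> sub s a b != set0.
Proof.
case: s => [|x s] us ab bs; first by rewrite /= in bs; lia.
have lt := leq_trans ab bs; apply/set0Pn; exists (nth x (x :: s) a).
by rewrite in_set index_uniq // mem_nth // leqnn ab.
Qed.

Lemma sub_adj e s a b c : sorted e s -> uniq s -> a < b -> b < c -> c <= size s ->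
  adjS e (sub s a b) (sub s b c).
Proof.
move=> ss us ab bc cs; case: s ss us cs => [|x s] ss us cs; first by rewrite /= in cs; lia.
have sz : b.-1.+1 < size (x :: s) by lia.
exists (nth x (x :: s) b.-1), (nth x (x :: s) b); split.
- have sz' : b.-1 < size (x :: s) by lia.
  by rewrite in_set index_uniq // mem_nth //; lia.
- have sz' : b < size (x :: s) by lia.
  by rewrite in_set index_uniq // mem_nth //; lia.
- have h : b = b.-1.+1 by lia.
  by rewrite {2}h; apply: (pathP x ss).
Qed.

Definition joins e X Y Z :=
  conn e Y /\ (Y = set0 /\ adjS e X Z \/ adjS e X Y /\ adjS e Y Z).

Section LadderGrid.
Variables (e : rel V) (A : {set V}) (n M : nat) (p : 'I_n -> seq V) (R : nat -> {set V}).
Hypotheses (es : symmetric e) (lad : ladder e A M p R).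

Let lp j : [/\ sorted e (p j), uniq (p j) & starts A (p j)].
Proof. by have [h _ _ _ _] := lad; have /and3P[] := h j. Qed.
Let ld i j z : z \in p i -> z \in p j -> i = j.
Proof. by have [_ h _ _ _] := lad; exact: h. Qed.
Let Rc s : s < M -> conn e (R s).
Proof. by have [_ _ h _ _] := lad; exact: h. Qed.
Let Rd s s' z : s < M -> s' < M -> z \in R s -> z \in R s' -> s = s'.
Proof. by have [_ _ _ h _] := lad; exact: h. Qed.
Let hit s j : s < M -> exists2 x, x \in R s & x \in p j.
Proof. by have [_ _ _ _ [h _]] := lad; exact: h. Qed.
Let ord s s' j x y : s < s' -> s' < M -> x \in R s -> x \in p j ->
  y \in R s' -> y \in p j -> index x (p j) < index y (p j).
Proof. by have [_ _ _ _ [_ h]] := lad; exact: h. Qed.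

(** Segments begin at the first vertex of [R s], but the first one begins with the path itself, so
    that its starting vertex in [A] is included, and the last one ends with the path. *)
Definition lo j s := if s == 0 then 0 else if s < M then find (mem (R s)) (p j) else size (p j).
Definition seg j s := sub (p j) (lo j s) (lo j s.+1).

Lemma lo_le j s : lo j s <= size (p j).
Proof. by rewrite /lo; case: ifP => // _; case: ifP => // _; exact: find_size. Qed.

(** By [ord], all vertices of [R s] on the path come before the first vertex of [R s.+1]. *)
Lemma R_seg s j z : s < M -> z \in R s -> z \in p j -> z \in seg j s.
Proof.
move=> sM zR zp; rewrite inE zp /=; apply/andP; split.
  rewrite /lo; case: ifP => // _; rewrite sM leqNgt; apply/negP => h.
  by have := before_find z h; rewrite nth_index //= zR.
rewrite /lo /=; case: ifP => [s1|_]; last by rewrite index_mem.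
have [w wR wp] := hit j s1.
have hw : has (mem (R s.+1)) (p j) by apply/hasP; exists w.
rewrite -(@index_uniq _ z (find (mem (R s.+1)) (p j)) (p j)); last by case: (lp j).
  apply: (@ord s s.+1 j) => //; last by rewrite mem_nth // -has_find.
  exact: (nth_find z hw).
by rewrite -has_find.
Qed.

Lemma lo_lt j s : s < M -> lo j s < lo j s.+1.
Proof.
move=> sM; have [w wR wp] := hit j sM; have := R_seg sM wR wp; rewrite inE => /and3P[_ h1 h2].
exact: leq_ltn_trans h1 h2.
Qed.

Lemma lo_mono j s s' : s <= s' -> s' <= M -> lo j s <= lo j s'.
Proof.
move=> /subnKC <-; elim: (s' - s) => [|d IH]; first by rewrite addn0.
by rewrite addnS => h; apply: leq_trans (IH (ltnW h)) (ltnW (lo_lt j h)).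
Qed.

Lemma lo_smono j s s' : s < s' -> s' <= M -> lo j s < lo j s'.
Proof. by move=> h1 h2; apply: leq_trans (lo_mono j h1 h2); apply: lo_lt; lia. Qed.

Definition level s := R s :|: \bigcup_(j in 'I_n) seg j s.

Lemma seg_p j s z : z \in seg j s -> z \in p j.
Proof. by rewrite inE => /and3P[]. Qed.

Lemma level_disj s s' z : s < M -> s' < M -> z \in level s -> z \in level s' -> s = s'.
Proof.
have segs t t' j w : t < M -> t' < M -> w \in seg j t -> w \in seg j t' -> t = t'.
  have aux u u' : u < u' -> u' < M -> w \in seg j u -> w \in seg j u' -> False.
    by move=> lt h h1 h2; apply: (sub_disj h1 h2); apply: lo_mono; lia.
  by move=> h h' w1 w2; case: (ltngtP t t') => // lt; case: (aux _ _ lt _ _ _).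
move=> h h'; rewrite !inE => /orP[zR|/bigcupP[j _ zj]] /orP[zR'|/bigcupP[j' _ zj']].
- exact: Rd zR zR'.
- by apply: (segs s s' j' z) => //; apply: R_seg => //; exact: seg_p zj'.
- by apply: (segs s s' j z) => //; apply: R_seg => //; exact: seg_p zj.
- by have E := ld (seg_p zj) (seg_p zj'); move: zj'; rewrite -E; exact: segs.
Qed.

(** The graph formed by the paths at level [s]: neighbours are joined inside [R s] without touching
    any path on the way. *)
Definition lam s : rel 'I_n := fun j j' => (j != j') &&
  `[< exists Y, [/\ Y \subset R s, forall i z, z \in Y -> z \notin p i &
      joins e (seg j s) Y (seg j' s)] >].

(** A walk in [R s] to an unreachable path has a last vertex on a reachable one; the stretch from
    there to the next path it meets would be an edge of [lam s]. *)
Lemma lam_connect s j j' : s < M -> connect (lam s) j j'.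
Proof.
move=> sM; apply: contrapT => /negP nc.
have [x xR xp] := hit j sM; have [y yR yp] := hit j' sM.
have [t [pt _ lt tR]] := connect_walk (Rc sM xR yR) xR.
pose inJ := [pred z | [exists i, (z \in p i) && connect (lam s) j i]].
have [|s1 [z [s2 [E /existsP[i /andP[zi ci]] nJ]]]] := @last_hit _ inJ (x :: t).
  by apply/hasP; exists x; [rewrite mem_head|apply/existsP; exists j; rewrite xp connect0].
have ys : y \in s2.
  have : y \in x :: t by rewrite -lt mem_last.
  have yz : y != z.
    by apply: contraNneq nc => yz; rewrite -(ld zi (_ : z \in p j')) // -yz.
  have: last x t = last z s2 by rewrite -[LHS]/(last x (x :: t)) E last_cat.
  rewrite lt => Ey _; case: (s2) Ey yz => [/= ->|a b /= ->]; first by rewrite eqxx.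
  by rewrite mem_last.
have [|t1 [w [t2 [E2 /existsP[i' wi'] nL]]]] := @first_hit _ [pred u | [exists i, u \in p i]] s2.
  by apply/hasP; exists y => //; apply/existsP; exists j'.
have wJ : ~~ connect (lam s) j i'.
  apply: contra nJ => c; apply/hasP; exists w; first by rewrite E2 mem_cat mem_head orbT.
  by apply/existsP; exists i'; rewrite wi' c.
have sub_t u : u \in z :: t1 ++ w :: t2 -> u \in R s.
  by move=> h; apply: tR; rewrite E E2 mem_cat h orbT.
case/negP: wJ; apply: (connect_trans ci); apply: connect1; apply/andP; split.
  apply/eqP => Ei; case/negP: nJ; apply/hasP; exists w; first by rewrite E2 mem_cat mem_head orbT.
  by apply/existsP; exists i'; rewrite wi' -Ei ci.
have st : sorted e (x :: t) by [].
move: st; rewrite E E2 sorted_split /= => /andP[_]; rewrite cat_path /= => /and3P[pt1 ew pt2].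
apply/asboolP; exists [set u in t1]; split.
- by apply/subsetP => u; rewrite inE => ut; apply: sub_t; rewrite inE mem_cat ut orbT.
- move=> a u; rewrite inE => ut; apply: contra nL => ua; apply/hasP; exists u => //.
  by apply/existsP; exists a.
have zs : z \in seg i s by apply: R_seg => //; apply: sub_t; rewrite mem_head.
have ws : w \in seg i' s.
  by apply: R_seg => //; apply: sub_t; rewrite inE mem_cat mem_head !orbT.
split; first by apply: walk_conn => //; exact: path_sorted pt1.
case: t1 {nL sub_t E2} pt1 ew => [|a t1] /= pt1 ew.
  by left; split; [apply/setP => u; rewrite !inE|exists z, w].
right; case/andP: pt1 => eza _; split; first by exists z, a; rewrite inE mem_head.
by exists (last a t1), w; rewrite inE mem_last.
Qed.

(** A long path in [lam s] gives the joins directly. At a vertex [c0] of large degree every join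
    runs through the segment of the path [c0], which is not among the chosen ones; these joins
    overlap, so such a level can serve only one pair of columns. *)
Lemma host_level g s : g ^ g < n -> s < M -> exists c : {ffun 'I_g -> 'I_n},
  injective c /\ forall i i' : 'I_g, val i' = i.+1 -> exists Y, [/\ Y \subset level s,
    forall l z, z \in Y -> z \notin p (c l) & joins e (seg (c i) s) Y (seg (c i') s)].
Proof.
move=> gn sM; have lamE j j' : lam s j j' -> exists Y, [/\ Y \subset R s,
    forall i z, z \in Y -> z \notin p i & joins e (seg j s) Y (seg j' s)].
  by move=> /andP[_ /asboolP].
have [|||[c [ci cl]]|[c0 [c [ci cl]]]] := @path_or_star _ (lam s) g.
- by move=> j j'; exact: lam_connect.
- by move=> j; rewrite /lam eqxx.
- by rewrite card_ord.
- exists [ffun i : 'I_g => c i]; split=> [i j|i i' E]; rewrite !ffunE.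
    by move/ci => /(_ (ltn_ord _) (ltn_ord _))/val_inj.
  have E' : i' = i.+1 :> nat := E.
  have [|Y [Y1 Y2 Y3]] := lamE _ _ (cl i _); first by rewrite -E' ltn_ord.
  exists Y; split; rewrite ?E' //; last by move=> l; exact: Y2.
  by apply: subset_trans Y1 _; exact: subsetUl.
exists [ffun i : 'I_g => c i]; split=> [i j|i i' E]; rewrite !ffunE.
  by move/ci => /(_ (ltn_ord _) (ltn_ord _))/val_inj.
have ne l : l < g -> c0 != c l by move=> /cl/andP[].
have [Y1 [s1 d1 j1]] := lamE _ _ (cl i (ltn_ord i)).
have [Y2 [s2 d2 j2]] := lamE _ _ (cl i' (ltn_ord i')).
have cseg : conn e (seg c0 s) by apply: sub_walk => //; case: (lp c0).
have cY X Y : joins e (seg c0 s) Y X -> conn e (seg c0 s :|: Y) /\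
    adjS e (seg c0 s :|: Y) X.
  move=> [cY [[-> h]|[h1 h2]]]; first by rewrite setU0.
  split; first by apply: connU => //; exact: adjS_touch.
  by apply: adjS_mono h2 => //; exact: subsetUr.
have [k1 a1] := cY _ _ j1; have [k2 a2] := cY _ _ j2.
have sl : seg c0 s \subset level s.
  by apply: subset_trans (subsetUr _ _); exact: bigcup_sup.
have Rl : R s \subset level s by exact: subsetUl.
exists ((seg c0 s :|: Y1) :|: (seg c0 s :|: Y2)); split.
- by rewrite !subUset sl (subset_trans s1 Rl) (subset_trans s2 Rl).
- move=> l z; rewrite ffunE => zY; apply/negP => zp.
  have nz : z \notin p c0.
    by apply/negP => zp0; have := ne l (ltn_ord l); rewrite (ld zp0 zp) eqxx.
  have ns : z \notin seg c0 s by apply: contra nz; exact: seg_p.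
  have d1' : z \notin Y1 by apply/negP => /(d1 (c l))/negP; apply.
  have d2' : z \notin Y2 by apply/negP => /(d2 (c l))/negP; apply.
  by move: zY; rewrite !in_setU (negbTE ns) (negbTE d1') (negbTE d2').
split; last right.
  apply: connU => //; have [x xR xp] := hit c0 sM; have xs := R_seg sM xR xp.
  by exists x, x; rewrite !in_setU xs eqxx.
split.
  by apply: adjS_sym => //; apply: adjS_mono a1 => //; exact: subsetUl.
by apply: adjS_mono a2 => //; exact: subsetUr.
Qed.

(** By pigeonhole more than [m * g] levels choose the same [g] paths. Each row of the grid gets [g]
    of these levels and takes from each at most one join, between one pair of neighbouring columns,
    because joins in one level may overlap. *)
Lemma ladder_gridm g m : g ^ g < n -> n ^ g * (m * g) < M -> 0 < m ->
  exists (B : nat -> nat -> {set V}) (y : nat -> V), gridm e g m B /\ forall i, i < g -> y i \in A /\ y i \in B i 0.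
Proof.
move=> gn cM m0; have M0 : 0 < M by exact: leq_ltn_trans cM.
have [x0 _ _] := hit (Ordinal (leq_ltn_trans (leq0n _) gn)) M0.
case: g gn cM => [|g'] gn cM; first by exists (fun _ _ => set0), (fun=> x0).
set g := g'.+1 in gn cM *; have g0 : 0 < g by [].
have hc (s : 'I_M) : exists c : {ffun 'I_g -> 'I_n}, injective c /\
    forall i i' : 'I_g, val i' = i.+1 -> exists Y, [/\ Y \subset level s,
    forall l z, z \in Y -> z \notin p (c l) & joins e (seg (c i) s) Y (seg (c i') s)].
  exact: host_level.
have [cs csP] := choose_fun hc.
have [|c cc] := @pigeonhole _ _ cs (m * g); first by rewrite card_ffun !card_ord.
set X := [set s | _] in cc.
pose L := sort leq [seq val s | s <- enum X].
have Ls : size L = #|X| by rewrite size_sort size_map -cardE.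
have Lsorted : sorted ltn L.
  rewrite ltn_sorted_uniq_leq sort_uniq map_inj_uniq ?enum_uniq ?sort_sorted //.
    exact: leq_total.
  exact: val_inj.
pose lv a := nth 0 L a.
have lv_lt a b : a < b -> b <= m * g -> lv a < lv b.
  by move=> ab bm; apply: (@sorted_ltn_nth _ ltn ltn_trans) => //; rewrite inE Ls; lia.
have lv_inj a b : a <= m * g -> b <= m * g -> lv a = lv b -> a = b.
  by move=> am bm E; case: (ltngtP a b) => // /lv_lt; rewrite E ltnn => h; [have := h bm|have := h am].
have lvX a : a <= m * g -> exists2 s : 'I_M, val s = lv a & cs s = c.
  move=> am; have : lv a \in L by rewrite mem_nth // Ls; lia.
  rewrite mem_sort => /mapP[s]; rewrite mem_enum inE => /eqP E1 E2.
  by exists s.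
have lvM a : a <= m * g -> lv a < M by move=> /lvX[s <- _]; exact: ltn_ord.
have c_inj : injective c by have [s _ <-] := lvX 0 (leq0n _); exact: (csP s).1.
(* Row [r] covers the levels from [ar r] up to [ar r.+1]. Starting row 0 at level 0 puts the first
   vertices of the paths into it. *)
pose ar r := if r == 0 then 0 else lv (r * g).
have rg r : r <= m -> r * g <= m * g by move=> rm; rewrite leq_mul2r rm orbT.
have ar_le r : r <= m -> ar r <= lv (r * g).
  by move=> rm; rewrite /ar; case: eqP.
have ar_lt r : r < m -> ar r < ar r.+1.
  move=> rm; apply: leq_ltn_trans (ar_le r (ltnW rm)) _; rewrite /ar /=.
  by apply: lv_lt; [rewrite mulSn; lia|exact: rg].
have arM r : r <= m -> ar r <= M.
  by move=> rm; apply: leq_trans (ar_le r rm) (ltnW (lvM _ (rg r rm))).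
have ar_mono r r' : r <= r' -> r' <= m -> ar r <= ar r'.
  move=> /subnKC <-; elim: (r' - r) => [|d IH]; first by rewrite addn0.
  by rewrite addnS => h; apply: leq_trans (IH (ltnW h)) (ltnW (ar_lt _ h)).
pose ci i := c (inord i).
have ci_inj i i' : i < g -> i' < g -> ci i = ci i' -> i = i'.
  by move=> h h' /c_inj/(congr1 val); rewrite /= !inordK.
pose li i r := lv (r * g + i).
have rgi i r : i < g -> r < m -> r * g + i <= m * g.
  by move=> h h'; have := rg _ h'; rewrite mulSn; lia.
have hY (ir : nat * nat) : exists Y, ir.1.+1 < g -> ir.2 < m ->
    [/\ Y \subset level (li ir.1 ir.2), forall l z, l < g -> z \in Y -> z \notin p (ci l) &
     joins e (seg (ci ir.1) (li ir.1 ir.2)) Y (seg (ci ir.1.+1) (li ir.1 ir.2))].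
  case: ir => i r /=; case h : ((i.+1 < g) && (r < m)); last first.
    by exists set0 => h1 h2; rewrite h1 h2 in h.
  case/andP: h => ig rm; have [s Es Ec] := lvX _ (rgi i r (ltnW ig) rm).
  have [|Y [Y1 Y2 Y3]] := (csP s).2 (inord i) (inord i.+1).
    by rewrite /= !inordK //; exact: ltnW.
  by exists Y; rewrite /li -Es /ci -Ec; split => // l z _; exact: Y2.
have [Y0 Y0P] := choose_fun hY.
pose Y i r := if i.+1 < g then Y0 (i, r) else set0.
pose T i r := sub (p (ci i)) (lo (ci i) (ar r)) (lo (ci i) (ar r.+1)).
have segT i r : i < g -> r < m -> seg (ci i) (li i r) \subset T i r.
  move=> ig rm; apply: sub_mono; apply: lo_mono.
  - by apply: leq_trans (ar_le r (ltnW rm)) _; rewrite /li; case: (i) ig => [|j] ig;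
      [rewrite addn0|apply: ltnW; apply: lv_lt; [lia|exact: rgi]].
  - by apply: ltnW; apply: lvM; exact: rgi.
  - rewrite /ar /=; apply: lv_lt; [by rewrite mulSn; lia|exact: rg].
  - exact: arM.
have segT' i r : i.+1 < g -> r < m -> seg (ci i.+1) (li i r) \subset T i.+1 r.
  move=> ig rm; apply: sub_mono; apply: lo_mono.
  - by apply: leq_trans (ar_le r (ltnW rm)) _; rewrite /li; case: (i) ig => [|j] ig;
      [rewrite addn0|apply: ltnW; apply: lv_lt; [lia|apply: rgi => //; lia]].
  - by apply: ltnW; apply: lvM; apply: rgi => //; lia.
  - rewrite /ar /=; apply: lv_lt; [by rewrite mulSn; lia|exact: rg].
  - exact: arM.
have Tp i r z : z \in T i r -> z \in p (ci i) by rewrite inE => /andP[].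
have TT i r i' r' z : i < g -> r < m -> i' < g -> r' < m ->
    z \in T i r -> z \in T i' r' -> i = i' /\ r = r'.
  move=> ig rm ig' rm' z1 z2; have Ei := ci_inj _ _ ig ig' (ld (Tp _ _ _ z1) (Tp _ _ _ z2)).
  split => //; rewrite -Ei in z2.
  case: (ltngtP r r') => // lt; exfalso.
    by apply: (sub_disj z1 z2); apply: lo_mono; [exact: ar_mono (ltnW rm')|apply: arM; lia].
  by apply: (sub_disj z2 z1); apply: lo_mono; [exact: ar_mono (ltnW rm)|apply: arM; lia].
have YT i r i' r' z : r < m -> i' < g -> z \in Y i r -> z \in T i' r' -> False.
  rewrite /Y; case: ifP => [ig|_] rm ig'; last by rewrite inE.
  by have [_ h _] := Y0P (i, r) ig rm => /(h i' z ig')/negP h' /Tp.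
have YY i r i' r' z : r < m -> r' < m -> z \in Y i r -> z \in Y i' r' -> i = i' /\ r = r'.
  rewrite /Y; case: ifP => [ig|_] rm rm'; last by rewrite inE.
  case: ifP => [ig'|_] zY; last by rewrite inE.
  have [/subsetP h1 _ _] := Y0P (i, r) ig rm; have [/subsetP h1' _ _] := Y0P (i', r') ig' rm'.
  move=> zY'; have b1 := rgi i r (ltnW ig) rm; have b2 := rgi i' r' (ltnW ig') rm'.
  have E : li i r = li i' r' by apply: level_disj (h1 _ zY) (h1' _ zY'); exact: lvM.
  have {}E : r * g + i = r' * g + i'.
    exact: lv_inj E.
  have Er : r = r'.
    have := congr1 (fun x => x %/ g) E.
    by rewrite !divnMDl // !divn_small ?addn0 // ltnW.
  by split => //; move: E; rewrite Er; lia.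
have cT i r : i < g -> conn e (T i r) by move=> ig; apply: sub_walk => //; case: (lp (ci i)).
exists (fun i r => T i r :|: Y i r), (fun i => head x0 (p (ci i))).
split; first split.
- move=> i r ig rm; split; last first.
    apply/set0Pn; have : T i r != set0.
      by apply: sub_n0; [case: (lp (ci i))|apply: lo_smono; [exact: ar_lt|exact: arM]|exact: lo_le].
    by case/set0Pn => z zT; exists z; rewrite inE zT.
  rewrite /Y; case: ifP => [ig1|_]; last by rewrite setU0; exact: cT.
  have [_ _ [cY [[-> _]|[h1 h2]]]] := Y0P (i, r) ig1 rm; first by rewrite setU0; exact: cT.
  apply: connU => //; first exact: cT.
  by apply: adjS_touch; apply: adjS_mono h1 => //; exact: segT.
- move=> i r i' r' z ig rm ig' rm'; rewrite !in_setU => /orP[z1|z1] /orP[z2|z2].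
  + exact: TT z1 z2.
  + by case: (YT _ _ _ _ _ rm' ig z2 z1).
  + by case: (YT _ _ _ _ _ rm ig' z1 z2).
  + exact: YY z1 z2.
- move=> i r ig rm; rewrite {1}/Y ig.
  have [_ _ [cY [[_ h]|[_ h2]]]] := Y0P (i, r) ig rm.
    apply: adjS_mono h => //; first exact: subset_trans (segT _ _ (ltnW ig) rm) (subsetUl _ _).
    by exact: subset_trans (segT' _ _ ig rm) (subsetUl _ _).
  apply: adjS_mono h2 => //; first exact: subsetUr.
  by exact: subset_trans (segT' _ _ ig rm) (subsetUl _ _).
- move=> i r ig rm.
  have : adjS e (T i r) (T i r.+1).
    have [h1 h2 _] := lp (ci i).
    apply: sub_adj => //; try exact: lo_le; apply: lo_smono; try exact: ar_lt; try exact: arM.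
    + exact: ar_lt (ltnW rm).
    + exact: arM (ltnW rm).
  by apply: adjS_mono => //; exact: subsetUl.
move=> i ig; have [_ u sA] := lp (ci i).
have : 0 < lo (ci i) (ar 1).
  by have /= := @lo_smono (ci i) 0 (ar 1); apply; [exact: (ar_lt 0)|exact: arM].
rewrite !inE; case: (p (ci i)) sA => //= x s xA lo0; split => //.
by rewrite mem_head /= eqxx lo0.
Qed.

End LadderGrid.
End Grid.

(* Double counting over pairs [(f, z)]: [(f, z) |-> (f with f l := z, f l)] is an
   involution. *)
Lemma card_update (I T : finType) (l : I) (P : pred {ffun I -> T}) q :
  (forall f : {ffun I -> T},
     #|[set z | P [ffun i => if i == l then z else f i]]| <= q) ->
  #|T| * #|[set f | P f]| <= q * #|{ffun I -> T}|.
Proof.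
move=> hq; pose upd (f : {ffun I -> T}) z : {ffun I -> T} := [ffun i => if i == l then z else f i].
pose sw (x : {ffun I -> T} * T) := (upd x.1 x.2, x.1 l).
have swK : involutive sw.
  move=> [f z]; rewrite /sw /=; congr (_, _); last by rewrite ffunE eqxx.
  by apply/ffunP => i; rewrite !ffunE; case: eqP => // ->.
have E : #|[set x : {ffun I -> T} * T | P (upd x.1 x.2)]| = #|T| * #|[set f | P f]|.
  rewrite -(card_imset _ (inv_inj swK)) mulnC -[#|T|]cardsT -cardsX.
  apply: eq_card => -[f z]; rewrite !inE andbT /=; apply/imsetP/idP => [[[f' z']]|Pf].
    by rewrite inE /= => h [-> _].
  by exists (sw (f, z)); rewrite ?swK // inE; have [-> _] := swK (f, z).
rewrite -E mulnC -sum_nat_const.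
rewrite -sum1dep_card -(pair_big_dep xpredT (fun f z => P (upd f z)) (fun _ _ => 1)) /=.
rewrite big_mkcond [X in _ <= X]big_mkcond /=; apply: leq_sum => f _.
by rewrite sum1dep_card; exact: hq.
Qed.

(** A random [f] works: each of the [t0 ^ 3] triples is bad with probability at most [q.+1 / t].
    Adding [f i] to the forbidden set makes [f] injective. *)
Lemma free_family t t0 q (B : 'I_t -> 'I_t -> {set 'I_t}) :
  (forall a b, #|B a b| <= q) -> t0 ^ 3 * q.+1 < t ->
  exists f : 'I_t0 -> 'I_t, injective f /\
    forall i j l, l != i -> l != j -> f l \notin B (f i) (f j).
Proof.
move=> hB ht.
pose P (x : 'I_t0 * 'I_t0 * 'I_t0) : pred {ffun 'I_t0 -> 'I_t} := fun f =>
  [&& x.2 != x.1.1, x.2 != x.1.2 & f x.2 \in f x.1.1 |: B (f x.1.1) (f x.1.2)].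
have hP x : t * #|[set f | P x f]| <= q.+1 * #|{ffun 'I_t0 -> 'I_t}|.
  have := @card_update _ _ x.2 (P x) q.+1; rewrite card_ord; apply=> f.
  case: x => [[i j] l]; rewrite /P /=.
  case li: (l != i); last by rewrite (_ : [set _ | _] = set0) ?cards0 //; apply/setP => z; rewrite !inE.
  case lj: (l != j); last by rewrite (_ : [set _ | _] = set0) ?cards0 //; apply/setP => z; rewrite !inE.
  apply: leq_trans (_ : #|f i |: B (f i) (f j)| <= _).
    apply: subset_leq_card; apply/subsetP => z; rewrite !inE !ffunE eqxx.
    by rewrite ![_ == l]eq_sym (negbTE li) (negbTE lj).
  by rewrite cardsU1 -(addn1 q) addnC leq_add ?leq_b1.
have t_pos : 0 < t by exact: leq_ltn_trans ht.
have tot : 0 < #|{ffun 'I_t0 -> 'I_t}| by rewrite card_ffun !card_ord expn_gt0 t_pos.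
have /subsetPn[f _ fb] : ~~ ([set: {ffun 'I_t0 -> 'I_t}] \subset \bigcup_x [set f | P x f]).
  apply/negP => /subset_leq_card; rewrite cardsT => le1.
  have le2 : t * #|\bigcup_x [set f | P x f]| <= t0 ^ 3 * q.+1 * #|{ffun 'I_t0 -> 'I_t}|.
    apply: leq_trans (_ : t * \sum_x #|[set f | P x f]| <= _).
      rewrite leq_mul2l; apply/orP; right; elim/big_ind2: _ => [|A a C b hA hC|//]; first by rewrite cards0.
      by rewrite cardsU; lia.
    rewrite big_distrr /=; apply: leq_trans (_ : \sum_(x : 'I_t0 * 'I_t0 * 'I_t0) q.+1 * #|{ffun 'I_t0 -> 'I_t}| <= _).
      by apply: leq_sum => x _; exact: hP.
    by rewrite sum_nat_const !card_prod !card_ord !expnS expn0 muln1 !mulnA.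
  have := leq_trans (leq_mul (leqnn t) le1) le2; rewrite leq_mul2r => /orP[|].
    by move/eqP => E; rewrite E in tot.
  by rewrite leqNgt ht.
have fN i j l : l != i -> l != j -> f l \notin f i |: B (f i) (f j).
  move=> li lj; apply: contra fb => h; apply/bigcupP; exists (i, j, l) => //.
  by rewrite inE /P /= li lj.
exists f; split=> [i l E|i j l li lj].
  apply/eqP; apply: contraT => il; have := fN i i l.
  by rewrite eq_sym il E !inE eqxx => /(_ isT isT).
by have := fN i j l li lj; rewrite !inE negb_or => /andP[].
Qed.

Lemma ord_conn M : conn [rel a b : 'I_M | (val b == a.+1) || (val a == b.+1)] [set: 'I_M].
Proof.
have up (a b : 'I_M) : a <= b -> connect
    (restr [rel a b : 'I_M | (val b == a.+1) || (val a == b.+1)] [set: 'I_M]) a b.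
  move=> ab; have [d] := ubnP (b - a); elim: d b ab => // d IH b ab; rewrite ltnS => le.
  case: (ltngtP a b) ab => // [lt _|/val_inj-> _]; last exact: connect0.
  have b1M : b.-1 < M by apply: leq_ltn_trans (ltn_ord b); exact: leq_pred.
  apply: (@connect_trans _ _ (Ordinal b1M)).
    by apply: IH => /=; lia.
  by apply: connect_restr1; rewrite ?inE //= prednK ?eqxx //; lia.
move=> a b _ _; case: (leqP a b) => [/up//|/ltnW/up].
rewrite connect_restr_sym // => x y /=; exact: orbC.
Qed.

(** * Grids tied to a well-linked set, and connectors between pieces *)

Section Control.
Variable V : finType.
Implicit Types (e : rel V) (A S W X Y Z : {set V}) (B : nat -> nat -> {set V}).

Definition col M B i := \bigcup_(r in [set: 'I_M]) B i r.
Definition row g B r := \bigcup_(i in [set: 'I_g]) B i r.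

Lemma touch_consec e M (F : nat -> {set V}) (i j : 'I_M) : symmetric e ->
  (forall r, r.+1 < M -> adjS e (F r) (F r.+1)) ->
  (val j == i.+1) || (val i == j.+1) -> touch e (F i) (F j).
Proof.
move=> es h /orP[/eqP E|/eqP E]; have := ltn_ord i; have := ltn_ord j.
  by rewrite E => lt _; apply: adjS_touch; exact: h.
by move=> _; rewrite E => lt; apply: touch_sym => //; apply: adjS_touch; exact: h.
Qed.

Lemma col_conn e g M B i : symmetric e -> gridm e g M B -> i < g -> conn e (col M B i).
Proof.
move=> es [h1 _ _ h4] ig; rewrite /col.
have := @conn_bigcup V e 'I_M _ _ (fun r : 'I_M => B i r) (@ord_conn M); apply => [r _|r r' L _ _].
  by have [] := h1 i r ig (ltn_ord r).
by apply: (@touch_consec e M (B i)) => // k kM; exact: h4.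
Qed.

Lemma row_conn e g M B r : symmetric e -> gridm e g M B -> r < M -> conn e (row g B r).
Proof.
move=> es [h1 _ h3 _] rM; rewrite /row; rewrite /row.
have := @conn_bigcup V e 'I_g _ _ (fun i : 'I_g => B i r) (@ord_conn g); apply => [i _|i i' L _ _].
  by have [] := h1 i r (ltn_ord i) rM.
by apply: (@touch_consec e g (B^~ r)) => // k kM; exact: h3.
Qed.

Lemma in_col M B i r z : r < M -> z \in B i r -> z \in col M B i.
Proof. by move=> rM zB; apply/bigcupP; exists (Ordinal rM); rewrite ?inE. Qed.

Lemma in_row g (B : nat -> nat -> {set V}) i r z : i < g -> z \in B i r -> z \in row g B r.
Proof. by move=> ig zB; apply/bigcupP; exists (Ordinal ig); rewrite ?inE. Qed.

Lemma hit_disj n (F : 'I_n -> {set V}) S :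
  (forall i j z, z \in F i -> z \in F j -> i = j) ->
  n - #|S| <= #|[set i | [disjoint F i & S]]|.
Proof.
move=> Fd; have := hit_card Fd S; set T := [set i | ~~ _] => h.
have -> : [set i | [disjoint F i & S]] = ~: T by apply/setP => i; rewrite !inE negbK.
by have := cardsC T; rewrite card_ord; lia.
Qed.

Lemma col_disj e g M B (i j : 'I_g) z : gridm e g M B ->
  z \in col M B i -> z \in col M B j -> i = j.
Proof.
move=> [_ h2 _ _] /bigcupP[r _ zr] /bigcupP[r' _ zr']; apply: val_inj.
by have [] := h2 _ _ _ _ z (ltn_ord i) (ltn_ord r) (ltn_ord j) (ltn_ord r') zr zr'.
Qed.

Lemma row_disj e g M B (r s : 'I_M) z : gridm e g M B ->
  z \in row g B r -> z \in row g B s -> r = s.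
Proof.
move=> [_ h2 _ _] /bigcupP[i _ zi] /bigcupP[i' _ zi']; apply: val_inj.
by have [] := h2 _ _ _ _ z (ltn_ord i) (ltn_ord r) (ltn_ord i') (ltn_ord s) zi zi'.
Qed.

Lemma free_col e g M B S : gridm e g M B -> #|S| < g ->
  exists2 i, i < g & [disjoint col M B i & S].
Proof.
move=> hB Sg; have := @hit_disj g (fun i => col M B i) S (fun i j z => @col_disj e g M B i j z hB).
case: (set_0Vmem [set i : 'I_g | [disjoint col M B i & S]]) => [->|[i]]; first by rewrite cards0; lia.
by rewrite inE => d _; exists i.
Qed.

Lemma free_row e g M B S : gridm e g M B -> #|S| < M ->
  exists2 r, r < M & [disjoint row g B r & S].
Proof.
move=> hB Sg; have := @hit_disj M (fun r => row g B r) S (fun i j z => @row_disj e g M B i j z hB).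
case: (set_0Vmem [set i : 'I_M | [disjoint row g B i & S]]) => [->|[i]]; first by rewrite cards0; lia.
by rewrite inE => d _; exists i.
Qed.

Lemma row_col_meet e g M B i r : gridm e g M B -> i < g -> r < M ->
  exists z, [/\ z \in B i r, z \in col M B i & z \in row g B r].
Proof.
move=> [h1 _ _ _] ig rM; have [_ /set0Pn[z zB]] := h1 i r ig rM.
by exists z; rewrite zB (in_col rM zB) (in_row ig zB).
Qed.

Lemma disj_subC X S : [disjoint X & S] -> X \subset ~: S.
Proof. by rewrite disjoints_subset. Qed.

Lemma cols_connect e g M B S i j x y : symmetric e -> gridm e g M B -> #|S| < M ->
  i < g -> j < g -> [disjoint col M B i & S] -> [disjoint col M B j & S] ->
  x \in col M B i -> y \in col M B j -> connect (restr e (~: S)) x y.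
Proof.
move=> es hB SM ig jg di dj xi yj; have [r rM dr] := free_row hB SM.
have [u [_ ui ur]] := row_col_meet hB ig rM; have [v [_ vj vr]] := row_col_meet hB jg rM.
apply: connect_trans (conn_sub (col_conn es hB ig) (disj_subC di) xi ui) _.
apply: connect_trans (conn_sub (row_conn es hB rM) (disj_subC dr) ur vr) _.
exact: conn_sub (col_conn es hB jg) (disj_subC dj) vj yj.
Qed.

(** This ties the grid to [W]: small separators leave the grid on the side of [W], so a vertex that
    is well connected to [W] is well connected to the grid. *)
Definition controlled e W g M B k K := forall S, #|S| < k ->
  exists i, [/\ i < g, [disjoint col M B i & S] & exists W1,
    [/\ W1 \subset W :\: S, K <= #|W1| & forall w, w \in W1 ->
      exists2 x, x \in col M B i & connect (restr e (~: S)) x w]].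

(** [S] spoils fewer than [k] columns and fewer than [k] of the paths that lead from the remaining
    columns to [W]. The untouched columns are joined to each other by an untouched row. *)
Lemma ladder_controlled e W g M B k K Y (y : nat -> V) : symmetric e ->
  gridm e g M B -> (forall i, i < g -> y i \in Y /\ y i \in B i 0) ->
  anchored e W Y -> 2 * k + K <= g -> 0 < M -> k <= M -> 0 < k ->
  controlled e W g M B k K.
Proof.
move=> es hB yP aY hg M0 kM k0 S Sk.
pose I : {set 'I_g} := [set i : 'I_g | [disjoint col M B i & S]].
have cI : g - #|S| <= #|I|.
  exact: (@hit_disj g (fun i => col M B i) S (fun i j z => @col_disj e g M B i j z hB)).
have y_inj (i j : 'I_g) : y i = y j -> i = j.
  move=> E; apply: (@col_disj e g M B i j (y i) hB); first exact: in_col M0 (yP i (ltn_ord i)).2.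
  by rewrite E; exact: in_col M0 (yP j (ltn_ord j)).2.
have cY : #|[set y (val i) | i in I]| = #|I| by rewrite card_in_imset // => i j _ _; exact: y_inj.
have sY : [set y (val i) | i in I] \subset Y.
  by apply/subsetP => _ /imsetP[i _ ->]; have [] := yP i (ltn_ord i).
have [W1 [sW cW hW]] := anchored_ends S es (anchored_sub sY aY).
have /set0Pn[i0 i0I] : I != set0 by rewrite -card_gt0; lia.
exists i0; rewrite ltn_ord; split => //; first by move: i0I; rewrite inE.
exists W1; split => //; first by lia.
move=> w /hW[_ /setDP[/imsetP[i iI ->] _] c].
have yc : y i \in col M B i by exact: in_col M0 (yP i (ltn_ord i)).2.
have [z [_ zc _]] := row_col_meet hB (ltn_ord i0) M0.
exists z => //; apply: connect_trans c; move: i0I iI; rewrite !inE => d0 di.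
by apply: (cols_connect es hB _ (ltn_ord i0) (ltn_ord i) d0 di zc yc); lia.
Qed.

Lemma clique_controlled e W g M (B : nat -> nat -> {set V}) k K j : symmetric e ->
  gridm e g M B -> (forall i, i < g -> linked e W (col M B i) j) ->
  k + K <= j -> k <= g -> controlled e W g M B k K.
Proof.
move=> es hB lB jK kg S Sk; have [i ig d] := free_col hB (leq_trans Sk kg).
exists i; split => //; have [Y [sY cY aY]] := linked_anchored es (lB i ig).
have [W1 [sW cW hW]] := anchored_ends S es aY; exists W1; split => //; first by lia.
by move=> w /hW[y /setDP[/(subsetP sY) yc _] c]; exists y.
Qed.

(** Cut the walk at its last vertex in [X], and then at the first vertex in [Z] after it. *)
Lemma trim e X Z s : sorted e s -> starts X s -> ends Z s -> [disjoint X & Z] ->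
  symmetric e ->
  exists a x m z b, [/\ s = a ++ x :: m ++ z :: b, x \in X, z \in Z,
    (forall u, u \in m -> u \notin X :|: Z) & joins e X [set u in m] Z].
Proof.
move=> ss sX sZ dXZ es.
have [|a [x [t [E xX nt]]]] := @last_hit _ (mem X) s.
  by case: (s) sX => //= x t ->.
have [|m [z [b [E' zZ nm]]]] := @first_hit _ (mem Z) t.
  move: sZ; rewrite E ends_cat; case: (t) => [|y t'] h.
    by have := disjointFr dXZ xX; rewrite (h : x \in Z).
  by apply/hasP; exists (last y t') => //; exact: mem_last.
exists a, x, m, z, b; split => //; first by rewrite E E'.
  move=> u um; rewrite inE negb_or; apply/andP; split.
    by apply: contra nt => uX; apply/hasP; exists u; rewrite // E' mem_cat um.
  by apply: contra nm => uZ; apply/hasP; exists u.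
move: ss; rewrite E E' sorted_split => /andP[_]; rewrite cat_path /= => /and3P[pm ez _].
split; first by apply: walk_conn => //; exact: path_sorted pm.
case: m pm ez {E' nm} => [|u m] /= pm ez.
  by left; split; [apply/setP => v; rewrite !inE|exists x, z].
right; case/andP: pm => exu _; split; first by exists x, u; rewrite inE mem_head.
by exists (last u m), z; rewrite inE mem_last.
Qed.

Lemma linkage_sub e A Z k k' (p : 'I_k -> seq V) (f : 'I_k' -> 'I_k) : injective f ->
  linkage e A Z p -> linkage e A Z (p \o f).
Proof.
move=> fi [h1 h2]; split=> [i|i j z zi zj]; first exact: h1.
by apply: fi; exact: h2 zi zj.
Qed.

Lemma sorted_restr e X s : sorted e s -> {subset s <= X} -> sorted (restr e X) s.
Proof.
move=> ss sX; apply/sorted_consec => u v c; have [us vs] := consec_mem c.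
by apply/and3P; split; rewrite ?sX //; move/sorted_consec: ss; apply.
Qed.

Lemma abpath_restr_in e U A Z s : [disjoint A & Z] -> abpath (restr e U) A Z s ->
  {subset s <= U}.
Proof.
move=> d; case: s => [|x [|y s]] /and4P[] //=.
  by move=> _ _ xA xZ; have := disjointFr d xA; rewrite xZ.
case/andP => /and3P[_ xU yU] ps _ _ _ z; rewrite !inE => /or3P[/eqP->|/eqP->|zs] //.
elim: s y yU ps zs => //= u s IH y yU /andP[/and3P[_ _ uU] pu].
by rewrite inE => /orP[/eqP->//|zs]; exact: IH uU pu zs.
Qed.


Variables (e : rel V) (t0 : nat) (Q Y : 'I_t0 -> {set V}).
Hypotheses (es : symmetric e) (Qc : forall a, conn e (Q a)).
Hypothesis Qd : forall a b z, z \in Q a -> z \in Q b -> a = b.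
Hypothesis YQ : forall a, Y a \subset Q a.

Definition region (a b : 'I_t0) (Ch : {set V}) :=
  ~: (Ch :|: \bigcup_(x in [set x | (x != a) && (x != b)]) Q x).

Definition links_in (a b : 'I_t0) Ch k :=
  exists p : 'I_k -> seq V, linkage (restr e (region a b Ch)) (Y a) (Y b) p.

Lemma Q_disj a b : a != b -> [disjoint Q a & Q b].
Proof.
move=> ab; apply/pred0P => z /=; apply/negP => /andP[za zb].
by rewrite (Qd za zb) eqxx in ab.
Qed.

Lemma links_weaken a b Ch k k' : k' <= k -> links_in a b Ch k -> links_in a b Ch k'.
Proof.
move=> kk [p lp]; exists (p \o widen_ord kk); apply: linkage_sub lp.
by move=> i j /(congr1 val) /= E; apply: val_inj.
Qed.

(** The sets [L i] avoid every [Q x], also those of their own pair. In the induction [Ch] grows by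
    the connectors already chosen. *)
Definition connectors (ps : seq ('I_t0 * 'I_t0)) (Ch : {set V}) (L : nat -> {set V}) :=
  (forall i z, i < size ps -> z \in L i -> z \notin Ch /\ forall x, z \notin Q x) /\
  (forall i j z, i < size ps -> j < size ps -> z \in L i -> z \in L j -> i = j) /\
  (forall i d, i < size ps -> joins e (Q (nth d ps i).1) (L i) (Q (nth d ps i).2)).

End Control.

(* The connectors are chosen one pair at a time; if every candidate for a pair
   crosses most lines of some other pair, [star] produces a ladder. *)
Lemma connectors_or_ladder n M s : 0 < n -> exists k, forall (V : finType) (e : rel V) t0
    (Q Y : 'I_t0 -> {set V}) (ps : seq ('I_t0 * 'I_t0)) (Ch : {set V}),
  symmetric e -> (forall a, conn e (Q a)) ->
  (forall a b z, z \in Q a -> z \in Q b -> a = b) ->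
  (forall a, Y a \subset Q a) -> size ps = s ->
  (forall x, x \in ps -> x.1 != x.2 /\ links_in e Q Y x.1 x.2 Ch k) ->
  (exists a (p : 'I_n -> seq V) R, ladder e (Y a) M p R) \/
  (exists L, connectors e Q ps Ch L).
Proof.
move=> n0; elim: s => [|s [k' IH]].
  exists 0 => V e t0 Q Y ps Ch es Qc Qd YQ /size0nil-> _; right; exists (fun=> set0).
  by split=> //; split.
(* A chosen connector hits fewer than [n] of the [N0] paths of each later pair, so [k'] of them
   remain. The main term is the pigeonhole bound over [s] pairs and [2 ^ N0] sets of paths, with the
   number required by [star] in one class. *)
pose N0 := k' + n; exists (s * 2 ^ N0 * (2 * N0 * M.+1) + N0).+1.
move=> V e t0 Q Y [//|[a b] ps] Ch es Qc Qd YQ [sz] hl.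
set k := (_ + _).+1 in hl.
have [/= ab [P lP]] := hl (a, b) (mem_head _ _).
have dY c d : c != d -> [disjoint Y c & Y d].
  move=> cd; apply: disjointWl (YQ c) _; apply: disjointWr (YQ d) _.
  exact: Q_disj.
have [m mP] : exists m : 'I_k -> seq V, forall i, exists a' x z b',
    [/\ P i = a' ++ x :: m i ++ z :: b',
      (forall u, u \in m i -> u \notin Q a :|: Q b) & joins e (Q a) [set u in m i] (Q b)].
  apply: (@choose_fun _ _ (fun i (m : seq V) => exists a' x z b',
    [/\ P i = a' ++ x :: m ++ z :: b',
      (forall u, u \in m -> u \notin Q a :|: Q b) & joins e (Q a) [set u in m] (Q b)])) => i.
  have /and4P[sP _ stP enP] := lP.1 i.
  have [|||a' [x [m [z [b' [E xa zb nm j]]]]]] :=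
    @trim V e (Q a) (Q b) (P i) _ _ _ (Q_disj Qd ab) es.
  - by apply: sub_sorted sP => u v /and3P[].
  - by case: (P i) stP => //= x _; exact: (subsetP (YQ a)).
  - by case: (P i) enP => //= x t; exact: (subsetP (YQ b)).
  by exists m, a', x, z, b'.
pose R i := [set u in m i].
have mPi i u : u \in m i -> u \in P i.
  by have [a' [x [z [b' [-> _ _]]]]] := mP i; rewrite !(mem_cat, inE) => ->; rewrite !orbT.
have Rreg i u : u \in R i -> u \notin Ch /\ forall x, u \notin Q x.
  rewrite inE => um; have := abpath_restr_in (dY _ _ ab) (lP.1 i) (mPi i u um).
  rewrite !inE negb_or => /andP[uC /bigcupP nu]; split => // x; apply/negP => uQ.
  have [a' [x' [z [b' [_ nab _]]]]] := mP i; have := nab u um; rewrite inE negb_or => /andP[na nb].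
  by apply: nu; exists x => //; rewrite inE; apply/andP; split; apply/eqP => E; rewrite -E uQ in na nb.
have Rjoin i : joins e (Q a) (R i) (Q b) by have [a' [x' [z [b' []]]]] := mP i.
have Rd i j z : z \in R i -> z \in R j -> i = j.
  by rewrite !inE => /mPi zi /mPi zj; exact: lP.2 zi zj.
have inreg c d i u : u \in R i -> u \in region Q c d Ch.
  move=> /Rreg[uC uQ]; rewrite !inE negb_or uC; apply/bigcupP => -[x _].
  by rewrite (negbTE (uQ x)).
have Rc c d i : conn (restr e (region Q c d Ch)) (R i).
  move=> u v ui vi; have [cR _] := Rjoin i.
  apply: connect_sub (cR u v ui vi) => x y /and3P[exy xi yi].
  by apply: connect_restr1 => //; apply/and3P; split => //; exact: (inreg c d i).
have lin x : x \in ps -> links_in e Q Y x.1 x.2 Ch N0.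
  move=> xps; have [_] := hl x (mem_behead (s := (a, b) :: ps) xps).
  by apply: links_weaken; rewrite /k; lia.
pose lk (j : 'I_s) (p : 'I_N0 -> seq V) := let x := nth (a, b) ps j in
  linkage (restr e (region Q x.1 x.2 Ch)) (Y x.1) (Y x.2) p.
have [p0 p0P] : exists p : 'I_s -> 'I_N0 -> seq V, forall j, lk j (p j) /\
    forall p', lk j p' -> #|offs R (p j)| <= #|offs R p'|.
  apply: (@choose_fun _ _ (fun j p => lk j p /\ forall p', lk j p' -> #|offs R p| <= #|offs R p'|)) => j.
  have js : j < size ps by rewrite sz.
  by have [p lp mp] := min_linkage R (lin _ (mem_nth (a, b) js)); exists p.
pose hits i (j : 'I_s) : {set 'I_N0} := [set l | has (mem (R i)) (p0 j l)].
case: (pselect (exists i, forall j, #|hits i j| < n)) => [[i good]|bad].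
  have [|[? [? [? lad]]]|[L [L1 [L2 L3]]]] := IH V e t0 Q Y ps (Ch :|: R i) es Qc Qd YQ sz.
  - move=> x xps; split; first by have [] := hl x (mem_behead (s := (a, b) :: ps) xps).
    have js : index x ps < s by rewrite -sz index_mem.
    have := good (Ordinal js); have [lp _] := p0P (Ordinal js).
    move: lp; rewrite /lk /= nth_index // => lp gd.
    have [f f_inj fP] : exists2 f : 'I_k' -> 'I_N0, injective f &
        forall l, f l \in ~: hits i (Ordinal js).
      apply: card_inj; have := cardsC (hits i (Ordinal js)); rewrite card_ord => E.
      by rewrite -(leq_add2l #|hits i (Ordinal js)|) E addnC leq_add2l ltnW.
    exists (p0 (Ordinal js) \o f); have [h1 h2] := linkage_sub f_inj lp; split => // l.
    have xne : x.1 != x.2 by have [] := hl x (mem_behead (s := (a, b) :: ps) xps).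
    have /and4P[s1 s2 s3 s4] := h1 l; apply/and4P; split => //.
    have inr := abpath_restr_in (dY _ _ xne) (h1 l).
    have s1' : sorted e ((p0 (Ordinal js) \o f) l) by apply: sub_sorted s1 => u v /and3P[].
    apply: sorted_restr => // u ul; have := inr u ul; rewrite !inE !negb_or => /andP[-> ->].
    rewrite andbT /=; apply: contraTN (fP l) => um; rewrite !inE negbK; apply/hasP.
    by exists u => //; rewrite /= inE.
  - by left; do 3 eexists; exact: lad.
  right; exists (fun l => if l is l'.+1 then L l' else R i); split; [|split].
  - move=> [|l] z lt zl; first exact: Rreg zl.
    by have := L1 l z lt zl; rewrite inE negb_or => -[/andP[]].
  - move=> [|l] [|l'] z lt lt' zl zl' //.
    + by have [] := L1 l' z lt' zl'; rewrite inE zl orbT.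
    + by have [] := L1 l z lt zl; rewrite inE zl' orbT.
    + by congr _.+1; exact: L2 zl zl'.
  - by move=> [|l] d lt; [exact: Rjoin|exact: L3].
left; have /choose_fun[js jsP] : forall i, exists j, n <= #|hits i j|.
  move=> i; apply: contrapT => no; apply: bad; exists i => j.
  by rewrite ltnNge; apply/negP => h; apply: no; exists j.
have [|[j J] cJ] := @pigeonhole 'I_k _ (fun i => (js i, hits i (js i))) (2 * N0 * M.+1).
  by rewrite card_prod card_ord -cardsT -powersetT card_powerset cardsT !card_ord /k; lia.
set I := [set i | _] in cJ.
have IP i : i \in I -> js i = j /\ hits i j = J by rewrite inE => /eqP[<- <-].
have [i0 i0I] : exists i0, i0 \in I by apply/set0Pn; rewrite -card_gt0; lia.
have [lp mp] := p0P j.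
rewrite /lk /= in lp mp; have [||||p' [R' lad]] := @star V _ _ _ N0 k (p0 j) R n M J I _ _ Rd lp mp n0 _ cJ.
- exact: restr_sym.
- exact: Rc.
- by have [E <-] := IP _ i0I; rewrite -E.
- by move=> i l /IP[_ <-]; rewrite inE.
by exists (nth (a, b) ps j).1, p', R'; apply: ladder_mono lad => u v /and3P[].
Qed.

Lemma pigeonhole_in (T F : finType) (D : {set T}) (f : T -> F) m :
  #|F| * m < #|D| -> exists y, m < #|[set x in D | f x == y]|.
Proof.
move=> h; apply: contrapT => no; move: h; rewrite ltnNge => /negP[].
rewrite -sum1_card (partition_big f xpredT) //= -sum_nat_const.
apply: leq_sum => y _; rewrite sum1dep_card leqNgt; apply/negP => h.
by apply: no; exists y.
Qed.

Lemma card_bigcup_le (I T : finType) (P : pred I) (F : I -> {set T}) n :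
  (forall i, P i -> #|F i| <= n) -> #|\bigcup_(i | P i) F i| <= #|P| * n.
Proof.
move=> h; apply: (@leq_trans (\sum_(i | P i) #|F i|)).
  elim/big_ind2: _ => [|A a C b hA hC|//]; first by rewrite cards0.
  by rewrite cardsU; lia.
apply: (@leq_trans (\sum_(i | P i) n)); first exact: leq_sum.
by rewrite sum_nat_const.
Qed.

(** * The clique model given by pieces and connectors *)

Section Clique.
Variables (V : finType) (e : rel V) (t0 : nat) (Q : 'I_t0 -> {set V}).
Hypotheses (es : symmetric e) (Qc : forall a, conn e (Q a)).
Hypothesis Qd : forall a b z, z \in Q a -> z \in Q b -> a = b.
Hypothesis Q0 : forall a, Q a != set0.
Variable L : nat -> {set V}.
Let ps : seq ('I_t0 * 'I_t0) := [seq x : 'I_t0 * 'I_t0 <- enum {: 'I_t0 * 'I_t0} | x.1 < x.2].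
Hypothesis hL : connectors e Q ps set0 L.

(** A connector is given to the piece of smaller index only, so that the enlarged pieces stay
    disjoint. *)
Definition link (a b : 'I_t0) := if a < b then L (index (a, b) ps) else set0.
Definition clique_set a := \bigcup_(b in [set: 'I_t0]) (Q a :|: link a b).

Lemma mem_ps (a b : 'I_t0) : ((a, b) \in ps) = (a < b).
Proof. by rewrite mem_filter /= mem_enum inE andbT. Qed.

Lemma link_idx (a b : 'I_t0) : a < b -> index (a, b) ps < size ps.
Proof. by move=> ab; rewrite index_mem mem_ps. Qed.

Lemma link_join (a b : 'I_t0) : a < b -> joins e (Q a) (link a b) (Q b).
Proof.
move=> ab; have [_ [_ h]] := hL.
by have := h _ (a, b) (link_idx ab); rewrite nth_index ?mem_ps // /link ab.
Qed.

Lemma sub_clique_set a : Q a \subset clique_set a.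
Proof.
by apply: subset_trans (bigcup_sup a _); rewrite ?inE //; exact: subsetUl.
Qed.

Lemma clique_conn a : conn e (clique_set a).
Proof.
have all_conn : conn [rel _ _ : 'I_t0 | true] [set: 'I_t0].
  by move=> x y _ _; apply: connect1; rewrite /restr /= !inE.
have := @conn_bigcup V e _ _ _ (fun b => Q a :|: link a b) all_conn; apply=> [b _|b b' _ _ _].
  rewrite /link; case: ifP => ab; last by rewrite setU0.
  have := link_join ab; rewrite /link ab => -[cL [[-> _]|[h _]]]; first by rewrite setU0.
  by apply: connU => //; exact: adjS_touch.
have /set0Pn[z zQ] := Q0 a.
by exists z, z; rewrite !inE zQ eqxx.
Qed.

Lemma clique_disj a b z : z \in clique_set a -> z \in clique_set b -> a = b.
Proof.
have [h1 [h2 _]] := hL.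
have LQ a' b' x z' : z' \in link a' b' -> z' \in Q x -> False.
  rewrite /link; case: ifP => [ab zL zQ|_]; last by rewrite inE.
  by have [_ /(_ x)] := h1 _ _ (link_idx ab) zL; rewrite zQ.
move=> /bigcupP[c _ /setUP[za|za]] /bigcupP[d _ /setUP[zb|zb]].
- exact: Qd za zb.
- by case: (LQ _ _ _ _ zb za).
- by case: (LQ _ _ _ _ za zb).
move: za zb; rewrite /link; case: ifP => [ac za|_]; last by rewrite inE.
case: ifP => [bd zb|_]; last by rewrite inE.
have E := h2 _ _ z (link_idx ac) (link_idx bd) za zb.
have : nth (a, c) ps (index (a, c) ps) = nth (a, c) ps (index (b, d) ps) by rewrite E.
by rewrite !nth_index ?mem_ps // => -[].
Qed.

Lemma clique_adj a b : a != b -> adjS e (clique_set a) (clique_set b).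
Proof.
have aux (x y : 'I_t0) : x < y -> adjS e (clique_set x) (clique_set y).
  move=> xy; have sL : link x y \subset clique_set x.
    by apply: subset_trans (bigcup_sup y _); rewrite ?inE //; exact: subsetUr.
  have [_ [[_ h]|[_ h]]] := link_join xy; apply: adjS_mono h => //; exact: sub_clique_set.
move=> ab; case: (ltngtP a b) => [/aux//|/aux h|/val_inj E].
  exact: adjS_sym.
by rewrite E eqxx in ab.
Qed.

End Clique.

(** If more than [q0] pieces cross many paths of one linkage between two pieces, [star] gives a
    ladder. Otherwise [free_family] selects [t0] pieces of which no third one crosses many paths
    between two others, and [connectors_or_ladder] gives a ladder or joins all pairs into a clique
    model, which contains the grid. *)
Lemma grid_theorem g M c k K : 2 * k + K <= g -> k <= M -> 0 < k ->
  exists N, forall (V : finType) (e : rel V) W, symmetric e -> wl e W c -> N <= #|W| ->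
    exists B, gridm e g M B /\ controlled e W g M B k K.
Proof.
move=> hg kM k0; have g0 : 0 < g by lia.
have M0 : 0 < M by lia.
pose n := (g ^ g).+1; pose M' := (n ^ g * (M * g)).+1; pose t0 := (g * M).+1.
pose ps : seq ('I_t0 * 'I_t0) := [seq x : 'I_t0 * 'I_t0 <- enum {: 'I_t0 * 'I_t0} | x.1 < x.2].
have [kap hkap] := @connectors_or_ladder n M' (size ps) isT.
(* Of [k1] paths, [kap] remain after dropping those hit by the other selected pieces, fewer than [n]
   for each. [q0] is the pigeonhole bound over sets of paths for [star], and [t] is what
   [free_family] requires. In [j], the part [2 * k1 + c] serves [anchored_link] and [k + K] serves
   [clique_controlled]. *)
pose k1 := kap + t0 * n; pose q0 := 2 ^ k1 * (2 * k1 * M'.+1).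
pose t := (t0 ^ 3 * q0.+1).+1; pose j := 2 * k1 + c + (k + K).
have j0 : 0 < j by rewrite /j; lia.
exists (3 * (t * j + c) + t * j + j).+1 => V e W es wW cW.
have [Q' [Q1 Q2]] := @pieces V e W c t j es wW j0 cW.
have [Q [Qc Ql Qd]] : exists Q : 'I_t -> {set V}, [/\ forall a, conn e (Q a),
    forall a, linked e W (Q a) j & forall a b z, z \in Q a -> z \in Q b -> a = b].
  exists (fun a => Q' a); split => [a|a|a b z za zb]; try by have [] := Q1 a (ltn_ord a).
  by apply: val_inj; exact: (Q2 a b z).
have [Y YP] : exists Y : 'I_t -> {set V}, forall a,
    [/\ Y a \subset Q a, #|Y a| = j & anchored e W (Y a)].
  have H a : exists Y : {set V}, [/\ Y \subset Q a, #|Y| = j & anchored e W Y] by exact: linked_anchored.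
  by have [Y YP] := choose_fun H; exists Y.
have lad_case (a : 'I_t) (p : 'I_n -> seq V) R : ladder e (Y a) M' p R ->
    exists B, gridm e g M B /\ controlled e W g M B k K.
  move=> lad; have [|B [y [gB yP]]] := ladder_gridm es lad (g := g) (m := M) _ (leqnn _) M0.
    by rewrite /n.
  exists B; split => //; have [_ _ aY] := YP a.
  exact: ladder_controlled es gB yP aY hg M0 kM k0.
have [p pP] : exists p : 'I_t -> 'I_t -> 'I_k1 -> seq V, forall a b,
    linkage e (Y a) (Y b) (p a b) /\
    forall p' : 'I_k1 -> seq V, linkage e (Y a) (Y b) p' -> #|offs Q (p a b)| <= #|offs Q p'|.
  have H x : exists p : 'I_k1 -> seq V, linkage e (Y x.1) (Y x.2) p /\
    forall p' : 'I_k1 -> seq V, linkage e (Y x.1) (Y x.2) p' -> #|offs Q p| <= #|offs Q p'|.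
    have [_ c1 a1] := YP x.1; have [_ c2 a2] := YP x.2.
    have [|q lq mq] := @min_linkage V e (Y x.1) (Y x.2) k1 t Q; last by exists q.
    by apply: (anchored_link es wW a1 a2); rewrite ?c1 ?c2 /j; lia.
  have [p hp] := choose_fun H; exists (fun a b => p (a, b)) => a b; exact: hp (a, b).
pose hits a b c' : {set 'I_k1} := [set l | has (mem (Q c')) (p a b l)].
pose Bd a b : {set 'I_t} := [set c' | n <= #|hits a b c'|].
case: (pselect (exists a b, q0 < #|Bd a b|)) => [[a [b big]]|small].
  have [|J cJ] := @pigeonhole_in _ {set 'I_k1} (Bd a b) (hits a b) (2 * k1 * M'.+1).
    by rewrite -cardsT -powersetT card_powerset cardsT card_ord.
  set I := [set x in _ | _] in cJ.
  have IP i : i \in I -> n <= #|J| /\ hits a b i = J.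
    by rewrite !inE => /andP[h /eqP E]; rewrite -E.
  have [i0 i0I] : exists i0, i0 \in I by apply/set0Pn; rewrite -card_gt0; lia.
  have [lp mp] := pP a b.
  have [||p' [R' lad]] := @star V e (Y a) (Y b) k1 t (p a b) Q n M' J I es Qc Qd lp mp isT _ cJ.
  - by have [] := IP _ i0I.
  - by move=> i l /IP[_ <-]; rewrite inE.
  exact: lad_case lad.
have Bq a b : #|Bd a b| <= q0.
  by rewrite leqNgt; apply/negP => h; apply: small; exists a, b.
have [f [f_inj fP]] := free_family Bq (ltnSn (t0 ^ 3 * q0.+1)).
have Qd' a b z : z \in Q (f a) -> z \in Q (f b) -> a = b.
  by move=> za zb; apply: f_inj; exact: Qd za zb.
have [|[a [p' [R' lad]]]|[L hL]] := hkap V e t0 (Q \o f) (Y \o f) ps set0 es (fun a => Qc (f a)) Qd' (fun a => let: And3 h _ _ := YP (f a) in h) erefl.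
- move=> [a b]; rewrite mem_filter /= => /andP[ab _]; have ne : a != b by rewrite neq_ltn ab.
  split => //; have [lp _] := pP (f a) (f b).
  pose H : {set 'I_k1} := \bigcup_(x : 'I_t0 | (x != a) && (x != b)) hits (f a) (f b) (f x).
  have cH : #|H| <= t0 * n.
    have := @card_bigcup_le 'I_t0 'I_k1 (fun x => (x != a) && (x != b)) (fun x => hits (f a) (f b) (f x)) n.
    move=> h; apply: (leq_trans (h _)); last by rewrite leq_mul2r -[X in _ <= X](card_ord t0) max_card orbT.
    move=> x /andP[xa xb]; by have := fP a b x xa xb; rewrite inE -ltnNge => /ltnW.
  have [h h_inj hH] : exists2 h : 'I_kap -> 'I_k1, injective h & forall l, h l \in ~: H.
    apply: card_inj; have := cardsC H; rewrite card_ord => E.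
    by rewrite -(leq_add2l #|H|) E addnC leq_add2l.
  exists (p (f a) (f b) \o h); have [l1 l2] := linkage_sub h_inj lp; split => // l.
  have /and4P[s1 s2 s3 s4] := l1 l; apply/and4P; split => //.
  apply: sorted_restr => // u ul; rewrite !inE /=; apply/bigcupP => -[x]; rewrite inE => xab ux.
  have := hH l; rewrite inE => /bigcupP[]; exists x => //; rewrite inE; apply/hasP; exists u => //.
- exact: lad_case lad.
have Q0 a : (Q \o f) a != set0.
  have [sY cY _] := YP (f a); apply: contraTneq j0 => E.
  by move: sY; rewrite /= in E; rewrite E subset0 -cards_eq0 cY => /eqP->.
pose BQ := clique_set (Q \o f) L; pose ix i r : 'I_t0 := inord (i * M + r).
have ix_lt i r : i < g -> r < M -> i * M + r < t0.
  move=> ig rM; rewrite /t0 ltnS; apply: ltnW; apply: (@leq_trans (i.+1 * M)).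
    by rewrite mulSn addnC ltn_add2r.
  by rewrite leq_mul2r ig orbT.
have ix_inj i r i' r' : i < g -> r < M -> i' < g -> r' < M -> ix i r = ix i' r' -> i = i' /\ r = r'.
  move=> ig rM ig' rM' /(congr1 val); rewrite /= !inordK ?ix_lt // => E.
  have Ei : i = i'.
    by have := congr1 (fun x => x %/ M) E; rewrite !divnMDl // !divn_small ?addn0.
  by split => //; move: E; rewrite Ei => /addnI.
have gB : gridm e g M (fun i r => BQ (ix i r)).
  split=> [i r ig rM|i r i' r' z ig rM ig' rM' z1 z2|i r ig rM|i r ig rM].
  - split; first by apply: clique_conn => // a; exact: Qc.
    have /set0Pn[z zQ] := Q0 (ix i r); apply/set0Pn; exists z.
    exact: (subsetP (sub_clique_set _ _ _)) zQ.
  - by apply: ix_inj => //; exact: (clique_disj Qd' hL z1 z2).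
  - apply: clique_adj => //; apply/eqP => /ix_inj[] //; [exact: ltnW|lia].
  - apply: clique_adj => //; apply/eqP => /ix_inj[] //; [exact: ltnW|lia].
exists (fun i r => BQ (ix i r)); split => //.
apply: (@clique_controlled _ _ _ _ _ _ _ _ j) => //; try by rewrite /j; lia.
move=> i ig; apply: linked_sub (Ql (f (ix i 0))).
apply: subset_trans (sub_clique_set (Q \o f) L (ix i 0)) _.
by apply/subsetP => z zB; exact: (@in_col _ M (fun i r => BQ (ix i r)) i 0).
Qed.

(** * Attaching vertices of large degree to a grid *)

Section Rooting.
Variables (T : finType) (E : rel T) (k L g M : nat) (X : {set T}).
Variable B : nat -> nat -> {set T}.
Hypotheses (Es : symmetric E) (gB : gridm E g M B).
Hypotheses (cX : #|X| = k) (gk : 2 * k < g) (L0 : 0 < L) (MkL : k.+1 * L <= M).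

(** The Menger condition for [k] disjoint paths from [X] into the grid. Reaching any untouched
    column counts as reaching the grid, since untouched columns are connected to each other. *)
Definition reaches (r : rel T) := forall S : {set T}, #|S| < k -> exists x i y,
  [/\ x \in X :\: S, i < g, [disjoint col M B i & S], y \in col M B i &
      connect (restr r (~: S)) x y].
Hypothesis hE : reaches E.

Let kM : k < M. Proof. by apply: leq_trans MkL; case: (L) L0 => // l _; rewrite mulnS; lia. Qed.

(* [cu i r -- cd i r] is a chosen edge from row [r] to row [r + 1] in column [i]. *)
Variables cu cd : nat -> nat -> T.
Hypothesis cuP : forall i r, i < g -> r.+1 < M ->
  [/\ cu i r \in B i r, cd i r \in B i r.+1 & E (cu i r) (cd i r)].

Definition col_edge x y := [exists i : 'I_g, exists r : 'I_M,
  [&& r.+1 < M, x == cu i r & y == cd i r]].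
(** Between different rows only the chosen column edges remain, so a path that changes rows within
    this graph does so at a known vertex. *)
Definition gam : rel T := fun x y => E x y && [|| [exists r : 'I_M, (x \in row g B r) && (y \in row g B r)],
  col_edge x y | col_edge y x].
Definition gamF (F : {set {set T}}) : rel T := fun x y => gam x y || (E x y && ([set x; y] \in F)).

Lemma gam_sym : symmetric gam.
Proof.
move=> x y; rewrite /gam Es; congr (_ && _); rewrite [col_edge x y || _]orbC; congr (_ || _).
by apply: eq_existsb => r; rewrite andbC.
Qed.

Lemma gamF_sym F : symmetric (gamF F).
Proof. by move=> x y; rewrite /gamF gam_sym Es setUC. Qed.

Lemma gamF_E F : subrel (gamF F) E.
Proof. by move=> x y /orP[/andP[]|/andP[]]. Qed.

Lemma gam_gamF F : subrel gam (gamF F).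
Proof. by move=> x y h; rewrite /gamF h. Qed.

Lemma gridm_gam : gridm gam g M B.
Proof.
have [h1 h2 h3 h4] := gB; have inr i r z : i < g -> z \in B i r -> z \in row g B r by exact: in_row.
have same r x y : r < M -> E x y -> x \in row g B r -> y \in row g B r -> gam x y.
  by move=> rM exy xr yr; rewrite /gam exy; apply/orP; left; apply/existsP; exists (Ordinal rM); rewrite xr yr.
split=> // [i r ig rM|i r ig rM|i r ig rM].
- have [cB nB] := h1 i r ig rM; split => // x y xB yB.
  apply: connect_sub (cB x y xB yB) => u v /and3P[euv ub vb].
  by apply: connect_restr1 => //; apply: (same r) => //; [exact: inr ub|exact: inr vb].
- have [x [y [xB yB exy]]] := h3 i r ig rM; exists x, y; split => //.
  by apply: (same r) => //; [exact: inr (ltnW ig) xB|exact: inr ig yB].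
have [x y exy] := cuP ig rM; exists (cu i r), (cd i r); split => //.
rewrite /gam exy; apply/or3P; apply: Or32; apply/existsP; exists (Ordinal ig).
by apply/existsP; exists (Ordinal (ltnW rM)); rewrite rM !eqxx.
Qed.

Lemma gridm_gamF F : gridm (gamF F) g M B.
Proof. exact: gridm_mono (@gam_gamF F) gridm_gam. Qed.

(** A separation of order [#|A :&: C|]. In [good] the side [A] holds the sources and misses a whole
    column, so the grid lies on the other side. *)
Definition sepn F (A C : {set T}) :=
  (forall x, (x \in A) || (x \in C)) /\
  (forall x y, x \in A -> x \notin C -> y \notin A -> ~~ gamF F x y).
Definition good F A C := [/\ sepn F A C, X \subset A &
  exists2 i, i < g & [disjoint col M B i & A]].

Lemma sep_stay F A C x y : sepn F A C -> connect (restr (gamF F) (~: (A :&: C))) x y ->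
  x \in A -> x \notin C -> y \in A /\ y \notin C.
Proof.
move=> [h1 h2] c xA xC; apply: (@connect_ind _ _ (fun z => z \in A /\ z \notin C) _ _ c) => //.
move=> u v /and3P[guv _]; rewrite !inE => nv [uA uC].
case vA: (v \in A) nv => /= nv; first by split.
by have := h2 u v uA uC (negbT vA); rewrite guv.
Qed.

Lemma good_order F A C : reaches (gamF F) -> good F A C -> k <= #|A :&: C|.
Proof.
move=> hF [sAC XA [i ig di]]; rewrite leqNgt; apply/negP => /[dup] lt /hF[x [i' [y [xX i'g di' yc c]]]].
have [z [_ zc _]] := row_col_meet (gridm_gamF F) ig (leq_ltn_trans (leq0n _) kM).
have dS : [disjoint col M B i & A :&: C] by apply: disjointWr di; exact: subsetIl.
have cz := cols_connect (gamF_sym F) (gridm_gamF F) (ltn_trans lt kM) i'g ig di' dS yc zc.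
move: xX; rewrite !inE negb_and => /andP[nS xX]; have xA := subsetP XA x xX.
rewrite xA /= in nS.
have [zA _] := sep_stay sAC (connect_trans c cz) xA nS.
by have := disjointFr di zc; rewrite zA.
Qed.

Lemma good_col F A C i : good F A C -> #|A :&: C| < M -> i < g ->
  [disjoint col M B i & A :&: C] -> [disjoint col M B i & A].
Proof.
move=> [sAC _ [i0 i0g d0]] lt ig di; apply/pred0P => x /=; apply/negP => /andP[xc xA].
have xC : x \notin C by apply/negP => xC; have := disjointFr di xc; rewrite inE xA xC.
have [z [_ zc _]] := row_col_meet (gridm_gamF F) i0g (leq_ltn_trans (leq0n _) kM).
have dS : [disjoint col M B i0 & A :&: C] by apply: disjointWr d0; exact: subsetIl.
have cz := cols_connect (gamF_sym F) (gridm_gamF F) lt ig i0g di dS xc zc.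
have [zA _] := sep_stay sAC cz xA xC.
by have := disjointFr d0 zc; rewrite zA.
Qed.

Lemma good_row F A C r : good F A C -> r < M ->
  [disjoint row g B r & A :&: C] -> [disjoint row g B r & A].
Proof.
move=> [sAC _ [i0 i0g d0]] rM dr; apply/pred0P => x /=; apply/negP => /andP[xr xA].
have xC : x \notin C by apply/negP => xC; have := disjointFr dr xr; rewrite inE xA xC.
have [z [_ zc zr]] := row_col_meet (gridm_gamF F) i0g rM.
have cz := conn_sub (row_conn (gamF_sym F) (gridm_gamF F) rM) (disj_subC dr) xr zr.
have [zA _] := sep_stay sAC cz xA xC.
by have := disjointFr d0 zc; rewrite zA.
Qed.

(** Submodularity: the orders of the two uncrossed separations add up to at most [2 * k], and
    [good_order] bounds each from below by [k]. The bound [2 * k < g] leaves a column that avoids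
    both separators. *)
Lemma good_union F A C A' C' : reaches (gamF F) -> good F A C -> good F A' C' ->
  #|A :&: C| = k -> #|A' :&: C'| = k ->
  good F (A :|: A') (C :&: C') /\ #|(A :|: A') :&: (C :&: C')| = k.
Proof.
move=> hF gA gA' oA oA'.
have [i ig di] : exists2 i, i < g & [disjoint col M B i & (A :&: C) :|: (A' :&: C')].
  by apply: (free_col gB); apply: leq_ltn_trans gk; rewrite cardsU; lia.
have dA : [disjoint col M B i & A].
  by apply: good_col gA _ ig _; rewrite ?oA //; apply: disjointWr di; exact: subsetUl.
have dA' : [disjoint col M B i & A'].
  by apply: good_col gA' _ ig _; rewrite ?oA' //; apply: disjointWr di; exact: subsetUr.
have [[a1 a2] XA _] := gA; have [[b1 b2] XA' _] := gA'.
have gU : good F (A :|: A') (C :&: C').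
  split; [split|exact: subset_trans XA (subsetUl _ _)|].
  - by move=> x; rewrite !inE; have := a1 x; have := b1 x; case: (x \in A); case: (x \in A') => //=; move=> -> ->.
  - move=> x y; rewrite !inE negb_and negb_or => xA xC /andP[yA yA'].
    case xA0: (x \in A); case xC0: (x \in C) xC => //= xC; try by apply: a2; rewrite ?xA0 ?xC0.
      case xA1: (x \in A'); first by apply: b2; rewrite ?xA1.
      by have := b1 x; rewrite xA1 (negbTE xC).
    + by rewrite xA0 /= in xA; apply: b2.
    + by have := a1 x; rewrite xA0 xC0.
  - exists i => //; apply/pred0P => x /=; apply/negP => /andP[xc]; rewrite inE => /orP[xA|xA].
      by have := disjointFr dA xc; rewrite xA.
    by have := disjointFr dA' xc; rewrite xA.
have gI : good F (A :&: A') (C :|: C').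
  split; [split|by rewrite subsetI XA XA'|].
  - move=> x; rewrite !inE; have := a1 x; have := b1 x.
    by case: (x \in A); case: (x \in A'); case: (x \in C); case: (x \in C').
  - move=> x y; rewrite !inE negb_and negb_or => /andP[xA xA'] /andP[xC xC'] /orP[yA|yA].
      exact: a2.
    exact: b2.
  - by exists i => //; apply: disjointWr dA; exact: subsetIl.
have h1 := good_order hF gU; have h2 := good_order hF gI.
have := cardsUI ((A :|: A') :&: (C :&: C')) ((A :&: A') :&: (C :|: C')).
have := cardsUI (A :&: C) (A' :&: C'); rewrite oA oA'.
have : #|((A :|: A') :&: (C :&: C')) :|: ((A :&: A') :&: (C :|: C'))| <= #|A :&: C :|: A' :&: C'|.
  apply: subset_leq_card; apply/subsetP => x; rewrite !inE.
  by case: (x \in A); case: (x \in A'); case: (x \in C); case: (x \in C').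
have : #|((A :|: A') :&: (C :&: C')) :&: ((A :&: A') :&: (C :|: C'))| <= #|A :&: C :&: (A' :&: C')|.
  apply: subset_leq_card; apply/subsetP => x; rewrite !inE.
  by case: (x \in A); case: (x \in A'); case: (x \in C); case: (x \in C').
by split => //; lia.
Qed.

Lemma good_init F : good F X setT /\ #|X :&: setT| = k.
Proof.
rewrite setIT cX; split => //; split => //; first split.
- by move=> x; rewrite !inE orbT.
- by move=> x y _; rewrite inE.
by apply: (free_col gB); rewrite cX; lia.
Qed.

Lemma good_max F : exists A C, [/\ good F A C, #|A :&: C| = k &
  forall A' C', good F A' C' -> #|A' :&: C'| = k -> #|A'| <= #|A|].
Proof.
pose P n := `[< exists A C, [/\ good F A C, #|A :&: C| = k & #|A| = n] >].
have exP : exists n, P n.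
  by exists #|X|; apply/asboolP; exists X, setT; have [] := good_init F.
have bP n : P n -> n <= #|T| by move=> /asboolP[A [C [_ _ <-]]]; exact: max_card.
case: (ex_maxnP exP bP) => n /asboolP[A [C [h1 h2 h3]]] hm; exists A, C; split => // A' C' h4 h5.
by rewrite h3; apply: hm; apply/asboolP; exists A', C'.
Qed.

(* A critical extra edge [f] gives a tight separation whose small side contains
   [f]; by uncrossing it lies in the maximal tight small side. *)
Lemma critical_edge F f : reaches (gamF F) -> f \in F -> ~ reaches (gamF (F :\ f)) ->
  exists A C, [/\ good F A C, #|A :&: C| = k & f \subset A].
Proof.
move=> hF fF /existsNP[S /not_implyP[Sk noS]].
pose reach := [set v | `[< exists2 x, x \in X :\: S & connect (restr (gamF (F :\ f)) (~: S)) x v >]].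
have reachS v : v \in reach -> v \notin S.
  rewrite inE => /asboolP[x]; rewrite !inE => /andP[xS xX] c.
  by have := connect_restr_in c; rewrite !inE xS; apply.
have XA : X \subset S :|: reach.
  apply/subsetP => x xX; rewrite !inE; case xS: (x \in S) => //=.
  by apply/asboolP; exists x; rewrite ?inE ?xS.
have step u v : u \in reach -> v \notin reach -> v \notin S -> gamF F u v -> f = [set u; v] /\ E u v.
  move=> ur vr vS guv; have uS := reachS u ur.
  have : ~~ gamF (F :\ f) u v.
    apply: contra vr => guv'; move: ur; rewrite !inE => /asboolP[x xX c].
    apply/asboolP; exists x => //; apply: connect_trans c (connect_restr1 _ _ _) => //.
      by rewrite inE.
    by rewrite inE.
  move: guv; rewrite /gamF; case: (gam u v) => //= /andP[euv uvF]; rewrite euv !inE uvF andbT negbK.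
  by move=> /eqP.
have colS i : i < g -> [disjoint col M B i & S] -> [disjoint col M B i & reach].
  move=> ig di; apply/pred0P => y /=; apply/negP => /andP[yc]; rewrite inE => /asboolP[x xX c].
  by apply: noS; exists x, i, y.
have disjU i (A C : {set T}) : [disjoint col M B i & A] -> [disjoint col M B i & C] ->
    [disjoint col M B i & A :|: C].
  move=> d1 d2; apply/pred0P => x /=; apply/negP => /andP[xc]; rewrite inE => /orP[xA|xA].
    by have := disjointFr d1 xc; rewrite xA.
  by have := disjointFr d2 xc; rewrite xA.
case: (pselect (exists u v, [/\ u \in reach, v \notin reach, v \notin S & gamF F u v])); last first.
  move=> nocross; have gd : good F (S :|: reach) (~: reach).
    split => //; first split.
    - by move=> x; rewrite !inE -orbA orbN orbT.
    - move=> x y _; rewrite !inE negbK negb_or => xr /andP[yS yr]; apply/negP => gxy.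
      by apply: nocross; exists x, y; rewrite !inE.
    have [|i ig di] := @free_col _ _ _ _ _ S gB; first by lia.
    by exists i => //; apply: (@disjU i) => //; exact: colS.
  have := good_order hF gd; have -> : (S :|: reach) :&: ~: reach = S.
    apply/setP => x; rewrite in_setI in_setU in_setC; case xr: (x \in reach); rewrite ?andbF ?andbT ?orbF //.
    by rewrite (negbTE (reachS x xr)).
  by lia.
move=> [u [v [ur vr vS guv]]]; have [Ef euv] := step u v ur vr vS guv.
have EI : (v |: (S :|: reach)) :&: ~: reach = v |: S.
  apply/setP => x; rewrite in_setI !in_setU in_setC in_set1; case xr: (x \in reach); rewrite ?andbF ?andbT ?orbF //.
  by rewrite (negbTE (reachS x xr)) orbF; apply/esym/eqP => E'; rewrite -E' xr in vr.
have gd : good F (v |: (S :|: reach)) (~: reach).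
  split; [split| |].
  - by move=> x; rewrite !in_setU in_setC -!orbA orbN !orbT.
  - move=> x y _; rewrite in_setC negbK => xr; rewrite !in_setU in_set1 => yn.
    apply/negP => gxy; move: yn; rewrite !negb_or => /and3P[yv yS yr]; have [Ef' _] := step x y xr yr yS gxy.
    have : y \in [set u; v] by rewrite -Ef Ef' !inE eqxx orbT.
    by rewrite !inE (negbTE yv) orbF => /eqP E'; rewrite E' ur in yr.
  - by apply: subset_trans XA _; exact: subsetUr.
  have [|i ig di] := @free_col _ _ _ _ _ (v |: S) gB; first by rewrite cardsU1; lia.
  exists i => //; apply: (@disjU i); first by apply: disjointWr di; exact: subsetUl.
  have dS : [disjoint col M B i & S] by apply: disjointWr di; exact: subsetUr.
  by apply: (@disjU i) => //; exact: colS.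
exists (v |: (S :|: reach)), (~: reach); split => //.
  by apply/eqP; rewrite eqn_leq (good_order hF gd) andbT EI cardsU1; lia.
by rewrite Ef; apply/subsetP => x; rewrite !in_setU !in_set1 => /orP[/eqP->|/eqP->]; rewrite ?ur ?eqxx ?orbT.
Qed.

Definition run r0 := \bigcup_(r in [set: 'I_L]) row g B (r0 + r).

Lemma in_run r0 r z : r0 <= r -> r < r0 + L -> z \in row g B r -> z \in run r0.
Proof.
move=> h1 h2 zr; have lt : r - r0 < L by lia.
by apply/bigcupP; exists (Ordinal lt); rewrite ?inE //= subnKC.
Qed.

(** With [F] minimal, [critical_edge] and [good_union] put all of [F] into the maximal tight small
    side [A]. One of [k.+1] blocks of [L] rows avoids the [k] separating vertices and hence avoids
    [A]. A path can enter this block neither by an edge of [F] nor along a row, so it enters by a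
    chosen column edge. *)
Lemma rooting : exists r0 (q : 'I_k -> seq T), [/\ r0 + L <= M,
  forall i, [&& sorted E (q i), uniq (q i) & starts X (q i)],
  forall i j z, z \in q i -> z \in q j -> i = j &
  forall i, exists s z j, [/\ q i = rcons s z, forall u, u \in s -> u \notin run r0, j < g &
    0 < r0 /\ z = cd j r0.-1 \/ r0 + L < M /\ z = cu j (r0 + L).-1]].
Proof.
pose P F := `[< reaches (gamF F) >].
have PT : P setT.
  apply/asboolP => S Sk; have [x [i [y [h1 h2 h3 h4 c]]]] := hE Sk; exists x, i, y; split => //.
  by apply: connect_restr_mono c => // u v euv; rewrite /gamF euv inE orbT.
have [F /minsetP[/asboolP hF minF] _] := minset_exists PT.
have crit f : f \in F -> ~ reaches (gamF (F :\ f)).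
  move=> fF h; have := minF (F :\ f) (asboolT h) (subD1set _ _) => E'.
  by move: fF; rewrite -E' !inE eqxx.
have [A [C [gA oA maxA]]] := good_max F.
have FA f : f \in F -> f \subset A.
  move=> fF; have [A' [C' [gA' oA' fA']]] := critical_edge hF fF (crit f fF).
  have [gU oU] := good_union hF gA gA' oA oA'.
  have E' : A = A :|: A' by apply/eqP; rewrite eqEcard subsetUl (maxA _ _ gU oU).
  by rewrite E'; apply: subset_trans fA' (subsetUr _ _).
have [b bfree] : exists b : 'I_k.+1, forall r, b * L <= r -> r < b * L + L ->
    [disjoint row g B r & A :&: C].
  apply: contrapT => no.
  have H (b : 'I_k.+1) : exists r : 'I_M, r %/ L = b /\ ~~ [disjoint row g B r & A :&: C].
    have /existsNP[r /not_implyP[h1 /not_implyP[h2 /negP h3]]] :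
        ~ forall r, b * L <= r -> r < b * L + L -> [disjoint row g B r & A :&: C].
      by move=> h; apply: no; exists b.
    have rM : r < M.
      apply: leq_trans h2 (leq_trans _ MkL); rewrite addnC -mulSn leq_mul2r.
      by rewrite ltn_ord orbT.
    exists (Ordinal rM); split => //=; apply/eqP; rewrite eqn_leq.
    by rewrite -ltnS ltn_divLR // leq_divRL // mulSn h1 addnC h2.
  have [h hP] := choose_fun H.
  have h_inj : injective h.
    by move=> x y Exy; apply: val_inj; rewrite /= -(hP x).1 Exy (hP y).1.
  have c1 : #|h @: setT| = k.+1 by rewrite card_imset // cardsT card_ord.
  have rd (x y : 'I_M) z : z \in row g B x -> z \in row g B y -> x = y by exact: row_disj gB.
  have := @hit_card T M (fun r => row g B r) rd (A :&: C); rewrite oA => le.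
  have : #|h @: setT| <= k; last by rewrite c1 ltnn.
  apply: leq_trans le; apply: subset_leq_card.
  by apply/subsetP => _ /imsetP[x _ ->]; rewrite inE; have [] := hP x.
pose r0 := b * L; have r0M : r0 + L <= M.
  apply: leq_trans MkL; rewrite /r0 addnC -mulSn leq_mul2r; apply/orP; right.
  exact: ltn_ord.
have rA r : r0 <= r -> r < r0 + L -> [disjoint row g B r & A].
  by move=> h1 h2; apply: good_row gA _ _; [lia|exact: bfree].
have runA z : z \in run r0 -> z \notin A.
  move=> /bigcupP[r _ zr]; have := ltn_ord r => rL.
  by rewrite (disjointFr (rA _ _ _) zr) //; lia.
have [p [p1 p2]] : exists p : 'I_k -> seq T, linkage (gamF F) X (run r0) p.
  apply: linked_menger; first exact: gamF_sym.
  move=> S /hF[x [i [y [xX ig di yc c]]]].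
  have r0M' : r0 < M by lia.
  have [z [_ zc zr]] := row_col_meet gB ig r0M'.
  have zrun : z \in run r0 by apply: (@in_run r0 r0 z) => //; lia.
  exists x, z; split => //; first by rewrite in_setD zrun andbT (disjointFr di zc).
  apply: connect_trans c (conn_sub (col_conn (gamF_sym F) (gridm_gamF F) ig) (disj_subC di) yc zc).
have XA : X \subset A by case: gA.
have H i : exists s z, [/\ exists t, p i = rcons s z ++ t, z \in run r0 & forall u, u \in s -> u \notin run r0].
  have [|s [z [t [Ep zr ns]]]] := @first_hit _ (mem (run r0)) (p i).
    have /and4P[_ _ sX sR] := p1 i; case: (p i) sR => // x s h; apply/hasP.
    by exists (last x s) => //; exact: mem_last.
  exists s, z; split => //; first by exists t; rewrite cat_rcons.
  by move=> u us; apply: contra ns => ur; apply/hasP; exists u.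
have [s hs] := choose_fun H; have [z hz] := choose_fun hs.
have sub_p i u : u \in rcons (s i) (z i) -> u \in p i.
  by have [[t ->] _ _] := hz i => h; rewrite mem_cat h.
exists r0, (fun i => rcons (s i) (z i)); split => //.
- move=> i; have [[t Ep] _ _] := hz i; have /and4P[h1 h2 h3 _] := p1 i.
  move: h1 h2 h3; rewrite Ep cat_uniq => /sorted_cat[h1 _] /and3P[h2 _ _].
  by rewrite h2 (sub_sorted (@gamF_E F) h1); case: (s i).
- by move=> i j u /sub_p ui /sub_p; exact: p2.
move=> i; exists (s i), (z i); have [[t Ep] zr ns] := hz i.
have /and4P[h1 _ sX _] := p1 i.
have zA := runA _ zr.
move: ns Ep; case/lastP: (s i) => [|s' u] ns Ep.
  by move: sX; rewrite Ep /= => /(subsetP XA); rewrite (negbTE zA).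
have guz : gamF F u (z i).
  move: h1; rewrite Ep -cats1 -catA cat_rcons => h1; have [_] := sorted_cat h1.
  by rewrite /= => /andP[].
have ur : u \notin run r0 by apply: ns; rewrite mem_rcons mem_head.
move: guz; rewrite /gamF => /orP[|/andP[_ /FA/subsetP/(_ (z i))]]; last first.
  by rewrite !inE eqxx orbT (negbTE zA) => /(_ isT).
move: (zr) => /bigcupP[r _ zrr]; have rL := ltn_ord r.
have rM : r0 + r < M by apply: leq_trans r0M; rewrite ltn_add2l.
have rd (x y : 'I_M) v : v \in row g B x -> v \in row g B y -> x = y by exact: row_disj gB.
rewrite /gam => /andP[_ /or3P[/existsP[r' /andP[ur' zr']]|/existsP[j /existsP[r' /and3P[r'M /eqP Eu /eqP Ez]]]|/existsP[j /existsP[r' /and3P[r'M /eqP Ez /eqP Eu]]]]].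
- have E' := rd r' (Ordinal rM) (z i) zr' zrr; case/negP: ur; apply: (@in_run r0 r' u) => //; rewrite E' /= ?leq_addr ?ltn_add2l //.
- have [h3 h4 _] := cuP (ltn_ord j) r'M; rewrite -Ez in h4; rewrite -Eu in h3.
  have E' := rd (Ordinal r'M) (Ordinal rM) (z i) (in_row (ltn_ord j) h4) zrr.
  have {}E' : r'.+1 = r0 + r := congr1 val E'.
  have r'r0 : r' < r0.
    rewrite ltnNge; apply/negP => le; case/negP: ur; apply: (@in_run r0 r' u) => //; first by clear - E' rL; lia.
    exact: in_row (ltn_ord j) h3.
  have Er : r0.-1 = r' by clear - E' r'r0; lia.
  by exists j; split => //; left; split; [exact: leq_ltn_trans (leq0n _) r'r0|rewrite Er].
have [h3 h4 _] := cuP (ltn_ord j) r'M; rewrite -Ez in h3; rewrite -Eu in h4.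
have E' := rd r' (Ordinal rM) (z i) (in_row (ltn_ord j) h3) zrr.
have {}E' : nat_of_ord r' = r0 + r := congr1 val E'.
have r'r0 : r0 + L <= r'.+1.
  rewrite leqNgt; apply/negP => le; case/negP: ur; apply: (@in_run r0 r'.+1 u) => //; first by clear - E'; lia.
  exact: in_row (ltn_ord j) h4.
have Er : (r0 + L).-1 = r' by clear - E' rL r'r0; lia.
have lt : r0 + L < M by clear - r'M E' rL r'r0; lia.
by exists j; split => //; right; split; [exact: lt|rewrite Er].
Qed.

End Rooting.

Lemma interval_conn M l u : conn [rel a b : 'I_M | (val b == a.+1) || (val a == b.+1)]
  [set i : 'I_M | l <= i < u].
Proof.
set P := [set i | _].
have up (a b : 'I_M) : a <= b -> a \in P -> b \in P -> connect
    (restr [rel a b : 'I_M | (val b == a.+1) || (val a == b.+1)] P) a b.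
  move=> ab aP; have [d] := ubnP (b - a); elim: d b ab => // d IH b ab; rewrite ltnS => le bP.
  case: (ltngtP a b) ab => // [lt _|/val_inj-> _]; last exact: connect0.
  have b1M : b.-1 < M by apply: leq_ltn_trans (ltn_ord b); exact: leq_pred.
  have b1P : Ordinal b1M \in P by move: aP bP; rewrite !inE /=; lia.
  apply: (@connect_trans _ _ (Ordinal b1M)).
    by apply: IH => //=; lia.
  by apply: connect_restr1 => //=; rewrite prednK ?eqxx //; lia.
move=> a b aP bP; case: (leqP a b) => [/up|/ltnW/up]; first exact.
rewrite connect_restr_sym; first exact.
by move=> x y /=; exact: orbC.
Qed.

Lemma enum_increasing M (X : {set 'I_M}) : exists lv : nat -> nat,
  (forall a b, a < b -> b < #|X| -> lv a < lv b) /\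
  (forall a, a < #|X| -> exists2 s, s \in X & val s = lv a).
Proof.
pose L := sort leq [seq val s | s <- enum X].
have Ls : size L = #|X| by rewrite size_sort size_map -cardE.
have Lsorted : sorted ltn L.
  rewrite ltn_sorted_uniq_leq sort_uniq map_inj_uniq ?enum_uniq ?sort_sorted //.
    exact: leq_total.
  exact: val_inj.
exists (nth 0 L); split=> [a b ab bX|a aX].
  by apply: (@sorted_ltn_nth _ ltn ltn_trans) => //; rewrite inE Ls //; exact: ltn_trans bX.
have : nth 0 L a \in L by rewrite mem_nth // Ls.
by rewrite mem_sort => /mapP[s]; rewrite mem_enum => sX E; exists s.
Qed.

(** Greedy from the left: the shortest prefix of ['I_g] that holds [N] positions of some remaining
    index goes to that index. By minimality every other index loses at most [N] positions. *)
Lemma blocks (J : finType) (j0 : J) g N n (D : {set J}) (P : J -> {set 'I_g}) :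
  #|D| = n -> (forall c, c \in D -> n * N <= #|P c|) -> 0 < N ->
  exists (pi : nat -> J) (a : nat -> nat -> nat),
  [/\ forall l, l < n -> pi l \in D,
      forall l l', l < n -> l' < n -> pi l = pi l' -> l = l',
      forall l x, l < n -> x < N -> exists2 s, s \in P (pi l) & val s = a l x &
      forall l l' x x', l < n -> l' < n -> x < N -> x' < N ->
        l < l' \/ l = l' /\ x < x' -> a l x < a l' x'].
Proof.
elim: n D P => [|n IH] D P cD cP N0; first by exists (fun=> j0), (fun _ _ => 0).
pose Q c := [exists j in D, N <= #|P j :&: [set i : 'I_g | i < c]|].
have exQ : exists c, Q c.
  have /set0Pn[j jD] : D != set0 by rewrite -card_gt0 cD.
  exists g; apply/exists_inP; exists j => //.
  have -> : P j :&: [set i : 'I_g | i < g] = P j by apply/setP => i; rewrite !inE ltn_ord andbT.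
  by apply: leq_trans (cP j jD); rewrite mulSn leq_addr.
case: (ex_minnP exQ) => c /exists_inP[j jD hj] minc.
have [|||pi [a [h1 h2 h3 h4]]] := IH (D :\ j) (fun i => P i :\: [set i : 'I_g | i < c]).
- by have := cardsD1 j D; rewrite jD cD => -[].
- move=> i; rewrite !inE => /andP[ij iD].
  have : #|P i :&: [set i : 'I_g | i < c]| <= N.
    case: c {hj exQ} minc => [|c] minc.
      by rewrite eq_card0 // => z; rewrite !inE ltn0 andbF.
    have : ~~ Q c by apply/negP => /minc; rewrite ltnn.
    rewrite negb_exists_in => /forall_inP/(_ i iD); rewrite -ltnNge => lt.
    case: (ltnP c g) => [cg|gc].
      have le : #|P i :&: [set i0 : 'I_g | i0 < c.+1]| <= #|P i :&: [set i0 : 'I_g | i0 < c]| + 1.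
        rewrite -[X in _ + X](cards1 (Ordinal cg)) -cardsUI.
        apply: leq_trans (leq_addr _ _); apply: subset_leq_card; apply/subsetP => z.
        rewrite !inE ltnS => /andP[-> zc] /=; move: zc; rewrite leq_eqVlt => /orP[/eqP E|->//].
        by apply/orP; right; apply/eqP; apply: val_inj.
      by lia.
    have -> : [set i0 : 'I_g | i0 < c.+1] = [set i0 : 'I_g | i0 < c].
      by apply/setP => z; rewrite !inE; have := ltn_ord z; lia.
    exact: ltnW.
  move=> le; rewrite -(leq_add2l N) -mulSn; apply: leq_trans (cP i iD) _.
  by rewrite -(cardsID [set i : 'I_g | i < c]) leq_add2r.
- exact: N0.
have [lv [lv1 lv2]] := enum_increasing (P j :&: [set i : 'I_g | i < c]).
have lvc x : x < N -> lv x < c.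
  move=> xN; have [|s + <-] := lv2 x; first exact: leq_trans hj.
  by rewrite !inE => /andP[].
have ac l x : l < n -> x < N -> c <= a l x.
  by move=> ln xN; have [s + <-] := h3 l x ln xN; rewrite !inE -leqNgt => /andP[].
exists (fun l => if l is l'.+1 then pi l' else j), (fun l x => if l is l'.+1 then a l' x else lv x); split.
- by move=> [|l] ln //; have := h1 l ln; rewrite !inE => /andP[].
- move=> [|l] [|l'] ln ln' // E.
  + by have := h1 l' ln'; rewrite -E !inE eqxx.
  + by have := h1 l ln; rewrite E !inE eqxx.
  + by congr _.+1; exact: h2.
- move=> [|l] x ln xN.
    by have [|s sX E] := lv2 x; [exact: leq_trans hj|exists s => //; case/setIP: sX].
  by have [s sX E] := h3 l x ln xN; exists s => //; case/setDP: sX.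
- move=> [|l] [|l'] x x' ln ln' xN xN' [lt|[E lt]] //.
  + by apply: lv1 lt _; exact: leq_trans hj.
  + by apply: leq_trans (lvc x xN) (ac l' x' ln' xN').
  + by apply: h4 => //; left.
  + by apply: h4 => //; right; split => //; case: E.
Qed.

(** * Many disjoint paths from vertices that no small separator cuts off *)

Section Big.
Variables (V : finType) (e : rel V) (W : {set V}).
Hypothesis es : symmetric e.

(** These vertices are cut off from nearly all of [W] by a small separator; the others are the
    candidates for the single vertices of large degree. *)
Definition small_vertex d v := exists I S : {set V}, [/\ v \in I, [disjoint I & S],
  forall x y, x \in I -> e x y -> y \in I :|: S, #|S| < d & #|W :&: I| < d].

(** [Z] enlarges the separator by at most [#|Z|] and takes at most [#|Z|] vertices from either
    part. *)
Lemma wl_del (Z : {set V}) : wl e W 0 -> wl (restr e (~: Z)) W (2 * #|Z|).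
Proof.
move=> wW S W1 W2 s1 s2 nc.
have sub (W0 : {set V}) : W0 \subset W :\: S -> W0 :\: Z \subset W :\: (S :|: Z).
  move=> /subsetP s; apply/subsetP => x; rewrite !inE => /andP[xZ /s].
  by rewrite !inE negb_or xZ andbT.
have card (W0 : {set V}) : #|W0| <= #|W0 :\: Z| + #|Z|.
  by rewrite -(cardsID Z W0) addnC leq_add2l subset_leq_card ?subsetIr.
have := wW (S :|: Z) _ _ (sub W1 s1) (sub W2 s2).
have h x y : x \in W1 :\: Z -> y \in W2 :\: Z -> ~~ connect (restr e (~: (S :|: Z))) x y.
  rewrite !inE => /andP[_ x1] /andP[_ y2]; apply: contra (nc x y x1 y2).
  apply: connect_sub => u v /and3P[euv]; rewrite !inE !negb_or => /andP[uS uZ] /andP[vS vZ].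
  by apply: connect_restr1; rewrite ?inE //; apply/and3P; split; rewrite ?inE.
move=> /(_ h); have := card W1; have := card W2; have := cardsUI S Z; lia.
Qed.

(** A one-element set is connected for every relation; it is the neighbouring column that places it
    in [U], hence [1 < g]. *)
Lemma grid_in_region U g M B i r : 1 < g -> gridm (restr e U) g M B -> i < g -> r < M ->
  B i r \subset U.
Proof.
move=> g1 [h1 h2 h3 h4] ig rM; have [cB _] := h1 i r ig rM.
have [x0 x0B x0U] : exists2 x0, x0 \in B i r & x0 \in U.
  case: (ltnP i.+1 g) => [i1|i1].
    by have [x [y [xB yB /and3P[_ xU yU]]]] := h3 i r i1 rM; exists x.
  have i0 : i.-1.+1 = i by lia.
  have [|x [y [xB yB /and3P[_ xU yU]]]] := h3 i.-1 r _ rM; first by rewrite i0.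
  by rewrite i0 in yB; exists y.
apply/subsetP => x xB; apply: (@connect_ind _ _ (fun z => z \in U) _ _ (cB x0 x x0B xB)) => //.
by move=> u v /and3P[/and3P[]].
Qed.

Section Lines.
Variables (h m : nat) (z : 'I_h -> V).
Hypothesis zi : injective z.
Notation T := (V + 'I_h * 'I_m)%type.
Definition ZS := z @: [set: 'I_h].

(* Each [z i] is split into [m] clones, so that linking the clones to a set
   yields [m] paths leaving [z i] that only share [z i]. *)
Definition src : rel T := fun a b => match a, b with
  | inl x, inl y => [&& e x y, x \notin ZS & y \notin ZS]
  | inl x, inr (i, _) | inr (i, _), inl x => e (z i) x && (x \notin ZS)
  | inr _, inr _ => false end.

Lemma src_sym : symmetric src.
Proof.
move=> [x|[i c]] [y|[j c']] //=; rewrite es.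
by case: (x \in ZS); case: (y \in ZS); rewrite ?andbF.
Qed.

Definition sources : {set T} := [set a | if a is inr _ then true else false].

Lemma card_sources : #|sources| = h * m.
Proof.
have -> : sources = inr @: [set: 'I_h * 'I_m].
  by apply/setP => -[x|p]; rewrite !inE; apply/esym; [apply/imsetP => -[]|rewrite imset_f].
by rewrite card_imset; [rewrite cardsT card_prod !card_ord|move=> ? ? []].
Qed.

Definition lift (B : nat -> nat -> {set V}) i r : {set T} := inl @: B i r.

Lemma mem_lift (X : {set V}) x : ((inl x : T) \in inl @: X) = (x \in X).
Proof. by rewrite mem_imset // => ? ? []. Qed.

Lemma connect_lift (S : {set T}) (U : {set V}) x y : (forall v, v \in U -> (inl v : T) \notin S) ->
  connect (restr (restr e (~: ZS)) U) x y -> connect (restr src (~: S)) (inl x) (inl y).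
Proof.
move=> hU c; apply: (@connect_ind _ _ (fun v => connect (restr src (~: S)) (inl x) (inl v)) _ _ c).
  exact: connect0.
move=> u v /and3P[/and3P[euv]]; rewrite !inE => uZ vZ uU vU c'.
apply: connect_trans c' (connect_restr1 _ _ _); rewrite ?inE ?hU //.
by rewrite /= euv uZ vZ.
Qed.

Lemma gridm_lift g M B : gridm (restr e (~: ZS)) g M B -> gridm src g M (lift B).
Proof.
have adj (X Y : {set V}) : adjS (restr e (~: ZS)) X Y -> adjS src (inl @: X) (inl @: Y).
  move=> [x [y [xX yY /and3P[exy]]]]; rewrite !inE => xZ yZ; exists (inl x), (inl y).
  by rewrite !mem_lift /= exy xZ yZ.
move=> [h1 h2 h3 h4]; split=> [i r ig rM|i r i' r' x ig rM ig' rM'|i r ig rM|i r ig rM].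
- have [cB /set0Pn[x xB]] := h1 i r ig rM; split; last by apply/set0Pn; exists (inl x); rewrite mem_lift.
  move=> _ _ /imsetP[u uB ->] /imsetP[v vB ->].
  have c := cB u v uB vB.
  apply: (@connect_ind _ _ (fun w => connect (restr src (lift B i r)) (inl u) (inl w)) _ _ c); first exact: connect0.
  move=> a b /and3P[/and3P[eab]]; rewrite !inE => aZ bZ aB bB c'.
  by apply: connect_trans c' (connect_restr1 _ _ _); rewrite ?mem_lift //= eab aZ bZ.
- by move=> /imsetP[u uB ->]; rewrite mem_lift; exact: h2.
- exact: adj (h3 i r ig rM).
- exact: adj (h4 i r ig rM).
Qed.

Lemma col_lift M B i x : (inl x \in col M (lift B) i) = (x \in col M B i).
Proof.
apply/bigcupP/bigcupP => -[r _ h']; exists r => //; first by rewrite -mem_lift.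
by rewrite mem_lift.
Qed.

(** Some clone of some [z i] avoids [S]. As [z i] is not small, it still reaches at least [d.-1]
    vertices of [W], and by [controlled] an untouched column reaches [K] of them. Both numbers
    exceed what [wl] allows to be separated, including the loss [2 * h] for deleting all [z]. *)
Lemma lines_reach g M B k K d : wl e W 0 -> (forall i, ~ small_vertex d (z i)) ->
  controlled (restr e (~: ZS)) W g M B k K -> k = h * m ->
  k + 2 * h < K -> k + 2 * h + 1 < d ->
  reaches k g M sources (lift B) src.
Proof.
move=> wW zbig cB kE kK kd S Sk.
have [[x|[i c]] ] : exists2 a, a \in sources & a \notin S.
    apply/subsetPn; apply/negP => /subset_leq_card; rewrite card_sources -kE.
    by rewrite leqNgt Sk.
  by rewrite inE.
move=> _ icS; pose S' := [set v | (inl v : T) \in S].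
have cS' : #|S'| < k.
  apply: leq_ltn_trans Sk; rewrite -(@card_imset _ _ (@inl V ('I_h * 'I_m))); last by move=> ? ? [].
  by apply: subset_leq_card; apply/subsetP => _ /imsetP[v + ->]; rewrite inE.
have cZ : #|ZS| = h by rewrite card_imset // cardsT card_ord.
have [i0 [i0g di0 [W1 [sW1 cW1 hW1]]]] := cB S' cS'.
(* [z i] itself has to stay in the graph; the other vertices [z] are deleted together with [S']. *)
pose S2 := (S' :|: ZS) :\ z i; pose I := comp e (~: S2) (z i).
have ziS2 : z i \in ~: S2 by rewrite !inE eqxx.
have cI : d <= #|W :&: I|.
  rewrite leqNgt; apply/negP => lt; apply: (zbig i); exists I, S2; split => //.
  - by rewrite inE connect0.
  - by rewrite disjoint_subset; apply/subsetP => x /(subsetP (comp_sub e ziS2)); rewrite inE.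
  - move=> x y xI exy; rewrite in_setU; case yS: (y \in S2); rewrite ?orbT // orbF.
    apply: (comp_closed xI _ _ exy); last by rewrite inE yS.
    by move: (subsetP (comp_sub e ziS2) x xI).
  - have : #|S2| <= #|S' :|: ZS| by apply: subset_leq_card; exact: subsetDl.
    by have := cardsUI S' ZS; rewrite cZ; lia.
pose W2 := [set w in W | [exists y, [&& e (z i) y, y \notin ZS, y \notin S' &
  connect (restr (restr e (~: ZS)) (~: S')) y w]]].
have sW2 : (W :&: I) :\ z i \subset W2.
  apply/subsetP => w; rewrite !inE => /and3P[wz wW' wI]; rewrite wW' /=.
  have [[|y t] [pt ut lt sub]] := connect_walk wI ziS2; first by rewrite /= in lt; rewrite -lt eqxx in wz.
  move: pt ut; rewrite /= => /andP[ey pt] /and3P[zyt ut ut'].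
  have inU u : u \in y :: t -> u \notin ZS /\ u \notin S'.
    move=> uy; have := sub u (mem_behead (s := z i :: y :: t) uy); rewrite !inE negb_and negbK.
    rewrite (_ : (u == z i) = false); last by apply: contraNF zyt => /eqP<-.
    by rewrite /= negb_or => /andP[-> ->].
  have [yZ yS] := inU y (mem_head _ _).
  apply/existsP; exists y; rewrite ey yZ yS /= -lt /=.
  apply: walk_connect; first exact: restr_sym.
    by apply: (@sorted_restr _ e (~: ZS) (y :: t) pt) => u /inU[uZ _]; rewrite in_setC.
  by move=> u /inU[_ uS]; rewrite in_setC.
have cW2 : d.-1 <= #|W2 :\: S'|.
  have : #|(W :&: I) :\ z i| <= #|W2 :\: S'|.
    apply: subset_leq_card; apply/subsetP => w h'; rewrite inE (subsetP sW2) // andbT.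
    have : w \in W2 by exact: (subsetP sW2).
    rewrite inE => /andP[_ /existsP[y /and4P[_ _ yS' cy]]].
    by have := connect_restr_in cy; rewrite !in_setC; apply.
  by have := cardsD1 (z i) (W :&: I); lia.
have sW2' : W2 :\: S' \subset W :\: S' by apply: setSD; apply/subsetP => w; rewrite inE => /andP[].
have [w1 [w2 [w1P w2P cw]]] : exists w1 w2, [/\ w1 \in W1, w2 \in W2 :\: S' &
    connect (restr (restr e (~: ZS)) (~: S')) w1 w2].
  apply: contrapT => no; have := @wl_del ZS wW S' W1 _ sW1 sW2'; rewrite cZ => h'.
  have : minn #|W1| #|W2 :\: S'| <= #|S'| + 2 * h.
    by apply: h' => x y xW yW; apply/negP => c'; apply: no; exists x, y.
  by lia.
have [u uc cu] := hW1 w1 w1P; move: w2P; rewrite !inE => /andP[_ /andP[_ /existsP[y /and4P[ey yZ yS' cy]]]].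
have sr : connect_sym (restr (restr e (~: ZS)) (~: S')).
  by apply: connect_restr_sym; exact: restr_sym.
have cyu : connect (restr (restr e (~: ZS)) (~: S')) y u.
  by apply: connect_trans cy _; rewrite sr; exact: connect_trans cu cw.
exists (inr (i, c)), i0, (inl u); split => //.
- by rewrite inE icS inE.
- apply/pred0P => -[x|x] /=.
    by rewrite col_lift; apply/negP => /andP[xc xS]; have := disjointFr di0 xc; rewrite inE xS.
  by apply/negP => /andP[/bigcupP[r _ /imsetP[]]].
- by rewrite col_lift.
apply: (@connect_trans _ _ (inl y)).
  apply: connect_restr1; rewrite ?inE ?icS //=; first by rewrite ey yZ.
  by move: yS'; rewrite inE.
by apply: connect_lift cyu => v; rewrite !inE.
Qed.

End Lines.
End Big.

Lemma map_inl (X Y : eqType) (t : seq (X + Y)) : (forall y, inr y \notin t) ->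
  exists s, t = map inl s.
Proof.
elim: t => [|[x|y] t IH] nt; first by exists [::].
  have [|s ->] := IH; last by exists (x :: s).
  by move=> y; have := nt y; rewrite in_cons.
by have := nt y; rewrite mem_head.
Qed.

(** There are as many disjoint paths as sources, so every source starts exactly one path, and after
    its first vertex each path lies in [V]. *)
Lemma rooted_paths (V J : finType) k (q : 'I_k -> seq (V + J)) : #|J| = k ->
  (forall i, uniq (q i) && starts [set inr p | p : J] (q i)) ->
  (forall i j u, u \in q i -> u \in q j -> i = j) ->
  exists (f : J -> 'I_k) (s : J -> seq V), injective f /\
    forall p, q (f p) = inr p :: map inl (s p).
Proof.
move=> cJ qP qd.
have fP p : exists i, exists t, q i = inr p :: t.
  have hd i : exists p' t, q i = inr p' :: t.
    have /andP[_] := qP i; case: (q i) => //= a t /imsetP[p' _ ->].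
    by exists p', t.
  have [f fE] := choose_fun hd.
  have fi : injective f.
    move=> i i' E; have [t ti] := fE i; have [t' ti'] := fE i'.
    by apply: (@qd _ _ (inr (f i))); rewrite ?ti ?ti' ?E mem_head.
  have [] := @inj_surj_card _ k f [set: J] fi _ _ p.
  - by move=> i; rewrite inE.
  - by rewrite cardsT cJ.
  - by rewrite inE.
  by move=> i <-; exists i; exact: fE.
have [f {}fP] := choose_fun fP.
have fi p p' : f p = f p' -> p = p'.
  by move=> E; have [t ti] := fP p; have [t'] := fP p'; rewrite -E ti => -[].
have only p t : q (f p) = inr p :: t -> forall p', inr p' \notin t.
  move=> E p'; apply/negP => p't.
  have [t' E'] := fP p'; have ff : f p = f p'.
    by apply: (@qd _ _ (inr p')); rewrite ?E ?E' ?mem_head // in_cons p't orbT.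
  have /andP[+ _] := qP (f p); rewrite E /= => /andP[/negP + _]; apply.
  by rewrite (fi _ _ ff).
have sP p : exists s, q (f p) = inr p :: map inl s.
  by have [t E] := fP p; have [s Es'] := map_inl (only p t E); exists s; rewrite -Es'.
by have [s {}sP] := choose_fun sP; exists f, s.
Qed.

Section Tails.
Variables (V : finType) (e : rel V) (W : {set V}) (h m : nat) (z : 'I_h -> V).
Hypotheses (es : symmetric e) (zi : injective z).
Let Z := ZS z.
Let e1 := restr e (~: Z).

Lemma tails g M B k K d L : gridm e1 g M B -> wl e W 0 ->
  (forall i, ~ small_vertex e W d (z i)) -> controlled e1 W g M B k K -> k = h * m ->
  k + 2 * h < K -> k + 2 * h + 1 < d -> 2 * k < g -> 0 < L -> k.+1 * L <= M ->
  exists r0 (A : 'I_h * 'I_m -> {set V}) (side : 'I_h * 'I_m -> bool) (j : 'I_h * 'I_m -> nat),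
  [/\ r0 + L <= M,
    forall p, [/\ conn e1 (A p), adjS e [set z p.1] (A p), A p \subset ~: Z & j p < g],
    forall p p' u, u \in A p -> u \in A p' -> p = p',
    forall p p', side p = side p' -> j p = j p' -> p = p' &
    forall p, exists x, [/\ x \in A p, x \in B (j p) (if side p then r0 else (r0 + L).-1) &
      forall u r i, u \in A p -> r0 <= r -> r < r0 + L -> i < g -> u \in B i r -> u = x]].
Proof.
move=> gB wW zb cB kE kK kd kg L0 kM.
have M0 : 0 < M by apply: leq_trans kM; rewrite muln_gt0.
have gT := @gridm_lift V e h m z _ _ _ gB; have [g1 g2 g3 g4] := gT.
have Es := src_sym es (m := m) z.
have cudP (ir : nat * nat) : exists c : (V + 'I_h * 'I_m) * (V + 'I_h * 'I_m),
    ir.1 < g -> ir.2.+1 < M -> [/\ c.1 \in lift h m B ir.1 ir.2, c.2 \in lift h m B ir.1 ir.2.+1 &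
      src e z c.1 c.2].
  case: ir => i r /=.
  have [x0 _] : exists x0, x0 \in lift h m B 0 0.
    by apply/set0Pn; have [] // := g1 0 0 _ M0; lia.
  case: (ltnP i g) => ig; last by exists (x0, x0).
  case: (ltnP r.+1 M) => rM; last by exists (x0, x0).
  by have [x [y [xB yB exy]]] := g4 i r ig rM; exists (x, y).
have [cud {}cudP] := choose_fun cudP.
have hE := lines_reach es zi wW zb cB kE kK kd.
have cS : #|sources V h m| = k by rewrite card_sources kE.
have [r0 [q [r0M qP qd qE]]] := rooting Es gT cS kg L0 kM hE
  (cu := fun i r => (cud (i, r)).1) (cd := fun i r => (cud (i, r)).2)
  (fun i r ig rM => cudP (i, r) ig rM).
have [||f [s [fi sP]]] := @rooted_paths V ('I_h * 'I_m)%type k q _ _ qd.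
- by rewrite card_prod !card_ord kE.
- move=> i; have /and3P[_ -> /=] := qP i; case: (q i) => //= -[x|p'] t; rewrite inE // => _.
  by rewrite imset_f.
have dP p : exists b : bool * nat, [/\ b.2 < g, b.1 -> 0 < r0, ~~ b.1 -> r0 + L < M &
    exists s' x, [/\ s p = rcons s' x, forall u, u \in s' -> inl u \notin run L g (lift h m B) r0 &
      inl x = if b.1 then (cud (b.2, r0.-1)).2 else (cud (b.2, (r0 + L).-1)).1]].
  have [s' [x [jj [E av jg xE]]]] := qE (f p).
  move: E; rewrite sP; case: s' av => [|a s'] av.
    case=> xE' _; move: xE; rewrite -xE'; case=> -[hr xE].
      have [||_ + _] := cudP (jj, r0.-1) => //=; first by lia.
      by rewrite -xE => /imsetP[].
    have [||+ _ _] := cudP (jj, (r0 + L).-1) => //=; first by lia.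
    by rewrite -xE => /imsetP[].
  rewrite rcons_cons => -[E1 E2].
  case/lastP: (s p) E2 => [|s1 y]; first by case: (s') .
  rewrite map_rcons => /rcons_inj[E2 E3].
  have av1 u : u \in s1 -> inl u \notin run L g (lift h m B) r0.
    by move=> us; apply: av; rewrite -E2 in_cons map_f ?orbT.
  case: xE => -[hr xE]; [exists (true, jj)|exists (false, jj)]; split=> //.
    by exists s1, y; split => //=; rewrite E3.
  by exists s1, y; split => //=; rewrite E3.
have [b {}dP] := choose_fun dP.
have srcE u v : src e z (inl u : V + 'I_h * 'I_m) (inl v) -> e1 u v.
  by rewrite /e1 /restr /= !in_setC.
exists r0, (fun p => [set u in s p]), (fun p => (b p).1), (fun p => (b p).2); split => //.
- move=> p; have [bg _ _ [s' [x [sE _ _]]]] := dP p; have /and3P[qs _ _] := qP (f p).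
  rewrite sP /= in qs; have qs' := path_sorted qs; rewrite sorted_map in qs'.
  split => //.
  + by apply: walk_conn; [exact: restr_sym|apply: sub_sorted qs' => u v; exact: srcE].
  + rewrite /adjS; move: qs; rewrite sE; case: (s') => [|y s1] /=; case: (p) => i c /=.
      by move=> /andP[/andP[ex _] _]; exists (z i), x; rewrite !inE !eqxx.
    by move=> /andP[/andP[ex _] _]; exists (z i), y; rewrite !inE !eqxx.
  + apply/subsetP => u; rewrite !inE.
    have : path (src e z) (inr p) (map inl (s p)) by [].
    elim: (s p) (inr p : V + 'I_h * 'I_m) {qs qs' sE} => // y s1 IH a /= /andP[ay py].
    rewrite in_cons => /orP[/eqP->|/IH]; last by apply; exact: py.
    by move: ay; case: (a) => [v|[i' c']] /=; rewrite /Z => /andP[] // _ /andP[].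
- move=> p p' u; rewrite !inE => us us'; apply: fi; apply: (@qd _ _ (inl u)); rewrite sP in_cons.
    by rewrite map_f ?orbT.
  by rewrite map_f ?orbT.
- move=> p p' sE jE; have [_ _ _ [s1 [x [E1 _ xE]]]] := dP p.
  have [_ _ _ [s2 [y [E2 _ yE]]]] := dP p'.
  have xy : x = y by move: xE; rewrite sE jE -yE => -[].
  by apply: fi; apply: (@qd _ _ (inl x)); rewrite sP in_cons map_f ?orbT // ?E1 ?E2 ?xy mem_rcons mem_head.
- move=> p; have [bg b1 b2 [s' [x [sE av xE]]]] := dP p; exists x; split.
  + by rewrite inE sE mem_rcons mem_head.
  + have mx i r : (inl x : V + 'I_h * 'I_m) \in lift h m B i r -> x \in B i r by rewrite mem_lift.
    apply: mx; rewrite xE; case: (b p).1 b1 b2 => b1 b2.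
      have r00 := b1 isT; have [|_ + _] := cudP ((b p).2, r0.-1) bg; first by rewrite /=; lia.
      by rewrite /= prednK.
    by have [] // := cudP ((b p).2, (r0 + L).-1) bg; rewrite /=; have := b2 isT; lia.
  + move=> u r i; rewrite inE sE mem_rcons in_cons => /orP[/eqP//|us] r0r rL ig uB.
    have /negP[] := av u us; apply: (in_run cS kg L0 kM r0r rL).
    by apply: (@in_row _ _ _ i) => //; rewrite mem_lift.
Qed.

End Tails.

(** * Merging columns so that the tails end in consecutive ones *)

Section Coarsen.
Variables (V : finType) (e : rel V) (g M N : nat) (B : nat -> nat -> {set V}).
Variables (a rho : nat -> nat) (A : nat -> {set V}).
Hypotheses (es : symmetric e) (gB : gridm e g M B).
Hypothesis ai : forall x x', x < x' -> x' < N -> a x < a x'.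
Hypothesis ag : forall x, x < N -> a x < g.
Hypothesis rM : forall r, r < N -> rho r < M.
Hypothesis rS : forall r, r.+1 < N -> rho r.+1 = (rho r).+1 \/ rho r = (rho r.+1).+1.
Hypothesis ri : forall r r', r < N -> r' < N -> rho r = rho r' -> r = r'.
Hypothesis Ac : forall x, x < N -> conn e (A x).
Hypothesis Ad : forall x x' u, x < N -> x' < N -> u \in A x -> u \in A x' -> x = x'.
Hypothesis AB : forall x, x < N -> exists2 u, u \in A x & u \in B (a x) (rho 0).
Hypothesis Aend : forall x u i r, x < N -> i < g -> r < N -> u \in A x -> u \in B i (rho r) ->
  i = a x /\ r = 0.

(** Columns from one selected column up to the next are merged, which makes selected columns
    neighbours. In [coarse] the first row absorbs the tails, and [rho] renumbers the rows because
    tails may arrive at the last row of the band. *)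
Definition span x := [set i : 'I_g | a x <= i < if x.+1 < N then a x.+1 else (a x).+1].
Definition coarse x r := (\bigcup_(i in span x) B i (rho r)) :|: (if r == 0 then A x else set0).

Lemma mem_coarse x r u : x < N -> r < N -> u \in coarse x r ->
  (exists i, [/\ i < g, a x <= i, x.+1 < N -> i < a x.+1, i <= a x \/ x.+1 < N & u \in B i (rho r)])
  \/ r = 0 /\ u \in A x.
Proof.
move=> xN rN; rewrite in_setU => /orP[/bigcupP[i]|]; last by case: eqP => [->|_]; rewrite ?in_set0 //; right.
rewrite inE => /andP[h1 h2] uB; left; exists i; split => //; first by move=> h; rewrite h in h2.
by move: h2; case: ifP => _ h2; [right|left].
Qed.

Lemma coarse_in x r u : x < N -> u \in B (a x) (rho r) -> u \in coarse x r.
Proof.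
move=> xN uB; rewrite in_setU; apply/orP; left; apply/bigcupP; exists (Ordinal (ag xN)) => //.
by rewrite inE /= leqnn /=; case: ifP => // h; exact: ai.
Qed.

Lemma span_eq x x' i : x < N -> x' < N -> a x <= i -> (x.+1 < N -> i < a x.+1) ->
  a x' <= i -> (x'.+1 < N -> i < a x'.+1) -> x = x'.
Proof.
have h y y' : y < y' -> y' < N -> (y.+1 < N -> i < a y.+1) -> a y' <= i -> False.
  move=> yy y'N h1 h2; have := h1 (leq_ltn_trans yy y'N); rewrite ltnNge => /negP; apply.
  apply: leq_trans h2; move: yy; rewrite leq_eqVlt => /orP[/eqP->//|lt].
  by apply: ltnW; exact: ai.
move=> xN x'N h1 h2 h3 h4; case: (ltngtP x x') => // lt; first by case: (h x x').
by case: (h x' x).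
Qed.

Lemma coarsen : gridm e N N coarse.
Proof.
have [g1 g2 g3 g4] := gB; split=> [x r xN rN|x r x' r' u xN rN x'N r'N h h'|x r xN rN|x r xN rN].
- have [_ /set0Pn[u uB]] := g1 _ _ (ag xN) (rM rN).
  split; last by apply/set0Pn; exists u; exact: coarse_in.
  have c1 : conn e (\bigcup_(i in span x) B i (rho r)).
    apply: (conn_bigcup (L := [rel i j : 'I_g | (val j == i.+1) || (val i == j.+1)])).
    + exact: interval_conn.
    + by move=> i _; have [] := g1 i (rho r) (ltn_ord i) (rM rN).
    + move=> i j ij _ _; apply: (@touch_consec _ e g (fun i => B i (rho r)) i j es) => // s sg; apply: g3 => //; exact: rM.
  rewrite /coarse; case: eqP => [r0|_]; last by rewrite setU0.
  apply: connU => //; first exact: Ac.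
  have [w wA wB] := AB xN; exists w, w; split; rewrite ?eqxx //.
  apply/bigcupP; exists (Ordinal (ag xN)); last by rewrite r0.
  by rewrite inE /= leqnn /=; case: ifP => // h; exact: ai.
- have [[i [ig i1 i2 _ uB]]|[r0 uA]] := mem_coarse xN rN h;
    have [[j [jg j1 j2 _ uB']]|[r0' uA']] := mem_coarse x'N r'N h'.
  + have [ij rr] := g2 _ _ _ _ _ ig (rM rN) jg (rM r'N) uB uB'.
    split; last exact: ri.
    by apply: (@span_eq _ _ i) => //; rewrite ij.
  + have [E1 E2] := Aend x'N ig rN uA' uB; split; last by rewrite E2.
    apply: (@span_eq _ _ i) => //; first by rewrite E1.
    by move=> h1; rewrite E1; exact: ai.
  + have [E1 E2] := Aend xN jg r'N uA uB'; split; last by rewrite E2.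
    apply: (@span_eq _ _ j) => //; first by rewrite E1.
    by move=> h1; rewrite E1; exact: ai.
  + by split; [exact: Ad uA uA'|rewrite r0].
- have lt := ai (ltnSn x) xN.
  have E : (a x.+1).-1.+1 = a x.+1 by lia.
  have [|u [w [uB wB euw]]] := g3 (a x.+1).-1 (rho r) _ (rM rN); first by rewrite E; exact: ag.
  exists u, w; split => //; last by apply: coarse_in => //; rewrite -E.
  have pg : (a x.+1).-1 < g by have := ag xN; lia.
  rewrite in_setU; apply/orP; left; apply/bigcupP; exists (Ordinal pg) => //.
  by rewrite inE /= xN; lia.
- have r1 : r < N by exact: ltnW.
  suff [u [w [uB wB euw]]] : adjS e (B (a x) (rho r)) (B (a x) (rho r.+1)).
    by exists u, w; split => //; apply: coarse_in.
  have := rM rN; have := rM r1; case: (rS rN) => E; rewrite E => h1 h2.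
    exact: (g4 _ _ (ag xN)).
  by apply: adjS_sym => //; exact: (g4 _ _ (ag xN)).
Qed.

End Coarsen.

Lemma majority (T : finType) (f : T -> bool) m : 2 * m <= #|T| ->
  exists b, m <= #|[set t | f t == b]|.
Proof.
move=> h; have := cardsC [set t | f t == true].
have -> : ~: [set t | f t == true] = [set t | f t == false].
  by apply/setP => t; rewrite !inE; case: (f t).
move=> E; case: (leqP m #|[set t | f t == true]|) => [le|lt]; first by exists true.
exists false; rewrite leqNgt; apply/negP => lt'.
by move: lt lt' h; rewrite -E; lia.
Qed.

(** For at least half of the [2 * h1] vertices the tails arrive mostly on the same side of the band.
    [blocks] gives each of these its own stretch of columns, and [coarsen] absorbs the tails into
    the first row. *)
Theorem host N h1 : 0 < N -> 0 < h1 -> exists N0 d, forall (V : finType) (e : rel V) W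
  (z : 'I_(2 * h1) -> V), symmetric e -> wl e W 0 -> N0 <= #|W| -> injective z ->
  (forall i, ~ small_vertex e W d (z i)) -> forall tau : nat -> 'I_h1,
  (forall x x', x <= x' -> tau x <= tau x') ->
  exists B (v : 'I_h1 -> V), [/\ injective v, gridm e N N B,
    forall i x r, x < N -> r < N -> v i \notin B x r &
    forall x, x < N -> adjS e [set v (tau x)] (B x 0)].
Proof.
move=> N_gt0 h1_gt0; pose m' := h1 * N; pose k := 2 * h1 * (2 * m').
pose K := k + 2 * (2 * h1) + 1; pose g := 2 * k + K; pose M := k.+1 * N.
have k0 : 0 < k by rewrite /k /m' !muln_gt0 h1_gt0 N_gt0.
have kM : k <= M by rewrite /M mulSn; nia.
have [N0 gt] := @grid_theorem g M (2 * (2 * h1)) k K (leqnn _) kM k0.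
exists N0, (k + 2 * (2 * h1) + 2) => V e W z es wW cW zi zb tau tm.
set Z := ZS z; set e1 := restr e (~: Z).
have e1s : symmetric e1 by exact: restr_sym.
have w1 : wl e1 W (2 * (2 * h1)).
  by have := wl_del (Z := Z) wW; rewrite card_imset // cardsT card_ord.
have [B [gB cB]] := gt V e1 W e1s w1 cW.
have [||||||r0 [A [side [j [r0M Ap Adis jinj Aend]]]]] :=
  @tails V e W (2 * h1) (2 * m') z es zi g M B k K _ N gB wW zb cB => //; try by rewrite /K /g /K; lia.
have sdP i : exists b, m' <= #|[set c | side (i, c) == b]| by apply: majority; rewrite card_ord.
have [sd {}sdP] := choose_fun sdP.
have [b hb] : exists b, h1 <= #|[set i | sd i == b]| by apply: majority; rewrite card_ord.
have [f fi fD] := card_inj hb.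
pose D := f @: [set: 'I_h1].
have cD : #|D| = h1 by rewrite card_imset // cardsT card_ord.
pose P i := [set jj : 'I_g | [exists c, (side (i, c) == b) && (j (i, c) == jj)]].
have PD i : i \in D -> h1 * N <= #|P i|.
  case/imsetP => l _ ->; have := fD l; rewrite inE => /eqP sb.
  apply: leq_trans (sdP (f l)) _; rewrite sb.
  have jg p : j p < g by have [] := Ap p.
  rewrite -(card_in_imset (f := fun c => Ordinal (jg (f l, c)))).
    apply: subset_leq_card; apply/subsetP => _ /imsetP[c + ->]; rewrite !inE => sc.
    by apply/existsP; exists c; rewrite sc /=.
  move=> c c'; rewrite !inE => /eqP sc /eqP sc' /(congr1 val) /= E.
  by have := @jinj (f l, c) (f l, c'); rewrite sc sc' => /(_ erefl E) [].
have i0 : 'I_(2 * h1) by apply: (@Ordinal _ 0); rewrite muln_gt0.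
have [pi [a [piD pii aP am]]] := blocks i0 cD PD N_gt0.
have pP x : exists p, x < N -> [/\ p.1 = pi (tau x), side p = b & j p = a (tau x) x].
  case: (ltnP x N) => xN; last by exists (i0, Ordinal (ltn_ord (Ordinal (ltac:(rewrite /m'; nia) : 0 < 2 * m')))).
  have [s + sE] := aP _ _ (ltn_ord (tau x)) xN.
  rewrite inE => /existsP[c /andP[/eqP sc /eqP jc]]; exists (pi (tau x), c) => _; split => //.
  by rewrite jc.
have [p {}pP] := choose_fun pP.
(* If the tails arrive at the last row of the band, its rows are read in reverse. *)
pose rho r := if b then r0 + r else (r0 + N).-1 - r.
have rho0 : rho 0 = if b then r0 else (r0 + N).-1 by rewrite /rho addn0 subn0.
(* Column [x] takes the [x]-th position in the block of [tau x]; as [tau] is monotone, these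
   positions increase. *)
have aI x x' : x < x' -> x' < N -> a (tau x) x < a (tau x') x'.
  move=> xx x'N; apply: am => //; first exact: ltn_trans x'N.
  have := tm _ _ (ltnW xx); rewrite leq_eqVlt => /orP[/eqP->|]; [right|left] => //.
have jE x : x < N -> j (p x) = a (tau x) x by move=> xN; have [] := pP x xN.
exists (coarse g N B (fun x => a (tau x) x) rho (fun x => A (p x))), (fun l => z (pi l)).
have rM r : r < N -> rho r < M by rewrite /rho; case: b {hb D cD P PD piD aP pP rho0 rho fD} => ? //; lia.
have ri r r' : r < N -> r' < N -> rho r = rho r' -> r = r'.
  by rewrite /rho; case: b {hb D cD P PD piD aP pP rho0 rho fD rM} => ? ? //; lia.
have ag x : x < N -> a (tau x) x < g by move=> xN; rewrite -jE //; have [] := Ap (p x).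
have g_gt1 : 1 < g by rewrite /g; lia.
split.
- by move=> l l' /zi /pii E; apply: val_inj; exact: E.
- apply: (@gridm_mono V e1); first by move=> u v /and3P[].
  apply: (@coarsen V e1 g M) => //.
  + by move=> r rN; rewrite /rho; case: b {hb D cD P PD piD aP pP rho0 rho fD rM ri}; lia.
  + by move=> x xN; have [] := Ap (p x).
  + move=> x x' u xN x'N uA uA'; have E := Adis _ _ _ uA uA'.
    have := jE _ xN; rewrite E jE //; case: (ltngtP x x') => // lt.
      by have := aI _ _ lt x'N; lia.
    by have := aI _ _ lt xN; lia.
  + move=> x xN; have [u [uA uB _]] := Aend (p x); exists u => //.
    by rewrite rho0; have [_ <- <-] := pP x xN.
  + move=> x u i r xN ig rN uA uB; have [w [wA wB wE]] := Aend (p x).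
    have [g1 g2 g3 g4] := gB.
    have rr : r0 <= rho r < r0 + N.
      by rewrite /rho; case: b {hb D cD P PD piD aP pP rho0 rho fD rM ri uB}; lia.
    have /andP[rr1 rr2] := rr.
    have E := wE u _ i uA rr1 rr2 ig uB; rewrite E in uB.
    have [_ sp jp] := pP x xN; rewrite sp jp -rho0 in wB.
    have [ii rh] := g2 _ _ _ _ _ ig (rM _ rN) (ag _ xN) (rM _ N_gt0) uB wB.
    by split => //; exact: ri.
- move=> l x r xN rN; apply/negP => h.
  have zZ : z (pi l) \in Z by apply/imsetP; exists (pi l).
  have [[i [ig _ _ _ uB]]|[_ uA]] := mem_coarse xN rN h.
    have := subsetP (grid_in_region g_gt1 gB ig (rM r rN)) _ uB.
    by rewrite inE zZ.
  by have [_ _ /subsetP/(_ _ uA) + _] := Ap (p x); rewrite inE zZ.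
- move=> x xN; have [_ + _ _] := Ap (p x); have [-> _ _] := pP x xN.
  by apply: adjS_mono => //; rewrite /coarse eqxx subsetUr.
Qed.

Notation cell N := ('I_N * 'I_N)%type.

(** * Planar models and apex vertices *)

Definition nextto (a b : nat) := (a.+1 == b) || (b.+1 == a).

Definition gadj N : rel (cell N) := fun p q =>
  (p.1 == q.1) && nextto p.2 q.2 || (p.2 == q.2) && nextto p.1 q.1.

Lemma nexttoC a b : nextto a b = nextto b a.
Proof. by rewrite /nextto orbC. Qed.

Lemma gadj_sym N : symmetric (@gadj N).
Proof. by move=> p q; rewrite /gadj eq_sym nexttoC (eq_sym p.2) (nexttoC p.1). Qed.
#[local] Hint Resolve gadj_sym : core.

Lemma interval_connect M l u (i j : 'I_M) : l <= i < u -> l <= j < u ->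
  connect (restr [rel a b : 'I_M | nextto a b] [set i : 'I_M | l <= i < u]) i j.
Proof.
move=> hi hj; have := @interval_conn M l u i j; rewrite !inE => /(_ hi hj).
apply: connect_sub => a b /and3P[/= ab aP bP]; apply: connect_restr1 => //=.
by move: ab; rewrite /nextto; lia.
Qed.

Lemma row_walk M (X : {set cell M}) l u (b : 'I_M) :
  (forall i : 'I_M, l <= i < u -> (i, b) \in X) ->
  forall i j : 'I_M, l <= i < u -> l <= j < u -> connect (restr (@gadj M) X) (i, b) (j, b).
Proof.
move=> hX i j hi hj; have c := interval_connect hi hj.
apply: (@connect_ind _ _ (fun j' => connect _ (i, b) (j', b)) _ _ c); first exact: connect0.
move=> v w /and3P[/= vw]; rewrite !inE => hv hw c'; apply: connect_trans c' (connect_restr1 _ _ _); try exact: hX.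
by rewrite /gadj /= eqxx vw orbT.
Qed.

Lemma col_walk M (X : {set cell M}) l u (b : 'I_M) :
  (forall i : 'I_M, l <= i < u -> (b, i) \in X) ->
  forall i j : 'I_M, l <= i < u -> l <= j < u -> connect (restr (@gadj M) X) (b, i) (b, j).
Proof.
move=> hX i j hi hj; have c := interval_connect hi hj.
apply: (@connect_ind _ _ (fun j' => connect _ (b, i) (b, j')) _ _ c); first exact: connect0.
move=> v w /and3P[/= vw]; rewrite !inE => hv hw c'; apply: connect_trans c' (connect_restr1 _ _ _); try exact: hX.
by rewrite /gadj /= eqxx vw.
Qed.

(** * Refining every cell of a grid into a [t] by [t] block *)

Section Thick.
Variables N t : nat.
Hypothesis t0 : 0 < t.

Lemma node_subproof (i : 'I_N) (a : 'I_t) : i * t + a < N * t.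
Proof.
apply: (@leq_trans (i.+1 * t)); first by rewrite mulSn addnC ltn_add2r.
by rewrite leq_mul2r ltn_ord orbT.
Qed.
Definition node i a := Ordinal (node_subproof i a).

Lemma block_subproof (x : 'I_(N * t)) : x %/ t < N.
Proof. by rewrite ltn_divLR. Qed.
Definition block x := Ordinal (block_subproof x).

Lemma block_node i a : block (node i a) = i.
Proof. by apply: val_inj; rewrite /= divnMDl // divn_small ?addn0. Qed.

Lemma node_inj i i' a a' : node i a = node i' a' -> i = i' /\ a = a'.
Proof.
move=> E; have ii : i = i' by rewrite -(block_node i a) E block_node.
by split => //; move: E; rewrite ii => /(congr1 val) /= /addnI /val_inj.
Qed.

Lemma block_range (i : 'I_N) (x : 'I_(N * t)) : (i * t <= x < i * t + t) = (block x == i).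
Proof.
rewrite -(inj_eq val_inj) /= eqn_leq leq_divRL // -(ltnS (x %/ t)) ltn_divLR // mulSn.
by rewrite andbC (addnC t).
Qed.

Definition cellof (p : cell (N * t)) : cell N := (block p.1, block p.2).
Definition thick (C : {set cell N}) := [set p | cellof p \in C].

(** Rows of the block of [c] for [o] true, columns for [o] false. The [t] parallel lines are
    disjoint, so fewer than [t] vertices leave one of them free. *)
Definition line (o : bool) (c : cell N) (a : 'I_t) : {set cell (N * t)} :=
  if o then [set p | (block p.1 == c.1) && (p.2 == node c.2 a)]
  else [set p | (p.1 == node c.1 a) && (block p.2 == c.2)].

Lemma line_cell o c a p : p \in line o c a -> cellof p = c.
Proof.
case: c => c1 c2; case: o; rewrite inE /= => /andP[/eqP E1 /eqP E2]; rewrite /cellof.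
  by rewrite E1 E2 block_node.
by rewrite E1 E2 block_node.
Qed.

Lemma line_disj o c c' a a' p : p \in line o c a -> p \in line o c' a' -> a = a'.
Proof.
by case: o; rewrite !inE => /andP[/eqP E1 /eqP E2] /andP[/eqP E3 /eqP E4];
  [move: E4; rewrite E2|move: E3; rewrite E1] => /node_inj[].
Qed.

Lemma line_connect (X : {set cell (N * t)}) o c a p q : line o c a \subset X ->
  p \in line o c a -> q \in line o c a -> connect (restr (@gadj _) X) p q.
Proof.
case: c p q => c1 c2 [p1 p2] [q1 q2] /subsetP sX; case: o sX => sX; rewrite !inE /=.
  rewrite -!block_range => /andP[h1 /eqP->] /andP[h2 /eqP->].
  by apply: row_walk h1 h2 => i hi; apply: sX; rewrite inE /= -block_range hi /=.
rewrite -!block_range => /andP[/eqP-> h1] /andP[/eqP-> h2].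
by apply: col_walk h1 h2 => i hi; apply: sX; rewrite inE /= -block_range hi /= eqxx.
Qed.

Lemma line_cross c a b : exists2 p, p \in line true c a & p \in line false c b.
Proof. by exists (node c.1 b, node c.2 a); rewrite inE /= block_node !eqxx. Qed.

Lemma free_line o c c' (S : {set cell (N * t)}) : #|S| < t ->
  exists a, [disjoint line o c a & S] /\ [disjoint line o c' a & S].
Proof.
move=> cS; have := @hit_disj _ t (fun a => line o c a :|: line o c' a) S.
have hd a a' z : z \in line o c a :|: line o c' a -> z \in line o c a' :|: line o c' a' -> a = a'.
  by rewrite !in_setU => /orP[] h /orP[]; exact: line_disj h.
move=> /(_ hd) => h; have /set0Pn[a] : [set i | [disjoint line o c i :|: line o c' i & S]] != set0.
  by rewrite -card_gt0; apply: leq_trans h; rewrite subn_gt0.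
rewrite inE => d; exists a; split; apply: disjointWl d; [exact: subsetUl|exact: subsetUr].
Qed.

Lemma line_sub o c a (C : {set cell N}) (S : {set cell (N * t)}) : c \in C -> [disjoint line o c a & S] ->
  line o c a \subset thick C :\: S.
Proof.
move=> cC d; apply/subsetP => p pl; rewrite in_setD (disjointFr d) //= inE.
by rewrite (line_cell pl).
Qed.

(** Crossing lines meet, and parallel free lines are joined through a free crossing line. *)
Lemma lines_connect (C : {set cell N}) (S : {set cell (N * t)}) c o o' a a' p q : c \in C -> #|S| < t ->
  [disjoint line o c a & S] -> [disjoint line o' c a' & S] ->
  p \in line o c a -> q \in line o' c a' -> connect (restr (@gadj _) (thick C :\: S)) p q.
Proof.
move=> cC cS.
have cross b b' u v : [disjoint line true c b & S] -> [disjoint line false c b' & S] ->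
    u \in line true c b -> v \in line false c b' ->
    connect (restr (@gadj _) (thick C :\: S)) u v /\ connect (restr (@gadj _) (thick C :\: S)) v u.
  move=> d d' ub vb'; suff c1 : connect (restr (@gadj _) (thick C :\: S)) u v.
    by split => //; rewrite connect_restr_sym //; exact: gadj_sym.
  have [w w1 w2] := line_cross c b b'.
  apply: (@connect_trans _ _ w); [apply: line_connect ub w1|apply: line_connect w2 vb'];
    exact: line_sub.
case: o; case: o' => d d' pl ql.
- have [b [db _]] := free_line false c c cS.
  have [w _ wb] := line_cross c a b.
  by apply: (@connect_trans _ _ w); [have [] := cross _ _ _ _ d db pl wb|have [] := cross _ _ _ _ d' db ql wb].
- by have [] := cross _ _ _ _ d d' pl ql.
- by have [] := cross _ _ _ _ d' d ql pl.
- have [b [db _]] := free_line true c c cS.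
  have [w wb _] := line_cross c b a.
  by apply: (@connect_trans _ _ w); [have [] := cross _ _ _ _ db d wb pl|have [] := cross _ _ _ _ db d' wb ql].
Qed.

Lemma border c c' : gadj c c' -> exists o, forall a, exists p q,
  [/\ p \in line o c a, q \in line o c' a & gadj p q].
Proof.
case: c c' => c1 c2 [d1 d2]; rewrite /gadj /= => /orP[/andP[/eqP<- h]|/andP[/eqP<- h]].
  exists false => a; case/orP: h => /eqP h.
    have lt0 : t.-1 < t by rewrite prednK.
    exists (node c1 a, node c2 (Ordinal lt0)), (node c1 a, node d2 (Ordinal t0)).
    by rewrite !inE /= !block_node !eqxx; split => //; rewrite /nextto /= -h mulSn; lia.
  have lt0 : t.-1 < t by rewrite prednK.
  exists (node c1 a, node c2 (Ordinal t0)), (node c1 a, node d2 (Ordinal lt0)).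
  by rewrite !inE /= !block_node !eqxx; split => //; rewrite /nextto /= -h mulSn; lia.
exists true => a; case/orP: h => /eqP h.
  have lt0 : t.-1 < t by rewrite prednK.
  exists (node c1 (Ordinal lt0), node c2 a), (node d1 (Ordinal t0), node c2 a).
  by rewrite !inE /= !block_node !eqxx; split => //; rewrite /nextto /= -h mulSn; lia.
have lt0 : t.-1 < t by rewrite prednK.
exists (node c1 (Ordinal t0), node c2 a), (node d1 (Ordinal lt0), node c2 a).
by rewrite !inE /= !block_node !eqxx; split => //; rewrite /nextto /= -h mulSn; lia.
Qed.

Lemma thick_connect (C : {set cell N}) (S : {set cell (N * t)}) c c' : conn (@gadj _) C -> c \in C -> c' \in C -> #|S| < t ->
  forall o o' a a' p q, [disjoint line o c a & S] -> [disjoint line o' c' a' & S] ->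
  p \in line o c a -> q \in line o' c' a' -> connect (restr (@gadj _) (thick C :\: S)) p q.
Proof.
move=> hC cC c'C cS; have cc := hC c c' cC c'C.
apply: (@connect_ind _ _ (fun d => forall o o' a a' p q, [disjoint line o c a & S] ->
  [disjoint line o' d a' & S] -> p \in line o c a -> q \in line o' d a' ->
  connect (restr (@gadj _) (thick C :\: S)) p q) _ _ cc).
  by move=> o o' a a' p q; exact: lines_connect.
move=> d d' /and3P[dd' dC d'C] IH o o' a a' p q hp hq pl ql.
have [o1 hb] := border dd'; have [b [f1 f2]] := free_line o1 d d' cS.
 have [u [v [ud vd uv]]] := hb b.
apply: connect_trans (IH _ _ _ _ _ _ hp f1 pl ud) _.
apply: (@connect_trans _ _ v).
  by apply: connect_restr1 => //; [exact: subsetP (line_sub dC f1) _ ud|exact: subsetP (line_sub d'C f2) _ vd].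
exact: lines_connect d'C cS f2 hq vd ql.
Qed.

Lemma mem_thick c p (C : {set cell N}) : c \in C -> cellof p = c -> p \in thick C.
Proof. by move=> cC E; rewrite inE E. Qed.

Lemma cell_line o p : exists a, p \in line o (cellof p) a.
Proof.
have lt (x : 'I_(N * t)) : x %% t < t by rewrite ltn_mod.
have E x : x = node (block x) (Ordinal (lt x)).
  by apply: val_inj => /=; rewrite -divn_eq.
by case: o; [exists (Ordinal (lt p.2))|exists (Ordinal (lt p.1))]; rewrite inE /= -E !eqxx.
Qed.

Lemma thick_conn (C : {set cell N}) : conn (@gadj _) C -> conn (@gadj _) (thick C).
Proof.
move=> hC p q; rewrite !inE => pC qC.
have [a pa] := cell_line true p; have [b qb] := cell_line true q.
have d0 (X : {set cell (N * t)}) : [disjoint X & (set0 : {set cell (N * t)})].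
  by apply/pred0P => x; rewrite /= inE andbF.
have := @thick_connect C set0 _ _ hC pC qC _ true true a b p q (d0 _) (d0 _) pa qb.
by rewrite setD0 cards0; apply.
Qed.

Lemma thick_adj (C D : {set cell N}) : adjS (@gadj _) C D -> adjS (@gadj _) (thick C) (thick D).
Proof.
move=> [c [d [cC dD cd]]]; have [o /(_ (Ordinal t0))[p [q [pc qd pq]]]] := border cd.
exists p, q; split => //; first exact: mem_thick cC (line_cell pc).
exact: mem_thick dD (line_cell qd).
Qed.

Lemma thick_neq0 (C : {set cell N}) : C != set0 -> thick C != set0.
Proof.
move=> /set0Pn[c cC]; apply/set0Pn; exists (node c.1 (Ordinal t0), node c.2 (Ordinal t0)).
by rewrite inE /cellof /= !block_node -surjective_pairing.
Qed.

Lemma thickU (C D : {set cell N}) : thick (C :|: D) = thick C :|: thick D.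
Proof. by apply/setP => p; rewrite !inE. Qed.

(* A separator of fewer than [t] vertices leaves a line free in every pair of
   adjacent blocks, so Menger's theorem applies. *)
Lemma fan (J : finType) (C : {set cell N}) (c : J -> cell N) c0 : conn (@gadj _) C ->
  #|J| <= t -> c0 \in C -> c0.2 = 0 :> nat ->
  (forall j, adjS (@gadj _) [set c j] C) ->
  exists P : J -> {set cell (N * t)}, [/\ forall j, conn (@gadj _) (P j),
    forall j, P j \subset thick C, forall j j' p, p \in P j -> p \in P j' -> j = j',
    forall j, exists p, [/\ p \in P j, cellof p = c0 & p.2 = 0 :> nat] &
    forall j, adjS (@gadj _) (thick [set c j]) (P j)].
Proof.
move=> hC cJ c0C c00 hc.
pose at_ j p := (p \in thick C) && [exists q in thick [set c j], gadj q p].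
(* Every [j] becomes an extra vertex that sees the part of [thick C] next to the block of [c j].
   Menger's theorem is applied from these vertices to the top row of the block of [c0]. *)
pose r : rel (cell (N * t) + J) := fun a b => match a, b with
  | inl p, inl q => [&& gadj p q, p \in thick C & q \in thick C]
  | inl p, inr j | inr j, inl p => at_ j p
  | inr _, inr _ => false end.
pose A : {set cell (N * t) + J} := [set inr j | j : J].
pose top p := (cellof p == c0) && (p.2 == 0 :> nat).
pose B : {set cell (N * t) + J} := inl @: [set p | top p].
have inlE (X : {set cell (N * t)}) p : ((inl p : cell (N * t) + J) \in inl @: X) = (p \in X).
  by rewrite mem_imset // => ? ? [].
have [|q [qP qd]] := @menger _ r A B #|J|.
  move=> S sep; rewrite leqNgt; apply/negP => cS.
  pose S' := [set p | (inl p : cell (N * t) + J) \in S].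
  have cS' : #|S'| < t.
    apply: leq_trans cJ; apply: leq_ltn_trans cS.
    rewrite -(@card_imset _ _ (@inl (cell (N * t)) J)); last by move=> ? ? [].
    by apply: subset_leq_card; apply/subsetP => _ /imsetP[v + ->]; rewrite inE.
  have [j jS] : exists j, inr j \notin S.
    have : ~~ (A \subset S).
      apply/negP => /subset_leq_card; rewrite card_imset; last by move=> ? ? [].
      by rewrite leqNgt; move: cS; rewrite -cardsT => ->.
    by case/subsetPn => _ /imsetP[j _ ->]; exists j.
  have [_ [d [/set1P-> dC cd]]] := hc j; have [o hb] := border cd.
  have [a [_ fd]] := free_line o (c j) d cS'.
  have [u [v [uc vd uv]]] := hb a.
  have [b [fb _]] := free_line false c0 c0 cS'.
  pose w := (node c0.1 b, node c0.2 (Ordinal t0)).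
  have wl : w \in line false c0 b by rewrite inE /= block_node !eqxx.
  have := thick_connect hC dC c0C cS' fd fb vd wl.
  have vX := subsetP (line_sub dC fd) _ vd.
  move=> /connect_walk/(_ vX)[s [ps us ls sub]].
  have [|||z + zS] := hasP (sep (inr j :: map inl (v :: s)) _ _ _).
    + rewrite /= /at_ (_ : v \in thick C); last by case/setDP: vX.
      apply/andP; split; first by apply/exists_inP; exists u => //; rewrite inE (line_cell uc) inE.
      rewrite path_map; apply: (sub_in_path (P := [in thick C :\: S'])) ps; last by apply/allP => x /sub.
      by move=> x y /setDP[xC _] /setDP[yC _] /= ->; rewrite xC yC.
    + by rewrite /= imset_f.
    + by rewrite /= last_map ls inlE inE /top (line_cell wl) eqxx /= c00.
  rewrite in_cons => /orP[/eqP E|/mapP[x xs E]]; first by move: zS; rewrite E /= (negPf jS).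
  by move: zS; rewrite E /= => zS; have := sub x xs; rewrite !inE zS.
have [|f [s [fi sP]]] := @rooted_paths (cell (N * t)) J #|J| q erefl _ qd.
  by move=> i; have /and4P[_ -> -> _] := qP i.
have sE j : [&& path r (inr j) (map inl (s j)), uniq (s j) & ends B (inr j :: map inl (s j))].
  have /and4P[h1 h2 _ h3] := qP (f j); rewrite sP in h1 h2 h3; move: h1 h2 h3 => /= -> /andP[_ h2] ->.
  by rewrite (map_inj_uniq) in h2; [rewrite h2|move=> ? ? []].
have pr x s' : path r (inl x) (map inl s') -> path (@gadj _) x s' /\ {subset s' <= thick C}.
  elim: s' x => // y s' IH x /= /andP[/and3P[xy xC yC] /IH[p1 p2]]; rewrite xy p1; split => // z.
  by rewrite in_cons => /orP[/eqP->|/p2].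
exists (fun j => [set p in s j]); split.
- move=> j; have /and3P[+ _ _] := sE j; case: (s j) => [|x s'] /=.
    by move=> _ u v; rewrite inE.
  by move=> /andP[_ /pr[ps _]]; apply: walk_conn => //; exact: gadj_sym.
- move=> j; apply/subsetP => p; rewrite inE; have /and3P[+ _ _] := sE j; case: (s j) => [|x s'] //=.
  by move=> /andP[/andP[xC _] /pr[_ sub]]; rewrite in_cons => /orP[/eqP->|/sub].
- move=> j j' p; rewrite !inE => pj pj'; apply: fi; apply: (@qd _ _ (inl p)); rewrite sP in_cons map_f ?orbT //.
- move=> j; have /and3P[_ _] := sE j; case: (s j) => [|x s'] /=.
    by move=> /imsetP[].
  rewrite last_map inlE inE /top => /andP[/eqP E /eqP E2]; exists (last x s').
  by rewrite inE mem_last.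
- move=> j; have /and3P[+ _ h] := sE j; move: h; case: (s j) => [|x s'] /=.
    by move=> /imsetP[].
  move=> _ /andP[/andP[_ /exists_inP[q' qc qx]] _]; exists q', x; split => //.
  by rewrite inE mem_head.
Qed.

End Thick.

Lemma conn_star (V I : finType) (e : rel V) (X : {set V}) (D : {set I}) (P : I -> {set V}) :
  symmetric e -> conn e X -> X != set0 -> (forall i, i \in D -> conn e (P i) /\ touch e X (P i)) ->
  conn e (X :|: \bigcup_(i in D) P i).
Proof.
move=> es cX /set0Pn[x0 x0X] hP; set U := X :|: _.
have XU : X \subset U by exact: subsetUl.
have toX y : y \in U -> connect (restr e U) x0 y.
  rewrite in_setU => /orP[yX|/bigcupP[i iD yP]]; first exact: conn_sub yX.
  have [cP tP] := hP i iD; apply: (@conn_sub _ _ (X :|: P i)).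
  - exact: connU.
  - by apply: setUS; exact: bigcup_sup.
  - by rewrite in_setU x0X.
  - by rewrite in_setU yP orbT.
by move=> y z yU zU; apply: connect_trans (toX z zU); rewrite connect_restr_sym //; exact: toX.
Qed.

(** Needed because the cells of an arc overlap those of its end vertices: the edge keeps only a
    stretch between the two ends. *)
Lemma bridge (V : finType) (e : rel V) (C X Z : {set V}) x z : symmetric e -> conn e C ->
  x \in C -> x \in X -> z \in C -> z \in Z -> (forall u, u \in X -> u \in Z -> False) ->
  ~ adjS e X Z ->
  exists I : {set V}, [/\ I \subset C, conn e I, I != set0,
    forall u, u \in I -> (u \notin X) && (u \notin Z) &
    adjS e X I /\ adjS e Z I].
Proof.
move=> es cC xC xX zC zZ hXZ nXZ.
have dXZ : [disjoint X & Z].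
  by apply/pred0P => u /=; apply/negP => /andP[uX uZ]; exact: hXZ uX uZ.
have [s [ps _ ls sC]] := connect_walk (cC x z xC zC) xC.
have [||a [u [m [w [b [E uX wZ mXZ [cm]]]]]]] := @trim V e X Z (x :: s) ps _ _ dXZ es.
- by [].
- by rewrite /= ls.
case=> [[_ a']|[a1 a2]]; first by case: nXZ.
exists [set v in m]; split => //.
- by apply/subsetP => v; rewrite inE => vm; apply: sC; rewrite E mem_cat in_cons mem_cat vm !orbT.
- by have [_ [v [_ vm _]]] := a1; apply/set0Pn; exists v.
- by move=> v; rewrite inE => /mXZ; rewrite inE negb_or.
- by split => //; exact: adjS_sym.
Qed.

(* Models of the graph obtained by subdividing every edge once: the vertices
   [inl x] and the edges [inr E] are represented by disjoint connected sets. *)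
Section SModel.
Variables (Q : finType) (Es : {set {set Q}}).

Definition valid (a : Q + {set Q}) := if a is inr E then E \in Es else true.

Definition smodel (V : finType) (e : rel V) (Y : Q + {set Q} -> {set V}) :=
  [/\ forall a, valid a -> conn e (Y a) /\ Y a != set0,
    forall a b z, valid a -> valid b -> z \in Y a -> z \in Y b -> a = b &
    forall x E, E \in Es -> x \in E -> adjS e (Y (inl x)) (Y (inr E))].

Lemma smodel_lift (V V' : finType) (e : rel V) (e' : rel V') (b : V -> {set V'}) Y :
  symmetric e' -> smodel e Y -> (forall n, conn e' (b n) /\ b n != set0) ->
  (forall n n' z, z \in b n -> z \in b n' -> n = n') ->
  (forall n n', e n n' -> adjS e' (b n) (b n')) ->
  smodel e' (fun a => \bigcup_(n in Y a) b n).
Proof.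
move=> es [h1 h2 h3] hb bd ba; split.
- move=> a va; have [cY /set0Pn[n nY]] := h1 a va; split.
    apply: (conn_bigcup cY) => [i _|i j ij _ _]; first by have [] := hb i.
    by apply: adjS_touch; exact: ba.
  have [_ /set0Pn[z zb]] := hb n.
  by apply/set0Pn; exists z; apply/bigcupP; exists n.
- move=> a a' z va va' /bigcupP[n nY zn] /bigcupP[n' nY' zn'].
  by apply: (h2 _ _ n va va' nY); rewrite (bd _ _ _ zn zn').
- move=> x E EE xE; have [n [n' [nY nY' nn]]] := h3 x E EE xE.
  have [z [z' [zb zb' zz]]] := ba _ _ nn.
  by exists z, z'; split => //; apply/bigcupP; [exists n|exists n'].
Qed.

End SModel.

Section Apex.
Variables (Q : finType) (Es : {set {set Q}}) (hi : {set Q}).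

(* [None] is an apex vertex, to be placed in the distinguished face. *)
Definition apex_edge (v : Q) : {set option Q} := [set None; Some v].
Definition apex_edges : {set {set option Q}} :=
  [set Some @: E | E : {set Q} in Es] :|: apex_edge @: hi.

Definition touches_top N (X : {set cell N}) := exists2 p, p \in X & p.2 = 0 :> nat.

Lemma some_inj (E F : {set Q}) : Some @: E = Some @: F -> E = F.
Proof. by apply: imset_inj => ? ? []. Qed.

Lemma apex_edge_inj u v : apex_edge u = apex_edge v -> u = v.
Proof.
move=> E; have : Some u \in apex_edge v by rewrite -E !inE eqxx.
by rewrite !inE /= => /eqP[].
Qed.

Lemma apex_edge_some v (E : {set Q}) : apex_edge v <> Some @: E.
Proof.
move=> H; have : None \in apex_edge v by rewrite !inE eqxx.
by rewrite H => /imsetP[].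
Qed.

Lemma remove_apex N (Y : option Q + {set option Q} -> {set cell N}) :
  smodel apex_edges (@gadj N) Y -> touches_top (Y (inl None)) ->
  exists N' Y', [/\ 0 < N', smodel Es (@gadj N') Y' &
    forall v, v \in hi -> touches_top (Y' (inl v))].
Proof.
move=> [h1 h2 h3] [c0 c0Y c00].
pose t := #|hi|.+1; have t0 : 0 < t by [].
pose J := {v | v \in hi}.
have vE v : v \in hi -> valid apex_edges (inr (apex_edge v)).
  by move=> vh; rewrite /= in_setU imset_f ?orbT.
have vS E : E \in Es -> valid apex_edges (inr (Some @: E)).
  by move=> EE; rewrite /= in_setU (imset_f (fun E : {set Q} => Some @: E)).
have cP (j : J) : exists c, c \in Y (inr (apex_edge (val j))) /\ adjS (@gadj N) [set c] (Y (inl None)).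
  have [|c [d [cY dY cd]]] := h3 None (apex_edge (val j)) (vE _ (valP j)); first by rewrite !inE eqxx.
  by exists d; split => //; exists d, c; rewrite inE eqxx gadj_sym.
have [c {}cP] := choose_fun cP.
have [|||||P [P1 P2 P3 P4 P5]] := @fan N t t0 J (Y (inl None)) c c0.
- by have [] := h1 (inl None).
- by rewrite card_sig -cardsE /t ltnW // ltnS subset_leq_card //; apply/subsetP => x; rewrite inE.
- by [].
- by [].
- by move=> j; have [] := cP j.
pose D v := Y (inl (Some v)) :|: (if v \in hi then Y (inr (apex_edge v)) else set0).
pose P' v := if insub v is Some j then P j else set0.
have P'P v p : p \in P' v -> exists j : J, val j = v /\ p \in P j.
  by rewrite /P'; case: insubP => [j _ jv pj|_]; [exists j|rewrite inE].
have P'E (j : J) : P' (val j) = P j by rewrite /P' valK.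
pose Y' (a : Q + {set Q}) := match a with
  | inl v => thick t0 (D v) :|: P' v
  | inr E => thick t0 (Y (inr (Some @: E))) end.
have kind a z : valid Es a -> z \in Y' a -> exists b, valid apex_edges b /\ cellof t0 z \in Y b /\
  match a with
  | inl v => b = inl (Some v) \/ b = inr (apex_edge v) \/ b = inl None /\ z \in P' v
  | inr E => b = inr (Some @: E) end.
  case: a => [v _|E va] /=; last by rewrite inE; exists (inr (Some @: E)); split; [exact: vS|].
  rewrite !in_setU inE in_setU -orbA => /or3P[h|h|h].
  - by exists (inl (Some v)); split => //; split => //; left.
  - move: h; case: ifP => vh; last by rewrite inE.
    by exists (inr (apex_edge v)); split; [exact: vE|split => //; right; left].
  - exists (inl None); split => //; split; last by right; right.
    by have [j [_ /(subsetP (P2 j))]] := P'P _ _ h; rewrite inE.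
exists (N * t), Y'; split; first by rewrite muln_gt0 (leq_ltn_trans _ (ltn_ord c0.1)).
split.
- case=> [v _|E va] /=; last first.
    by have [k1 k2] := h1 _ (vS _ va); split; [exact: thick_conn|exact: thick_neq0].
  have [k1 k2] := h1 (inl (Some v)) isT.
  split; last first.
    apply/set0Pn; have /set0Pn[p pY] := thick_neq0 t0 k2; exists p.
    by rewrite /D thickU !in_setU pY.
  have cD : conn (@gadj N) (D v).
    rewrite /D; case: ifP => vh; last by rewrite setU0.
    apply: connU => //; first exact: gadj_sym.
      by have [] := h1 _ (vE _ vh).
    by apply: adjS_touch; apply: h3; [exact: vE|rewrite !inE eqxx orbT].
  case vh: (v \in hi); last first.
    by rewrite /P' insubN ?vh // setU0; exact: thick_conn.
  have E := P'E (exist _ v vh); rewrite /= in E; rewrite E.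
  apply: connU; [exact: gadj_sym|exact: thick_conn|exact: P1|].
  apply: adjS_touch; apply: adjS_mono (P5 _) => //.
  apply/subsetP => p; rewrite !inE => /eqP->; have [/= + _] := cP (exist _ v vh).
  by rewrite vh => ->; rewrite orbT.
- move=> a a' z va va' za za'.
  have [b [vb [zb hb]]] := kind a z va za; have [b' [vb' [zb' hb']]] := kind a' z va' za'.
  have E := h2 _ _ _ vb vb' zb zb'; subst b'.
  case: a {va za} hb => [v|F]; case: a' {va' za'} hb' => [v'|F'].
  + move=> [->|[->|[-> zv]]] [|[|[]]] //; first by case=> ->.
      by case=> /apex_edge_inj->.
    move=> _ zv'; have [j [<- zj]] := P'P _ _ zv; have [j' [<- zj']] := P'P _ _ zv'.
    by rewrite (P3 _ _ _ zj zj').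
  + by move=> -> [//|[[/esym/apex_edge_some//]|[]//]].
  + by move=> [->|[->|[-> _]]] // [] /apex_edge_some.
  + by move=> -> [] /some_inj->.
- move=> x E EE xE; apply: (@adjS_mono _ (@gadj _) _ (thick t0 (Y (inl (Some x)))) _ (thick t0 (Y (inr (Some @: E))))) => //.
    by rewrite /= /D thickU -setUA subsetUl.
  by apply: thick_adj; apply: h3; [exact: vS|rewrite imset_f].
- move=> v vh; have [p [pP _ p0]] := P4 (exist _ v vh); exists p => //.
  by rewrite /= in_setU -(P'E (exist _ v vh)) in pP *; rewrite pP orbT.
Qed.

(** For monotone [tau] this is the fan grid: each extra vertex sees consecutive cells of the first
    row. *)
Definition hadj N h (tau : nat -> 'I_h) : rel (cell N + 'I_h) := fun a b => match a, b with
  | inl p, inl q => gadj p q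
  | inl p, inr i | inr i, inl p => (p.2 == 0 :> nat) && (tau p.1 == i)
  | inr _, inr _ => false end.

(** The set of [v] in [hi] is replaced by an extra vertex. The freed room, thickened, holds [fan]
    paths from the edges at [v] to the top row of the block of [cv v], and each edge absorbs its
    path. As [tau] counts the blocks [cv u] further left, it sends all columns of the block of
    [cv v] to [rank v]. *)
Lemma spread N (Y : Q + {set Q} -> {set cell N}) : 0 < N ->
  smodel Es (@gadj N) Y -> (forall v, v \in hi -> touches_top (Y (inl v))) ->
  exists N' (tau : nat -> 'I_(#|hi|.+1)) Y',
  [/\ 0 < N', forall x x', x <= x' -> tau x <= tau x', smodel Es (@hadj N' _ tau) Y' &
    forall v, v \in hi -> exists i, Y' (inl v) = [set inr i]].
Proof.
move=> N0 [h1 h2 h3] top.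
have cvP v : exists c, v \in hi -> c \in Y (inl v) /\ c.2 = 0 :> nat.
  case vh: (v \in hi); last by exists (Ordinal N0, Ordinal N0).
  by have [c cY c0] := top v vh; exists c.
have [cv {}cvP] := choose_fun cvP.
pose t := #|Es|.+1; have t0 : 0 < t by [].
pose R n := #|[set u in hi | (cv u).1 < n]|.
(* To the right of all selected blocks the count is [#|hi|] itself, hence the additional extra
   vertex. *)
have Rlt n : R n < #|hi|.+1.
  by rewrite ltnS; apply: subset_leq_card; apply/subsetP => u; rewrite inE => /andP[].
pose tau x := Ordinal (Rlt (x %/ t)).
pose rank v := Ordinal (Rlt (cv v).1).
have rank_inj u v : u \in hi -> v \in hi -> rank u = rank v -> u = v.
  have lt x y : x \in hi -> y \in hi -> (cv x).1 < (cv y).1 -> rank x <> rank y.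
    move=> xh yh xy /(congr1 val) /= E; suff : R (cv x).1 < R (cv y).1 by rewrite E ltnn.
    apply: proper_card; apply/properP; split.
      by apply/subsetP => w; rewrite !inE => /andP[-> /= h]; exact: ltn_trans xy.
    by exists x; rewrite !inE xh ?ltnn.
  move=> uh vh E; case: (ltngtP (cv u).1 (cv v).1) => [h|h|h].
  - by case: (lt u v).
  - by case: (lt v u).
  - have [uY u0] := cvP u uh; have [vY v0] := cvP v vh.
    have EE : cv u = cv v.
      by apply/eqP; rewrite -pair_eqE /pair_eq; apply/andP; split; apply/eqP; apply: val_inj; rewrite //= u0 v0.
    by rewrite EE in uY; have [] := h2 (inl u) (inl v) _ isT isT uY vY.
pose J v := {E : {set Q} | (E \in Es) && (v \in E)}.
have fanP v : exists P : {set Q} -> {set cell (N * t)}, v \in hi -> forall E, E \in Es -> v \in E ->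
    [/\ conn (@gadj _) (P E), P E \subset thick t0 (Y (inl v)),
      forall E' p, E' \in Es -> v \in E' -> p \in P E -> p \in P E' -> E = E',
      exists p, [/\ p \in P E, cellof t0 p = cv v & p.2 = 0 :> nat] &
      adjS (@gadj _) (thick t0 (Y (inr E))) (P E)].
  case vh: (v \in hi); last by exists (fun=> set0).
  have [c0Y c00] := cvP v vh.
  have cP (j : J v) : exists c, c \in Y (inr (val j)) /\ adjS (@gadj N) [set c] (Y (inl v)).
    have /andP[jE vj] := valP j; have [c [d [cY dY cd]]] := h3 v (val j) jE vj.
    by exists d; split => //; exists d, c; rewrite inE eqxx gadj_sym.
  have [c {}cP] := choose_fun cP.
  have [|||P [P1 P2 P3 P4 P5]] := @fan N t t0 (J v) (Y (inl v)) c (cv v) _ _ c0Y c00.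
  - by have [] := h1 (inl v).
  - by rewrite card_sig ltnW // ltnS subset_leq_card //; apply/subsetP => x /andP[].
  - by move=> j; have [] := cP j.
  exists (fun E => if insub E is Some j then P j else set0) => _ E EE vE.
  have jP E' : E' \in Es -> v \in E' -> exists j : J v, val j = E' /\ insub E' = Some j.
    by move=> e1 e2; case: insubP => [j _ <-|]; [exists j|rewrite e1 e2].
  have [j [jE ->]] := jP E EE vE; split => //.
  + move=> E' p EE' vE'; have [j' [jE' ->]] := jP E' EE' vE' => pj pj'.
    by rewrite -jE -jE' (P3 _ _ _ pj pj').
  + apply: adjS_mono (P5 j) => //; apply/subsetP => p; rewrite !inE => /eqP->.
    by rewrite -jE; have [] := cP j.
have [P {}fanP] := choose_fun fanP.
pose Y' a : {set cell (N * t) + 'I_(#|hi|.+1)} := match a with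
  | inl v => if v \in hi then [set inr (rank v)] else inl @: thick t0 (Y (inl v))
  | inr E => inl @: (thick t0 (Y (inr E)) :|: \bigcup_(v in E :&: hi) P v E) end.
have inlE (X : {set cell (N * t)}) p : ((inl p : cell (N * t) + 'I_(#|hi|.+1)) \in inl @: X) = (p \in X).
  by rewrite mem_imset // => ? ? [].
have connl (X : {set cell (N * t)}) : conn (@gadj _) X -> conn (@hadj _ _ tau) (inl @: X).
  move=> cX _ _ /imsetP[p pX ->] /imsetP[q qX ->].
  apply: (@connect_ind _ _ (fun q => connect _ (inl p) (inl q)) _ _ (cX p q pX qX)); first exact: connect0.
  by move=> u v /and3P[uv uX vX] c; apply: connect_trans c (connect_restr1 _ _ _); rewrite ?inlE //.
have kind a z : valid Es a -> z \in Y' a ->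
  (exists v, [/\ v \in hi, a = inl v & z = inr (rank v)]) \/
  exists p b, [/\ z = inl p, valid Es b, cellof t0 p \in Y b &
    a = b /\ (forall v, v \in hi -> a <> inl v) \/
    exists v E, [/\ a = inr E, v \in hi, v \in E, b = inl v & p \in P v E]].
  case: a => [v _|E va] /=.
    case: ifP => vh; first by rewrite inE => /eqP->; left; exists v.
    move=> /imsetP[p + ->]; rewrite inE => pY; right; exists p, (inl v); split => //; left; split => //.
    by move=> u uh [vu]; rewrite vu uh in vh.
  move=> /imsetP[p + ->]; rewrite in_setU inE => /orP[pY|/bigcupP[v /setIP[vE vh] pP]]; right.
    by exists p, (inr E); split => //; left.
  exists p, (inl v); split => //; last by right; exists v, E.
  by have [_ /subsetP/(_ _ pP) + _ _ _] := fanP v vh E va vE; rewrite inE.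
exists (N * t), tau, Y'; split.
- by rewrite muln_gt0 N0.
- move=> x x' xx; apply: subset_leq_card; apply/subsetP => u; rewrite !inE => /andP[-> /= h].
  by apply: leq_trans h _; exact: leq_div2r.
- split.
  + case=> [v _|E va] /=.
      have [k1 k2] := h1 (inl v) isT.
      case: ifP => vh; first by split; [exact: conn1|apply/set0Pn; exists (inr (rank v)); rewrite inE].
      split; first by apply: connl; exact: thick_conn.
      by have /set0Pn[p pY] := thick_neq0 t0 k2; apply/set0Pn; exists (inl p); rewrite inlE.
    have [k1 k2] := h1 (inr E) va; split.
      apply: connl; apply: conn_star => //; [exact: gadj_sym|exact: thick_conn|exact: thick_neq0|].
      move=> v /setIP[vE vh]; have [p1 p2 p3 p4 p5] := fanP v vh E va vE; split => //.
      exact: adjS_touch.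
    have /set0Pn[p pY] := thick_neq0 t0 k2; apply/set0Pn; exists (inl p).
    by rewrite inlE in_setU pY.
  + move=> a a' z va va' za za'.
    case: (kind a z va za) => [[v [vh av zv]]|[p [b [zp vb pb hb]]]];
      case: (kind a' z va' za') => [[v' [vh' av' zv']]|[p' [b' [zp' vb' pb' hb']]]].
    * by rewrite av av'; move: zv'; rewrite zv => -[] E; congr inl; apply: rank_inj => //; apply: val_inj.
    * by rewrite zv in zp'.
    * by rewrite zv' in zp.
    * move: zp'; rewrite zp => -[pp]; subst p'.
      have E := h2 _ _ _ vb vb' pb pb'; subst b'.
      case: hb => [[ab hv]|[v [F [aF vh vF bv pP]]]]; case: hb' => [[ab' hv']|[v' [F' [aF' vh' vF' bv' pP']]]].
      - by rewrite ab ab'.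
      - by case: (hv v' vh'); rewrite ab.
      - by case: (hv' v vh); rewrite ab'.
      - move: bv'; rewrite bv => -[vv]; subst v'; subst a a'.
        have [_ _ p3 _ _] := fanP v vh F va vF.
        by rewrite (p3 F' p va' vF' pP pP').
  + move=> x E EE xE /=; case: ifP => xh.
      have [_ _ _ [p [pP pc p0]] _] := fanP x xh E EE xE.
      exists (inr (rank x)), (inl p); split; rewrite ?inE ?eqxx //.
        by rewrite inlE in_setU; apply/orP; right; apply/bigcupP; exists x => //; rewrite inE xE.
      rewrite /= p0 eqxx /=; apply/eqP; apply: val_inj => /=.
      by rewrite -[in RHS]pc.
    have [p [q [pY qY pq]]] := thick_adj t0 (h3 x E EE xE).
    by exists (inl p), (inl q); split; rewrite ?inlE ?in_setU ?pY ?qY.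
- by move=> v vh; exists (rank v); rewrite /= vh.
Qed.

Lemma apex_host N (Y : option Q + {set option Q} -> {set cell N}) :
  smodel apex_edges (@gadj N) Y -> touches_top (Y (inl None)) ->
  exists N' (tau : nat -> 'I_(#|hi|.+1)) Y',
  [/\ 0 < N', forall x x', x <= x' -> tau x <= tau x', smodel Es (@hadj N' _ tau) Y' &
    forall v, v \in hi -> exists i, Y' (inl v) = [set inr i]].
Proof.
move=> sY tY.
by have [N1 [Y1 [N0 sY1 t1]]] := remove_apex sY tY; exact: spread sY1 t1.
Qed.

Lemma host_smodel N (tau : nat -> 'I_(#|hi|.+1)) Y (V : finType) (e : rel V) B v :
  symmetric e -> smodel Es (@hadj N _ tau) Y ->
  (forall v, v \in hi -> exists i, Y (inl v) = [set inr i]) ->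
  injective v -> gridm e N N B -> (forall i x r, x < N -> r < N -> v i \notin B x r) ->
  (forall x, x < N -> adjS e [set v (tau x)] (B x 0)) ->
  exists Y', smodel Es e Y' /\ forall u, u \in hi -> exists x, Y' (inl u) = [set x].
Proof.
move=> es sY Y1 vi [g1 g2 g3 g4] vB va.
pose b n : {set V} := match n with inl (x, r) => B (x : 'I_N) (r : 'I_N) | inr i => [set v i] end.
have nb (x y : 'I_N) r : r < N -> nextto x y -> adjS e (B x r) (B y r).
  move=> rN /orP[/eqP E|/eqP E]; rewrite -E.
    by apply: g3 => //; rewrite E.
  by apply: adjS_sym => //; apply: g3 => //; rewrite E.
have nb' (x y : 'I_N) r : r < N -> nextto x y -> adjS e (B r x) (B r y).
  move=> rN /orP[/eqP E|/eqP E]; rewrite -E.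
    by apply: g4 => //; rewrite E.
  by apply: adjS_sym => //; apply: g4 => //; rewrite E.
exists (fun a => \bigcup_(n in Y a) b n); split; last first.
  by move=> u uh; have [i ->] := Y1 u uh; exists (v i); rewrite big_set1.
apply: (smodel_lift es sY) => [[[x r]|i]|[[x r]|i] [[x' r']|i'] z|[[x r]|i] [[x' r']|i']] /=.
- exact: g1.
- by split; [exact: conn1|apply/set0Pn; exists (v i); rewrite inE].
- move=> zb zb'; have [E1 E2] := g2 _ _ _ _ _ (ltn_ord x) (ltn_ord r) (ltn_ord x') (ltn_ord r') zb zb'.
  by rewrite (val_inj E1) (val_inj E2).
- by rewrite inE => zb /eqP E; move: (vB i' x r (ltn_ord x) (ltn_ord r)); rewrite -E zb.
- by rewrite inE => /eqP E zb; move: (vB i x' r' (ltn_ord x') (ltn_ord r')); rewrite -E zb.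
- by rewrite !inE => /eqP-> /eqP/vi->.
- by rewrite /gadj /= => /orP[/andP[/eqP-> h]|/andP[/eqP-> h]]; [exact: nb'|exact: nb].
- by move=> /andP[/eqP -> /eqP<-]; apply: adjS_sym => //; exact: va.
- by move=> /andP[/eqP -> /eqP<-]; exact: va.
- by [].
Qed.

End Apex.

(** * Decomposition into bags with few vertices of large degree *)

Section Decomposition.
Variable V : finType.
Implicit Types (e : rel V) (X Z K U W C S I B : {set V}).

Lemma cardsU_le (A B : {set V}) : #|A :|: B| <= #|A| + #|B|.
Proof. by rewrite leq_card_setU. Qed.

Definition nbh e K := [set y | (y \notin K) && [exists x in K, e x y]].

Lemma nbhP e K y : reflect (y \notin K /\ exists2 x, x \in K & e x y) (y \in nbh e K).
Proof.
rewrite inE; apply: (iffP andP) => -[yK h]; split=> //; first by move/exists_inP: h => [x xK xy]; exists x.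
by case: h => x xK xy; apply/exists_inP; exists x.
Qed.

Lemma comp_eq e X x y : symmetric e -> y \in comp e X x -> comp e X y = comp e X x.
Proof.
rewrite inE => es c; apply/setP => z; rewrite !inE; apply/idP/idP; first exact: connect_trans.
by apply: connect_trans; rewrite connect_restr_sym.
Qed.

Lemma nbh_comp e X x y : x \in X -> y \in nbh e (comp e X x) -> y \notin X.
Proof.
move=> xX /nbhP[yK [z zK zy]]; apply: contra yK => yX.
have zX := subsetP (comp_sub e xX) z zK; exact: comp_closed zK zX yX zy.
Qed.

Definition scattered e W d C := forall x, x \notin C ->
  #|nbh e (comp e (~: C) x)| < d /\ #|W :&: comp e (~: C) x| < d.

(** Take [C] of minimum size. If a part [I] behind a small [S] met [C] too often, replacing
    [C :&: I] by [S] would give a smaller scattered set. This can only fail at the rest of a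
    component [K0] of the complement of [C] that gets too many neighbours; uncrossing with [K0] then
    yields a smaller separator, so the induction runs on [#|S|]. *)
Lemma scattered_core e W d : symmetric e -> exists C, scattered e W d C /\
  forall I S, (forall x, x \in I -> x \notin S) -> (forall x y, x \in I -> e x y -> y \in I :|: S) ->
    #|S| < d -> #|W :&: I| < d -> #|(I :|: S) :&: C| < 2 * d.
Proof.
move=> es; pose P C := `[< scattered e W d C >].
have PT : P setT by apply/asboolP => x; rewrite inE.
case: (arg_minnP (fun C : {set V} => #|C|) PT) => C /asboolP hC minC.
exists C; split => // I S; have [n] := ubnP #|S|; elim: n I S => // n IH I S; rewrite ltnS => Sn.
move=> dIS cl Sd WI; rewrite ltnNge; apply/negP => big.
pose C' := S :|: (C :\: I).
have cC' : #|C'| < #|C|.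
  have -> : C' = S :|: (C :\: (I :|: S)) by apply/setP => x; rewrite !inE; case: (x \in S); case: (x \in I).
  apply: leq_ltn_trans (cardsU_le _ _) _.
  by have := cardsID (I :|: S) C; rewrite setIC; move: big Sd; lia.
have : ~ scattered e W d C' by move=> /asboolP/minC; rewrite leqNgt cC'.
apply=> x xC'; set K := comp e (~: C') x.
have xC'' : x \in ~: C' by rewrite inE.
have [xS xCI] : x \notin S /\ (x \in C -> x \in I).
  move: xC'; rewrite !inE negb_or negb_and negbK => /andP[-> h]; split => // xC; move: h.
  by rewrite xC orbF.
have Kclosed z y : z \in K -> e z y -> y \notin C' -> y \in K.
  move=> zK zy yC'; have zC' := subsetP (comp_sub e xC'') z zK.
  by apply: comp_closed zK zC' _ zy; rewrite inE.
have nK y : y \in nbh e K -> exists2 z, z \in K & e z y /\ y \in C'.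
  move=> /nbhP[yK [z zK zy]]; exists z => //; split => //; apply/negPn/negP => yC'.
  by rewrite (Kclosed _ _ zK zy yC') in yK.
case xI : (x \in I).
  have KI y : y \in K -> y \in I.
    rewrite inE => c; apply: (@connect_ind _ _ (fun y => y \in I) _ _ c) => // u v /and3P[uv uC vC] uI.
    by have := cl u v uI uv; move: vC; rewrite !inE negb_or => /andP[/negPf-> _]; rewrite orbF.
  split; last by apply: leq_ltn_trans WI; apply: subset_leq_card; apply: setIS; apply/subsetP => y; exact: KI.
  apply: leq_ltn_trans Sd; apply: subset_leq_card; apply/subsetP => y /nK[z zK [zy]].
  rewrite !inE => /orP[//|/andP[yI _]].
  by have := cl z y (KI z zK) zy; rewrite inE (negPf yI).
have xC : x \notin C by apply/negP => /xCI; rewrite xI.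
set K0 := comp e (~: C) x; have [N0d WK0] := hC x xC; rewrite -/K0 in N0d WK0.
have xC0 : x \in ~: C by rewrite inE.
have KK0 y : y \in K -> y \in K0 /\ y \notin I.
  rewrite inE => c; apply: (@connect_ind _ _ (fun y => y \in K0 /\ y \notin I) _ _ c).
    by split; [rewrite inE connect0|rewrite xI].
  move=> u v /and3P[uv uC' vC'] [uK0 uI].
  have vI : v \notin I.
    apply/negP => vI; have := cl v u vI; rewrite es => /(_ uv); rewrite inE (negPf uI) /= => uS.
    by move: uC'; rewrite !inE uS.
  split => //; apply: comp_closed uK0 _ _ uv; last by move: vC'; rewrite !inE negb_or vI /= => /andP[].
  by move: uC'; rewrite !inE negb_or uI /= => /andP[].
split; last first.
  by apply: leq_ltn_trans WK0; apply: subset_leq_card; apply: setIS; apply/subsetP => y /KK0[].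
rewrite ltnNge; apply/negP => dN.
have K0C y : y \in K0 -> y \notin C.
  by move=> yK; have := subsetP (comp_sub e xC0) y yK; rewrite inE.
set N0 := nbh e K0 in N0d.
have N0K y : y \in N0 -> y \notin K0 by move=> /nbhP[].
have N0C y : y \in N0 -> y \in C by move=> /(nbh_comp xC0); rewrite inE negbK.
have subN : nbh e K \subset (N0 :\: (I :|: S)) :|: (S :&: K0) :|: (S :&: N0).
  apply/subsetP => y /nK[z /KK0[zK0 zI] [zy]].
  have yK0N : (y \in K0) || (y \in N0).
    by case yK : (y \in K0) => //=; apply/nbhP; rewrite yK; split => //; exists z.
  rewrite !in_setU !in_setD !in_setI in_setU; case yS : (y \in S) => /=.
    by move=> _; move: yK0N => /orP[]->; rewrite ?orbT.
  rewrite !orbF => /andP[yI yC]; rewrite yI /=.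
  by move: yK0N; case yK0 : (y \in K0) => //; have := K0C y yK0; rewrite yC.
have lt : #|N0 :&: I| < #|S :&: K0|.
  have le1 := leq_trans dN (subset_leq_card subN).
  have le2 := leq_trans le1 (cardsU_le _ _); have le3 : d <= #|N0 :\: (I :|: S)| + #|S :&: K0| + #|S :&: N0|.
    by apply: leq_trans le2 _; rewrite leq_add2r cardsU_le.
  have eq1 := cardsID (I :|: S) N0.
  have eq2 : #|N0 :&: (I :|: S)| = #|N0 :&: I| + #|S :&: N0|.
    rewrite setIUr cardsU (setIC S); have -> : N0 :&: I :&: (N0 :&: S) = set0.
      by apply/setP => y; rewrite !inE; case yI : (y \in I); rewrite ?andbF //= (negPf (dIS y yI)) !andbF.
    by rewrite cards0 subn0.
  by move: N0d le3; rewrite -eq1 eq2; lia.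
(* The uncrossed pair still covers [(I :|: S) :&: C], and its separator lost more in [K0] than it
   gained in [N0 :&: I]. *)
pose S1 := (S :\: K0) :|: (N0 :&: I); pose I1 := (I :\: K0) :\: N0.
have S1S : #|S1| < #|S|.
  apply: leq_ltn_trans (cardsU_le _ _) _.
  by rewrite -(cardsID K0 S) addnC ltn_add2r.
have d1 y : y \in I1 -> y \notin S1.
  rewrite !in_setD => /andP[yN /andP[yK yI]].
  by rewrite in_setU in_setD in_setI (negPf (dIS y yI)) (negPf yN) andbF.
have cl1 y w : y \in I1 -> e y w -> w \in I1 :|: S1.
  rewrite !in_setD => /andP[yN /andP[yK yI]] yw.
  have wK : w \notin K0.
    apply/negP => wK; move/negP: yN; apply; apply/nbhP; split => //.
    by exists w => //; rewrite es.
  have := cl y w yI yw; rewrite !in_setU !in_setD !in_setI wK /=.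
  by case/orP => ->; [case: (w \in N0); rewrite ?orbT|rewrite orbT].
have W1 : #|W :&: I1| < d.
  apply: leq_ltn_trans WI; apply: subset_leq_card; apply: setIS.
  by apply/subsetP => y; rewrite !in_setD => /and3P[].
have := IH I1 S1 (leq_trans S1S Sn) d1 cl1 (ltn_trans S1S Sd) W1.
apply/negP; rewrite -leqNgt; apply: leq_trans big _; apply: subset_leq_card; apply/subsetP => y.
rewrite !in_setI !in_setU !in_setD !in_setI => /andP[yIS yC]; rewrite yC andbT.
have -> : y \notin K0 by apply/negP => /K0C; rewrite yC.
by case/orP: yIS => ->; rewrite ?orbT //=; case: (y \in N0); rewrite ?orbT.
Qed.

Definition bagok r (E : rel V) B := #|[set v in B | r < #|[set u in B | E v u]|]| <= r.

(* The torso of the bag [W :|: C]: cliques are added on [W] and on the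
   neighbourhoods of the components of [Z :\: C]. *)
Definition torso e W Z C : rel V := fun u v => [&& u != v, u \in W :|: C, v \in W :|: C &
  [|| e u v, (u \in W) && (v \in W) | [exists x in Z :\: C,
    (u \in nbh e (comp e (Z :\: C) x)) && (v \in nbh e (comp e (Z :\: C) x))]]].

Lemma torso_sym e W Z C : symmetric e -> symmetric (torso e W Z C).
Proof.
move=> es u v; rewrite /torso eq_sym es [(u \in W) && _]andbC.
rewrite (_ : [exists x in _, _ && _] = [exists x in Z :\: C,
  (v \in nbh e (comp e (Z :\: C) x)) && (u \in nbh e (comp e (Z :\: C) x))]); last first.
  by apply: eq_existsb => x; rewrite [(u \in _) && (v \in _)]andbC.
by case: (_ != _) => //=; rewrite andbCA.
Qed.

Lemma small_bag r E B : #|B| <= r -> bagok r E B.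
Proof.
move=> Br; rewrite /bagok (_ : [set v in B | _] = set0) ?cards0 //.
apply/setP => v; rewrite !inE; apply/negP => /andP[_]; rewrite ltnNge => /negP; apply.
by apply: leq_trans Br; apply: subset_leq_card; apply/subsetP => u; rewrite inE => /andP[].
Qed.

(** If [W] has fewer than [N] vertices, one vertex is added. If [W] is not well linked, the
    violating separator is added; every component then misses [W1] or [W2], each larger than [S]. If
    [W] is well linked, a scattered core [C0] is added. Torso neighbours of a small vertex then lie
    in [W], in [(I :|: S) :&: C0], at [x0], or around components that meet [S]; there are at most
    [d] of these, with [N] neighbours each. *)
Lemma choose_bag e N d h W Z x0 r : symmetric e -> x0 \in Z ->
  (forall x y, x \in Z -> e x y -> y \in W :|: Z) -> #|W| <= N -> 0 < d -> 2 * d <= N ->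
  (wl (restr e (Z :|: W)) W 0 -> #|W| = N ->
    #|[set v | `[< ~ small_vertex (restr e (Z :|: W)) W d v >]]| < h) ->
  N + 1 + 2 * d + d * N + (2 * N + 1) + h <= r ->
  exists C, [/\ C \subset Z, x0 \in C,
    forall x, x \in Z :\: C -> #|nbh e (comp e (Z :\: C) x)| <= N &
    bagok r (torso e W Z C) (W :|: C)].
Proof.
move=> es x0Z cl WN d0 dN few rh.
have nsub C x : x \in Z :\: C -> nbh e (comp e (Z :\: C) x) \subset W :|: C.
  move=> xZ; apply/subsetP => y yN; have := nbh_comp xZ yN.
  have /nbhP[_ [z zK zy]] := yN; have := subsetP (comp_sub e xZ) z zK.
  rewrite !inE => /andP[_ zZ]; have := cl z y zZ zy; rewrite !inE => /orP[->//|->].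
  by rewrite andbT negbK => ->; rewrite orbT.
have [ltW|geW] := ltnP #|W| N.
  exists [set x0]; split; rewrite ?sub1set ?inE //.
    move=> x /nsub/subset_leq_card le; apply: leq_trans le _; apply: leq_trans (cardsU_le _ _) _.
    by rewrite cards1 addn1.
  apply: small_bag; apply: leq_trans (cardsU_le _ _) _; rewrite cards1; lia.
have WNe : #|W| = N by apply/eqP; rewrite eqn_leq WN.
set e' := restr e (Z :|: W) in few.
have es' : symmetric e' by exact: restr_sym.
case: (pselect (wl e' W 0)) => [wW|].
  have [C0 [sC0 hC0]] := scattered_core W d es'.
  pose C := (C0 :&: Z) :|: [set x0].
  have CZ : C \subset Z by apply/subsetP => x; rewrite !inE => /orP[/andP[]//|/eqP->].
  have inX x y : x \in Z -> e x y -> e' x y.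
    by move=> xZ xy; apply/and3P; split; rewrite ?inE ?xZ //; have := cl x y xZ xy; rewrite !inE orbC.
  have bagN x : x \in Z :\: C -> #|nbh e (comp e (Z :\: C) x)| <= N.
    move=> xZC; set K := comp e (Z :\: C) x.
    have xZC' := xZC; move: xZC'; rewrite !inE negb_or negb_and => /andP[/andP[h1 h2] h3].
    have xC0 : x \notin C0 by move: h1; rewrite h3 orbF.
    have xC0' : x \in ~: C0 by rewrite inE.
    have [n1 n2] := sC0 x xC0; set K0 := comp e' (~: C0) x in n1 n2.
    have KK0 : K \subset K0.
      apply/subsetP => y; rewrite !inE => c.
      apply: (@connect_ind _ _ (fun y => connect (restr e' (~: C0)) x y) _ _ c); first exact: connect0.
      move=> u v /and3P[uv]; rewrite !inE => /andP[u1 u2] /andP[v1 v2] c'.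
      apply: connect_trans c' (connect_restr1 _ _ _); rewrite ?inE; first exact: inX.
        by move: u1; rewrite u2 negb_or andbT => /andP[].
      by move: v1; rewrite v2 negb_or andbT => /andP[].
    have sub : nbh e K \subset nbh e' K0 :|: (W :&: K0) :|: [set x0].
      apply/subsetP => y yN; have := subsetP (nsub C x xZC) y yN.
      have /nbhP[yK [z zK zy]] := yN; have zZC := subsetP (comp_sub e xZC) z zK.
      have zZ : z \in Z by move: zZC; rewrite inE => /andP[].
      have zy' := inX z y zZ zy; have zK0 := subsetP KK0 z zK.
      rewrite !in_setU !in_setI in_set1; case: eqP => [_|_]; rewrite ?orbT // !orbF.
      case yC0 : (y \in C0) => /= yWC.
        apply/orP; left; apply/nbhP; split; last by exists z.
        by apply/negP => /(subsetP (comp_sub e' xC0')); rewrite inE yC0.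
      rewrite orbF in yWC; rewrite yWC /=; apply/orP; right.
      have zC0 := subsetP (comp_sub e' xC0') z zK0.
      by apply: comp_closed zK0 zC0 _ zy'; rewrite inE yC0.
    apply: leq_trans (subset_leq_card sub) _; apply: leq_trans (cardsU_le _ _) _.
    rewrite cards1; have := cardsU_le (nbh e' K0) (W :&: K0).
    by move: n1 n2 dN; lia.
  exists C; split => //; first by rewrite !inE eqxx orbT.
  have small v : v \in W :|: C -> small_vertex e' W d v -> #|[set u in W :|: C | torso e W Z C v u]| <= r.
    move=> vB [I [S [vI dIS clI Sd WI]]].
    have dIS' y : y \in I -> y \notin S by move=> yI; rewrite (disjointFr dIS yI).
    have bd := hC0 I S dIS' clI Sd WI.
    pose T := \bigcup_(s | (s \in S) && (s \in Z :\: C)) nbh e (comp e (Z :\: C) s).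
    have cT : #|T| <= d * N.
      apply: leq_trans (card_bigcup_le (n := N) _) _.
        by move=> s /andP[_ /bagN].
      rewrite leq_mul2r; apply/orP; right; apply: leq_trans (ltnW Sd); apply: subset_leq_card.
      by apply/subsetP => s /andP[].
    have sub : [set u in W :|: C | torso e W Z C v u] \subset W :|: [set x0] :|: ((I :|: S) :&: C0) :|: T.
      apply/subsetP => u; rewrite inE => /andP[uB /and4P[_ _ _ uv]].
      rewrite 3!in_setU in_set1; case uW : (u \in W) => //=; case: (u =P x0) => //= ux0.
      have uC0 : u \in C0.
        by move: uB; rewrite !inE uW /= => /orP[/andP[]//|/eqP].
      have uZ : u \in Z by move: uB; rewrite in_setU uW => /(subsetP CZ).
      rewrite in_setI uC0 andbT; case uIS : (u \in I :|: S) => //=.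
      case/or3P: uv => [uv|/andP[_]|].
      - have e'uv : e' v u by rewrite es'; apply: inX => //; rewrite es.
        by rewrite (clI v u vI e'uv) in uIS.
      - by rewrite uW.
      case/exists_inP => x xZC /andP[vN uN]; set K := comp e (Z :\: C) x in vN uN.
      have cK : conn e K by exact: comp_conn.
      have KZ y : y \in K -> y \in Z.
        by move=> /(subsetP (comp_sub e xZC)); rewrite inE => /andP[].
      have /nbhP[_ [kv kvK kvv]] := vN; have /nbhP[_ [ku kuK kuu]] := uN.
      case: (set_0Vmem (K :&: S)) => [KS0|[s /setIP[sK sS]]].
        have nS y : y \in K -> y \notin S.
          by move=> yK; apply/negP => yS; have : y \in K :&: S; [by rewrite in_setI yK|by rewrite KS0 inE].
        have kvI : kv \in I.
          have := clI v kv vI; rewrite in_setU (negPf (nS kv kvK)) orbF; apply.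
          by rewrite es'; exact: inX (KZ _ kvK) kvv.
        have kuI : ku \in I.
          apply: (@connect_ind _ _ (fun y => y \in I) _ _ (cK kv ku kvK kuK)) => // a b /and3P[ab aK bK] aI.
          by have := clI a b aI (inX _ _ (KZ _ aK) ab); rewrite in_setU (negPf (nS b bK)) orbF.
        by have := clI ku u kuI (inX _ _ (KZ _ kuK) kuu); rewrite uIS.
      apply/bigcupP; exists s; last by rewrite (comp_eq es sK).
      by rewrite sS (subsetP (comp_sub e xZC)).
    apply: leq_trans (subset_leq_card sub) _; apply: leq_trans (cardsU_le _ _) _.
    have l1 := cardsU_le (W :|: [set x0]) ((I :|: S) :&: C0); have l2 := cardsU_le W [set x0].
    by move: l2; rewrite cards1 => l2; move: l1 l2 bd cT rh WN; lia.
  apply: leq_trans (_ : #|[set v | `[< ~ small_vertex e' W d v >]]| <= r); last first.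
    by apply: leq_trans (ltnW (few wW WNe)) _; move: rh; lia.
  apply: subset_leq_card; apply/subsetP => v; rewrite 2!in_set => /andP[vB].
  by rewrite ltnNge => h2; apply/asboolP => h3; move/negP: h2; apply; exact: small.
move=> /existsNP[S /existsNP[W1 /existsNP[W2 /not_implyP[sW1 /not_implyP[sW2 /not_implyP[sep /negP]]]]]].
rewrite addn0 -ltnNge leq_min => /andP[c1 c2].
have [W1W W2W] : W1 \subset W /\ W2 \subset W.
  by split; [apply: subset_trans sW1 _|apply: subset_trans sW2 _]; exact: subsetDl.
have SN : #|S| < N by apply: leq_trans c1 _; apply: leq_trans WN; exact: subset_leq_card.
pose C := (S :&: Z) :|: [set x0].
have CZ : C \subset Z by apply/subsetP => x; rewrite !inE => /orP[/andP[]//|/eqP->].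
have cC : #|C| <= #|S| + 1.
  by apply: leq_trans (cardsU_le _ _) _; rewrite cards1 leq_add2r subset_leq_card // subsetIl.
exists C; split => //; first by rewrite !inE eqxx orbT.
  move=> x xZC; set K := comp e (Z :\: C) x.
  have bound (Wi : {set V}) : Wi \subset W -> #|S| < #|Wi| -> nbh e K :&: Wi = set0 -> #|nbh e K| <= N.
    move=> WiW Wi0 no; have : nbh e K \subset (W :\: Wi) :|: C.
      apply/subsetP => y yN; have := subsetP (nsub C x xZC) y yN; rewrite !in_setU in_setD.
      case yW : (y \in Wi) => //; have : y \in nbh e K :&: Wi by rewrite in_setI yN yW.
      by rewrite no in_set0.
    move=> /subset_leq_card le; apply: leq_trans le _; apply: leq_trans (cardsU_le _ _) _.
    have := cardsID Wi W; rewrite (setIidPr WiW); move: cC Wi0 WNe; lia.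
  case: (set_0Vmem (nbh e K :&: W1)) => [no|[y1 /setIP[y1N y1W]]]; first exact: bound no.
  case: (set_0Vmem (nbh e K :&: W2)) => [no|[y2 /setIP[y2N y2W]]]; first exact: bound no.
  have /negP[] := sep y1 y2 y1W y2W.
  have /nbhP[_ [k1 k1K e1]] := y1N; have /nbhP[_ [k2 k2K e2]] := y2N.
  have KP y : y \in K -> (y \in Z :|: W) /\ y \in ~: S.
    move=> /(subsetP (comp_sub e xZC)); rewrite !inE negb_or negb_and => /andP[/andP[h1 _] h2].
    by rewrite h2 /=; split => //; move: h1; rewrite h2 orbF.
  have WP (Wi : {set V}) y : Wi \subset W :\: S -> y \in Wi -> (y \in Z :|: W) /\ y \in ~: S.
    by move=> s /(subsetP s); rewrite !inE => /andP[-> ->]; rewrite orbT.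
  have [a1 b1] := WP _ _ sW1 y1W; have [a2 b2] := WP _ _ sW2 y2W.
  have [a3 b3] := KP _ k1K; have [a4 b4] := KP _ k2K.
  apply: (@connect_trans _ _ k1).
    by apply: connect_restr1 => //; apply/and3P; split => //; rewrite es.
  apply: (@connect_trans _ _ k2); last by apply: connect_restr1 => //; apply/and3P.
  apply: (@connect_ind _ _ (fun y => connect (restr e' (~: S)) k1 y) _ _ (comp_conn es k1K k2K)).
    exact: connect0.
  move=> a b /and3P[ab /KP[p1 p2] /KP[q1 q2]] c; apply: connect_trans c (connect_restr1 _ _ _) => //.
  by apply/and3P.
apply: small_bag; apply: leq_trans (cardsU_le _ _) _.
by move: WN cC SN rh; lia.
Qed.

(* Tree decompositions in elimination order: each bag [B] is attached along a
   clique with at most [k] vertices of what was built before. *)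
Inductive glued (k r : nat) : {set V} -> rel V -> Prop :=
| glued0 (E : rel V) : (forall u v, E u v = false) -> glued k r set0 E
| glued_step U (E : rel V) B (EB E' : rel V) : glued k r U E -> symmetric EB ->
    (forall u v, EB u v -> u != v /\ u \in B /\ v \in B) -> bagok r EB B -> #|U :&: B| <= k ->
    (forall u v, u \in U :&: B -> v \in U :&: B -> u != v -> E u v) ->
    (forall u v, u \in U -> v \in U -> EB u v -> E u v) ->
    (forall u v, E' u v = E u v || EB u v) -> glued k r (U :|: B) E'.

Lemma glued_rel k r U E : glued k r U E -> symmetric E /\
  forall u v, E u v -> u != v /\ u \in U /\ v \in U.
Proof.
elim=> [E' E0|U' E' B EB E'' _ [s1 h1] s2 h2 _ _ _ _ EE].
  by split=> [u v|u v]; rewrite !E0.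
split=> [u v|u v]; rewrite !EE; first by rewrite s1 s2.
by case/orP => [/h1|/h2] [uv [uU vU]]; rewrite !in_setU uU vU ?orbT.
Qed.

Lemma glue_all e N d h r : symmetric e -> irreflexive e -> 0 < d -> 2 * d <= N ->
  (forall Z W, wl (restr e (Z :|: W)) W 0 -> #|W| = N ->
    #|[set v | `[< ~ small_vertex (restr e (Z :|: W)) W d v >]]| < h) ->
  N + 1 + 2 * d + d * N + (2 * N + 1) + h <= r ->
  exists E, glued N r setT E /\ subrel e E.
Proof.
move=> es ei d0 dN few rh.
(* Invariant: [U] is finished, [X] is still open, and the neighbours of each component of [X] form a
   clique on at most [N] vertices of the graph built so far. *)
suff rec n : forall X U E, #|X| < n -> glued N r U E -> (forall x, x \in X -> x \notin U) ->
    (forall x y, x \in X -> e x y -> y \in X :|: U) ->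
    (forall x, x \in X -> #|nbh e (comp e X x)| <= N /\
      forall u v, u \in nbh e (comp e X x) -> v \in nbh e (comp e X x) -> u != v -> E u v) ->
    exists E', [/\ glued N r (U :|: X) E', subrel E E' & forall x y, x \in X -> e x y -> E' x y].
  have [||x||x|E [gE _ hE]] := @rec #|V|.+1 setT set0 (fun _ _ => false).
  - by rewrite cardsT.
  - exact: glued0.
  - by rewrite in_set0.
  - by move=> *; rewrite setU0 in_setT.
  - move=> _; have -> : nbh e (comp e setT x) = set0.
      by apply/setP => y; rewrite in_set0; apply/negbTE/negP => /(nbh_comp (in_setT x)); rewrite in_setT.
    by rewrite cards0; split => // u v; rewrite inE.
  by rewrite set0U in gE; exists E; split => // u v uv; apply: hE; rewrite ?inE.
elim: n => // n IH X U E; rewrite ltnS => Xn gU dXU cl hX.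
case: (set_0Vmem X) => [X0|[x0 x0X]].
  by exists E; rewrite X0 setU0; split => // x y; rewrite inE.
have [Es Ein] := glued_rel gU.
pose Z := comp e X x0; pose W := nbh e Z.
have ZX : Z \subset X by exact: comp_sub.
have x0Z : x0 \in Z by rewrite inE connect0.
have [WN Wc] := hX x0 x0X; rewrite -/Z -/W in WN Wc.
have WX y : y \in W -> y \notin X by exact: nbh_comp.
have WU : W \subset U.
  apply/subsetP => y yW; have /nbhP[_ [z zZ zy]] := yW.
  by have := cl z y (subsetP ZX z zZ) zy; rewrite in_setU (negPf (WX y yW)).
have Zcl x y : x \in Z -> e x y -> y \in W :|: Z.
  move=> xZ xy; rewrite in_setU; case yZ : (y \in Z); rewrite ?orbT // orbF.
  by apply/nbhP; rewrite yZ; split => //; exists x.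
have [C [CZ x0C CN bC]] := choose_bag es x0Z Zcl WN d0 dN (few Z W) rh.
have CU x : x \in C -> x \notin U by move=> /(subsetP CZ)/(subsetP ZX)/dXU.
pose EB := torso e W Z C; pose E2 u v := E u v || EB u v.
have UB : U :&: (W :|: C) = W.
  apply/setP => x; rewrite in_setI in_setU; case xW : (x \in W) => /=; first by rewrite (subsetP WU x xW).
  by case xC : (x \in C); rewrite ?andbF // (negPf (CU x xC)).
have UC : U :|: (W :|: C) = U :|: C by rewrite setUA (setUidPl WU).
have g2 : glued N r (U :|: C) E2.
  rewrite -UC; apply: (glued_step gU (torso_sym W Z C es) _ bC) => //; rewrite ?UB //.
    by move=> u v /and4P[uv uB vB _].
  move=> u v uU vU /and4P[uv uB vB _].
  have inW y : y \in U -> y \in W :|: C -> y \in W.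
    by move=> yU yB; have : y \in U :&: (W :|: C); [rewrite in_setI yU|rewrite UB].
  by apply: Wc => //; exact: inW.
pose X2 := X :\: C.
have X2n : #|X2| < n.
  apply: leq_trans Xn; apply: proper_card; apply/properP; split; first exact: subsetDl.
  by exists x0 => //; rewrite in_setD x0C.
have [|x y|x|E' [g' s' h']] := IH X2 (U :|: C) E2 X2n g2.
- move=> x; rewrite in_setD in_setU negb_or => /andP[xC xX].
  by rewrite xC (dXU x xX).
- rewrite in_setD => /andP[xC xX] xy; have := cl x y xX xy; rewrite !in_setU in_setD.
  by case: (y \in C); rewrite ?orbT //= => /orP[]->; rewrite ?orbT.
- rewrite in_setD => /andP[xC xX]; case xZ : (x \in Z).
    have E3 : comp e X2 x = comp e (Z :\: C) x.
      apply/setP => y; rewrite !inE; apply/idP/idP => c.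
        suff [] : y \in Z /\ connect (restr e (Z :\: C)) x y by [].
        apply: (@connect_ind _ _ (fun y => y \in Z /\ connect (restr e (Z :\: C)) x y) _ _ c).
          by split => //; exact: connect0.
        move=> u v /and3P[uv]; rewrite !in_setD => /andP[uC uX] /andP[vC vX] [uZ c'].
        have vZ : v \in Z by exact: comp_closed uZ uX vX uv.
        by split => //; apply: connect_trans c' (connect_restr1 _ _ _); rewrite ?in_setD ?uC ?vC.
      by apply: connect_restr_mono c => //; exact: setSD.
    have xZC : x \in Z :\: C by rewrite in_setD xC.
    rewrite E3; split; first exact: CN.
    move=> u v uN vN uv; apply/orP; right; apply/and4P.
    have nB y : y \in nbh e (comp e (Z :\: C) x) -> y \in W :|: C.
      move=> yN; have := nbh_comp xZC yN; have /nbhP[_ [z zK zy]] := yN.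
      have := subsetP (comp_sub e xZC) z zK; rewrite !in_setD => /andP[_ zZ].
      by have := Zcl z y zZ zy; rewrite !in_setU negb_and negbK => /orP[->//|->]; rewrite orbF => ->; rewrite orbT.
    split => //; try exact: nB.
    by apply/orP; right; apply/orP; right; apply/exists_inP; exists x => //; rewrite uN vN.
  have E3 : comp e X2 x = comp e X x.
    apply/setP => y; rewrite !inE; apply/idP/idP => c.
      by apply: connect_restr_mono c => //; exact: subsetDl.
    suff [] : y \notin Z /\ connect (restr e X2) x y by [].
    apply: (@connect_ind _ _ (fun y => y \notin Z /\ connect (restr e X2) x y) _ _ c).
      by rewrite xZ; split => //; exact: connect0.
    move=> u v /and3P[uv uX vX] [uZ c'].
    have vZ : v \notin Z.
      by apply: contra uZ => vZ; apply: comp_closed vZ vX uX _; rewrite es.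
    split => //; apply: connect_trans c' (connect_restr1 _ _ _) => //; rewrite in_setD ?uX ?vX andbT.
      by apply: contra uZ; exact: (subsetP CZ).
    by apply: contra vZ; exact: (subsetP CZ).
  have [hn hc] := hX x xX; rewrite E3; split => // u v uN vN uv.
  by rewrite /E2 hc.
have [sE' _] := glued_rel g'.
exists E'; split.
- have -> : U :|: X = U :|: C :|: X2 => //.
  apply/setP => x; rewrite !in_setU in_setD; case xC : (x \in C); rewrite ?orbF //= orbT.
  by rewrite (subsetP ZX) ?orbT // (subsetP CZ).
- by move=> u v uv; apply: s'; rewrite /E2 uv.
- move=> x y xX xy; case xC : (x \in C); last by apply: h'; rewrite // in_setD xC.
  have xZ := subsetP CZ x xC; case yB : (y \in W :|: C).
    apply: s'; apply/orP; right; apply/and4P; split => //.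
    + by apply: contraTneq xy => ->; rewrite ei.
    + by rewrite in_setU xC orbT.
    + by rewrite xy.
  rewrite sE'; apply: h'; last by rewrite es.
  have := Zcl x y xZ xy; move: yB; rewrite !in_setU in_setD => /negbT; rewrite negb_or => /andP[/negPf-> /negPf->] /=.
  exact: (subsetP ZX).
Qed.

End Decomposition.

(** * Nonrepetitive colourings *)

Definition nonrep (V : finType) (E : rel V) (X : {set V}) (T : eqType) (psi : V -> T) :=
  forall p1 p2 : seq V, p1 <> [::] -> sorted E (p1 ++ p2) -> uniq (p1 ++ p2) ->
  {subset p1 ++ p2 <= X} -> map psi p1 <> map psi p2.

Lemma sum_halves a M : \sum_(0 <= n < M) a %/ 2 ^ n <= 2 * a.
Proof.
elim: M a => [|M IH] a; first by rewrite big_nil.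
rewrite big_nat_recl // expn0 divn1.
have -> : \sum_(0 <= i < M) a %/ 2 ^ i.+1 = \sum_(0 <= i < M) (a %/ 2) %/ 2 ^ i.
  by apply: eq_bigr => i _; rewrite expnS divnMA.
by have := IH (a %/ 2); have := leq_divM a 2; lia.
Qed.

Lemma card_has_le (T : finType) (I : Type) (L : seq I) (P : I -> pred T) b :
  (forall x, #|[set g | P x g]| <= b) -> #|[set g | has (P^~ g) L]| <= size L * b.
Proof.
move=> h; elim: L => [|x L IH] /=; first by rewrite eq_card0 // => g; rewrite inE.
rewrite mulSn; apply: leq_trans (leq_add (h x) IH); apply: leq_trans (subset_leq_card _) (cardsU_le _ _).
by apply/subsetP => g; rewrite !inE.
Qed.

(** * Bounded degree: counting nonrepetitive colourings *)

Section Rosenfeld.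
Variables (V : finType) (e : rel V) (D : nat).
Hypotheses (es : symmetric e) (D0 : 0 < D) (deg : forall v, #|[set u | e v u]| <= D).

(** The starting vertex is left out of the lists, so that two walks can be glued at it. *)
Fixpoint walks l x : seq (seq V) :=
  if l is l'.+1 then [seq y :: s | y <- enum [set u | e x u], s <- walks l' y] else [:: [::]].

Lemma walks_size l x : size (walks l x) <= D ^ l.
Proof.
elim: l x => //= l IH x; rewrite size_allpairs_dep expnS.
apply: leq_trans (_ : size (enum [set u | e x u]) * D ^ l <= _); last by rewrite leq_mul2r -cardE deg orbT.
elim: (enum _) => //= y s IHs; rewrite mulSn; exact: leq_add.
Qed.

Lemma walksP x s : path e x s -> s \in walks (size s) x.
Proof.
elim: s x => //= y s IH x /andP[xy ps]; apply/allpairsPdep; exists y, s.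
by rewrite mem_enum inE xy IH.
Qed.

(** On average repetitions spoil at most [4 * D] of the colours for a new vertex, so each vertex
    multiplies the number of colourings by at least [4 * D ^ 2]. *)
Let C := 4 * D ^ 2 + 4 * D.
Lemma C_gt0 : 0 < C. Proof. by rewrite /C addn_gt0 !muln_gt0 D0 orbT. Qed.
Let o : 'I_C := Ordinal C_gt0.
Implicit Types (f g : {ffun V -> 'I_C}) (X Y : {set V}).

(** Vertices outside [X] get the dummy colour [o], so that colourings of different sets are counted
    in one type. *)
Definition colourings X := [set f : {ffun V -> 'I_C} | [forall u, (u \notin X) ==> (f u == o)] && `[< nonrep e X f >]].

Lemma colouringsP X f : reflect ((forall u, u \notin X -> f u = o) /\ nonrep e X f) (f \in colourings X).
Proof.
rewrite inE; apply: (iffP andP) => -[h1 h2]; split.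
- by move=> u uX; apply/eqP; move/forallP: h1 => /(_ u); rewrite uX.
- exact/asboolP.
- by apply/forallP => u; apply/implyP => uX; rewrite h1.
- exact/asboolP.
Qed.

Section Extend.
Variables (v : V) (X : {set V}).
Hypothesis vX : v \notin X.
Hypothesis IHX : forall Y, Y \subset X -> (4 * D ^ 2) ^ #|X :\: Y| * #|colourings Y| <= #|colourings X|.

Definition update (p : {ffun V -> 'I_C} * 'I_C) : {ffun V -> 'I_C} :=
  [ffun u => if u == v then p.2 else p.1 u].
Definition updates := update @: setX (colourings X) [set: 'I_C].

Lemma card_updates : #|updates| = #|colourings X| * C.
Proof.
rewrite card_in_imset ?cardsX ?cardsT ?card_ord // => -[f c] [f' c'].
rewrite !in_setX /= => /andP[/colouringsP[f0 _] _] /andP[/colouringsP[f0' _] _] /ffunP E.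
congr pair; last by have := E v; rewrite !ffunE eqxx.
apply/ffunP => u; case: (eqVneq u v) => [->|uv]; first by rewrite f0 ?f0'.
by have := E u; rewrite !ffunE (negPf uv).
Qed.

Lemma updatesP g : g \in updates -> (forall u, u \notin v |: X -> g u = o) /\ nonrep e X g.
Proof.
move=> /imsetP[[f c]]; rewrite in_setX => /andP[/= /colouringsP[f0 fn] _] ->; split.
  by move=> u; rewrite !inE negb_or ffunE => /andP[/negPf-> /f0].
move=> p1 p2 p10 ps pu sub E; apply: (fn p1 p2 p10 ps pu sub); move: E.
have h p : {subset p <= X} -> map (update (f, c)) p = map f p.
  move=> sp; apply/eq_in_map => u /sp uX; rewrite ffunE.
  by case: (eqVneq u v) => // E; rewrite E (negPf vX) in uX.
by rewrite !h // => u uP; apply: sub; rewrite mem_cat uP ?orbT.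
Qed.

Definition bad n (s : seq V) (g : {ffun V -> 'I_C}) := [&& g \in updates, uniq s, all (mem (v |: X)) s,
  size s == 2 * n.+1, v \in s & map g (take n.+1 s) == map g (drop n.+1 s)].

(** The half of [s] without [v] fixes the colours of the half with [v], so a bad colouring is
    determined outside that half. This leaves a colouring of [X] without [n] vertices, and [IHX]
    bounds the number of those. *)
Lemma card_bad n s : #|[set g | bad n s g]| <= #|colourings X| %/ (4 * D ^ 2) ^ n.
Proof.
case cond: [&& uniq s, all (mem (v |: X)) s, size s == 2 * n.+1 & v \in s]; last first.
  rewrite eq_card0 // => g; rewrite inE; apply/negP => /and5P[_ h1 h2 h3 /andP[h4 _]].
  by rewrite h1 h2 h3 h4 in cond.
have /and4P[us sX /eqP ss vs] := cond.
have [H [O [vH perm sH sO hg]]] : exists H O : seq V, [/\ v \in H, perm_eq (H ++ O) s,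
    size H = n.+1, size O = n.+1 & forall g, bad n s g -> map g H = map g O].
  have st : size (take n.+1 s) = n.+1 by rewrite size_takel // ss; lia.
  have sd : size (drop n.+1 s) = n.+1 by rewrite size_drop ss; lia.
  move: (vs); rewrite -{1}(cat_take_drop n.+1 s) mem_cat => /orP[h|h].
    exists (take n.+1 s), (drop n.+1 s); rewrite cat_take_drop; split => // g.
    by case/and5P=> _ _ _ _ /andP[_ /eqP].
  exists (drop n.+1 s), (take n.+1 s); split => //; first by rewrite perm_catC cat_take_drop.
  by move=> g; case/and5P=> _ _ _ _ /andP[_ /eqP].
have uHO : uniq (H ++ O) by rewrite (perm_uniq perm).
have sHO u : u \in H ++ O -> u \in v |: X by rewrite (perm_mem perm) => /(allP sX).
pose Y := X :\: [set u in H].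
have YX : Y \subset X by exact: subsetDl.
have cY : #|X :\: Y| = n.
  have E : [set u in H] = v |: (X :\: Y).
    apply/setP => u; rewrite !inE negb_and negbK; case: (eqVneq u v) => [->|uv] /=; first by rewrite vH.
    case uH : (u \in H) => /=; last by rewrite andNb.
    by have := sHO u; rewrite mem_cat uH !inE (negPf uv) /= => ->.
  have : #|[set u in H]| = n.+1.
    by rewrite cardsE; have /card_uniqP-> : uniq H by move: uHO; rewrite cat_uniq => /and3P[].
  by rewrite E cardsU1 !inE vH (negPf vX) /= add1n => -[].
pose proj g := [ffun u => if u \in Y then g u else o] : {ffun V -> 'I_C}.
rewrite leq_divRL ?expn_gt0 ?muln_gt0 ?expn_gt0 ?D0 // mulnC.
have IH := IHX YX; rewrite cY in IH; apply: leq_trans IH; rewrite leq_mul2l; apply/orP; right.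
rewrite -(card_in_imset (f := proj)).
  apply: subset_leq_card; apply/subsetP => _ /imsetP[g + ->]; rewrite inE => bg.
  have /andP[/updatesP[g0 gn] _] := bg; apply/colouringsP; split.
    by move=> u uY; rewrite ffunE (negPf uY).
  move=> p1 p2 p10 ps pu sub E.
  apply: (gn p1 p2 p10 ps pu); first by move=> u /sub/(subsetP YX).
  have h p : {subset p <= Y} -> map (proj g) p = map g p.
    by move=> sp; apply/eq_in_map => u /sp uY; rewrite ffunE uY.
  by rewrite -!h // => u uP; apply: sub; rewrite mem_cat uP ?orbT.
move=> g g'; rewrite !inE => bg bg' /ffunP E; apply/ffunP => u.
have EY w : w \in Y -> g w = g' w by move=> wY; have := E w; rewrite !ffunE wY.
have /andP[/updatesP[g0 _] _] := bg; have /andP[/updatesP[g0' _] _] := bg'.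
case uX : (u \in v |: X); last by rewrite g0 ?g0' ?uX.
case uH : (u \in H); last first.
  apply: EY; rewrite !inE uH /=; move: uX; rewrite !inE; case: (eqVneq u v) => // E'.
  by rewrite E' vH in uH.
have uHn : index u H < size H by rewrite index_mem.
have key k : map k H = map k O -> k u = k (nth u O (index u H)) :> 'I_C.
  move=> /(congr1 (fun t => nth (k u) t (index u H))).
  by rewrite !(nth_map u) ?sO -?sH // nth_index.
rewrite (key g) ?hg // (key g') ?hg //; apply: EY.
have nO : nth u O (index u H) \in O by rewrite mem_nth // sO -sH.
have nH : nth u O (index u H) \notin H.
  by move: uHO; rewrite cat_uniq => /and3P[_ /hasPn/(_ _ nO)].
rewrite !inE nH /=; have := sHO (nth u O (index u H)); rewrite mem_cat nO orbT !inE => /(_ isT) /orP[/eqP E'|//].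
by rewrite E' vH in nH.
Qed.

Definition bad_paths n := flatten [seq [seq rev s1 ++ v :: s2 | s1 <- walks i v, s2 <- walks ((2 * n).+1 - i) v]
  | i <- iota 0 (2 * n.+1)].

Lemma bad_paths_size n : size (bad_paths n) <= 2 * n.+1 * (D * (D ^ 2) ^ n).
Proof.
rewrite size_flatten /shape -map_comp.
have -> : D * (D ^ 2) ^ n = D ^ (2 * n).+1 by rewrite -expnM expnS.
have h i : i < 2 * n.+1 -> size [seq rev s1 ++ v :: s2 | s1 <- walks i v, s2 <- walks ((2 * n).+1 - i) v] <= D ^ (2 * n).+1.
  move=> ilt; rewrite size_allpairs; apply: leq_trans (leq_mul (walks_size _ _) (walks_size _ _)) _.
  by rewrite -expnD subnKC //; lia.
have {h} : forall i, i \in iota 0 (2 * n.+1) -> size [seq rev s1 ++ v :: s2 | s1 <- walks i v, s2 <- walks ((2 * n).+1 - i) v] <= D ^ (2 * n).+1.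
  by move=> i; rewrite mem_iota add0n => /h.
rewrite -[X in _ -> _ <= X * _](size_iota 0); elim: (iota _ _) => //= i s IH h.
rewrite mulSn leq_add //; first by apply: h; rewrite mem_head.
by apply: IH => j js; apply: h; rewrite in_cons js orbT.
Qed.

(** There are at most [2 * n.+1 * D ^ (2 * n).+1] candidate paths with [2 * n.+1] vertices, each
    spoiling at most [a / (4 * D ^ 2) ^ n] colourings. The factor [n.+1 / 4 ^ n] is at most
    [1 / 2 ^ n], so the total loss is at most [4 * D * a], which the second term of [C] covers. *)
Lemma extend : 4 * D ^ 2 * #|colourings X| <= #|colourings (v |: X)|.
Proof.
set a := #|colourings X|.
have sub : updates \subset colourings (v |: X) :|:
    [set g | has (fun n => has (bad n ^~ g) (bad_paths n)) (iota 0 #|V|)].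
  apply/subsetP => g gU; rewrite in_setU; case gc : (g \in colourings _) => //=.
  have [g0 gn] := updatesP gU.
  have : ~ nonrep e (v |: X) g by move=> h; move/negP: gc; apply; apply/colouringsP.
  move=> /existsNP[p1 /existsNP[p2 /not_implyP[p10 /not_implyP[ps /not_implyP[pu /not_implyP[sp /contrapT E]]]]]].
  have vp : v \in p1 ++ p2.
    apply/negPn/negP => vp; apply: (gn p1 p2) => // u up; have := sp u up.
    by rewrite !inE; case: eqP => // uv; rewrite uv (negPf vp) in up.
  have ss : size p1 = size p2 by have := congr1 size E; rewrite !size_map.
  case: p1 p10 ps pu sp E vp ss => // x p1 _ ps pu sp E vp ss.
  have [s1 [s2 sE]] := mem_split vp.
  have size_eq : size s1 + size s2 = (2 * size p1).+1.
    by have := congr1 size sE; rewrite !size_cat -ss /=; lia.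
  have lt : size p1 < #|V|.
    have up1 : uniq (x :: p1) by move: pu; rewrite cat_uniq => /andP[].
    by apply: leq_trans (max_card (mem (x :: p1))); rewrite (card_uniqP up1).
  rewrite inE; apply/hasP; exists (size p1); first by rewrite mem_iota.
  apply/hasP; exists ((x :: p1) ++ p2).
    apply/flattenP; exists [seq rev t1 ++ v :: t2 | t1 <- walks (size s1) v, t2 <- walks ((2 * size p1).+1 - size s1) v].
      by apply/mapP; exists (size s1) => //; rewrite mem_iota; lia.
    apply/allpairsP; exists (rev s1, s2); split; rewrite /= ?revK // ?sE //.
      rewrite -{1}(size_rev s1); apply: walksP.
      have : sorted e (v :: rev s1).
        by have := ps; rewrite sE sorted_split => /andP[h _]; rewrite -sorted_rev_sym // rev_cons revK.
      by [].
    have -> : (2 * size p1).+1 - size s1 = size s2 by rewrite -size_eq addKn.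
    by apply: walksP; have := ps; rewrite sE sorted_split => /andP[].
  rewrite /bad gU pu vp; apply/and4P; split => //.
  - by apply/allP.
  apply/and3P; split => //; first by rewrite size_cat -ss /=; apply/eqP; lia.
  - rewrite -[(size p1).+1]/(size (x :: p1)) take_size_cat // drop_size_cat //.
    by apply/eqP.
have cb : #|[set g | has (fun n => has (bad n ^~ g) (bad_paths n)) (iota 0 #|V|)]| <= 4 * D * a.
  apply: (@leq_trans (\sum_(n <- iota 0 #|V|) 2 * D * (a %/ 2 ^ n))).
    elim: (iota _ _) => [|n l IH] /=; first by rewrite big_nil eq_card0 // => g; rewrite inE.
    rewrite big_cons; apply: (@leq_trans (#|[set g | has (bad n ^~ g) (bad_paths n)]| +
      #|[set g | has (fun n => has (bad n ^~ g) (bad_paths n)) l]|)).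
      by apply: leq_trans (subset_leq_card _) (cardsU_le _ _); apply/subsetP => g; rewrite !inE.
    apply: leq_add => //; apply: leq_trans (card_has_le _ (card_bad n)) _.
    apply: leq_trans (leq_mul (bad_paths_size n) (leqnn _)) _.
    have q4 : (D ^ 2) ^ n * (a %/ (4 * D ^ 2) ^ n) <= a %/ 4 ^ n.
      rewrite leq_divRL ?expn_gt0 // mulnAC -expnMn [D ^ 2 * 4]mulnC mulnC; exact: leq_divM.
    have q2 : n.+1 * (a %/ 4 ^ n) <= a %/ 2 ^ n.
      rewrite leq_divRL ?expn_gt0 // mulnAC; apply: leq_trans (leq_divM a (4 ^ n)).
      rewrite mulnC leq_mul2l (expnMn 2 2 n : 4 ^ n = _) leq_mul2r; apply/orP; right.
      by rewrite (ltn_expl n (isT : 1 < 2)) orbT.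
    have := leq_mul (leqnn (2 * D)) q2; have := leq_mul (leqnn (2 * D * n.+1)) q4.
    by move: (a %/ 4 ^ n) (a %/ 2 ^ n) (a %/ (4 * D ^ 2) ^ n) ((D ^ 2) ^ n) => x y z w; nia.
  rewrite -big_distrr /=; have := sum_halves a #|V|; rewrite /index_iota subn0.
  by move: (\sum_(_ <- _) _) => S; nia.
have := leq_trans (subset_leq_card sub) (cardsU_le _ _); rewrite card_updates -/a.
by move: cb; rewrite /C; nia.
Qed.
End Extend.

Lemma colourings_grow n X : #|X| <= n -> forall Y, Y \subset X ->
  (4 * D ^ 2) ^ #|X :\: Y| * #|colourings Y| <= #|colourings X|.
Proof.
elim: n X => [|n IH] X Xn Y YX.
  have -> : X = Y by apply/eqP; rewrite eqEsubset YX andbT; move: Xn; rewrite leqn0 cards_eq0 => /eqP->; exact: sub0set.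
  by rewrite setDv cards0 mul1n.
case: (set_0Vmem (X :\: Y)) => [E|[v]].
  have -> : X = Y by apply/eqP; rewrite eqEsubset YX andbT -setD_eq0 E.
  by rewrite setDv cards0 mul1n.
rewrite in_setD => /andP[vY vX].
have X'n : #|X :\ v| <= n by have := cardsD1 v X; rewrite vX; lia.
have YX' : Y \subset X :\ v.
  by apply/subsetP => u uY; rewrite !inE (subsetP YX) // andbT; apply: contraNneq vY => <-.
have := @extend v (X :\ v) _ (IH _ X'n); rewrite setD11 setD1K // => /(_ isT).
apply: leq_trans; have := IH _ X'n Y YX'.
have -> : #|X :\: Y| = #|(X :\ v) :\: Y|.+1.
  rewrite (cardsD1 v) in_setD vX vY add1n; congr _.+1; apply: eq_card => u; rewrite !inE.
  by case: (u == v); case: (u \in Y).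
by move=> IH'; rewrite expnS -mulnA leq_mul2l IH' orbT.
Qed.

Lemma rosenfeld : exists psi : V -> 'I_C, nonrep e setT psi.
Proof.
have h := colourings_grow (leqnn #|[set: V]|) (sub0set _).
have : 0 < #|colourings setT|.
  apply: leq_trans h; rewrite muln_gt0 expn_gt0 muln_gt0 expn_gt0 D0 /=.
  apply/card_gt0P; exists [ffun=> o]; apply/colouringsP; split; first by move=> u; rewrite ffunE.
  by move=> [|x p1] p2 // _ _ _ /(_ x); rewrite /= mem_head in_set0 => /(_ isT).
by case/card_gt0P => f /colouringsP[_ fn]; exists f.
Qed.

End Rosenfeld.

Lemma bounded_degree D : exists T : finType, (exists t : T, True) /\
  forall (V : finType) (e : rel V), symmetric e ->
    (forall v, #|[set u | e v u]| <= D) -> exists psi : V -> T, nonrep e setT psi.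
Proof.
exists 'I_(4 * D.+1 ^ 2 + 4 * D.+1); split; first by exists (Ordinal (C_gt0 (ltn0Sn D))).
by move=> V e es deg; apply: rosenfeld => // v; apply: leqW.
Qed.

(** The word is read off a nonrepetitive colouring of a path, which has maximum degree 2; the
    alphabet does not depend on the length [M]. *)
Lemma squarefree : exists T : finType, (exists t : T, True) /\ forall M, exists u : nat -> T,
  forall a D, 0 < D -> a + 2 * D <= M -> ~ forall x, a <= x < a + D -> u x = u (x + D).
Proof.
have [T [[t0 _] hT]] := bounded_degree 2; exists T; split; first by exists t0.
case=> [|M]; first by exists (fun=> t0) => a D D0; lia.
pose e : rel 'I_M.+1 := fun i j => (i.+1 == j :> nat) || (j.+1 == i :> nat).
have [|i|psi hpsi] := hT _ e; first by move=> i j; rewrite /e orbC.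
  apply: (@leq_trans #|[set inord i.+1; inord i.-1] : {set 'I_M.+1}|); last by rewrite cards2; case: (_ != _).
  apply: subset_leq_card; apply/subsetP => j; rewrite in_set in_set2 /e => /orP[]/eqP E; apply/orP; [left|right];
    apply/eqP; apply: val_inj; rewrite /= inordK -?E //; have := ltn_ord j; have := ltn_ord i; lia.
exists (fun x => psi (inord x)) => a D D0 aD h.
pose p b := [seq (inord x : 'I_M.+1) | x <- iota b D].
have cat_p : p a ++ p (a + D) = [seq inord x | x <- iota a (2 * D)] by rewrite -map_cat -iotaD mul2n addnn.
apply: (hpsi (p a) (p (a + D))).
- by rewrite /p; case: (D) D0.
- rewrite cat_p sorted_map.
  have st : sorted (fun x y => x.+1 == y) (iota a (2 * D)).
    by elim: (2 * D) a {h aD p cat_p} => // n IH a /=; case: n IH => //= n IH; rewrite eqxx; apply: (IH a.+1).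
  apply: (sub_in_sorted (P := [in iota a (2 * D)])) st; last by apply/allP.
  move=> x y; rewrite ![_ \in [in _]]mem_iota => hx hy /eqP xy; rewrite /e /= !inordK; lia.
- rewrite cat_p map_inj_in_uniq ?iota_uniq // => x y; rewrite !mem_iota => hx hy /(congr1 val).
  by rewrite /= !inordK; lia.
- by move=> x; rewrite inE.
- rewrite /p addnC iotaDl -!map_comp; apply/eq_in_map => x; rewrite mem_iota => /h /=.
  by rewrite addnC.
Qed.

(** A private colour occurs only once, so a repetitively coloured path avoids the vertices of large
    degree. *)
Lemma bag_colouring r : exists T : finType, (exists t : T, True) /\
  forall (V : finType) (E : rel V) B, symmetric E -> bagok r E B -> exists psi : V -> T, nonrep E B psi.
Proof.
have [T [[t0 _] hT]] := bounded_degree r.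
exists ('I_r.+1 + T)%type; split; first by exists (inr t0).
move=> V E B Es bB; pose Hs := [set v in B | r < #|[set u in B | E v u]|].
have cH : #|Hs| <= r by [].
pose e : rel V := restr E (B :\: Hs).
have [|v|psi hpsi] := hT V e; first exact: restr_sym.
  case vH : (v \in B :\: Hs); last first.
    by rewrite eq_card0 // => u; rewrite inE /e /restr /= vH andbF.
  move: vH; rewrite !inE => /andP[+ vB]; rewrite vB /= -leqNgt; apply: leq_trans.
  apply: subset_leq_card; apply/subsetP => u; rewrite !inE => /and3P[-> _].
  by rewrite inE => /andP[_ ->].
pose c v : 'I_r.+1 + T := if v \in Hs then inl (inord (index v (enum Hs))) else inr (psi v).
exists c => p1 p2 p10 ps pu sB eqm.
have hi u v : u \in Hs -> c u = c v -> u = v.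
  move=> uH; rewrite /c uH; case: ifP => // vH [] /(congr1 val) /=.
  have lt w : w \in Hs -> index w (enum Hs) < r.+1.
    by move=> wH; apply: leq_trans (_ : #|Hs| <= _); [rewrite cardE index_mem mem_enum|apply: leqW].
  rewrite !inordK ?lt // => E'.
  by rewrite -[u](nth_index u (s := enum Hs)) ?mem_enum // E' nth_index ?mem_enum.
have pH x : x \in p1 ++ p2 -> x \notin Hs.
  move=> xp; apply/negP => xH; move: pu; rewrite cat_uniq => /and3P[u1 /hasPn dis u2].
  have key (q q' : seq V) : map c q = map c q' -> x \in q -> x \in q'.
    move=> E1 xq; have := map_f c xq; rewrite E1 => /mapP[y yq E'].
    by rewrite (hi x y xH E').
  move: xp; rewrite mem_cat => /orP[] h.
    by have := dis x (key _ _ eqm h); rewrite h.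
  by have := dis x h; rewrite /= (key _ _ (esym eqm) h).
apply: (hpsi p1 p2 p10 _ pu) => //.
  by apply: sorted_restr => // x xp; rewrite inE (pH x xp) sB.
  by move=> x; rewrite inE.
have h q : {subset q <= p1 ++ p2} -> map c q = map inr (map psi q).
  by move=> sq; rewrite -map_comp; apply/eq_in_map => x /sq/pH/negPf xH; rewrite /c xH.
move: eqm; rewrite !h; first by apply: inj_map => ? ? [].
  by move=> x xp; rewrite mem_cat xp orbT.
by move=> x xp; rewrite mem_cat xp.
Qed.

(* A lazy walk [l] on the integers all of whose labels repeat after [n] steps
   is constant on the two halves: modulo 3 the steps agree, so the halves
   differ by a constant [D], and [D > 0] would produce a square in [u]. *)
Section LazyWalk.
Variables (T : Type) (u : nat -> T) (M n : nat).
Hypothesis uM : forall a D, 0 < D -> a + 2 * D <= M -> ~ forall x, a <= x < a + D -> u x = u (x + D).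

Lemma walk_hits (l : nat -> nat) m x : (forall i, i < m -> l i.+1 <= l i + 1) ->
  l 0 <= x < l m -> exists2 i, i < m & l i = x.
Proof.
elim: m => [|m IH] hl; first by lia.
case: (ltnP x (l m)) => h /andP[h1 h2].
  have [|i im E] := IH (fun i im => hl i (ltnW im)); first by rewrite h1.
  by exists i => //; exact: ltnW.
by exists m => //; have := hl m (ltnSn _); lia.
Qed.

Definition lazy_repeat (l : nat -> nat) := [/\ 0 < n,
  forall i, i.+1 < 2 * n -> l i.+1 <= l i + 1 /\ l i <= l i.+1 + 1,
  forall i, i < n -> l i = l (i + n) %[mod 3], forall i, i < n -> u (l i) = u (l (i + n)) &
  forall i, i < 2 * n -> l i < M].

(** Both steps lie between -1 and 1 and agree modulo 3, so they are equal. *)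
Lemma lazy_step l i : lazy_repeat l -> i.+1 < n ->
  l i + l (i.+1 + n) = l i.+1 + l (i + n).
Proof.
move=> [n0 st m3 _ _] ilt.
have [] := st i; first by lia.
have [] := st (i + n); first by lia.
have := m3 i (ltnW ilt); have := m3 i.+1 ilt; rewrite !addSn.
move: (l i) (l i.+1) (l (i + n)) (l (i + n).+1) => a b c d; lia.
Qed.

Lemma lazy_diff l i : lazy_repeat l -> i < n -> l i + l n = l 0 + l (i + n).
Proof.
move=> hl; elim: i => [|i IH] ilt; first by rewrite add0n.
by have := lazy_step hl ilt; have := IH (ltnW ilt); lia.
Qed.

(** If [l] rose by [D > 0] from 0 to [n], it would visit every integer in between during the first
    half, and the labels would have period [D] there: a square. *)
Lemma lazy_up l : lazy_repeat l -> l n <= l 0.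
Proof.
move=> hl; have [n0 st m3 hu hM] := hl; rewrite leqNgt; apply/negP => lt.
have hit x : l 0 <= x < l n -> exists2 i, i < n & l i = x.
  by apply: walk_hits => i il; have [] := st i; [lia|].
pose D := l n - l 0.
apply: (@uM (l 0) D).
- by rewrite /D; lia.
- have [|i il E] := hit (l n).-1; first by lia.
  by have := lazy_diff hl il; have := hM (i + n); rewrite /D; lia.
- move=> x hx; have [|i il <-] := hit x; first by move: hx; rewrite /D; lia.
  by rewrite hu //; congr u; have := lazy_diff hl il; rewrite /D; lia.
Qed.

Lemma lazy_constant l i : lazy_repeat l -> i < n -> l i = l (i + n).
Proof.
move=> hl il; have [n0 st m3 hu hM] := hl.
(* Reading the walk backwards gives the opposite inequality. *)
pose l' i := l ((2 * n).-1 - i).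
have hl' : lazy_repeat l'.
  rewrite /l'; split=> // [j jn|j jn|j jn|j jn].
  - have [] := st ((2 * n).-1 - j.+1); first by lia.
    by have -> : ((2 * n).-1 - j.+1).+1 = (2 * n).-1 - j by lia.
  - have -> : (2 * n).-1 - j = (n.-1 - j) + n by lia.
    have -> : (2 * n).-1 - (j + n) = n.-1 - j by lia.
    by rewrite -m3 //; lia.
  - have -> : (2 * n).-1 - j = (n.-1 - j) + n by lia.
    have -> : (2 * n).-1 - (j + n) = n.-1 - j by lia.
    by rewrite -hu //; lia.
  - by apply: hM; lia.
have := lazy_up hl; have := lazy_up hl'; rewrite /l' subn0.
have -> : (2 * n).-1 - n = n.-1 by lia.
have -> : (2 * n).-1 = n.-1 + n by lia.
have n1 : n.-1 < n by lia.
by have := lazy_diff hl n1; have := lazy_diff hl il; lia.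
Qed.
End LazyWalk.

(** * Layers of a glued graph, and the induction on the size of the cliques *)

Section Layers.
Variable V : finType.
Implicit Types (E : rel V) (U B : {set V}) (lam : V -> nat).

Lemma glued_ext k r U E E' : glued k r U E -> (forall u v, E' u v = E u v) -> glued k r U E'.
Proof.
case=> [E0 h|U0 E0 B EB E1 g s1 h1 b1 c1 q1 w1 h] hE.
  by apply: glued0 => u v; rewrite hE.
by apply: glued_step g s1 h1 b1 c1 q1 w1 _ => u v; rewrite hE h.
Qed.

Definition layer U lam j := [set u in U | lam u == j].
Definition above U lam j := [set u in U | j < lam u].

(* A layer meets a bag in a clique with one vertex less, since the clique along
   which the bag was attached has a vertex in the previous layer. *)
Lemma layering k r U E : glued k.+1 r U E -> exists lam : V -> nat,
  [/\ forall u v, E u v -> lam u <= lam v + 1,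
      forall j, glued k r (layer U lam j) (restr E (layer U lam j)) &
      forall j u v, u \in layer U lam j -> v \in layer U lam j ->
        connect (restr E ([set u; v] :|: above U lam j)) u v -> u = v \/ E u v].
Proof.
elim=> [E0 h|{}U E0 B EB E1 g [lam [L1 L2 L3]] s1 h1 b1 c1 q1 w1 hE].
  exists (fun=> 0); split=> [u v|j|j u v]; rewrite ?h //.
    have -> : layer set0 (fun=> 0) j = set0 by apply/setP => u; rewrite !inE.
    by apply: glued0 => u v; rewrite /restr /= h.
  by rewrite inE in_set0.
have [Es EU] := glued_rel g.
have E1s : symmetric E1 by move=> u v; rewrite !hE Es s1.
pose K := U :&: B.
(* New vertices of the bag go one layer above the lowest vertex of the clique [K]. That vertex thus
   drops out of their layer, and [K] lies in two consecutive layers. *)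
have [j0 j0P] : exists j0, (K = set0 \/ exists2 w, w \in K & lam w < j0) /\
    forall u, u \in K -> lam u <= j0 /\ j0 <= lam u + 1.
  case: (set_0Vmem K) => [K0|[w0 w0K]]; first by exists 0; split; [left|move=> u; rewrite K0 inE].
  case: (arg_minnP lam w0K) => w wK wmin; exists (lam w).+1; split; first by right; exists w.
  move=> u uK; have := wmin u uK; split; last by lia.
  case: (eqVneq u w) => [->|uw]; first by lia.
  by have := L1 u w (q1 u w uK wK uw); lia.
have [hK jK] := j0P.
pose lam' v := if v \in U then lam v else j0.
have lamU v : v \in U -> lam' v = lam v by rewrite /lam' => ->.
have lamB v : v \notin U -> lam' v = j0 by rewrite /lam' => /negPf->.
have EBU u v : u \in U -> EB u v -> u \in K by move=> uU /h1[_ [uB _]]; rewrite inE uU uB.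
have E1U u v : u \in U -> v \in U -> E1 u v = E0 u v.
  move=> uU vU; rewrite hE; case Euv : (E0 u v) => //=; apply/negP => EBuv.
  by rewrite (w1 u v uU vU EBuv) in Euv.
have E1n u v : u \notin U -> E1 u v = EB u v.
  by move=> uU; rewrite hE; case Euv : (E0 u v) => //; have [_ [uU' _]] := EU u v Euv; rewrite uU' in uU.
exists lam'; split.
- move=> u v; case uU : (u \in U); case vU : (v \in U).
  + by rewrite E1U // !lamU //; exact: L1.
  + rewrite E1s E1n ?vU // s1 (lamU u) // (lamB v) ?vU // => EBuv.
    by have [] := jK u (EBU u v uU EBuv); lia.
  + rewrite E1n ?uU // s1 (lamU v) // (lamB u) ?uU // => EBvu.
    by have [] := jK v (EBU v u vU EBvu); lia.
  + by rewrite !lamB ?uU ?vU //; lia.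
- move=> j; case: (eqVneq j j0) => [->|jj]; last first.
    have -> : layer (U :|: B) lam' j = layer U lam j.
      apply/setP => u; rewrite !inE /lam'; case uU : (u \in U) => //=.
      by rewrite eq_sym (negPf jj) andbF.
    apply: glued_ext (L2 j) _ => u v; rewrite /restr /= !inE.
    by case uU : (u \in U); case vU : (v \in U); rewrite ?andbF // E1U.
  pose L := layer U lam j0; pose B' := (B :\: U) :|: (K :&: L).
  have BB : B' \subset B by apply/subsetP => u; rewrite !inE => /orP[/andP[]//|/andP[/andP[]]].
  have -> : layer (U :|: B) lam' j0 = L :|: B'.
    apply/setP => u; rewrite !inE /lam'; case uU : (u \in U) => /=.
      by case: (u \in B); case: (lam u == j0).
    by rewrite eqxx; case: (u \in B).
  have LB : L :&: B' = K :&: L.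
    by apply/setP => u; rewrite !inE; case: (u \in U); case: (u \in B); case: (lam u == j0).
  apply: (@glued_step _ k r L (restr E0 L) B' (restr EB B')) => //.
  + exact: L2.
  + exact: restr_sym.
  + by move=> u v /and3P[/h1[uv _] uB vB].
  + apply: leq_trans b1; rewrite /bagok; apply: subset_leq_card; apply/subsetP => u.
    move=> /setIdP[uB' lt]; apply/setIdP; split; first exact: (subsetP BB).
    apply: leq_trans lt _; apply: subset_leq_card; apply/subsetP => v.
    by move=> /setIdP[vB' /and3P[uv _ _]]; apply/setIdP; split; first exact: (subsetP BB).
  + rewrite LB; case: hK => [->|[w wK wj]]; first by rewrite set0I cards0.
    rewrite -ltnS; apply: leq_trans c1; apply: proper_card; apply/properP; split; first exact: subsetIl.
    by exists w => //; rewrite !inE negb_and; apply/orP; right; rewrite negb_and; apply/orP; right; lia.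
  + move=> u v; rewrite LB !in_setI => /andP[uK uL] /andP[vK vL] uv.
    by apply/and3P; split => //; apply: q1 => //; rewrite in_setI.
  + move=> u v uL vL /and3P[EBuv _ _]; apply/and3P; split => //; apply: w1 EBuv.
      by move: uL; rewrite inE => /andP[].
    by move: vL; rewrite inE => /andP[].
  + have B'U u : u \in U -> (u \in B') = (u \in K :&: L) by move=> uU; rewrite /B' in_setU in_setD uU.
    have LU u : u \in L -> u \in U by rewrite inE => /andP[].
    move=> u v; rewrite /restr /= !(in_setU _ L B') hE.
    case uL : (u \in L); case vL : (v \in L); rewrite /= ?andbT ?andbF ?orbF //.
    * have uU := LU _ uL; have vU := LU _ vL; case Euv : (E0 u v) => //=.
      case EBuv : (EB u v) => //=.
      by rewrite (w1 u v uU vU EBuv) in Euv.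
    * case vB : (v \in B'); rewrite ?andbF // !andbT.
      have vU : v \notin U by move: vB; rewrite in_setU in_setI vL andbF orbF in_setD => /andP[].
      have -> : E0 u v = false by apply/negP => /EU[_ [_ vU']]; rewrite vU' in vU.
      case EBuv : (EB u v) => //=; rewrite B'U ?LU // in_setI uL andbT.
      by apply/esym; apply: (EBU u v) => //; exact: LU.
    * case uB : (u \in B'); rewrite ?andbF //= !andbT.
      have uU : u \notin U by move: uB; rewrite in_setU in_setI uL andbF orbF in_setD => /andP[].
      have -> : E0 u v = false by apply/negP => /EU[_ [uU' _]]; rewrite uU' in uU.
      case EBuv : (EB u v) => //=; rewrite B'U ?LU // in_setI vL andbT.
      by apply/esym; apply: (EBU v u); rewrite ?LU // s1.
    * case uB : (u \in B'); case vB : (v \in B'); rewrite ?andbF ?andbT //=.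
      have uU : u \notin U by move: uB; rewrite in_setU in_setI uL andbF orbF in_setD => /andP[].
      by have -> : E0 u v = false by apply/negP => /EU[_ [uU' _]]; rewrite uU' in uU.
- have new j u v : u \notin U -> u \in layer (U :|: B) lam' j ->
      connect (restr E1 ([set u; v] :|: above (U :|: B) lam' j)) u v -> u = v \/ E1 u v.
    move=> uU; rewrite inE lamB // => /andP[uB /eqP jj] /connectP[[|x p] /=]; first by left.
    move=> /andP[/and3P[E1ux _ xX] pp] lv; right.
    move: E1ux; rewrite E1n // => EBux.
    have [ux [_ xB]] := h1 _ _ EBux.
    move: xX; rewrite !inE (eq_sym x u) (negPf ux) /= => /orP[/eqP<-|/andP[_]].
      by rewrite E1n.
    rewrite -jj; case xU : (x \in U); last by rewrite lamB ?xU // ltnn.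
    by rewrite lamU //; have [] := jK x _; [rewrite inE xU xB|lia].
  move=> j u v uL vL c; case uU : (u \in U); last by apply: (new j) => //; rewrite uU.
  case vU : (v \in U); last first.
    have [||->|E1vu] := new j v u _ vL; rewrite ?vU //; last 2 first.
    - by left.
    - by right; rewrite E1s.
    by rewrite connect_restr_sym // setUC [[set v; u]]setUC setUC.
  rewrite E1U //; apply: (L3 j).
  + by move: uL; rewrite !inE lamU // uU => /andP[].
  + by move: vL; rewrite !inE lamU // vU => /andP[].
  pose X := [set u; v] :|: above U lam j.
  have XU z : z \in [set u; v] :|: above (U :|: B) lam' j -> z \in U -> z \in X.
    by rewrite !in_setU !inE => /orP[->//|/andP[_ h]] zU; rewrite zU; rewrite lamU // in h; rewrite h orbT.
  (* Follow the path inside [U]: an excursion to new vertices leaves and returns through the clique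
     [K], so one edge can replace it. *)
  suff : (v \in U -> connect (restr E0 X) u v) /\ (v \notin U -> exists2 k0, k0 \in K & k0 \in X /\ connect (restr E0 X) u k0).
    by case=> h _; exact: h.
  apply: (@connect_ind _ _ (fun z => (z \in U -> connect (restr E0 X) u z) /\
    (z \notin U -> exists2 k0, k0 \in K & k0 \in X /\ connect (restr E0 X) u k0)) _ _ c).
    by split; [move=> _; exact: connect0|rewrite uU].
  move=> z z' /and3P[E1zz zX z'X] [hz hz']; case zU : (z \in U); case z'U : (z' \in U); split=> // _.
  + apply: connect_trans (hz zU) (connect_restr1 _ _ _); try exact: XU.
    by rewrite -E1U.
  + exists z; last by split; [exact: XU|exact: hz].
    by apply: (EBU z z') => //; move: E1zz; rewrite E1s E1n ?z'U // s1.
  + have [|k0 k0K [k0X ck]] := hz' _; first by rewrite zU.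
    have z'K : z' \in K by apply: (EBU z' z) => //; move: E1zz; rewrite E1n ?zU // s1.
    case: (eqVneq k0 z') => [<-//|kz].
    by apply: connect_trans ck (connect_restr1 _ _ _) => //; [exact: q1|exact: XU].
  + by apply: hz'; rewrite zU.
Qed.

(** The vertices above layer [j] form detours between successive vertices of layer [j]; the
    hypothesis replaces every detour by an edge. *)
Lemma filter_layer (U : {set V}) E lam j : (forall u v, u \in layer U lam j -> v \in layer U lam j ->
    connect (restr E ([set u; v] :|: above U lam j)) u v -> u = v \/ E u v) ->
  forall s, sorted E s -> uniq s -> {subset s <= U} -> (forall v, v \in s -> j <= lam v) ->
  sorted E [seq v <- s | lam v == j].
Proof.
move=> L3.
have main : forall s x y, x \in layer U lam j -> y \in x |: above U lam j ->
    connect (restr E (x |: above U lam j)) x y -> path E y s -> x \notin s -> uniq s ->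
    {subset s <= U} -> (forall v, v \in s -> j <= lam v) -> path E x [seq v <- s | lam v == j].
  elim=> //= z s IH x y xL yX c /andP[yz ps]; rewrite in_cons negb_or => /andP[xz xs] /andP[zs us] sU hl.
  have zU : z \in U by apply: sU; rewrite mem_head.
  have sU' : {subset s <= U} by move=> w ws; apply: sU; rewrite in_cons ws orbT.
  have hl' v : v \in s -> j <= lam v by move=> vs; apply: hl; rewrite in_cons vs orbT.
  have sub : x |: above U lam j \subset [set x; z] :|: above U lam j.
    by apply: setSU; rewrite sub1set !inE eqxx.
  case: eqP => [zj|zj] /=.
    have zL : z \in layer U lam j by rewrite inE zU zj eqxx.
    apply/andP; split; last by apply: (IH z z) => //; rewrite ?in_setU1 ?eqxx.
    have [|xz'|//] := L3 x z xL zL; last by rewrite xz' eqxx in xz.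
    apply: connect_trans (connect_restr_mono _ sub c) (connect_restr1 yz _ _) => //.
      exact: (subsetP sub).
    by rewrite !inE eqxx orbT.
  have zX : z \in x |: above U lam j.
    rewrite in_setU1 inE zU /= ltn_neqAle (hl z (mem_head _ _)) andbT.
    by apply/orP; right; apply/eqP => E'; exact: zj (esym E').
  by apply: (IH x z) => //; apply: connect_trans c (connect_restr1 yz _ _).
elim=> //= x s IH ps /andP[xs us] sU hl.
have xU : x \in U by apply: sU; rewrite mem_head.
have sU' : {subset s <= U} by move=> w ws; apply: sU; rewrite in_cons ws orbT.
have hl' v : v \in s -> j <= lam v by move=> vs; apply: hl; rewrite in_cons vs orbT.
case: eqP => [xj|xj] /=; last by apply: IH => //; exact: path_sorted ps.
by apply: (main s x x) => //; rewrite ?inE ?xU ?xj ?eqxx ?connect0.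
Qed.

End Layers.

Theorem glued_colouring k r : exists T : finType, (exists t : T, True) /\
  forall (V : finType) U (E : rel V), glued k r U E -> exists psi : V -> T, nonrep E U psi.
Proof.
elim: k => [|k [T [[t0 _] hT]]].
  (* For [k = 0] the bags are disjoint and without edges between them, so a path stays in one
     bag. *)
  have [T [[t0 _] hT]] := bag_colouring r; exists T; split; first by exists t0.
  move=> V U E; elim=> [E0 h|{}U E0 B EB E1 g [psi hpsi] s1 h1 b1 c1 _ _ hE].
    by exists (fun=> t0) => -[|x p1] p2 // _ _ _ /(_ x); rewrite /= mem_head in_set0 => /(_ isT).
  have [Es EU] := glued_rel g.
  have [phi hphi] := hT V EB B s1 b1.
  have UB u : u \in U -> u \in B -> False.
    by move=> uU uB; move: c1; rewrite leqn0 cards_eq0 => /eqP/setP/(_ u); rewrite !inE uU uB.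
  have side (X : {set V}) (F : rel V) : (forall u v, E1 u v -> u \in X -> v \in X /\ F u v) ->
      forall x p, x \in X -> path E1 x p -> path F x p /\ {subset x :: p <= X}.
    move=> hF x p; elim: p x => [|y p IH] x xX /=; first by split => // z; rewrite inE => /eqP->.
    move=> /andP[/hF/(_ xX)[yX Fxy] /(IH y yX)[pp sub]]; rewrite Fxy pp; split => // z.
    by rewrite in_cons => /orP[/eqP->//|/sub].
  exists (fun v => if v \in B then phi v else psi v) => -[//|x p1] p2 p10 ps pu sub Ec.
  have cong (X : {set V}) (c : V -> T) q : {subset q <= X} -> (forall v, v \in X -> (if v \in B then phi v else psi v) = c v) ->
      map (fun v => if v \in B then phi v else psi v) q = map c q.
    by move=> qX hc; apply/eq_in_map => v /qX/hc.
  case xB : (x \in B); last first.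
    have xU : x \in U by have := sub x (mem_head _ _); rewrite in_setU xB orbF.
    have [|pp sX] := side U E0 _ x (p1 ++ p2) xU ps.
      move=> u v; rewrite hE => /orP[/[dup]/EU[_ [_ vU]]|/h1[_ [uB _]] uU] //.
      by case: (UB u).
    apply: (hpsi (x :: p1) p2 p10 pp pu sX); move: Ec.
    have hc v : v \in U -> (if v \in B then phi v else psi v) = psi v.
      by case: ifP => // vB vU; case: (UB v).
    by rewrite !(cong U psi) // => v vp; apply: sX; rewrite -cat_cons mem_cat vp ?orbT.
  have [|pp sX] := side B EB _ x (p1 ++ p2) xB ps.
    move=> u v; rewrite hE => /orP[/EU[_ [uU _]] uB|/[dup]/h1[_ [_ vB]]] //.
    by case: (UB u).
  apply: (hphi (x :: p1) p2 p10 pp pu sX); move: Ec.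
  have hc v : v \in B -> (if v \in B then phi v else psi v) = phi v by move=> ->.
  by rewrite !(cong B phi) // => v vp; apply: sX; rewrite -cat_cons mem_cat vp ?orbT.
have [S [[s0 _] hS]] := squarefree.
exists (T * (S * 'I_3))%type; split; first by exists (t0, (s0, ord0)).
move=> V U E gU; have [lam [L1 L2 L3]] := layering gU; have [Es _] := glued_rel gU.
have phiP j : exists phi : V -> T, nonrep (restr E (layer U lam j)) (layer U lam j) phi by exact: hT.
have [phi {}phiP] := choose_fun phiP.
pose M := (\max_v lam v).+1; have [u uM] := hS M.
pose c v := (phi (lam v) v, (u (lam v), inord (lam v %% 3) : 'I_3)).
exists c => p1 p2 p10 ps pu sU E12.
have ss : size p1 = size p2 by have := congr1 size E12; rewrite !size_map.
case: p1 p10 ps pu sU E12 ss => // v0 q1 _; set p1 := v0 :: q1 => ps pu sU E12 ss.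
pose n := size p1; pose l i := lam (nth v0 (p1 ++ p2) i).
have sz : size (p1 ++ p2) = 2 * n by rewrite size_cat -ss; lia.
have cn i : i < n -> c (nth v0 (p1 ++ p2) i) = c (nth v0 (p1 ++ p2) (i + n)).
  move=> iN; rewrite !nth_cat iN; have -> : i + n < size p1 = false by rewrite /n; lia.
  rewrite addnK -!(nth_map v0 (c v0)) -?ss // E12 //.
have lr : lazy_repeat u M n l.
  split=> // [i il|i il|i il|i il].
  - have E1 : E (nth v0 (p1 ++ p2) i) (nth v0 (p1 ++ p2) i.+1).
      by move: ps; rewrite /p1 /= => /(pathP v0)/(_ i); apply; move: sz; rewrite /p1 /=; lia.
    by split; apply: L1 => //; rewrite Es.
  - have [_ _ /(congr1 val)] := cn i il; rewrite /= !inordK ?ltn_mod //.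
  - by have [] := cn i il.
  - by rewrite /M ltnS; exact: (leq_bigmax (nth v0 (p1 ++ p2) i)).
have lamE : map lam p1 = map lam p2.
  apply: (@eq_from_nth _ 0); rewrite ?size_map // => i il.
  rewrite !(nth_map v0) -?ss //; have := lazy_constant uM lr il.
  by rewrite /l !nth_cat il; have -> : i + n < size p1 = false by [rewrite /n; lia]; rewrite addnK.
(* The lowest layer met by the path. Corresponding vertices of the two halves lie in the same layer,
   so the filtered halves still repeat. *)
case: (@arg_minnP V v0 (fun v => v \in p1 ++ p2) lam (mem_head _ _)) => w wp wmin.
pose j := lam w.
pose f v := (phi (lam v) v, lam v).
have fE : map f p1 = map f p2.
  apply: (@eq_from_nth _ (f v0)); rewrite ?size_map // => i il; rewrite !(nth_map v0) -?ss //.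
  have := cn i il; have := congr1 (fun s => nth 0 s i) lamE.
  rewrite !(nth_map v0) -?ss // !nth_cat il; have -> : i + n < size p1 = false by rewrite /n; lia.
  by rewrite addnK /f => E1 [-> _ _]; rewrite E1.
have filt : forall q q', map f q = map f q' ->
    map (phi j) [seq v <- q | lam v == j] = map (phi j) [seq v <- q' | lam v == j].
  elim=> [|x q IH] [|x' q'] //= [E1 E2 /IH E3]; rewrite E2; case: eqP => //= xj.
  by rewrite E3; congr (_ :: _); move: E1; rewrite E2 xj.
have fcat : [seq v <- p1 | lam v == j] ++ [seq v <- p2 | lam v == j] = [seq v <- p1 ++ p2 | lam v == j].
  by rewrite filter_cat.
apply: (phiP j [seq v <- p1 | lam v == j] [seq v <- p2 | lam v == j]); rewrite ?fcat.
- move=> E1; have := filt _ _ fE; rewrite E1 /= => /esym/(congr1 size); rewrite size_map /= => /size0nil E2.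
  have : w \in [seq v <- p1 ++ p2 | lam v == j] by rewrite mem_filter eqxx.
  by rewrite -fcat E1 E2.
- apply: sorted_restr; first by apply: (filter_layer (L3 j)) => // v vp; exact: wmin.
  by move=> v; rewrite mem_filter in_set => /andP[vj /sU vU]; rewrite vU.
- exact: filter_uniq.
- by move=> v; rewrite mem_filter in_set => /andP[vj /sU vU]; rewrite vU.
- exact: filt.
Qed.

(** * Topological minors *)

Require Import Defs.

(** Take a path from [a1] to [a2], and a path from [a3] up to its first vertex [b] on the former. *)
Lemma tripod3 (V : finType) (e : rel V) (X : {set V}) (a1 a2 a3 : V) :
  symmetric e -> conn e X -> a1 \in X -> a2 \in X -> a3 \in X ->
  exists b (J : nat -> {set V}), [/\ b \in X, forall i, J i \subset X :\ b,
    forall i j z, z \in J i -> z \in J j -> i = j &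
    forall i, i < 3 -> connect (restr e (b |: J i)) b (nth a1 [:: a1; a2; a3] i)].
Proof.
move=> es cX h1 h2 h3.
have [s [ps us ls sX]] := connect_walk (cX _ _ h1 h2) h1.
have [s' [ps' us' ls' sX']] := connect_walk (cX _ _ h3 h1) h3.
have hs : has (mem (a1 :: s)) (a3 :: s').
  by apply/hasP; exists a1; rewrite /= ?mem_head // -ls' mem_last.
have [q1 [b [q2 [qE bP q1P]]]] := first_hit hs.
have [p1 [p2 pE]] := mem_split bP.
have up : uniq (p1 ++ b :: p2) by rewrite -pE.
have sp : sorted e (p1 ++ b :: p2) by rewrite -pE.
have uq : uniq (q1 ++ b :: q2) by rewrite -qE.
have sq : sorted e (q1 ++ b :: q2) by rewrite -qE.
have bX : b \in X by apply: sX.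
move: up uq; rewrite !cat_uniq /= !negb_or => /and3P[_ /andP[bp1 hp] /andP[bp2 _]] /and3P[_ /andP[bq1 _] _].
have pX z : z \in p1 ++ b :: p2 -> z \in X by rewrite -pE; exact: sX.
have qX z : z \in q1 ++ b :: q2 -> z \in X by rewrite -qE; exact: sX'.
exists b, (fun i => match i with 0 => [set z in p1] | 1 => [set z in p2] | 2 => [set z in q1] | _ => set0 end).
have q1' z : z \in q1 -> z \notin a1 :: s by move=> zq; apply: contra q1P => zs; apply/hasP; exists z.
split=> //.
- move=> [|[|[|i]]]; apply/subsetP => z; rewrite !inE // => zz; apply/andP; split.
  + by apply: contraNneq bp1 => <-.
  + by apply: pX; rewrite mem_cat zz.
  + by apply: contraNneq bp2 => <-.
  + by apply: pX; rewrite mem_cat in_cons zz !orbT.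
  + by apply: contraNneq bq1 => <-.
  + by apply: qX; rewrite mem_cat zz.
- have d12 z : z \in p1 -> z \in p2 -> False.
    by move=> z1 z2; have /hasPn/(_ z z2)/negP := hp.
  have d13 z : z \in p1 -> z \in q1 -> False.
    by move=> z1 /q1'; rewrite pE mem_cat z1.
  have d23 z : z \in p2 -> z \in q1 -> False.
    by move=> z1 /q1'; rewrite pE mem_cat in_cons z1 !orbT.
  move=> [|[|[|i]]] [|[|[|j]]] z; rewrite !inE // => z1 z2; exfalso; eauto.
- have walk t : sorted e (b :: t) -> forall z, z \in b :: t -> connect (restr e (b |: [set z in t])) b z.
    move=> st z zt; have := walk_conn es st (x := b) (y := z).
    have -> : [set z in b :: t] = b |: [set z in t] by apply/setP => w; rewrite !inE.
    by apply; rewrite in_setU1 ?eqxx // inE -in_cons.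
  have rv t : b |: [set z in rev t] = b |: [set z in t] by apply/setP => z; rewrite !inE mem_rev.
  have [sp1 sp2] : sorted e (b :: rev p1) /\ sorted e (b :: p2).
    have := sp; rewrite sorted_split => /andP[sp1 sp2]; split; last exact: sp2.
    by rewrite -sorted_rev_sym // rev_cons revK.
  have sq1 : sorted e (b :: rev q1).
    have := sq; rewrite sorted_split => /andP[sq1 _].
    by rewrite -sorted_rev_sym // rev_cons revK.
  move=> [|[|[|//]]] _ /=.
  + rewrite -rv; apply: walk => //; rewrite in_cons mem_rev.
    by move: pE; case: (p1) => [|x p] [<-]; rewrite ?eqxx // mem_head orbT.
  + apply: walk => //; have : last a1 s = last b p2.
      by have := congr1 (last a1) pE; rewrite /= last_cat.
    by rewrite ls => ->; exact: mem_last.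
  + rewrite -rv; apply: walk => //; rewrite in_cons mem_rev.
    by move: qE; case: (q1) => [|x p] [<-]; rewrite ?eqxx // mem_head orbT.
Qed.

Lemma tripod (V T : finType) (e : rel V) (X : {set V}) (D : {set T}) (a : T -> V) :
  symmetric e -> conn e X -> X != set0 -> #|D| <= 3 -> (forall t, t \in D -> a t \in X) ->
  exists b (J : T -> {set V}), [/\ b \in X, forall t, J t \subset X :\ b,
    forall t t' z, t \in D -> t' \in D -> z \in J t -> z \in J t' -> t = t' &
    forall t, t \in D -> connect (restr e (b |: J t)) b (a t)].
Proof.
move=> es cX /set0Pn[x0 x0X] cD aX.
pose l := [seq a t | t <- enum D]; pose c i := nth x0 l i.
have cX' i : c i \in X.
  rewrite /c; case: (ltnP i (size l)) => il; last by rewrite nth_default.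
  have /mapP[t] : nth x0 l i \in l by exact: mem_nth.
  by rewrite mem_enum => tD ->; exact: aX.
have [b [J [bX JX Jd Jc]]] := tripod3 es cX (cX' 0) (cX' 1) (cX' 2).
exists b, (fun t => J (index t (enum D))); split=> // [t t' z tD t'D z1 z2|t tD].
  have E := Jd _ _ _ z1 z2.
  by rewrite -[t](nth_index t (s := enum D)) ?mem_enum // E nth_index ?mem_enum.
have it : index t (enum D) < size (enum D) by rewrite index_mem mem_enum.
have i3 : index t (enum D) < 3 by apply: leq_trans it _; rewrite -cardE.
have := Jc _ i3; suff -> : nth (c 0) [:: c 0; c 1; c 2] (index t (enum D)) = a t by [].
have -> : a t = c (index t (enum D)) by rewrite /c (nth_map t) // nth_index // mem_enum.
by move: (index t (enum D)) i3 => [|[|[|]]].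
Qed.

Section TModel.
Variable G : sgraph.
Let e := @adj G.

(* [K] is a topological minor of [G]; all inner vertices of the subdivided
   edges lie in [S]. *)
Definition tmodel (K : sgraph) (S : {set G}) (f : K -> G) (U : {set K} -> {set G}) :=
  [/\ injective f, forall x, f x \notin S,
    forall x y, adj x y -> U [set x; y] \subset S /\
      connect (restr e ([set f x; f y] :|: U [set x; y])) (f x) (f y) &
    forall x y x' y' z, adj x y -> adj x' y' -> z \in U [set x; y] -> z \in U [set x'; y'] ->
      [set x; y] = [set x'; y']].

Lemma direct_subgraph (K : sgraph) (f : K -> G) : injective f ->
  (forall x y, adj x y -> adj (f x) (f y)) ->
  exists S : subgraph G, isomorphic (subgraph_graph S) K.
Proof.
move=> fi fe.
pose SV := f @: [set: K]; pose SE := [set [set f p.1; f p.2] | p : K * K & adj p.1 p.2].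
have h1 : SE \subset edges G.
  apply/subsetP => E /imsetP[[x y]]; rewrite inE /= => xy ->.
  by apply/imsetP; exists (f x, f y); rewrite ?inE //=; exact: fe.
have h2 E : E \in SE -> E \subset SV.
  move=> /imsetP[[x y] _ ->]; apply/subsetP => z; rewrite !inE /=.
  by case/orP => /eqP->; rewrite imset_f.
exists (Subgraph h1 h2).
have gP (v : {x : G | x \in SV}) : exists k, f k = val v by have /imsetP[k _ E] := valP v; exists k.
have [g {}gP] := choose_fun gP.
exists g.
  exists (fun k => exist _ (f k) (imset_f f (in_setT k)) : {x : G | x \in SV}) => [v|k].
    by apply: val_inj; rewrite /= gP.
  by apply: fi; rewrite gP.
move=> u v; rewrite /= /subgraph_adj -!gP /=; apply/idP/imsetP => [uv|[[x y]]].
  by exists (g u, g v); rewrite ?inE.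
rewrite inE /= => xy E.
have E' : [set g u; g v] = [set x; y].
  by apply: (imset_inj fi); rewrite !imsetU !imset_set1.
have gu : g u \in [set x; y] by rewrite -E' !inE eqxx.
have gv : g v \in [set x; y] by rewrite -E' !inE eqxx orbT.
have xE : x \in [set g u; g v] by rewrite E' !inE eqxx.
have yE : y \in [set g u; g v] by rewrite E' !inE eqxx orbT.
have xy' : x != y by apply: contraTneq xy => ->; rewrite adj_irrefl.
move: gu gv xE yE; rewrite !inE => /orP[]/eqP-> /orP[]/eqP->; rewrite ?eqxx ?orbF ?orbb /=.
- by rewrite eq_sym (negPf xy').
- by [].
- by rewrite adj_sym.
- by rewrite (negPf xy').
Qed.

(** An edge [x y] of [K] that is not realised by an edge of [G] is subdivided, and the new vertex is
    placed at the successor [w] of [f x] on the connecting path. This uses up one vertex of [S],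
    hence the induction on [#|S|]. *)
Lemma tmodel_topological_minor (H K : sgraph) S f U : subdivision H K -> @tmodel K S f U ->
  topological_minor H G.
Proof.
have [n] := ubnP #|S|; elim: n K S f U => // n IH K S f U; rewrite ltnS => Sn HK [fi fS Uc Ud].
case: (pselect (forall x y, adj x y -> adj (f x) (f y))) => [fe|].
  by have [T iT] := direct_subgraph fi fe; exists T, K.
move=> /existsNP[x /existsNP[y /not_implyP[xy nfxy]]].
have [US c] := Uc x y xy; have fxin : f x \in [set f x; f y] :|: U [set x; y] by rewrite !inE eqxx.
have [[|w s] [ps us ls sub]] := connect_walk c fxin.
  by move: ls => /= /fi E; rewrite E adj_irrefl in xy.
move: ps us; rewrite /= => /andP[fxw ps] /and3P[fxs ws us].
have wU : w \in U [set x; y].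
  have : w \in f x :: w :: s by rewrite !inE eqxx orbT.
  move=> /sub; rewrite !inE => /orP[/orP[/eqP E|/eqP E]|//].
    by rewrite E mem_head in fxs.
  by case: nfxy; rewrite -E.
pose K' := subdivide_edge x y.
pose f' (v : K') := if v is Some a then f a else w.
(* The half at [x] is now an edge of [G]; the half at [y] inherits the other inner vertices. *)
pose U' (E : {set K'}) := if None \in E then (if Some x \in E then set0 else U [set x; y] :\ w)
  else U (Some @^-1: E).
have pre (a b : K) : Some @^-1: [set Some a; Some b] = [set a; b].
  by apply/setP => z; rewrite !inE.
have xny : x != y by apply: contraTneq xy => ->; rewrite adj_irrefl.
have wS : w \in S by exact: (subsetP US).
have U'ss (a b : K) : U' [set Some a; Some b] = U [set a; b] by rewrite /U' pre !inE.
have U'x1 : U' [set None; Some x] = set0 by rewrite /U' set21 set22.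
have U'y1 : U' [set None; Some y] = U [set x; y] :\ w.
  rewrite /U' set21; case: ifP => //; rewrite !inE /= => /eqP[E].
  by rewrite E eqxx in xny.
have ed (u v : K') : adj u v -> [\/ exists a b, [/\ adj a b, [set a; b] != [set x; y], u = Some a & v = Some b],
     [set u; v] = [set None; Some x] /\ ((u = None /\ v = Some x) \/ (v = None /\ u = Some x)) |
     [set u; v] = [set None; Some y] /\ ((u = None /\ v = Some y) \/ (v = None /\ u = Some y))].
  case: u v => [a|] [b|] //=; rewrite /subdivide_adj.
  - by move=> /andP[ab abxy]; constructor 1; exists a, b.
  - by rewrite !inE => /orP[]/eqP->; [constructor 2|constructor 3]; rewrite setUC; split => //; right.
  - by rewrite !inE => /orP[]/eqP->; [constructor 2|constructor 3]; split => //; left.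
have conn_w : connect (restr e ([set w; f y] :|: U [set x; y] :\ w)) w (f y).
  have := @walk_connect _ e ([set w; f y] :|: U [set x; y] :\ w) s w (@adj_sym G) ps.
  rewrite -[last w s]/(last (f x) (w :: s)) ls; apply => z zs.
  have := sub z; rewrite in_cons zs orbT => /(_ isT); rewrite !inE.
  case: (z =P w) => //= _; case: (z =P f x) => [E|//]; rewrite E in zs.
  by rewrite zs in fxs.
apply: (IH K' (S :\ w) f' U').
- by apply: leq_trans Sn; rewrite (cardsD1 w S) wS.
- exact: subdivision_step.
split.
- move=> [a|] [b|] //= E; first by rewrite (fi _ _ E).
    by have := fS a; rewrite E wS.
  by have := fS b; rewrite -E wS.
- by move=> [a|]; rewrite !inE ?eqxx //= (negPf (fS a)) andbF.
- move=> u v uv; case: (ed u v uv) => [[a [b [ab abxy -> ->]]]|[-> h]|[-> h]].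
  + rewrite U'ss; have [h1 h2] := Uc a b ab; split => //.
    apply/subsetP => z zU; rewrite !inE (subsetP h1 _ zU) andbT.
    apply: contraNneq abxy => E; rewrite E in zU; apply/eqP; exact: Ud ab xy zU wU.
  + rewrite U'x1 setU0 sub0set; split => //.
    case: h => -[-> ->] /=; apply: connect_restr1; rewrite ?inE ?eqxx ?orbT //.
    by rewrite /e adj_sym.
  + rewrite U'y1; split; first exact: setSD.
    case: h => -[-> ->] /=; first exact: conn_w.
    rewrite (setUC [set f y]) connect_restr_sym ?conn_w //; exact: adj_sym.
- move=> u v u' v' z uv uv'.
  case: (ed u v uv) => [[a [b [ab abxy -> ->]]]|[-> _]|[-> _]];
    case: (ed u' v' uv') => [[a' [b' [ab' abxy' -> ->]]]|[-> _]|[-> _]] //;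
    rewrite ?U'ss ?U'x1 ?U'y1 ?in_set0 // ?in_setD1.
  + move=> z1 z2; have E := Ud _ _ _ _ _ ab ab' z1 z2.
    by apply/setP => -[k|]; [have := congr1 (fun X : {set K} => k \in X) E|]; rewrite !inE.
  + by move=> z1 /andP[_ z2]; rewrite (Ud _ _ _ _ _ ab xy z1 z2) eqxx in abxy.
  + by move=> /andP[_ z2] z1; rewrite (Ud _ _ _ _ _ ab' xy z1 z2) eqxx in abxy'.
Qed.

Lemma edgesP (H : sgraph) (x y : H) : ([set x; y] \in edges H) = adj x y.
Proof.
apply/imsetP/idP => [[[a b]]|xy]; last by exists (x, y); rewrite ?inE.
rewrite inE /= => ab E; have anb : a != b by apply: contraTneq ab => ->; rewrite adj_irrefl.
have xE : x \in [set a; b] by rewrite -E !inE eqxx.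
have yE : y \in [set a; b] by rewrite -E !inE eqxx orbT.
have aE : a \in [set x; y] by rewrite E !inE eqxx.
have bE : b \in [set x; y] by rewrite E !inE eqxx orbT.
move: xE yE aE bE; rewrite !inE => /orP[]/eqP-> /orP[]/eqP->; rewrite ?eqxx ?orbF ?orbb /=.
- by rewrite eq_sym (negPf anb).
- by [].
- by rewrite adj_sym.
- by rewrite (negPf anb).
Qed.

(** A vertex of degree at most 3 is placed at the centre of a tripod inside its set, and each leg is
    handed over to the edge it leads to. For larger degree the set is a single vertex and the legs
    are empty. *)
Lemma smodel_topological_minor (H : sgraph) Y : smodel (edges H) e Y ->
  (forall v : H, 4 <= degree v -> exists x, Y (inl v) = [set x]) -> topological_minor H G.
Proof.
move=> [h1 h2 h3] hi; have es : symmetric e by exact: adj_sym.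
have aP (p : H * H) : exists a : G, adj p.1 p.2 ->
    a \in Y (inl p.1) /\ adjS e [set a] (Y (inr [set p.1; p.2])).
  case: p => v w /=; have [_ /set0Pn[x0 _]] := h1 (inl v) isT.
  case vw: (adj v w); last by exists x0.
  have [||a [b [aY bY ab]]] := h3 v [set v; w]; rewrite ?edgesP ?inE ?eqxx //.
  by exists a => _; split => //; exists a, b; rewrite inE.
have [a {}aP] := choose_fun aP.
have bP v : exists bJ : G * (H -> {set G}), [/\ bJ.1 \in Y (inl v), forall w, bJ.2 w \subset Y (inl v) :\ bJ.1,
    forall w w' z, adj v w -> adj v w' -> z \in bJ.2 w -> z \in bJ.2 w' -> w = w' &
    forall w, adj v w -> connect (restr e (bJ.1 |: bJ.2 w)) bJ.1 (a (v, w))].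
  have [cY Y0] := h1 (inl v) isT.
  case: (leqP 4 (degree v)) => dv.
    have [x xE] := hi v dv; exists (x, fun=> set0); split => /=.
    - by rewrite xE inE.
    - by move=> w; exact: sub0set.
    - by move=> w w' z _ _; rewrite inE.
    - by move=> w vw; have [/= + _] := aP (v, w) vw; rewrite xE inE => /eqP->; exact: connect0.
  have [|b [J [k1 k2 k3 k4]]] := @tripod G H e (Y (inl v)) [set w | adj v w] (fun w => a (v, w)) es cY Y0 dv.
    by move=> w; rewrite inE => vw; have [] := aP (v, w) vw.
  exists (b, J); split => //=.
    by move=> w w' z vw vw'; apply: k3; rewrite inE.
  by move=> w vw; apply: k4; rewrite inE.
have [bJ {}bP] := choose_fun bP.
pose f v := (bJ v).1; pose J v w := if adj v w then (bJ v).2 w else set0.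
have JY v w z : z \in J v w -> [/\ adj v w, z \in Y (inl v), z != f v & z \in (bJ v).2 w].
  rewrite /J; case: ifP; last by rewrite inE.
  by move=> vw zb; have [_ /(_ w)/subsetP/(_ z zb) + _ _] := bP v; rewrite !inE => /andP[].
have fY v : f v \in Y (inl v) by have [] := bP v.
pose U (E : {set H}) := Y (inr E) :|: \bigcup_(p in [set p : H * H | (p.1 \in E) && (p.2 \in E)]) J p.1 p.2.
have UP x y z : adj x y -> z \in U [set x; y] -> z \in Y (inr [set x; y]) \/
    exists v w, [/\ [set v; w] = [set x; y] & z \in J v w].
  move=> xy; rewrite in_setU => /orP[->|/bigcupP[[v w]]]; first by left.
  rewrite inE /= => /andP[vE wE] zJ; right; exists v, w; split => //.
  have [vw _ _ _] := JY _ _ _ zJ; have vnw : v != w by apply: contraTneq vw => ->; rewrite adj_irrefl.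
  move: vE wE; rewrite !inE => /orP[]/eqP Ev /orP[]/eqP Ew; rewrite Ev Ew ?eqxx // in vnw *.
  by rewrite setUC.
apply: (@tmodel_topological_minor H H (~: (f @: [set: H])) f U (subdivision_refl H)); split.
- by move=> x y E; have := fY x; rewrite E => fx; have [] := h2 (inl y) (inl x) _ isT isT (fY y) fx.
- by move=> x; rewrite !inE negbK imset_f.
- move=> x y xy; split.
    apply/subsetP => z /(UP x y z xy) zU; rewrite inE; apply/negP => /imsetP[u _ E].
    have zY : z \in Y (inl u) by rewrite E.
    case: zU => [zE|[v [w [_ zJ]]]].
      by have := h2 (inl u) (inr [set x; y]) z isT; rewrite /= edgesP => /(_ xy zY zE).
    have [_ zv nz _] := JY _ _ _ zJ; have [uv] := h2 (inl u) (inl v) z isT isT zY zv.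
    by rewrite E uv eqxx in nz.
  have half v w : [set v; w] = [set x; y] -> f v \in [set f x; f y] -> adj v w -> exists2 b, b \in Y (inr [set x; y]) &
      connect (restr e ([set f x; f y] :|: U [set x; y])) (f v) b.
    move=> E fv vw; have [/= aY [a' [b [/set1P-> bY ab]]]] := aP (v, w) vw.
    rewrite E in bY; exists b => //.
    have [_ _ _ /(_ w vw) c] := bP v.
    have aU : a (v, w) \in [set f x; f y] :|: U [set x; y].
      have := connect_restr_in c; rewrite in_setU1 eqxx => /(_ isT).
      rewrite in_setU1 => /orP[/eqP->|aJ]; first by rewrite in_setU fv.
      rewrite !in_setU; apply/orP; right; apply/orP; right; apply/bigcupP; exists (v, w) => //=.
        by rewrite inE /= -E !inE !eqxx orbT.
      by rewrite /J vw.
    apply: (@connect_trans _ _ (a (v, w))).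
      apply: connect_restr_mono c => //; apply/subsetP => z; rewrite in_setU1 => /orP[/eqP->|zJ].
        by rewrite in_setU fv.
      rewrite !in_setU; apply/orP; right; apply/orP; right; apply/bigcupP; exists (v, w) => //=.
        by rewrite inE /= -E !inE !eqxx orbT.
      by rewrite /J vw.
    by apply: connect_restr1 => //; rewrite !in_setU bY orbT.
  have [|b bY cb] := half x y erefl _ xy; first by rewrite !inE eqxx.
  have [||b' bY' cb'] := half y x (setUC _ _); [by rewrite !inE eqxx orbT|by rewrite adj_sym|].
  have [|cE _] := h1 (inr [set x; y]); first by rewrite /= edgesP.
  apply: connect_trans cb _; rewrite connect_restr_sym //; apply: connect_trans cb' _.
  apply: (@conn_sub _ _ (Y (inr [set x; y]))) => //.
  by rewrite /U setUA -setUA setUCA subsetUl.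
- move=> x y x' y' z xy xy' z1 z2.
  have vE : valid (edges H) (inr [set x; y]) by rewrite /= edgesP.
  have vE' : valid (edges H) (inr [set x'; y']) by rewrite /= edgesP.
  case: (UP _ _ _ xy z1) => [k1|[v [w [<- k1]]]]; case: (UP _ _ _ xy' z2) => [k2|[v' [w' [<- k2]]]].
  + by have [] := h2 _ _ _ vE vE' k1 k2.
  + by have [_ k _ _] := JY _ _ _ k2; have := h2 _ (inl v') _ vE isT k1 k.
  + by have [_ k _ _] := JY _ _ _ k1; have := h2 _ (inl v) _ vE' isT k2 k.
  + have [vw k1' _ j1] := JY _ _ _ k1; have [vw' k2' _ j2] := JY _ _ _ k2.
    have [vv] := h2 (inl v) (inl v') z isT isT k1' k2'; subst v'.
    by have [_ _ /(_ w w' z vw vw' j1 j2)-> _] := bP v.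
Qed.

End TModel.

Lemma smodel_mono (Q : finType) (Es : {set {set Q}}) (V : finType) (e e' : rel V) Y :
  subrel e e' -> smodel Es e Y -> smodel Es e' Y.
Proof.
move=> sub [h1 h2 h3]; split=> // [a va|x E EEs xE].
  by have [cY nY] := h1 a va; split => //; exact: conn_mono sub cY.
exact: adjS_mono sub (subxx _) (subxx _) (h3 x E EEs xE).
Qed.

Lemma small_vertex_mono (V : finType) (e : rel V) W d d' v :
  d <= d' -> small_vertex e W d v -> small_vertex e W d' v.
Proof.
move=> dd [I [S [vI IS cl cS cW]]]; exists I, S; split=> //; exact: leq_trans dd.
Qed.

Lemma glued_nonrepetitive (G : sgraph) (T : finType) (psi : G -> T) E :
  subrel (@adj G) E -> nonrep E setT psi -> nonrepetitively_colourable G #|T|.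
Proof.
move=> sub hpsi; exists (enum_rank \o psi) => p /and3P[p0 ps pu] [s [sz]].
rewrite -map_take -map_drop => E1.
apply: (hpsi (take s p) (drop s p)); rewrite ?cat_take_drop //.
- by move=> /(congr1 size) /=; rewrite size_takel; lia.
- exact: sub_sorted ps.
- by move=> x; rewrite in_setT.
- by apply: (inj_map enum_rank_inj); rewrite -!map_comp.
Qed.

Lemma fan_model_colouring (H : sgraph) (hi := [set v : H | 4 <= degree v]) N
    (tau : nat -> 'I_(#|hi|.+1)) (Y : H + {set H} -> {set cell N + 'I_(#|hi|.+1)}) :
  0 < N -> (forall x x', x <= x' -> tau x <= tau x') -> smodel (edges H) (hadj tau) Y ->
  (forall v, v \in hi -> exists i, Y (inl v) = [set inr i]) ->
  exists k, forall G : sgraph, ~ topological_minor H G -> nonrepetitively_colourable G k.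
Proof.
move=> N0 tauM sY hY; pose h1 := #|hi|.+1.
have [n0 [d0 hostP]] := host N0 (ltn0Sn #|hi| : 0 < h1).
(* [glue_all] requires [0 < d] and [2 * d <= n], and [n0 <= n] makes a full [W] large enough for
   [host]. A set of [h] vertices that are not small would give the fan grid. *)
pose d := d0.+1; pose n := maxn n0 (2 * d); pose h := 2 * h1.
pose r := n + 1 + 2 * d + d * n + (2 * n + 1) + h.
have [T [_ hT]] := glued_colouring n r.
exists #|T| => G noH.
have [||||Z W wlW cW|//|E [gE sub]] := @glue_all G (@adj G) n d h r.
- exact: adj_sym.
- exact: adj_irrefl.
- by [].
- exact: leq_maxr.
- rewrite ltnNge; apply/negP => big; apply: noH.
  pose X := [set v | `[< ~ small_vertex (restr (@adj G) (Z :|: W)) W d v >]].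
  have Es : symmetric (restr (@adj G) (Z :|: W)) by apply: restr_sym; exact: adj_sym.
  pose z (i : 'I_(2 * h1)) : G := enum_val (widen_ord big i : 'I_#|X|).
  have zinj : injective z.
    by move=> i j /enum_val_inj /(congr1 val) /= /val_inj.
  have zX i : ~ small_vertex (restr (@adj G) (Z :|: W)) W d0 (z i).
    have := enum_valP (widen_ord big i : 'I_#|X|); rewrite in_set => /asboolP h' h2.
    by apply: h'; apply: small_vertex_mono h2.
  have [|B [v [vinj gB vB vtop]]] := hostP _ _ W z Es wlW _ zinj zX tau tauM.
    by rewrite cW; exact: leq_maxl.
  have [Y' [sY' hY']] := host_smodel Es sY hY vinj gB vB vtop.
  apply: (@smodel_topological_minor G H Y').
    by apply: smodel_mono sY' => x y /and3P[].
  by move=> x dx; apply: hY'; rewrite in_set.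
- by have [psi hpsi] := hT _ _ _ gE; exact: glued_nonrepetitive sub hpsi.
Qed.

(** * From plane drawings to grids *)

From mathcomp Require Import all_order all_algebra.
From mathcomp Require Import all_classical all_reals all_analysis.
From mathcomp Require Import ring lra.
Import Defs.

Import Order.TTheory GRing.Theory Num.Theory.
Import numFieldNormedType.Exports.
Local Open Scope classical_set_scope.
Local Open Scope ring_scope.

Section Cells.
Variable R : realType.
Notation plane := (R * R)%type.

Lemma closed_fin (T : topologicalType) (I : finType) (P : pred I) (F : I -> set T) :
  (forall i, closed (F i)) -> closed [set p | exists2 i, P i & F i p].
Proof.
move=> cF; have -> : [set p | exists2 i, P i & F i p] = \bigcup_(i in [set i | P i]) F i by [].
by apply: closed_bigcup => // ; exact: finite_finset.
Qed.

Definition dist1 (x : plane * plane) : R := `|x.1.1 - x.2.1| + `|x.1.2 - x.2.2|.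

Lemma dist1_cont : continuous dist1.
Proof.
move=> x; apply: cvgD; apply: cvg_norm; apply: cvgB.
- by apply: (cvg_comp _ _ cvg_fst); exact: cvg_fst.
- by apply: (cvg_comp _ _ cvg_snd); exact: cvg_fst.
- by apply: (cvg_comp _ _ cvg_fst); exact: cvg_snd.
- by apply: (cvg_comp _ _ cvg_snd); exact: cvg_snd.
Qed.

Lemma apart (A B : set plane) : compact A -> compact B -> A `&` B = set0 ->
  exists2 d : R, 0 < d & forall p q, A p -> B q -> d <= `|p.1 - q.1| + `|p.2 - q.2|.
Proof.
move=> cA cB AB; have [AB0|] := pselect ((A `*` B) !=set0); last first.
  by move=> h; exists 1 => // p q Ap Bq; case: h; exists (p, q).
have cAB : compact (A `*` B) by exact: compact_setX.
have [|[p q] + h] := compact_EVT_min AB0 cAB (f := dist1).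
  by apply: continuous_subspaceT; exact: dist1_cont.
rewrite inE => -[/= Ap Bq]; exists (dist1 (p, q)); last first.
  by move=> p' q' Ap' Bq'; apply: (h (p', q')); rewrite inE.
rewrite lt_neqAle addr_ge0 // andbT eq_sym /dist1 /= paddr_eq0 // !normr_eq0 !subr_eq0.
apply/negP => /andP[/eqP E1 /eqP E2]; have : (A `&` B) p.
  by split => //; move: p q E1 E2 Bq {Ap h} => [p1 p2] [q1 q2] /= -> ->.
by rewrite AB.
Qed.

Lemma unit_cell n (y : R) : 0 <= y <= n.+1%:R -> exists i : 'I_n.+1, i%:R <= y <= i%:R + 1.
Proof.
elim: n => [|n IH] /andP[y0 yn]; first by exists ord0; rewrite /= add0r y0 yn.
have [yn'|yn'] := leP y n.+1%:R.
  have [|i hi] := IH _; first by rewrite y0.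
  by exists (widen_ord (leqnSn _) i).
by exists ord_max; rewrite /= (ltW yn') natr1.
Qed.

Definition box N (c : cell N) : set plane := [set p |
  [/\ c.1%:R <= N%:R * p.1, N%:R * p.1 <= c.1%:R + 1, c.2%:R <= N%:R * p.2 & N%:R * p.2 <= c.2%:R + 1]].

Lemma box_closed N (c : cell N) : closed (box c).
Proof.
have h (f : plane -> R) (a b : R) : continuous f -> closed [set p | a <= f p /\ f p <= b].
  move=> cf; apply: (@closedI _ (f @^-1` [set x | a <= x]) (f @^-1` [set x | x <= b]));
    apply: (@closed_comp _ _ f); try by move=> x _; exact: cf.
  - exact: closed_ge.
  - exact: closed_le.
have -> : box c = [set p | c.1%:R <= N%:R * p.1 /\ N%:R * p.1 <= c.1%:R + 1] `&`
    [set p | c.2%:R <= N%:R * p.2 /\ N%:R * p.2 <= c.2%:R + 1].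
  by apply/seteqP; split=> [p []|p [] [] h1 h2 []] //=; split.
by apply: closedI; apply: h => p; apply: cvgM; try exact: cvg_cst; [exact: cvg_fst|exact: cvg_snd].
Qed.

Definition cells N (K : set plane) : {set cell N} := [set c | `[< exists2 p, K p & box c p >]]%SET.

Lemma cellsP N (K : set plane) (c : cell N) : reflect (exists2 p, K p & box c p) (c \in cells N K).
Proof. by rewrite inE; exact: asboolP. Qed.

Definition square : set plane := [set p | 0 <= p.1 <= 1 /\ 0 <= p.2 <= 1].

Lemma square_cell N p : (0 < N)%N -> square p -> exists c : cell N, box c p.
Proof.
case: N => // n _ [/andP[h1 h2] /andP[h3 h4]].
have h (x : R) : 0 <= x -> x <= 1 -> 0 <= n.+1%:R * x <= n.+1%:R.
  by move=> x0 x1; rewrite mulr_ge0 // ler_piMr.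
have [i /andP[i1 i2]] := unit_cell (h _ h1 h2); have [j /andP[j1 j2]] := unit_cell (h _ h3 h4).
by exists (i, j).
Qed.

Lemma near_index (i j : nat) (x : R) : i%:R <= x -> x <= i%:R + 1 -> j%:R <= x -> x <= j%:R + 1 ->
  i = j \/ nextto i j.
Proof.
move=> h1 h2 h3 h4.
have : (i%:R <= (j.+1)%:R :> R) by rewrite -natr1; lra.
have : (j%:R <= (i.+1)%:R :> R) by rewrite -natr1; lra.
rewrite !ler_nat /nextto => a b; case: (ltngtP i j) => h; [right|right|left] => //; lia.
Qed.

(** The cell [(i', j)] contains [p] as well, so a diagonal step splits into two. *)
Lemma cells_corner N (K : set plane) (c c' : cell N) p : K p -> box c p -> box c' p ->
  connect (restr (@gadj N) (cells N K)) c c'.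
Proof.
case: c c' => i j [i' j'] Kp [/= a1 a2 a3 a4] [/= b1 b2 b3 b4].
have m1 : (i, j) \in cells N K by apply/cellsP; exists p.
have m2 : (i', j) \in cells N K by apply/cellsP; exists p.
have m3 : (i', j') \in cells N K by apply/cellsP; exists p.
apply: (@connect_trans _ _ (i', j)).
  have [E|h] := near_index a1 a2 b1 b2; first by rewrite (val_inj E) connect0.
  by apply: connect_restr1 => //; rewrite /gadj /= eqxx h orbT.
have [E|h] := near_index a3 a4 b3 b4; first by rewrite (val_inj E) connect0.
by apply: connect_restr1 => //; rewrite /gadj /= eqxx h.
Qed.

(** The cells of one component and the remaining cells cover [K] by two closed sets, which by
    [cells_corner] do not meet on [K]. *)
Lemma cells_conn N (K : set plane) : (0 < N)%N -> connected K -> K `<=` square ->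
  conn (@gadj N) (cells N K).
Proof.
move=> N0 cK Ksq c0 c1 c0K c1K; pose C := cells N K; pose X := comp (@gadj N) C c0.
pose inX : set plane := [set p | exists2 c, c \in X & box c p].
pose outX : set plane := [set p | exists2 c, c \in (C :\: X)%SET & box c p].
have cov p : K p -> inX p \/ outX p.
  move=> Kp; have [c cp] := square_cell N0 (Ksq p Kp).
  have cC : c \in C by apply/cellsP; exists p.
  by case cX : (c \in X); [left; exists c|right; exists c; rewrite // finset.inE cX cC].
have dis p : K p -> inX p -> outX p -> False.
  move=> Kp [c cX cp] [c' + cp']; rewrite finset.inE => /andP[/negP + c'C]; apply.
  rewrite finset.inE; apply: connect_trans (cells_corner Kp cp cp').
  by rewrite finset.inE in cX.
have : K `&` inX = K.
  apply: cK.
  - have /cellsP[p Kp cp] := c0K; exists p; split => //; exists c0 => //.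
    by rewrite finset.inE connect0.
  - exists (~` outX); first by apply: closed_openC; apply: closed_fin => c; exact: box_closed.
    apply/seteqP; split=> p [Kp h]; split => //; first by move=> /(dis p Kp h).
    by have [//|] := cov p Kp.
  - by exists inX => //; apply: closed_fin => c; exact: box_closed.
move=> E; have /cellsP[p Kp cp] := c1K; have : (K `&` inX) p by rewrite E.
move=> [_ [c cX cp']]; rewrite finset.inE in cX.
by apply: connect_trans cX (cells_corner Kp cp' cp).
Qed.

(** After scaling by [N], points of equal or adjacent cells differ by at most 3 in the sum of
    coordinate distances. *)
Lemma cells_far N (A B : set plane) (d : R) (c c' : cell N) :
  (forall p q, A p -> B q -> d <= `|p.1 - q.1| + `|p.2 - q.2|) -> 3 < N%:R * d ->
  c \in cells N A -> c' \in cells N B -> c != c' /\ ~~ gadj c c'.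
Proof.
move=> hd dN /cellsP[p Ap [a1 a2 a3 a4]] /cellsP[q Bq [b1 b2 b3 b4]].
have Nd := hd p q Ap Bq.
have N0 : 0 <= N%:R :> R by [].
have key : N%:R * d <= `|N%:R * p.1 - N%:R * q.1| + `|N%:R * p.2 - N%:R * q.2|.
  rewrite -!mulrBr !normrM (ger0_norm N0) -mulrDr; exact: ler_wpM2l.
have abs (x y u v : R) : u <= x -> x <= u + 1 -> v <= y -> y <= v + 1 ->
    `|x - y| <= 1 + `|u - v|.
  move=> *; rewrite ler_norml; have := ler_norm (u - v); have := ler_norm (v - u).
  by rewrite distrC => *; apply/andP; split; lra.
have k1 := abs _ _ _ _ a1 a2 b1 b2; have k2 := abs _ _ _ _ a3 a4 b3 b4.
have nx (i j : nat) : nextto i j -> `|i%:R - j%:R| <= 1 :> R.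
  by move=> /orP[]/eqP<-; rewrite -natr1 ler_norml; apply/andP; split; lra.
split.
  by apply/negP => /eqP E; move: k1 k2; rewrite E !subrr normr0 => *; lra.
apply/negP; rewrite /gadj => /orP[/andP[/eqP E /nx h]|/andP[/eqP E /nx h]]; move: k1 k2;
  rewrite E subrr normr0 => *; lra.
Qed.

(** Only an edge and its ends may overlap; for these, [bridge] cuts a suitable stretch out of the
    cells of the edge. The mesh is fine enough for all pairs of disjoint sets at once. *)
Lemma discretize (Q : finType) (Es : {set {set Q}}) (Z : Q + {set Q} -> set plane) top p0 :
  (forall E, E \in Es -> exists x y, x != y /\ E = [set x; y]%SET) ->
  (forall a, valid Es a -> [/\ compact (Z a), connected (Z a) & Z a `<=` square]) ->
  (forall x, Z (inl x) !=set0) ->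
  (forall x y, x != y -> Z (inl x) `&` Z (inl y) = set0) ->
  (forall x E, E \in Es -> x \notin E -> Z (inl x) `&` Z (inr E) = set0) ->
  (forall E F, E \in Es -> F \in Es -> E != F -> Z (inr E) `&` Z (inr F) = set0) ->
  (forall x E, E \in Es -> x \in E -> Z (inl x) `&` Z (inr E) !=set0) ->
  Z (inl top) p0 -> p0.2 = 0 ->
  exists N Y, smodel Es (@gadj N) Y /\ touches_top (Y (inl top)).
Proof.
move=> EE Zc Z0 Zv ZvE ZE Zin tp0 p00.
have dP (ab : (Q + {set Q}) * (Q + {set Q})) : exists d : R, 0 < d /\
    (valid Es ab.1 -> valid Es ab.2 -> Z ab.1 `&` Z ab.2 = set0 ->
      forall p q, Z ab.1 p -> Z ab.2 q -> d <= `|p.1 - q.1| + `|p.2 - q.2|).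
  have [[va [vb ab0]]|h] := pselect (valid Es ab.1 /\ valid Es ab.2 /\ Z ab.1 `&` Z ab.2 = set0).
    have [ca _ _] := Zc _ va; have [cb _ _] := Zc _ vb.
    by have [d d0 dE] := apart ca cb ab0; exists d.
  by exists 1; split => // va vb ab0; case: h.
have [d {}dP] := choose_fun dP.
pose n ab := Num.bound (3 / d ab); pose N := (\max_ab n ab).+1.
have dN ab : 3 < N%:R * d ab.
  have [d0 _] := dP ab; rewrite -ltr_pdivrMr //; apply: lt_le_trans (archi_boundP _) _.
    by rewrite divr_ge0 // ltW.
  by rewrite ler_nat; apply: leqW; exact: leq_bigmax.
pose C a := cells N (Z a).
have far a b c c' : valid Es a -> valid Es b -> Z a `&` Z b = set0 -> c \in C a -> c' \in C b ->
    c != c' /\ ~~ gadj c c'.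
  by move=> va vb ab0 ca cb; have [_ h] := dP (a, b); exact: cells_far (h va vb ab0) (dN (a, b)) ca cb.
have meet a b : valid Es a -> Z a `&` Z b !=set0 -> exists2 c, c \in C a & c \in C b.
  move=> va [p [pa pb]]; have [_ _ sa] := Zc _ va.
  have [c cp] := @square_cell N p isT (sa p pa).
  by exists c; apply/cellsP; exists p.
have cC a : valid Es a -> conn (@gadj N) (C a).
  by move=> va; have [_ ca sa] := Zc _ va; exact: cells_conn.
have IP E : exists I : {set cell N}, E \in Es -> [/\ (I \subset C (inr E))%SET, conn (@gadj N) I,
    I != finset.set0, forall x u, x \in E -> u \in I -> u \notin C (inl x) &
    forall x, x \in E -> adjS (@gadj N) (C (inl x)) I].
  case EEs : (E \in Es); last by exists finset.set0.
  have [x [y [xy Exy]]] := EE E EEs.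
  have xE : x \in E by rewrite Exy !finset.inE eqxx.
  have yE : y \in E by rewrite Exy !finset.inE eqxx orbT.
  have [c cx cE] := meet (inl x) (inr E) isT (Zin _ _ EEs xE).
  have [c' cy cE'] := meet (inl y) (inr E) isT (Zin _ _ EEs yE).
  have [||I [I1 I2 I3 I4 [I5 I6]]] := bridge (@gadj_sym N) (cC (inr E) EEs) cE cx cE' cy.
  - move=> k k1 k2.
    by have [/eqP] := far (inl x) (inl y) _ _ isT isT (Zv _ _ xy) k1 k2.
  - move=> [k [k' [k1 k2 kk]]].
    by have [_] := far (inl x) (inl y) _ _ isT isT (Zv _ _ xy) k1 k2; rewrite kk.
  exists I => _; split => //.
  - by move=> u k; rewrite Exy finset.in_set2 => /orP[]/eqP-> /I4/andP[].
  - by move=> u; rewrite Exy finset.in_set2 => /orP[]/eqP->.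
have [I {}IP] := choose_fun IP.
exists N, (fun a => match a with inl x => C (inl x) | inr E => I E end); split; first split.
- case=> [x _|E vE]; last by have [] := IP E vE.
  split; first exact: cC.
  have [p px] := Z0 x; have [_ _ sx] := Zc (inl x) isT.
  have [c cp] := @square_cell N p isT (sx p px).
  by apply/finset.set0Pn; exists c; apply/cellsP; exists p.
- have vE x E k : E \in Es -> k \in C (inl x) -> k \in I E -> False.
    move=> EEs kx kE; have [sE _ _ dE _] := IP E EEs.
    case xE : (x \in E); first by have := dE x k xE kE; rewrite kx.
    have [] := far (inl x) (inr E) k k isT EEs; rewrite ?eqxx //.
      by apply: ZvE => //; rewrite xE.
    exact: (fintype.subsetP sE).
  move=> [x|E] [y|F] k va vb ka kb.
  + congr inl; apply/eqP/contraT => xy.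
    by have [] := far (inl x) (inl y) k k isT isT (Zv _ _ xy) ka kb; rewrite eqxx.
  + by case: (vE x F k).
  + by case: (vE y E k).
  + congr inr; apply/eqP/contraT => EF.
    have [sE _ _ _ _] := IP E va; have [sF _ _ _ _] := IP F vb.
    by have [] := far (inr E) (inr F) k k va vb (ZE _ _ va vb EF) (fintype.subsetP sE k ka) (fintype.subsetP sF k kb); rewrite eqxx.
- by move=> x E EEs xE; have [_ _ _ _ h] := IP E EEs; exact: h.
- have [_ _ st] := Zc (inl top) isT; have [[_ h1] _] := (st p0 tp0, I).
  have [c cp] := @square_cell N p0 isT (st p0 tp0).
  (* A point at height 0 also lies in the cell of row 0, the row meant by [touches_top]. *)
  have cb : box (c.1, ord0 : 'I_N) p0.
    by case: cp => b1 b2 _ _; split => //=; rewrite p00 mulr0 // add0r.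
  by exists (c.1, ord0) => //; apply/cellsP; exists p0.
Qed.

End Cells.

(** * Arcs and continua in the plane *)

Section Plane.
Variable R : realType.
Notation plane := (R * R)%type.

Definition within_box (r : R) (c p : plane) := (`|p.1 - c.1| <= r) && (`|p.2 - c.2| <= r).

Lemma nbhs_box (A : set plane) p : nbhs p A <->
  exists2 r, 0 < r & forall q, within_box r p q -> A q.
Proof.
split=> [/nbhs_ballP[e e0 eA]|[r r0 rA]].
  exists (e / 2); first by rewrite divr_gt0.
  move=> q /andP[h1 h2]; apply: eA; split; rewrite /ball /= distrC.
    by apply: le_lt_trans h1 _; rewrite gtr_pMr // invf_lt1 // ltr1n.
  by apply: le_lt_trans h2 _; rewrite gtr_pMr // invf_lt1 // ltr1n.
apply/nbhs_ballP; exists r => // q [h1 h2]; apply: rA; rewrite /ball /= in h1 h2.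
by rewrite /within_box distrC (ltW h1) distrC (ltW h2).
Qed.

Lemma open_box (A : set plane) : open A <->
  forall p, A p -> exists2 r, 0 < r & forall q, within_box r p q -> A q.
Proof.
rewrite openE; split=> [h p Ap|h p Ap]; first by apply/nbhs_box; exact: h.
by apply/nbhs_box; exact: h.
Qed.

Lemma within_box_sym r p q : within_box r p q = within_box r q p.
Proof. by rewrite /within_box distrC (distrC q.2). Qed.

Lemma within_box_add r s p q u : within_box r p q -> within_box s q u -> within_box (r + s) p u.
Proof.
move=> /andP[a1 a2] /andP[b1 b2]; apply/andP; split.
  by rewrite -(subrKA q.1) addrC; apply: le_trans (ler_normD _ _) _; exact: lerD.
by rewrite -(subrKA q.2) addrC; apply: le_trans (ler_normD _ _) _; exact: lerD.
Qed.

Definition segment (p q : plane) : set plane :=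
  (fun t : R => (p.1 + t * (q.1 - p.1), p.2 + t * (q.2 - p.2))) @` `[0, 1].

Lemma pair_cont (T : topologicalType) (f g : T -> R) : continuous f -> continuous g ->
  continuous (fun t => (f t, g t) : plane).
Proof. by move=> cf cg t; exact: (cvg_pair (cf t) (cg t)). Qed.

Lemma seg_cont (p q : plane) :
  continuous (fun t : R => (p.1 + t * (q.1 - p.1), p.2 + t * (q.2 - p.2)) : plane).
Proof.
apply: pair_cont => t; apply: cvgD; try exact: cvg_cst; apply: cvgM; try exact: cvg_cst; exact: cvg_id.
Qed.

Lemma seg_compact p q : compact (segment p q).
Proof.
by apply: continuous_compact; [apply: continuous_subspaceT; exact: seg_cont|exact: segment_compact].
Qed.

Lemma seg_connected p q : connected (segment p q).
Proof.
by apply: connected_continuous_connected; [exact: segment_connected|apply: continuous_subspaceT; exact: seg_cont].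
Qed.

Lemma segl p q : segment p q p.
Proof. by exists 0; [rewrite /= in_itv /= lexx ler01|rewrite !mul0r !addr0; case: p]. Qed.

Lemma segr p q : segment p q q.
Proof. by exists 1; [rewrite /= in_itv /= lexx ler01|rewrite !mul1r !subrKC; case: q]. Qed.

Lemma convex_bound (t a b l u : R) : 0 <= t -> t <= 1 -> l <= a -> a <= u -> l <= b -> b <= u ->
  l <= a + t * (b - a) /\ a + t * (b - a) <= u.
Proof. by move=> t0 t1 la au lb bu; split; nra. Qed.

Lemma seg_rect p q u (l1 u1 l2 u2 : R) : segment p q u ->
  l1 <= p.1 -> p.1 <= u1 -> l2 <= p.2 -> p.2 <= u2 ->
  l1 <= q.1 -> q.1 <= u1 -> l2 <= q.2 -> q.2 <= u2 ->
  [/\ l1 <= u.1, u.1 <= u1, l2 <= u.2 & u.2 <= u2].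
Proof.
move=> [t]; rewrite /= in_itv /= => /andP[t0 t1] <- a1 a2 a3 a4 b1 b2 b3 b4 /=.
by have [] := convex_bound t0 t1 a1 a2 b1 b2; have [] := convex_bound t0 t1 a3 a4 b3 b4.
Qed.

Lemma within_boxE r c p : within_box r c p = [&& c.1 - r <= p.1, p.1 <= c.1 + r, c.2 - r <= p.2 & p.2 <= c.2 + r].
Proof.
by rewrite /within_box !ler_distl -andbA.
Qed.

Lemma seg_box r c p q u : within_box r c p -> within_box r c q -> segment p q u -> within_box r c u.
Proof.
rewrite !within_boxE => /and4P[a1 a2 a3 a4] /and4P[b1 b2 b3 b4] su.
by have [-> -> -> ->] := seg_rect su a1 a2 a3 a4 b1 b2 b3 b4.
Qed.

(** Cut at the parameters [1/3] and [2/3]; injectivity keeps the two end pieces disjoint. *)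
Lemma arc_split (A : set plane) a b : is_arc A a b -> a <> b -> exists A1 A2 M : set plane,
  [/\ [/\ compact A1, compact A2, compact M, connected A1 & connected A2 /\ connected M],
      [/\ A1 a, A2 b, A1 `&` M !=set0 & A2 `&` M !=set0],
      [/\ A1 `<=` A, A2 `<=` A & M `<=` A] &
      [/\ A1 `&` A2 = set0, ~ A1 b, ~ A2 a, ~ M a & ~ M b]].
Proof.
move=> [g [gc gi g0 g1 gA]] _.
have sub (l u : R) : 0 <= l -> u <= 1 -> `[l, u] `<=` `[0, 1].
  by move=> l0 u1 t; rewrite /= !in_itv /= => /andP[h1 h2]; rewrite (le_trans l0) // (le_trans h2).
have in01 (t : R) : 0 <= t -> t <= 1 -> t \in (`[0, 1]%classic : set R).
  by move=> *; rewrite inE /= in_itv /=; apply/andP.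
have cc (l u : R) : 0 <= l -> u <= 1 -> [/\ compact (g @` `[l, u]), connected (g @` `[l, u]) & g @` `[l, u] `<=` A].
  move=> l0 u1; have gc' : {within `[l, u], continuous g}.
    by apply: continuous_subspaceW gc; exact: sub.
  split; first by apply: continuous_compact => //; exact: segment_compact.
    by apply: connected_continuous_connected => //; exact: segment_connected.
  by rewrite -gA => _ [t /(sub l u l0 u1) h <-]; exists t.
have ginj (s t : R) : 0 <= s -> s <= 1 -> 0 <= t -> t <= 1 -> g s = g t -> s = t.
  by move=> s0 s1 t0 t1; apply: gi; exact: in01.
have mem (l u t : R) : l <= t -> t <= u -> (g @` `[l, u]) (g t).
  by move=> lt tu; exists t => //=; rewrite in_itv /= lt.
have memP (l u : R) p : (g @` `[l, u]) p -> exists t, [/\ l <= t, t <= u & g t = p].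
  by move=> [t]; rewrite /= in_itv /= => /andP[h1 h2] <-; exists t.
have [|| c1 n1 s1] := cc 0 (1/3); [lra|lra|].
have [|| c2 n2 s2] := cc (2/3) 1; [lra|lra|].
have [|| c3 n3 s3] := cc (1/3) (2/3); [lra|lra|].
exists (g @` `[0, 1/3]), (g @` `[2/3, 1]), (g @` `[1/3, 2/3]); split => //; split.
- by rewrite -g0; apply: mem; lra.
- by rewrite -g1; apply: mem; lra.
- by exists (g (1/3)); split; apply: mem; lra.
- by exists (g (2/3)); split; apply: mem; lra.
- rewrite -subset0 => p [/memP[s [h1 h2 <-]] /memP[t [h3 h4 E]]].
  by have : t = s; [apply: ginj => //; lra|lra].
- by rewrite -g1 => /memP[s [h1 h2 E]]; have : s = 1; [apply: ginj => //; lra|lra].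
- by rewrite -g0 => /memP[s [h1 h2 E]]; have : s = 0; [apply: ginj => //; lra|lra].
- by rewrite -g0 => /memP[s [h1 h2 E]]; have : s = 0; [apply: ginj => //; lra|lra].
- by rewrite -g1 => /memP[s [h1 h2 E]]; have : s = 1; [apply: ginj => //; lra|lra].
Qed.

(** Within a small box points are joined by segments, so the reachable points of [F] and the others
    both form open sets. *)
Lemma continuum (F : set plane) z q : open F -> connected F -> F z -> F q ->
  exists K : set plane, [/\ compact K, connected K, K `<=` F, K z & K q].
Proof.
move=> oF cF Fz Fq.
pose reach q := exists K : set plane, [/\ compact K, connected K, K `<=` F, K z & K q].
have ext p r u : F p -> (forall q, within_box r p q -> F q) -> within_box r p u ->
    (reach p -> reach u) /\ (reach u -> reach p).
  move=> Fp hr up; have pp : within_box r p p.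
    have := up; rewrite /within_box !subrr normr0 => /andP[h1 h2].
    by rewrite (le_trans _ h1) ?(le_trans _ h2).
  have add (K : set plane) a b : within_box r p a -> within_box r p b ->
      compact K -> connected K -> K `<=` F -> K z -> K a -> reach b.
    move=> ha hb k1 k2 k3 k4 k5; exists (K `|` segment a b); split.
    - by apply: compactU => //; exact: seg_compact.
    - by apply: connectedU => //; [exists a; split => //; exact: segl|exact: seg_connected].
    - by move=> v [/k3//|sv]; apply: hr; exact: seg_box sv.
    - by left.
    - by right; exact: segr.
  by split=> -[K [k1 k2 k3 k4 k5]]; [exact: (add K p u)|exact: (add K u p)].
pose B := [set p | F p /\ reach p].
have box p : F p -> exists2 r, 0 < r & forall q, within_box r p q -> F q.
  by move=> Fp; move/open_box : oF => /(_ p Fp).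
have oB : open B.
  apply/open_box => p [Fp rp]; have [r r0 hr] := box p Fp; exists r => // u up.
  by split; [exact: hr|have [h _] := ext p r u Fp hr up; exact: h].
have oB' : open [set p | F p /\ ~ reach p].
  apply/open_box => p [Fp rp]; have [r r0 hr] := box p Fp; exists r => // u up.
  by split; [exact: hr|move=> ru; apply: rp; have [_ h] := ext p r u Fp hr up; exact: h].
suff E : B = F by have [] : B q by rewrite E.
apply: cF.
- exists z; split => //; exists [set z]; split => //.
  + exact: compact_set1.
  + exact: connected1.
  + by move=> _ ->.
- by exists B => //; apply/seteqP; split=> p [] //; move=> h1 h2; split.
- exists (~` [set p | F p /\ ~ reach p]); first exact: open_closedC.
  apply/seteqP; split=> p [Fp h]; split => //; first by move=> [_].
  by apply: contrapT => nr; apply: h.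
Qed.

(** A clopen part of the new set that contains [S] becomes, together with [B], a clopen part of [K],
    so it is everything. A clopen part that does not contain [S] misses it, and its complement is
    used instead. *)
Lemma puncture (K B S : set plane) z : connected K -> K z -> B z -> open B -> connected S ->
  closed (B `|` S) -> S !=set0 -> connected ((K `\` B) `|` S).
Proof.
move=> cK Kz Bz oB cS cBS S0; set X := _ `|` _.
have main (U C O : set plane) : open O -> closed C -> U = X `&` O -> U = X `&` C -> S `<=` U -> U = X.
  move=> oO cC UO UC SU; apply/seteqP; split; first by rewrite UO => p [].
  have E : K `&` (U `|` B) = K.
    apply: cK; first by exists z; split => //; right.
    - exists (O `|` B); first exact: openU.
      apply/seteqP; split=> p [Kp [h|h]]; split => //; try by right.
        by left; move: h; rewrite UO => -[].
      have [Bp|nB] := pselect (B p); first by right.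
      by left; rewrite UO; split => //; left.
    - exists (C `|` (B `|` S)); first exact: closedU.
      apply/seteqP; split=> p [Kp h]; split => //.
        by case: h => h; [left; move: h; rewrite UC => -[]|right; left].
      have [Bp|nB] := pselect (B p); first by right.
      left; case: h => [Cp|[//|Sp]]; last exact: SU.
      by rewrite UC; split => //; left.
  move=> p [[Kp nB]|Sp]; last exact: SU.
  by move: Kp; rewrite -E => -[_ []].
move=> U U0 [] O oO UO [C cC UC].
have [SU|nSU] := pselect (S `<=` U); first exact: main UO UC SU.
have SX : S `<=` X by move=> p Sp; right.
have SU0 : S `&` U = set0.
  apply: contrapT => /eqP/set0P ne; apply: nSU.
  suff <- : S `&` U = S by move=> p [].
  apply: cS => //.
  - exists O => //; rewrite UO; apply/seteqP; split=> p [Sp]; first by case.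
    by move=> Op; split => //; split => //; right.
  - exists C => //; rewrite UC; apply/seteqP; split=> p [Sp]; first by case.
    by move=> Cp; split => //; split => //; right.
have : X `\` U = X.
  apply: (main _ (~` O) (~` C)).
  - exact: closed_openC.
  - exact: open_closedC.
  - by rewrite UC; apply/seteqP; split=> p [Xp h]; split => //; [move=> Cp; apply: h; split|move=> []].
  - by rewrite UO; apply/seteqP; split=> p [Xp h]; split => //; [move=> Cp; apply: h; split|move=> []].
  - by move=> p Sp; split; [exact: SX|move=> Up; have : (S `&` U) p by []; rewrite SU0].
move=> E; case: U0 => p Up; have Xp : X p by move: Up; rewrite UO => -[].
by move: Xp; rewrite -E => -[].
Qed.

End Plane.

(** * Inversion at a point of the distinguished face *)

Section Inversion.
Variable R : realType.
Notation plane := (R * R)%type.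
Variables (z : plane) (d : R).
Hypothesis d0 : 0 < d.

Definition sqn (p : plane) : R := (p.1 - z.1) ^+ 2 + (p.2 - z.2) ^+ 2.
(** Scaled so that all points with [far_from] land in the unit square; the sign of the second
    coordinate sends [(z.1, z.2 + d)] to height 0. *)
Definition inversion (p : plane) : plane :=
  (1 / 2 + d * (p.1 - z.1) / (2 * sqn p), 1 / 2 - d * (p.2 - z.2) / (2 * sqn p)).
Definition far_from (p : plane) := (d <= `|p.1 - z.1|) || (d <= `|p.2 - z.2|).

Lemma sqn_far p : far_from p ->
  [/\ d * `|p.1 - z.1| <= sqn p, d * `|p.2 - z.2| <= sqn p & 0 < sqn p].
Proof.
rewrite /sqn -[(p.1 - z.1) ^+ 2]real_normK ?num_real // -[(p.2 - z.2) ^+ 2]real_normK ?num_real //.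
rewrite /far_from; have := normr_ge0 (p.1 - z.1); have := normr_ge0 (p.2 - z.2).
have aux (a b : R) : 0 <= b -> d <= a ->
    [/\ d * a <= a ^+ 2 + b ^+ 2, d * b <= a ^+ 2 + b ^+ 2 & 0 < a ^+ 2 + b ^+ 2].
  move=> b0 da; have a0 : 0 < a by exact: lt_le_trans da.
  have k1 : d * a <= a ^+ 2 by rewrite expr2 ler_wpM2r // ltW.
  have k2 : d * b <= a * b by rewrite ler_wpM2r.
  have k3 := sqr_ge0 (a - b); rewrite sqrrB -mulr_natl in k3.
  have k4 : 0 < a ^+ 2 by rewrite exprn_gt0.
  by have k5 := sqr_ge0 b; split; lra.
move=> b0 a0 /orP[]/aux; first by move=> /(_ _ b0).
by move=> /(_ _ a0)[k1 k2 k3]; split; lra.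
Qed.

Lemma inversion_square p : far_from p -> square (inversion p).
Proof.
move=> /sqn_far[h1 h2 n0].
have h (x : R) : d * `|x| <= sqn p -> `|d * x / (2 * sqn p)| <= 1 / 2.
  move=> hx; rewrite normrM normrM (gtr0_norm d0) normfV [`|2 * _|]gtr0_norm ?mulr_gt0 //.
  by rewrite ler_pdivrMr ?mulr_gt0 //; lra.
have := h _ h1; have := h _ h2; rewrite !ler_norml => /andP[a1 a2] /andP[b1 b2].
by split; apply/andP; split; rewrite /=; lra.
Qed.

(** The image determines both coordinate differences divided by [sqn], and their squares add up to
    the inverse of [sqn]. *)
Lemma inversion_inj p q : far_from p -> far_from q -> inversion p = inversion q -> p = q.
Proof.
move=> /sqn_far[_ _ n0] /sqn_far[_ _ m0] [E1 E2].
have e1 : (p.1 - z.1) / sqn p = (q.1 - z.1) / sqn q.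
  move/addrI: E1; move: (p.1 - z.1) (q.1 - z.1) => x y E.
  have -> : x / sqn p = 2 / d * (d * x / (2 * sqn p)) by field; rewrite !gt_eqF.
  by rewrite E; field; rewrite !gt_eqF.
have e2 : (p.2 - z.2) / sqn p = (q.2 - z.2) / sqn q.
  move/addrI/oppr_inj: E2; move: (p.2 - z.2) (q.2 - z.2) => x y E.
  have -> : x / sqn p = 2 / d * (d * x / (2 * sqn p)) by field; rewrite !gt_eqF.
  by rewrite E; field; rewrite !gt_eqF.
have nV p' : 0 < sqn p' -> (sqn p')^-1 = ((p'.1 - z.1) / sqn p') ^+ 2 + ((p'.2 - z.2) / sqn p') ^+ 2.
  move=> p0; rewrite !expr_div_n -mulrDl -/(sqn p') expr2 invfM mulrA divff ?mul1r //.
  by rewrite gt_eqF.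
have En : sqn p = sqn q by apply: invr_inj; rewrite (nV p n0) (nV q m0) e1 e2.
have m1 : sqn q != 0 by rewrite gt_eqF.
move: e1 e2; rewrite En => /(mulIf (invr_neq0 m1))/addIr k1 /(mulIf (invr_neq0 m1))/addIr k2.
by move: p q k1 k2 {n0 m0 E1 E2 En m1} => [? ?] [? ?] /= -> ->.
Qed.

Lemma inversion_cont (A : set plane) : (forall p, A p -> far_from p) -> {within A, continuous inversion}.
Proof.
move=> Af; apply: continuous_in_subspaceT => p; rewrite inE => Ap.
have [_ _ n0] := sqn_far (Af p Ap).
have c1 : {for p, continuous (fun p : plane => p.1 - z.1)} by apply: cvgB; [exact: cvg_fst|exact: cvg_cst].
have c2 : {for p, continuous (fun p : plane => p.2 - z.2)} by apply: cvgB; [exact: cvg_snd|exact: cvg_cst].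
have cn : {for p, continuous (fun p : plane => (2 * sqn p)^-1)}.
  apply: cvgV; first by rewrite mulf_neq0 // gt_eqF.
  apply: cvgM; first exact: cvg_cst.
  by apply: cvgD; apply: cvgM.
have k1 : {for p, continuous (fun p : plane => 1 / 2 + d * (p.1 - z.1) / (2 * sqn p))}.
  apply: cvgD; first exact: cvg_cst.
  by apply: cvgM => //; apply: cvgM => //; exact: cvg_cst.
have k2 : {for p, continuous (fun p : plane => 1 / 2 - d * (p.2 - z.2) / (2 * sqn p))}.
  apply: cvgB; first exact: cvg_cst.
  by apply: cvgM => //; apply: cvgM => //; exact: cvg_cst.
exact: (cvg_pair k1 k2).
Qed.

Lemma inversion_disjoint (A B : set plane) : (forall p, A p -> far_from p) ->
  (forall p, B p -> far_from p) -> A `&` B = set0 -> inversion @` A `&` inversion @` B = set0.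
Proof.
move=> Af Bf AB; rewrite -subset0 => _ [[p Ap <-] [q Bq E]].
have E' := inversion_inj (Bf q Bq) (Af p Ap) E; rewrite E' in Bq.
by have : (A `&` B) p by []; rewrite AB.
Qed.

Lemma inversion_top : far_from (z.1, z.2 + d) /\ (inversion (z.1, z.2 + d)).2 = 0.
Proof.
have E : z.2 + d - z.2 = d by ring.
split; first by rewrite /far_from /= E (gtr0_norm d0) lexx orbT.
by rewrite /= /sqn /= subrr E expr0n add0r; field; rewrite !gt_eqF.
Qed.

Lemma discretize_plane (Q : finType) (Es : {set {set Q}}) (Z : Q + {set Q} -> set plane) top :
  (forall E, E \in Es -> exists x y, x != y /\ E = [set x; y]%SET) ->
  (forall a, valid Es a -> [/\ compact (Z a), connected (Z a) & forall p, Z a p -> far_from p]) ->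
  (forall x, Z (inl x) !=set0) ->
  (forall x y, x != y -> Z (inl x) `&` Z (inl y) = set0) ->
  (forall x E, E \in Es -> x \notin E -> Z (inl x) `&` Z (inr E) = set0) ->
  (forall E F, E \in Es -> F \in Es -> E != F -> Z (inr E) `&` Z (inr F) = set0) ->
  (forall x E, E \in Es -> x \in E -> Z (inl x) `&` Z (inr E) !=set0) ->
  Z (inl top) (z.1, z.2 + d) ->
  exists N Y, smodel Es (@gadj N) Y /\ touches_top (Y (inl top)).
Proof.
move=> EE Zc Z0 Zv ZvE ZE Zin tp.
have zf a : valid Es a -> forall p, Z a p -> far_from p by move=> /Zc[].
have [_ t0] := inversion_top.
apply: (@discretize R Q Es (fun a => inversion @` Z a) top (inversion (z.1, z.2 + d))) => //.
- move=> a /Zc[c1 c2 c3]; split.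
  + by apply: continuous_compact => //; exact: inversion_cont.
  + by apply: connected_continuous_connected => //; exact: inversion_cont.
  + by move=> _ [p Zp <-]; apply: inversion_square; exact: c3.
- by move=> x; have [p Zp] := Z0 x; exists (inversion p); exists p.
- by move=> x y xy; apply: inversion_disjoint (Zv x y xy); exact: zf.
- by move=> x E ES xE; apply: inversion_disjoint (ZvE x E ES xE); exact: zf.
- by move=> E G ES GS EG; apply: inversion_disjoint (ZE E G ES GS EG); exact: zf.
- by move=> x E ES xE; have [p [Zp Zp']] := Zin x E ES xE; exists (inversion p); split; exists p.
Qed.

End Inversion.

Section Tools.
Variable R : realType.
Notation plane := (R * R)%type.

Lemma compact_fin (T : topologicalType) (I : finType) (P : pred I) (F : I -> set T) :
  (forall i, P i -> compact (F i)) -> compact [set p | exists2 i, P i & F i p].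
Proof.
move=> cF; have -> : [set p | exists2 i, P i & F i p] = \big[setU/set0]_(i <- enum P) F i.
  rewrite -bigcup_seq; apply/seteqP; split=> p [i Pi Fp]; exists i => //.
    by rewrite /= mem_enum.
  by move: Pi; rewrite /= mem_enum.
rewrite big_seq; apply: bigsetU_compact => i; rewrite mem_enum => Pi; exact: cF.
Qed.

Lemma star_continuum (I : finType) (P : pred I) (F : I -> set plane) z :
  (forall i, P i -> [/\ compact (F i), connected (F i) & F i z]) ->
  let U := [set p | p = z \/ exists2 i, P i & F i p] in compact U /\ connected U.
Proof.
move=> hF U; split.
  have -> : U = [set z] `|` [set p | exists2 i, P i & F i p] by [].
  by apply: compactU; [exact: compact_set1|apply: compact_fin => i /hF[]].
have -> : U = \bigcup_(o in [set o : option I | if o is Some i then P i else true])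
    (if o is Some i then F i else [set z]).
  apply/seteqP; split=> p.
    by move=> [->|[i Pi Fp]]; [exists None|exists (Some i)].
  by move=> [[i|] /= Pi Fp]; [right; exists i|left].
apply: bigcup_connected.
  by exists z => -[i|] //= Pi; have [] := hF i Pi.
by move=> [i|] /= Pi; [have [] := hF i Pi|exact: connected1].
Qed.

Lemma fin_radius (I : finType) (P : I -> R -> Prop) :
  (forall i, exists2 d : R, 0 < d & forall r, 0 < r -> r <= d -> P i r) ->
  exists2 d : R, 0 < d & forall i r, 0 < r -> r <= d -> P i r.
Proof.
move=> h; have h' i : exists d : R, 0 < d /\ forall r, 0 < r -> r <= d -> P i r.
  by have [d d0 hd] := h i; exists d.
have [f fP] := choose_fun h'.
pose n i := Num.bound (f i)^-1; pose N := (\max_i n i).+1.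
exists N%:R^-1; first by rewrite invr_gt0 ltr0n.
move=> i r r0 rN; have [f0 hf] := fP i; apply: hf => //; apply: le_trans rN _.
rewrite -[leRHS]invrK lef_pV2 ?posrE ?invr_gt0 ?ltr0n //.
apply: le_trans (ltW (archi_boundP _)) _; first by rewrite invr_ge0 ltW.
by rewrite ler_nat; apply: leqW; exact: leq_bigmax.
Qed.

Lemma apart_box (A : set plane) p : compact A -> ~ A p ->
  exists2 d : R, 0 < d & forall r, 0 < r -> r <= d -> forall q, within_box (2 * r) p q -> ~ A q.
Proof.
move=> cA nA; have [|d d0 hd] := apart (@compact_set1 _ p) cA.
  by rewrite -subset0 => _ [-> /nA].
exists (d / 5); first by rewrite divr_gt0.
move=> r r0 rd q /andP[h1 h2] Aq; have := hd p q erefl Aq.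
by rewrite distrC (distrC p.2); lra.
Qed.

Section Frame.
Variables (z : plane) (d : R).
Hypothesis d0 : 0 < d.

Definition frame : set plane :=
  segment (z.1 - d, z.2 - d) (z.1 + d, z.2 - d) `|` segment (z.1 + d, z.2 - d) (z.1 + d, z.2 + d) `|`
  segment (z.1 - d, z.2 + d) (z.1 + d, z.2 + d) `|` segment (z.1 - d, z.2 - d) (z.1 - d, z.2 + d).
Definition open_square : set plane := [set p | `|p.1 - z.1| < d /\ `|p.2 - z.2| < d].

Lemma seg_h (x1 x2 y x : R) : x1 < x2 -> x1 <= x -> x <= x2 -> segment (x1, y) (x2, y) (x, y).
Proof.
move=> h h1 h2; exists ((x - x1) / (x2 - x1)).
  rewrite /= in_itv /=; apply/andP; split; first by rewrite divr_ge0 // subr_ge0 // ltW.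
  by rewrite ler_pdivrMr ?subr_gt0 // mul1r lerD2r.
by rewrite /= subrr mulr0 addr0 divfK ?subr_eq0 ?gt_eqF // subrKC.
Qed.

Lemma seg_v (x y1 y2 y : R) : y1 < y2 -> y1 <= y -> y <= y2 -> segment (x, y1) (x, y2) (x, y).
Proof.
move=> h h1 h2; exists ((y - y1) / (y2 - y1)).
  rewrite /= in_itv /=; apply/andP; split; first by rewrite divr_ge0 // subr_ge0 // ltW.
  by rewrite ler_pdivrMr ?subr_gt0 // mul1r lerD2r.
by rewrite /= subrr mulr0 addr0 divfK ?subr_eq0 ?gt_eqF // subrKC.
Qed.

Lemma frame_compact : compact frame.
Proof. by do 3! (apply: compactU; last exact: seg_compact); exact: seg_compact. Qed.

Lemma frame_connected : connected frame.
Proof.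
apply: connectedU; last exact: seg_connected.
  by exists (z.1 - d, z.2 - d); split; [left; left; exact: segl|exact: segl].
apply: connectedU; last exact: seg_connected.
  by exists (z.1 + d, z.2 + d); split; [right; exact: segr|exact: segr].
apply: connectedU; try exact: seg_connected.
by exists (z.1 + d, z.2 - d); split; [exact: segr|exact: segl].
Qed.

Lemma seg_hP (x1 x2 y : R) p : x1 <= x2 -> segment (x1, y) (x2, y) p ->
  [/\ x1 <= p.1, p.1 <= x2 & p.2 = y].
Proof.
move=> h [t]; rewrite /= in_itv /= => /andP[t0 t1] <- /=.
by have [] := convex_bound t0 t1 (lexx x1) h h (lexx x2); rewrite subrr mulr0 addr0.
Qed.

Lemma seg_vP (x y1 y2 : R) p : y1 <= y2 -> segment (x, y1) (x, y2) p ->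
  [/\ y1 <= p.2, p.2 <= y2 & p.1 = x].
Proof.
move=> h [t]; rewrite /= in_itv /= => /andP[t0 t1] <- /=.
by have [] := convex_bound t0 t1 (lexx y1) h h (lexx y2); rewrite subrr mulr0 addr0.
Qed.

Lemma frame_bound p : frame p -> within_box d z p /\ far_from z d p.
Proof.
rewrite within_boxE /far_from !ler_normr => h.
have dp := d0; have hl (x : R) : x - d <= x + d by lra.
by case: h => [[[/seg_hP|/seg_vP]|/seg_hP]|/seg_vP] /(_ (hl _))[h1 h2 ->];
  split; lra.
Qed.

Lemma square_frame p : within_box d z p -> open_square p \/ frame p.
Proof.
have dp := d0; case: p => x y; rewrite within_boxE /= => /and4P[a1 a2 a3 a4].
have [h1|h1] := ltP `|x - z.1| d; last first.
  right; have [h|h] := leP (z.1) x.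
    have -> : x = z.1 + d by move: h1; rewrite ler_normr => /orP[]; lra.
    by left; left; right; apply: seg_v; lra.
  have -> : x = z.1 - d by move: h1; rewrite ler_normr => /orP[]; lra.
  by right; apply: seg_v; lra.
have [h2|h2] := ltP `|y - z.2| d; first by left.
right; have [h|h] := leP (z.2) y.
  have -> : y = z.2 + d by move: h2; rewrite ler_normr => /orP[]; lra.
  by left; right; apply: seg_h; lra.
have -> : y = z.2 - d by move: h2; rewrite ler_normr => /orP[]; lra.
by left; left; left; apply: seg_h; lra.
Qed.

Lemma open_square_open : open open_square.
Proof.
apply/open_box => p [h1 h2]; exists (Num.min (d - `|p.1 - z.1|) (d - `|p.2 - z.2|) / 2).
  by rewrite divr_gt0 // lt_min !subr_gt0 h1.
move=> q; rewrite /within_box => /andP[k1 k2].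
have m1 : Num.min (d - `|p.1 - z.1|) (d - `|p.2 - z.2|) <= d - `|p.1 - z.1| by rewrite ge_min lexx.
have m2 : Num.min (d - `|p.1 - z.1|) (d - `|p.2 - z.2|) <= d - `|p.2 - z.2| by rewrite ge_min lexx orbT.
have t1 : `|q.1 - z.1| <= `|q.1 - p.1| + `|p.1 - z.1| by rewrite -(subrKA p.1); exact: ler_normD.
have t2 : `|q.2 - z.2| <= `|q.2 - p.2| + `|p.2 - z.2| by rewrite -(subrKA p.2); exact: ler_normD.
by split; lra.
Qed.

Lemma square_closed : closed (open_square `|` frame).
Proof.
have -> : open_square `|` frame = [set p | within_box d z p].
  apply/seteqP; split=> p; last exact: square_frame.
  by case=> [[h1 h2]|/frame_bound[]//]; rewrite /= /within_box !ltW.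
rewrite -[X in closed X]setCK; apply: open_closedC; apply/open_box => p /negP.
have cl (a b : R) : d < `|a - b| -> exists2 r, 0 < r & forall c, `|c - a| <= r -> d < `|c - b|.
  move=> h; exists ((`|a - b| - d) / 2); first by rewrite divr_gt0 // subr_gt0.
  move=> c hc; have : `|a - b| <= `|a - c| + `|c - b| by rewrite -(subrKA c); exact: ler_normD.
  by rewrite distrC in hc; lra.
rewrite negb_and -!ltNge => /orP[]/cl[r r0 hr]; exists r => // q /andP[h1 h2] /andP[k1 k2].
  by have := hr _ h1; rewrite ltNge k1.
by have := hr _ h2; rewrite ltNge k2.
Qed.

End Frame.
End Tools.

(** * Connected sets for the graph with an apex in the face *)

Section Embedding.
Variables (R : realType) (H : sgraph) (D : planar_embedding R H).
Notation plane := (R * R)%type.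

Lemma is_arc_compact (A : set plane) a b : is_arc A a b -> compact A.
Proof.
move=> [g [gc _ _ _ <-]]; apply: continuous_compact => //; exact: segment_compact.
Qed.

Lemma edge_ends E : E \in edges H -> exists x y : H, adj x y /\ E = [set x; y]%SET.
Proof. by case/imsetP => -[x y]; rewrite finset.inE /= => xy ->; exists x, y. Qed.

Lemma drawing_closed : closed (drawing D).
Proof.
apply: compact_closed; first exact: norm_hausdorff.
have -> : drawing D = [set p | exists2 v, predT v & [set point D v] p] `|`
    [set p | exists2 E, E \in edges H & edge_arc D E p].
  by rewrite /drawing; congr (_ `|` _); apply/seteqP; split=> p [v]; [move=> _ <-; exists v|move=> _ ->; exists v].
apply: compactU; apply: compact_fin; first by move=> v _; exact: compact_set1.
move=> E EE; have [x [y [xy ->]]] := edge_ends EE; exact: is_arc_compact (edge_arcP D xy).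
Qed.

(* Every arc is cut into two end pieces [T.1 v] and a middle piece [T.2]. *)
Lemma pieces_of_arc E : exists T : (H -> set plane) * set plane, E \in edges H ->
  [/\ forall v, v \in E -> [/\ compact (T.1 v), connected (T.1 v), T.1 v (point D v),
        T.1 v `&` T.2 !=set0 & T.1 v `<=` edge_arc D E],
      [/\ compact T.2, connected T.2, T.2 `<=` edge_arc D E & forall w, ~ T.2 (point D w)],
      forall v w, v \in E -> T.1 v (point D w) -> w = v &
      forall v w, v \in E -> w \in E -> v != w -> T.1 v `&` T.1 w = set0].
Proof.
case EE : (E \in edges H); last by exists (fun=> set0, set0).
have [x [y [xy Exy]]] := edge_ends EE.
have xny : x != y by apply: contraTneq xy => ->; rewrite adj_irrefl.
have av z : edge_arc D E (point D z) -> z = x \/ z = y.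
  by move=> /(edge_arc_vertex EE); rewrite Exy finset.in_set2 => /orP[]/eqP->; [left|right].
have arc := edge_arcP D xy; rewrite -Exy in arc.
have [|A1 [A2 [M [[c1 c2 c3 n1 [n2 n3]] [m1 m2 m3 m4] [s1 s2 s3] [e1 e2 e3 e4 e5]]]]] := arc_split arc.
  by move=> /point_inj E'; rewrite E' eqxx in xny.
exists (fun v => if v == x then A1 else A2, M) => _ /=; split.
- move=> v; rewrite {1}Exy finset.in_set2 => /orP[]/eqP->; first by rewrite eqxx; split.
  by rewrite [y == x]eq_sym (negPf xny); split.
- by split => // w Mw; case: (av w (s3 _ Mw)) => E'; rewrite E' in Mw.
- move=> v w; rewrite Exy finset.in_set2 => /orP[]/eqP->.
    rewrite eqxx => h; case: (av w (s1 _ h)) => // E'; by rewrite E' in h.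
  rewrite [y == x]eq_sym (negPf xny) => h; case: (av w (s2 _ h)) => // E'; by rewrite E' in h.
- move=> v w; rewrite Exy !finset.in_set2 => /orP[]/eqP-> /orP[]/eqP->; rewrite ?eqxx //.
    by rewrite [y == x]eq_sym (negPf xny).
  by rewrite [y == x]eq_sym (negPf xny) setIC.
Qed.

Section Face.
Variables (F : set plane) (hi : {set H}).
Hypothesis hF : face D F.
Hypothesis hiF : forall v, v \in hi -> lies_on D v F.

Lemma face_grow (S : set plane) p : connected S -> S p -> F p -> S `<=` ~` drawing D -> S `<=` F.
Proof.
move: hF => [z nz ->] cS Sp Fp SD.
have h : connected_component (~` drawing D) z `|` S `<=` connected_component (~` drawing D) z.
  apply: connected_component_max.
  - by left; exact: connected_component_refl.
  - by rewrite subUset; split => //; exact: connected_component_sub.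
  - by apply: connectedU => //; [exists p|exact: component_connected].
by move=> q Sq; apply: h; right.
Qed.

Lemma face_sub : F `<=` ~` drawing D.
Proof. by move: hF => [z nz ->]; exact: connected_component_sub. Qed.

Lemma face_open : open F.
Proof.
apply/open_box => p Fp.
have /open_box/(_ p (face_sub Fp))[r r0 hr] : open (~` drawing D).
  by apply: closed_openC; exact: drawing_closed.
exists r => // q pq; apply: (@face_grow (segment p q) p) => //.
- exact: seg_connected.
- exact: segl.
- move=> u su; apply: hr; apply: seg_box su => //.
  by rewrite /within_box !subrr normr0 ltW.
- exact: segr.
Qed.

(** The apex is a continuum in the face from [z] to points [q v] close to the vertices of [hi]; near
    [z] a square is replaced by its frame, which keeps it away from the centre of inversion. The
    apex edge at [v] is the segment from [q v] to the vertex. It may leave the face, but so close to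
    [v] it can meet only the sets of its own two ends, which is allowed. Hence it is enough that the
    vertex lies in the closure of the face. *)
Lemma planar_apex : exists N Y, smodel (apex_edges (edges H) hi) (@gadj N) Y /\
  touches_top (Y (inl None)).
Proof.
have [T TP] := choose_fun pieces_of_arc.
have [z Fz] : exists z, F z.
  by move: hF => [z nz ->]; exists z; exact: connected_component_refl.
have cF : connected F by move: hF => [z' nz ->]; exact: component_connected.
pose M E := (T E).2.
(* A vertex takes the end pieces of its arcs and leaves the middle pieces to the edges, so that
   edges with a common end become disjoint. *)
pose K v := [set p | p = point D v \/ exists2 E, (E \in edges H) && (v \in E) & (T E).1 v p].
have Kc v : compact (K v) /\ connected (K v).
  apply: star_continuum => E /andP[EE vE].
  by have [/(_ v vE)[]] := TP E EE.
have MP E : E \in edges H -> [/\ compact (M E), connected (M E), M E `<=` edge_arc D E & forall w, ~ M E (point D w)].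
  by move=> EE; have [_ []] := TP E EE.
have Kv v : K v (point D v) by left.
have KD v : K v `<=` drawing D.
  move=> p [->|[E /andP[EE vE] Tp]]; first by left; exists v.
  right; exists E => //; have [/(_ v vE)[_ _ _ _ sub] _ _ _] := TP E EE; exact: sub.
have MD E : E \in edges H -> M E `<=` drawing D.
  by move=> EE p Mp; right; exists E => //; have [_ _ sub _] := MP E EE; exact: sub.
have arcs E G p : E \in edges H -> G \in edges H -> E != G -> edge_arc D E p -> edge_arc D G p ->
    exists w, point D w = p.
  by move=> EE GE EG h1 h2; have [w _ <-] := edge_arc_disjoint EE GE EG (conj h1 h2); exists w.
have Kpt v w : K v (point D w) -> w = v.
  move=> [/point_inj//|[E /andP[EE vE] Tp]].
  by have [_ _ /(_ v w vE Tp)] := TP E EE.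
have KK v w : v != w -> K v `&` K w = set0.
  move=> vw; rewrite -subset0 => p [k1 k2].
  case: (k1) => [E|[E /andP[EE vE] Tp]].
    by move: k2; rewrite E => /Kpt E'; rewrite E' eqxx in vw.
  case: (k2) => [E'|[G /andP[GE wG] Tp']].
    by move: k1; rewrite E' => /Kpt E''; rewrite E'' eqxx in vw.
  have [EG|EG] := eqVneq E G.
    subst G; have [_ _ _ /(_ v w vE wG vw) E0] := TP E EE.
    by have : ((T E).1 v `&` (T E).1 w) p by []; rewrite E0.
  have [/(_ v vE)[_ _ _ _ sE] _ _ _] := TP E EE; have [/(_ w wG)[_ _ _ _ sG] _ _ _] := TP G GE.
  have [u up] := arcs E G p EE GE EG (sE _ Tp) (sG _ Tp'); subst p.
  by move: k1 k2 => /Kpt -> /Kpt E'; rewrite E' eqxx in vw.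
have KM v E : E \in edges H -> v \notin E -> K v `&` M E = set0.
  move=> EE vE; rewrite -subset0 => p [[E'|[G /andP[GE vG] Tp]] Mp].
    by have [_ _ _ /(_ v)] := MP E EE; rewrite -E'.
  have GE' : G != E by apply: contraNneq vE => <-.
  have [/(_ v vG)[_ _ _ _ sG] _ _ _] := TP G GE; have [_ _ sE nE] := MP E EE.
  by have [u up] := arcs G E p GE EE GE' (sG _ Tp) (sE _ Mp); subst p; exact: nE Mp.
have KMin v E : E \in edges H -> v \in E -> K v `&` M E !=set0.
  move=> EE vE; have [/(_ v vE)[_ _ _ [p [p1 p2]] _] _ _ _] := TP E EE.
  by exists p; split => //; right; exists E => //; rewrite EE.
have MM E G : E \in edges H -> G \in edges H -> E != G -> M E `&` M G = set0.
  move=> EE GE EG; rewrite -subset0 => p [m1 m2].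
  have [_ _ sE nE] := MP E EE; have [_ _ sG _] := MP G GE.
  by have [u up] := arcs E G p EE GE EG (sE _ m1) (sG _ m2); subst p; exact: nE m1.
have [d1 d10 h1] : exists2 d : R, 0 < d & forall r, 0 < r -> r <= d -> forall q, within_box (3 * r) z q -> F q.
  have /open_box/(_ z Fz)[r r0 hr] := face_open.
  exists (r / 3); first by rewrite divr_gt0.
  move=> s s0 sr q /andP[a1 a2]; apply: hr; apply/andP; split; lra.
have [d2 d20 h2] : exists2 d : R, 0 < d & forall vw : H * H, forall r, 0 < r -> r <= d ->
    vw.1 != vw.2 -> forall q, within_box (2 * r) (point D vw.1) q -> ~ K vw.2 q.
  apply: fin_radius => -[v w] /=; have [E|vw] := eqVneq v w; first by exists 1.
  have [cK _] := Kc w.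
  by have [|d d0 hd] := apart_box cK (p := point D v); [move=> /Kpt E; rewrite E eqxx in vw|exists d => // s s0 sd _; exact: hd].
have [d3 d30 h3] : exists2 d : R, 0 < d & forall vE : H * {set H}, forall r, 0 < r -> r <= d ->
    vE.2 \in edges H -> forall q, within_box (2 * r) (point D vE.1) q -> ~ M vE.2 q.
  apply: fin_radius => -[v E] /=; case EE : (E \in edges H); last by exists 1.
  have [cM _ _ nM] := MP E EE.
  by have [|d d0 hd] := apart_box cM (p := point D v); [exact: nM|exists d => // s s0 sd _; exact: hd].
(* The factor 3 keeps the drawing, and segments starting at its vertices, away from the square at
   [z]; the factor 2 excludes that the segments at two vertices meet. *)
pose r := Num.min d1 (Num.min d2 d3).
have r0 : 0 < r by rewrite !lt_min d10 d20.
have [r1 r2 r3] : [/\ r <= d1, r <= d2 & r <= d3] by rewrite !ge_min !lexx !orbT.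
have {}h1 := h1 r r0 r1.
have {}h2 v w q : v != w -> within_box (2 * r) (point D v) q -> ~ K w q.
  by move=> vw; apply: (h2 (v, w) r r0 r2 vw).
have {}h3 v E q : E \in edges H -> within_box (2 * r) (point D v) q -> ~ M E q.
  by move=> EE; apply: (h3 (v, E) r r0 r3 EE).
have wide s t p q : within_box s p q -> s <= t -> within_box t p q.
  by move=> /andP[a1 a2] st; apply/andP; split; lra.
have outside p : drawing D p -> ~ within_box (3 * r) z p.
  by move=> Dp /h1/face_sub.
have far3 p : ~ within_box r z p -> far_from z r p.
  move=> /negP; rewrite negb_and -!ltNge => /orP[]/ltW h; by rewrite /far_from h ?orbT.
have qP v : exists q, F q /\ (v \in hi -> within_box r (point D v) q).
  case vh : (v \in hi); last by exists z.
  have [|q [Fq qv]] := hiF vh (B := [set q | within_box r (point D v) q]).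
    by apply/nbhs_box; exists r.
  by exists q.
have [q {}qP] := choose_fun qP.
pose L v := segment (q v) (point D v).
have cen p : within_box r p p by rewrite /within_box !subrr normr0 ltW.
have Lbox v p : v \in hi -> L v p -> within_box r (point D v) p.
  by move=> vh; apply: seg_box => //; have [_ /(_ vh)] := qP v.
have Lout v p : v \in hi -> L v p -> ~ within_box r z p.
  move=> vh /(Lbox _ _ vh) vp zp; apply: (outside (point D v)); first by left; exists v.
  have := within_box_add zp (_ : within_box r p (point D v)); rewrite within_box_sym => /(_ vp) h.
  apply: wide h _; lra.
have CP v : exists C : set plane, [/\ compact C, connected C, C `<=` F, C z & C (q v)].
  by have [Fq _] := qP v; exact: continuum face_open cF Fz Fq.
have [C {}CP] := choose_fun CP.
have [cC nC] : compact [set p | p = z \/ exists2 v, predT v & C v p] /\ connected [set p | p = z \/ exists2 v, predT v & C v p].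
  by apply: star_continuum => v _; have [] := CP v.
set K0 := [set p | _] in cC nC.
pose Kw := (K0 `\` open_square z r) `|` frame z r.
have osz : open_square z r z by rewrite /open_square /= !subrr normr0.
have KwF : Kw `<=` F.
  move=> p [[[->//|[v _ Cp]] _]|/(frame_bound r0)[zp _]].
    by have [_ _ sub _ _] := CP v; exact: sub.
  by apply: h1; apply: wide zp _; lra.
have cKw : compact Kw.
  apply: compactU; last exact: frame_compact.
  rewrite setDE; apply: compact_closedI => //; apply: open_closedC; exact: open_square_open.
have nKw : connected Kw.
  apply: (puncture nC) osz _ _ _ _; first by left.
  - exact: open_square_open.
  - exact: frame_connected.
  - exact: square_closed.
  - by exists (z.1 - r, z.2 - r); left; left; left; exact: segl.
have Kwfar p : Kw p -> far_from z r p.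
  move=> [[_ nz]|/(frame_bound r0)[]//].
  by rewrite /far_from -implyNb -!ltNge; apply/implyP => a1; rewrite leNgt; apply/negP => a2; apply: nz.
have qKw v : v \in hi -> Kw (q v).
  move=> vh; left; split; first by right; exists v => //; have [] := CP v.
  move=> [a1 a2]; apply: (Lout v (q v) vh); first exact: segl.
  by rewrite /within_box !ltW.
pose Z (a : option H + {set option H}) : set plane := match a with
  | inl None => Kw | inl (Some v) => K v
  | inr E => if None \in E then [set p | exists2 v, Some v \in E & L v p] else M (Some @^-1: E)%SET end.
have ZL v : Z (inr (apex_edge v)) = L v.
  rewrite /Z !finset.inE /=; apply/seteqP; split=> p; last by move=> Lp; exists v => //; rewrite !finset.inE eqxx orbT.
  by move=> [u]; rewrite !finset.inE /= => /eqP[->].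
have ZM (E : {set H}) : Z (inr (Some @: E)%SET) = M E.
  rewrite /Z; case: ifP => [/imsetP[]//|_]; congr M; apply/setP => v; rewrite finset.inE.
  by rewrite mem_imset // => ? ? [].
have kind (E : {set option H}) : E \in apex_edges (edges H) hi -> (exists2 G, G \in edges H & E = (Some @: G)%SET) \/
    exists2 v, v \in hi & E = apex_edge v.
  by rewrite finset.in_setU => /orP[]/imsetP[G GE ->]; [left|right]; exists G.
apply: (@discretize_plane R z r r0 _ _ Z None).
- move=> E /kind[[G /edge_ends[x [y [xy ->]]] ->]|[v vh ->]]; last by exists None, (Some v).
  exists (Some x), (Some y); split; last by rewrite imsetU1 imset_set1.
  by apply: contraTneq xy => -[->]; rewrite adj_irrefl.
- case=> [[v|] _|E /kind[[G GE ->]|[v vh ->]]].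
  + have [k1 k2] := Kc v; split => // p /KD/outside np; apply: far3 => zp.
    by apply: np; apply: wide zp _; lra.
  + by split.
  + rewrite ZM; have [m1 m2 _ _] := MP G GE; split => // p /(MD G GE)/outside np; apply: far3 => zp.
    by apply: np; apply: wide zp _; lra.
  + rewrite ZL; split; [exact: seg_compact|exact: seg_connected|].
    by move=> p /(Lout _ _ vh) np; apply: far3.
- by move=> [v|]; [exists (point D v); exact: Kv|exists (z.1 - r, z.2 - r); right; left; left; left; exact: segl].
- have KwK v : Kw `&` K v = set0.
    by rewrite -subset0 => p [/KwF/face_sub np /KD].
  by move=> [v|] [w|] //= vw; [exact: KK|rewrite setIC].
- move=> x E /kind[[G GE ->]|[v vh ->]]; rewrite ?ZL ?ZM.
    case: x => [v|] vG /=.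
      by apply: KM => //; apply: contra vG => vG; rewrite imset_f.
    by rewrite -subset0 => p [/KwF/face_sub np /(MD G GE)].
  case: x => [w|]; rewrite !finset.inE //= => wv.
  rewrite -subset0 => p [Kp Lp]; apply: (h2 v w p) Kp; first by rewrite eq_sym.
  by apply: wide (Lbox _ _ vh Lp) _; lra.
- have LM v G : v \in hi -> G \in edges H -> L v `&` M G = set0.
    move=> vh GE; rewrite -subset0 => p [Lp Mp]; apply: (h3 v G p GE) Mp.
    by apply: wide (Lbox _ _ vh Lp) _; lra.
  move=> E E' /kind[[G GE ->]|[v vh ->]] /kind[[G' GE' ->]|[v' vh' ->]]; rewrite ?ZL ?ZM => EE.
  + by apply: MM => //; apply: contraNneq EE => ->.
  + by rewrite setIC; exact: LM.
  + exact: LM.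
  + have vv : v != v' by apply: contraNneq EE => ->.
    rewrite -subset0 => p [Lp Lp']; apply: (h2 v v' (point D v')) => //.
    have := within_box_add (Lbox _ _ vh Lp) (_ : within_box r p (point D v')).
    rewrite within_box_sym => /(_ (Lbox _ _ vh' Lp')) h; apply: wide h _; lra.
- move=> x E /kind[[G GE ->]|[v vh ->]]; rewrite ?ZL ?ZM.
    by move=> /imsetP[v vG ->]; exact: KMin.
  case: x => [w|]; rewrite !finset.inE //=.
    by move=> /eqP[->]; exists (point D v); split => //; exact: segr.
  by move=> _; exists (q v); split; [exact: qKw|exact: segl].
- by right; left; right; have dp := r0; apply: seg_h; lra.
Qed.

End Face.
End Embedding.

Theorem theorem5 (R : realType) (H : sgraph)
  (hH : exists (D : planar_embedding R H) (F : set (R * R)),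
      face D F /\ forall v : H, (4 <= degree v)%N -> lies_on D v F) :
  exists k : nat, forall G : sgraph,
    ~ topological_minor H G -> nonrepetitively_colourable G k.
Proof.
have [D [F [hF hi]]] := hH.
have [|N [Y [sY topY]]] := @planar_apex R H D F [set v : H | (4 <= degree v)%N]%SET hF.
  by move=> v; rewrite finset.inE; exact: hi.
have [N' [tau [Y' [N0 tauM sY' hY']]]] := apex_host sY topY.
exact: fan_model_colouring N0 tauM sY' hY'.
Qed.
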